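(* Let $k$ be an infinite Brauer field and let $\underline{d}=(d_1,\ldots,d_r)$ be a multi-degree. There exists a constant $C(\underline{d})$ (depending only on $\underline{d}$ and $k$) such that for every finite-dimensional $k$-vector space $V$ and every tuple $\underline{f}=(f_1,\ldots,f_r)$ with $f_i$ a homogeneous polynomial of degree $d_i$ on $V$ satisfying $\operatorname{str}(\underline{f})>C(\underline{d})$, the set $Z(\underline{f})(k)$ of $k$-points is Zariski dense in $Z(\underline{f})$.
   Context: A field $k$ is a Brauer field if for every $d\ge 1$ there is a number $N_k(d)$ such that every equation $a_1x_1^d+\cdots+a_nx_n^d=0$ with $n>N_k(d)$ and $a_i\in k$ has a non-trivial solution in $k^n$. A multi-degree is a tuple $(d_1,\ldots,d_r)$ of integers with $d_1\ge\cdots\ge d_r\ge 1$. $Z(\underline{f})$ is the closed subvariety of $V$ defined by $f_1=\cdots=f_r=0$. Strength: for a homogeneous polynomial $f$ of degree $d>0$ on $V$ (an element of $\mathrm{Sym}^d(V^* )$), $\operatorname{str}(f)$ is the minimal $s\ge 0$ such that $f=g_1h_1+\cdots+g_sh_s$ with $g_i,h_i$ homogeneous polynomials on $V$ (over $k$) of degrees $<d$; if no such expression exists (only possible when $d=1$) then $\operatorname{str}(f)=\infty$. The strength of a tuple $\underline{f}$ is the minimum of the strengths of all nontrivial $k$-linear combinations of members of $\underline{f}$ having the same degree ($\infty$ for the empty tuple). *)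

(* Defs.v *)
From mathcomp Require Import all_boot all_algebra.
From mathcomp Require Export mpoly.
Set Implicit Arguments. Unset Strict Implicit. Unset Printing Implicit Defensive.
Import GRing.Theory.
Local Open Scope ring_scope.

Definition infinite_field (k : fieldType) : Prop :=
  forall s : seq k, exists x : k, x \notin s.

Definition brauer_field (k : fieldType) : Prop :=
  forall d : nat, (1 <= d)%N ->
    exists N : nat, forall (n : nat) (a : 'I_n -> k), (N < n)%N ->
      exists x : 'I_n -> k, (exists i, x i != 0) /\
        \sum_(i < n) a i * x i ^+ d = 0.

Definition multidegree (r : nat) (d : 'I_r -> nat) : Prop :=
  (forall i : 'I_r, (1 <= d i)%N) /\
  (forall i j : 'I_r, (i <= j)%N -> (d j <= d i)%N).

Definition strength_gt (k : fieldType) (n : nat) (d : nat)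
    (f : {mpoly k[n]}) (C : nat) : Prop :=
  ~ exists (s : nat) (g h : 'I_s -> {mpoly k[n]}),
      [/\ (s <= C)%N,
          forall i, exists a1 : nat, (a1 < d)%N /\ g i \is a1.-homog,
          forall i, exists b : nat, (b < d)%N /\ h i \is b.-homog &
          f = \sum_(i < s) g i * h i].

Definition tuple_strength_gt (k : fieldType) (n r : nat) (d : 'I_r -> nat)
    (f : 'I_r -> {mpoly k[n]}) (C : nat) : Prop :=
  forall (e : nat) (c : 'I_r -> k),
    (forall i, c i != 0 -> d i = e) ->
    (exists i, c i != 0) ->
    strength_gt e (\sum_(i < r) c i *: f i) C.

(* Z(f)(k) is Zariski dense in Z(f) = Spec k[x]/(f_1,...,f_r): the closure of
   the set of k-points is V(J) where J is the ideal of polynomials vanishing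
   on all k-points of Z(f); it is all of Z(f) iff J is contained in the
   nilradical of k[x]/(f), i.e. every such g has a power in (f_1,...,f_r). *)
Definition kpoints_zariski_dense (k : fieldType) (n r : nat)
    (f : 'I_r -> {mpoly k[n]}) : Prop :=
  forall g : {mpoly k[n]},
    (forall x : 'I_n -> k, (forall i, (f i).@[x] = 0) -> g.@[x] = 0) ->
    exists (m : nat) (q : 'I_r -> {mpoly k[n]}),
      g ^+ m = \sum_(i < r) q i * f i.

(* Main.v *)
(* Everything is done with polynomial functions on vector spaces over [k].  Over a Brauer field, boundedly many
forms of bounded positive degree have a linear space of common zeros of any prescribed dimension, once the ambient
dimension is large.  Call a tuple nice if, whenever a product [g h] vanishes on its rational zeros, [g] or [h] is in
its ideal, and if moreover it has a smooth rational zero.  By induction on [d], tuples whose leading forms have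
degree at most [d] and are sufficiently strong are nice.

The induction passes through normal forms [sum_i l_i a_i^q] with [l_i] linear and [q] a power of the characteristic
exponent; for [q = 1] these are all forms of positive degree.  The polarization of such a form, of degree
[1 + q e], is linear in one argument, additive up to the power [q] in a second, and lies in a third.

- If no combination of the polarizations of the members of one type has low strength, one finds slices, along
  a subspace of a generic finite-dimensional space, on which the normal forms have lower degree and strong leading
  forms.  The slices are nice by induction, and niceness spreads from a dense family of slices to the whole space.

- If the polarization of a normal form has low strength, expand the form along a formal section of the zero locus
  of the factors, at a point where the differentials of the coefficients have maximal rank: up to low strength
  the form is zero or a normal form with a larger [q].

Hence every bounded tuple of forms lies in a polynomial ring in boundedly many normal forms all of whose level
sets are nice.  When the tuple is strong it can be exchanged against some of these normal forms, and its zero set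
is then swept out by their level sets. *)

Require Import Defs.
From mathcomp Require Import all_boot all_algebra.
From mathcomp Require Import mpoly.
From mathcomp Require Import ring zify.
From Stdlib Require Import Classical ClassicalEpsilon FunctionalExtensionality.
Set Implicit Arguments. Unset Strict Implicit. Unset Printing Implicit Defensive.
Import GRing.Theory.
Local Open Scope ring_scope.

(** * Polynomial functions *)

Section PolynomialFunctions.
Variable K : fieldType.

(** Density alone would not survive the induction: passing from slices to the whole space needs
    prime ideals and leading forms that are a regular sequence. Niceness tests products at rational
    zeros only, which gives irreducibility, reducedness and density at once; the smooth zero
    excludes an empty zero set.

    The obstacle is positive characteristic. A strong form may have vanishing second derivatives,
    and [K] need not be perfect. Two facts repair this. A form with zero differential is a
    combination of [p]-th powers, so a degenerate normal form acquires a larger [q], and [q] is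
    bounded by the degree. The Brauer condition in degree [q] bounds the degree of [K] over its
    [q]-th powers, so such powers regroup into boundedly many.

    Bounds must not depend on the dimension of [V]. They come from expanding along spaces of fixed
    dimension, and from families whose rank is bounded.

    The induction is joint: niceness and regularization up to degree [d] split degenerate normal
    forms of degree [d+1]; splitting gives regularization in degree [d+1], and this with niceness in
    degree [d] gives niceness in degree [d+1]. *)

Definition lin (V : lmodType K) (l : V -> K) : Prop :=
  forall a x y, l (a *: x + y) = a * l x + l y.

Definition linm (V W : lmodType K) (s : V -> W) : Prop :=
  forall a x y, s (a *: x + y) = a *: s x + s y.

(** Polynomial functions without a basis, on spaces of any dimension: pullback along linear maps,
    products and subspaces then cost nothing. Over an infinite field nothing is lost against formal
    polynomials. *)
Inductive pol (V : lmodType K) : (V -> K) -> Prop :=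
| pol_cst c : pol (fun _ => c)
| pol_lin l : lin l -> pol l
| pol_add f g : pol f -> pol g -> pol (fun x => f x + g x)
| pol_mul f g : pol f -> pol g -> pol (fun x => f x * g x).

Definition polm (V W : lmodType K) (s : V -> W) : Prop :=
  forall l : W -> K, lin l -> pol (fun x => l (s x)).

(** The restriction of [f] to the line [x + t v]. For polynomial [f] over an infinite field it
    exists and is unique, so the choice by [epsilon] is harmless. Derivatives, homogeneous
    components and polarizations are all coefficients of it. *)
Definition tp (V : lmodType K) (f : V -> K) (x v : V) : {poly K} :=
  epsilon (inhabits 0) (fun P => forall t, f (x + t *: v) = P.[t]).

Definition hom (V : lmodType K) (d : nat) (f : V -> K) : Prop :=
  pol f /\ forall t x, f (t *: x) = t ^+ d * f x.

Definition comp (V : lmodType K) (i : nat) (f : V -> K) (x : V) : K :=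
  (tp f 0 x)`_i.

Definition D (V : lmodType K) (f : V -> K) (x v : V) : K := (tp f x v)`_1.

Lemma lin0 (V : lmodType K) (l : V -> K) : lin l -> l 0 = 0.
Proof. by move=> h; have := h (-1) 0 0; rewrite scaler0 addr0 mulN1r addNr. Qed.

Lemma linD (V : lmodType K) (l : V -> K) x y : lin l -> l (x + y) = l x + l y.
Proof. by move=> h; rewrite -[x in LHS]scale1r h mul1r. Qed.

Lemma linZ (V : lmodType K) (l : V -> K) a x : lin l -> l (a *: x) = a * l x.
Proof. by move=> h; rewrite -[_ *: _]addr0 h lin0 // addr0. Qed.

Lemma linB (V : lmodType K) (l : V -> K) x y : lin l -> l (x - y) = l x - l y.
Proof. by move=> h; rewrite linD // -scaleN1r linZ // mulN1r. Qed.

Lemma lin_sum (V : lmodType K) (l : V -> K) (I : Type) (r : seq I) (P : pred I) F :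
  lin l -> l (\sum_(i <- r | P i) F i) = \sum_(i <- r | P i) l (F i).
Proof.
move=> h; elim/big_rec2: _ => [|i y1 y2 _ <-]; first by rewrite lin0.
by rewrite linD.
Qed.

Lemma linm0 (V W : lmodType K) (s : V -> W) : linm s -> s 0 = 0.
Proof. by move=> h; have := h (-1) 0 0; rewrite scaler0 addr0 scaleN1r addNr. Qed.

Lemma linmD (V W : lmodType K) (s : V -> W) x y : linm s -> s (x + y) = s x + s y.
Proof. by move=> h; rewrite -[x in LHS]scale1r h scale1r. Qed.

Lemma linmZ (V W : lmodType K) (s : V -> W) a x : linm s -> s (a *: x) = a *: s x.
Proof. by move=> h; rewrite -[_ *: _]addr0 h linm0 // addr0. Qed.

Lemma linm_sum (V W : lmodType K) (s : V -> W) (I : Type) (r : seq I) (P : pred I) F :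
  linm s -> s (\sum_(i <- r | P i) F i) = \sum_(i <- r | P i) s (F i).
Proof.
move=> h; elim/big_rec2: _ => [|i y1 y2 _ <-]; first by rewrite linm0.
by rewrite linmD.
Qed.

Lemma linm_linear (V W : lmodType K) (s : {linear V -> W}) : linm s.
Proof. by move=> a x y; rewrite linearP. Qed.

Lemma lin_linm (V W : lmodType K) (s : V -> W) (l : W -> K) :
  linm s -> lin l -> lin (fun x => l (s x)).
Proof. by move=> hs hl a x y; rewrite hs hl. Qed.

Lemma linm_comp (V W X : lmodType K) (s : V -> W) (u : W -> X) :
  linm s -> linm u -> linm (fun x => u (s x)).
Proof. by move=> hs hl a x y; rewrite hs hl. Qed.

Lemma linm_id (V : lmodType K) : linm (fun x : V => x).
Proof. by []. Qed.
Lemma linm_fst (V W : lmodType K) : linm (fun x : V * W => x.1).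
Proof. by []. Qed.
Lemma linm_snd (V W : lmodType K) : linm (fun x : V * W => x.2).
Proof. by []. Qed.
Lemma linm_zero (V W : lmodType K) : linm (fun _ : V => 0 : W).
Proof. by move=> a x y; rewrite scaler0 addr0. Qed.
Lemma linm_add (V W : lmodType K) (s u : V -> W) :
  linm s -> linm u -> linm (fun x => s x + u x).
Proof. by move=> hs hu a x y; rewrite hs hu scalerDr addrACA. Qed.
Lemma linm_scale (V W : lmodType K) (s : V -> W) c :
  linm s -> linm (fun x => c *: s x).
Proof. by move=> hs a x y; rewrite hs scalerDr !scalerA mulrC. Qed.
Lemma linm_bigsum (V W : lmodType K) (I : Type) (r : seq I) (P : pred I) (s : I -> V -> W) :
  (forall i, linm (s i)) -> linm (fun x => \sum_(i <- r | P i) s i x).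
Proof.
move=> h a x y; rewrite scaler_sumr -big_split /=.
by apply: eq_bigr => i _; rewrite h.
Qed.
Lemma linm_pair (V W X : lmodType K) (s : V -> W) (u : V -> X) :
  linm s -> linm u -> linm (fun x => (s x, u x)).
Proof. by move=> hs hu a x y; rewrite hs hu. Qed.

Lemma pol_ext (V : lmodType K) (f g : V -> K) : pol f -> f =1 g -> pol g.
Proof. by move=> pf /functional_extensionality <-. Qed.

Lemma pol_scale (V : lmodType K) c (f : V -> K) : pol f -> pol (fun x => c * f x).
Proof. by move=> pf; apply: pol_mul => //; apply: pol_cst. Qed.

Lemma pol_opp (V : lmodType K) (f : V -> K) : pol f -> pol (fun x => - f x).
Proof. by move=> pf; apply: (pol_ext (pol_scale (-1) pf)) => x; rewrite mulN1r. Qed.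

Lemma pol_sub (V : lmodType K) (f g : V -> K) : pol f -> pol g -> pol (fun x => f x - g x).
Proof. by move=> pf pg; apply: pol_add => //; apply: pol_opp. Qed.

Lemma pol_sum (V : lmodType K) (I : Type) (r : seq I) (P : pred I) (F : I -> V -> K) :
  (forall i, P i -> pol (F i)) -> pol (fun x => \sum_(i <- r | P i) F i x).
Proof.
move=> h; elim: r => [|i r IH].
  by apply: (pol_ext (pol_cst _ 0)) => x; rewrite big_nil.
case Pi: (P i).
  by apply: (pol_ext (pol_add (h i Pi) IH)) => x; rewrite big_cons Pi.
by apply: (pol_ext IH) => x; rewrite big_cons Pi.
Qed.

Lemma pol_prod (V : lmodType K) (I : Type) (r : seq I) (P : pred I) (F : I -> V -> K) :
  (forall i, P i -> pol (F i)) -> pol (fun x => \prod_(i <- r | P i) F i x).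
Proof.
move=> h; elim: r => [|i r IH].
  by apply: (pol_ext (pol_cst _ 1)) => x; rewrite big_nil.
case Pi: (P i).
  by apply: (pol_ext (pol_mul (h i Pi) IH)) => x; rewrite big_cons Pi.
by apply: (pol_ext IH) => x; rewrite big_cons Pi.
Qed.

Lemma pol_exp (V : lmodType K) (f : V -> K) n : pol f -> pol (fun x => f x ^+ n).
Proof.
move=> pf; elim: n => [|n IH].
  by apply: (pol_ext (pol_cst _ 1)) => x; rewrite expr0.
by apply: (pol_ext (pol_mul pf IH)) => x; rewrite exprS.
Qed.

Lemma pol_comp (V W : lmodType K) (s : V -> W) (f : W -> K) :
  polm s -> pol f -> pol (fun x => f (s x)).
Proof.
move=> hs; elim => [c|l hl|g h _ pg _ ph|g h _ pg _ ph].
- exact: pol_cst.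
- exact: hs.
- exact: pol_add.
- exact: pol_mul.
Qed.

Lemma polm_linm (V W : lmodType K) (s : V -> W) : linm s -> polm s.
Proof. by move=> hs l hl; apply/pol_lin/lin_linm. Qed.

Lemma polm_cst (V W : lmodType K) (w : W) : polm (fun _ : V => w).
Proof. by move=> l hl; apply: pol_cst. Qed.

Lemma polm_add (V W : lmodType K) (s u : V -> W) :
  polm s -> polm u -> polm (fun x => s x + u x).
Proof.
move=> hs hu l hl; apply: (pol_ext (pol_add (hs l hl) (hu l hl))) => x.
by rewrite linD.
Qed.

Lemma polm_scale (V W : lmodType K) (f : V -> K) (s : V -> W) :
  pol f -> polm s -> polm (fun x => f x *: s x).
Proof.
move=> pf hs l hl; apply: (pol_ext (pol_mul pf (hs l hl))) => x.
by rewrite linZ.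
Qed.

Lemma polm_sum (V W : lmodType K) (I : Type) (r : seq I) (P : pred I) (s : I -> V -> W) :
  (forall i, P i -> polm (s i)) -> polm (fun x => \sum_(i <- r | P i) s i x).
Proof.
move=> h l hl.
apply: (@pol_ext _ (fun x => \sum_(i <- r | P i) l (s i x))) => [|x].
  by apply: pol_sum => i Pi; apply: h.
by rewrite lin_sum.
Qed.

Lemma polm_pair (V W X : lmodType K) (s : V -> W) (u : V -> X) :
  polm s -> polm u -> polm (fun x => (s x, u x)).
Proof.
move=> hs hu l hl.
have h1 : lin (fun w : W => l (w, 0)).
  by move=> a x y; rewrite -hl; congr l; congr pair; rewrite /= ?scaler0 ?addr0.
have h2 : lin (fun w : X => l (0, w)).
  by move=> a x y; rewrite -hl; congr l; congr pair; rewrite /= ?scaler0 ?addr0.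
apply: (pol_ext (pol_add (hs _ h1) (hu _ h2))) => x.
by rewrite -linD //; congr l; congr pair; rewrite /= ?addr0 ?add0r.
Qed.

End PolynomialFunctions.

(** * Taylor coefficients and homogeneous components *)

Section Taylor.
Variable K : fieldType.
Hypothesis Kinf : infinite_field K.

Lemma inf_uniq n : exists s : seq K, uniq s /\ size s = n.
Proof.
elim: n => [|n [s [us ss]]]; first by exists [::].
have [x xs] := Kinf s; exists (x :: s) => /=.
by rewrite xs us ss.
Qed.

Lemma poly_fun0 (P : {poly K}) : (forall t, P.[t] = 0) -> P = 0.
Proof.
move=> h; apply/eqP/negP => /negP P0.
have [s [us ss]] := inf_uniq (size P).
have rs : all (root P) s by apply/allP => x _; rewrite /root h.
by have := max_poly_roots P0 rs us; rewrite ss ltnn.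
Qed.

Lemma poly_fun_inj (P Q : {poly K}) : (forall t, P.[t] = Q.[t]) -> P = Q.
Proof.
move=> h; apply/eqP; rewrite -subr_eq0; apply/eqP/poly_fun0 => t.
by rewrite hornerD hornerN h subrr.
Qed.

Variable V : lmodType K.
Implicit Types (f g l : V -> K) (x v : V).

Lemma pol_line f x v : pol f -> exists P : {poly K}, forall t, f (x + t *: v) = P.[t].
Proof.
elim=> [c|l hl|g h _ [P hP] _ [Q hQ]|g h _ [P hP] _ [Q hQ]].
- by exists c%:P => t; rewrite hornerC.
- exists ((l x)%:P + l v *: 'X) => t.
  by rewrite linD // linZ // hornerD hornerC hornerZ hornerX mulrC.
- by exists (P + Q) => t; rewrite hornerD hP hQ.
- by exists (P * Q) => t; rewrite hornerM hP hQ.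
Qed.

Lemma tpE f x v t : pol f -> f (x + t *: v) = (tp f x v).[t].
Proof. by move=> /(pol_line x v) /(epsilon_spec (inhabits 0)) ->. Qed.

Lemma tp_unique f x v (P : {poly K}) :
  pol f -> (forall t, f (x + t *: v) = P.[t]) -> tp f x v = P.
Proof. by move=> pf h; apply: poly_fun_inj => t; rewrite -h tpE. Qed.

Lemma tp_cst c x v : tp (fun _ => c) x v = c%:P.
Proof. by apply: tp_unique => [|t]; [exact: pol_cst | rewrite hornerC]. Qed.

Lemma tp_lin l x v : lin l -> tp l x v = (l x)%:P + l v *: 'X.
Proof.
move=> hl; apply: tp_unique => [|t]; first exact: pol_lin.
by rewrite linD // linZ // hornerD hornerC hornerZ hornerX mulrC.
Qed.

Lemma tp_add f g x v : pol f -> pol g ->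
  tp (fun x => f x + g x) x v = tp f x v + tp g x v.
Proof.
move=> pf pg; apply: tp_unique => [|t]; first exact: pol_add.
by rewrite hornerD !tpE.
Qed.

Lemma tp_mul f g x v : pol f -> pol g ->
  tp (fun x => f x * g x) x v = tp f x v * tp g x v.
Proof.
move=> pf pg; apply: tp_unique => [|t]; first exact: pol_mul.
by rewrite hornerM !tpE.
Qed.

Lemma tp_scale f c x v : pol f -> tp (fun x => c * f x) x v = c *: tp f x v.
Proof.
by move=> pf; rewrite tp_mul ?tp_cst ?mul_polyC //; apply: pol_cst.
Qed.

Lemma tp_sub f g x v : pol f -> pol g ->
  tp (fun x => f x - g x) x v = tp f x v - tp g x v.
Proof.
move=> pf pg; apply: tp_unique => [|t]; first exact: pol_sub.
by rewrite hornerD hornerN !tpE.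
Qed.

Lemma tp_sum (I : Type) (r : seq I) (P : pred I) (F : I -> V -> K) x v :
  (forall i, P i -> pol (F i)) ->
  tp (fun x => \sum_(i <- r | P i) F i x) x v = \sum_(i <- r | P i) tp (F i) x v.
Proof.
move=> h; apply: tp_unique => [|t]; first exact: pol_sum.
by rewrite horner_sum; apply: eq_bigr => i Pi; rewrite tpE //; apply: h.
Qed.

Lemma tp_coef0 f x v : pol f -> (tp f x v)`_0 = f x.
Proof. by move=> pf; rewrite -horner_coef0 -tpE // scale0r addr0. Qed.

Lemma pol_tc f i : pol f -> pol (fun p : V * V => (tp f p.1 p.2)`_i).
Proof.
move=> pf; elim: pf i => [c|l hl|g h pg IHg ph IHh|g h pg IHg ph IHh] i.
- by apply: (pol_ext (pol_cst _ (if i == 0%N then c else 0))) => p; rewrite tp_cst coefC.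
- case: i => [|[|i]].
  + apply: (@pol_ext _ _ (fun p => l p.1)); last first.
      by move=> p; rewrite tp_lin // coefD coefC coefZ coefX /= mulr0 addr0.
    by apply: pol_lin; apply: lin_linm hl.
  + apply: (@pol_ext _ _ (fun p => l p.2)); last first.
      by move=> p; rewrite tp_lin // coefD coefC coefZ coefX /= mulr1 add0r.
    by apply: pol_lin; apply: lin_linm hl.
  + apply: (pol_ext (pol_cst _ 0)) => p.
    by rewrite tp_lin // coefD coefC coefZ coefX /= mulr0 addr0.
- apply: (pol_ext (pol_add (IHg i) (IHh i))) => p.
  by rewrite tp_add // coefD.
- apply: (@pol_ext _ _ (fun p => \sum_(j < i.+1) (tp g p.1 p.2)`_j * (tp h p.1 p.2)`_(i - j))).
    by apply: pol_sum => j _; apply: pol_mul.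
  by move=> p; rewrite tp_mul // coefM.
Qed.

Lemma pol_tp_size f : pol f -> exists N, forall x v, (size (tp f x v) <= N)%N.
Proof.
elim=> [c|l hl|g h pg [N hN] ph [M hM]|g h pg [N hN] ph [M hM]].
- by exists 1%N => x v; rewrite tp_cst size_polyC leq_b1.
- exists 2%N => x v; rewrite tp_lin //.
  apply: (leq_trans (size_polyD _ _)); rewrite geq_max.
  rewrite (leq_trans (size_polyC_leq1 _)) //.
  by apply: (leq_trans (size_scale_leq _ _)); rewrite size_polyX.
- exists (maxn N M) => x v; rewrite tp_add //.
  apply: (leq_trans (size_polyD _ _)).
  by rewrite geq_max !leq_max hN hM orbT.
- exists (N + M)%N => x v; rewrite tp_mul //.
  apply: (leq_trans (size_polyMleq _ _)).
  by apply: (leq_trans (leq_pred _)); apply: leq_add.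
Qed.

(** Restricting to the line through [x] and [y] reduces the claim to [{poly K}] being an integral
    domain. *)
Lemma pol_domain f g x y : pol f -> pol g -> f x != 0 -> g y != 0 ->
  exists z, f z * g z != 0.
Proof.
move=> pf pg fx gy; apply: NNPP => H.
have h z : f z * g z = 0.
  by apply/eqP/negP => /negP n; apply: H; exists z.
have : tp f x (y - x) * tp g x (y - x) = 0.
  by apply: poly_fun0 => t; rewrite hornerM -!tpE.
move/eqP; rewrite mulf_eq0 => /orP [] /eqP E.
  by move: fx; rewrite -(tp_coef0 x (y - x) pf) E coef0 eqxx.
move: gy; have <- : x + 1 *: (y - x) = y by rewrite scale1r addrC subrK.
by rewrite tpE // E horner0 eqxx.
Qed.

Lemma tp_scalev f x v a i : pol f -> (tp f x (a *: v))`_i = a ^+ i * (tp f x v)`_i.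
Proof.
move=> pf; rewrite (tp_unique (P := tp f x v \Po (a *: 'X))) //; last first.
  by move=> t; rewrite scalerA horner_comp hornerZ hornerX mulrC -tpE // mulrC.
rewrite comp_polyE coef_sum.
rewrite (eq_bigr (fun j : 'I__ => (tp f x v)`_j * (a ^+ j * (i == j)%:R))); last first.
  by move=> j _; rewrite coefZ exprZn coefZ coefXn.
case: (ltnP i (size (tp f x v))) => hi.
  rewrite (bigD1 (Ordinal hi)) //= eqxx mulr1 big1 ?addr0 1?mulrC // => j.
  rewrite -val_eqE /= eq_sym => /negPf ->; by rewrite !mulr0.
rewrite nth_default // mulr0 big1 // => j _.
case: eqP => [E|_]; last by rewrite !mulr0.
by move: (ltn_ord j); rewrite -E ltnNge hi.
Qed.

Lemma hom_pol d f : hom d f -> pol f. Proof. by case. Qed.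

Lemma homE d f t x : hom d f -> f (t *: x) = t ^+ d * f x.
Proof. by case=> _ ->. Qed.

Lemma hom_cst c : hom 0 (fun _ : V => c).
Proof. by split=> [|t x]; [exact: pol_cst | rewrite expr0 mul1r]. Qed.

Lemma hom_lin l : lin l -> hom 1 l.
Proof. by move=> hl; split=> [|t x]; [exact: pol_lin | rewrite linZ // expr1]. Qed.

Lemma hom_zero d : hom d (fun _ : V => 0).
Proof. by split=> [|t x]; [exact: pol_cst | rewrite mulr0]. Qed.

Lemma hom_add d f g : hom d f -> hom d g -> hom d (fun x => f x + g x).
Proof.
by case=> pf hf [pg hg]; split=> [|t x]; [exact: pol_add | rewrite hf hg mulrDr].
Qed.

Lemma hom_mul d e f g : hom d f -> hom e g -> hom (d + e) (fun x => f x * g x).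
Proof.
case=> pf hf [pg hg]; split=> [|t x]; first exact: pol_mul.
by rewrite hf hg mulrACA exprD.
Qed.

Lemma hom_scale d c f : hom d f -> hom d (fun x => c * f x).
Proof. by move=> h; rewrite -[d]add0n; apply: hom_mul => //; apply: hom_cst. Qed.

Lemma hom_sum d (I : Type) (r : seq I) (P : pred I) (F : I -> V -> K) :
  (forall i, P i -> hom d (F i)) -> hom d (fun x => \sum_(i <- r | P i) F i x).
Proof.
move=> h; split=> [|t x]; first by apply: pol_sum => i /h [].
by rewrite mulr_sumr; apply: eq_bigr => i /h [_ ->].
Qed.

Lemma hom_exp d f n : hom d f -> hom (d * n) (fun x => f x ^+ n).
Proof.
case=> pf hf; split=> [|t x]; first exact: pol_exp.
by rewrite hf exprMn exprM.
Qed.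

Lemma hom_ext d f g : hom d f -> f =1 g -> hom d g.
Proof. by move=> hf /functional_extensionality <-. Qed.

Lemma pol_comp_i i f : pol f -> pol (comp i f).
Proof.
move=> pf; apply: (pol_comp _ (pol_tc i pf) (s := fun x => (0, x))).
by apply: polm_pair; [exact: polm_cst | exact: polm_linm].
Qed.

Lemma hom_comp i f : pol f -> hom i (comp i f).
Proof.
by move=> pf; split=> [|t x]; [exact: pol_comp_i | rewrite /comp tp_scalev].
Qed.

Lemma comp_homE d f : hom d f -> forall i x, comp i f x = if i == d then f x else 0.
Proof.
move=> hf i x; rewrite /comp (tp_unique (P := f x *: 'X^d)) ?coefZ ?coefXn.
- by case: eqP => _; rewrite ?mulr1 ?mulr0.
- exact: hom_pol hf.
- by move=> t; rewrite add0r (homE _ _ hf) hornerZ hornerXn mulrC.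
Qed.

Lemma comp_id d f x : hom d f -> comp d f x = f x.
Proof. by move=> hf; rewrite (comp_homE hf) eqxx. Qed.

Lemma comp_neq d f i x : hom d f -> i != d -> comp i f x = 0.
Proof. by move=> hf /negPf n; rewrite (comp_homE hf) n. Qed.

Lemma comp_add i f g x : pol f -> pol g ->
  comp i (fun x => f x + g x) x = comp i f x + comp i g x.
Proof. by move=> pf pg; rewrite /comp tp_add // coefD. Qed.

Lemma comp_sub i f g x : pol f -> pol g ->
  comp i (fun x => f x - g x) x = comp i f x - comp i g x.
Proof. by move=> pf pg; rewrite /comp tp_sub // coefD coefN. Qed.

Lemma comp_scale i c f x : pol f -> comp i (fun x => c * f x) x = c * comp i f x.
Proof. by move=> pf; rewrite /comp tp_scale // coefZ. Qed.

Lemma comp_sum i (I : Type) (r : seq I) (P : pred I) (F : I -> V -> K) x :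
  (forall i, P i -> pol (F i)) ->
  comp i (fun x => \sum_(i <- r | P i) F i x) x = \sum_(j <- r | P j) comp i (F j) x.
Proof. by move=> h; rewrite /comp tp_sum // coef_sum. Qed.

Lemma comp_mul i f g x : pol f -> pol g ->
  comp i (fun x => f x * g x) x = \sum_(j < i.+1) comp j f x * comp (i - j) g x.
Proof. by move=> pf pg; rewrite /comp tp_mul // coefM. Qed.

Lemma comp_bound f : pol f -> exists N, (forall i x, (N <= i)%N -> comp i f x = 0) /\
   forall M x, (N <= M)%N -> f x = \sum_(i < M) comp i f x.
Proof.
move=> pf; have [N hN] := pol_tp_size pf; exists N; split=> [i x Ni|M x NM].
  by rewrite /comp nth_default // (leq_trans (hN _ _)).
have <- : 0 + 1 *: x = x by rewrite scale1r add0r.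
rewrite tpE // (horner_coef_wide _ (leq_trans (hN _ _) NM)).
by apply: eq_bigr => i _; rewrite expr1n mulr1 scale1r add0r.
Qed.

Lemma comp0 f x : pol f -> comp 0 f x = f 0.
Proof. by move=> pf; rewrite /comp tp_coef0. Qed.

Lemma hom0_cst f x : hom 0 f -> f x = f 0.
Proof. by move=> hf; rewrite -(comp_id x hf) comp0 //; case: hf. Qed.

Lemma hom_at0 d f : hom d f -> (0 < d)%N -> f 0 = 0.
Proof. by move=> hf d0; rewrite -[0 in LHS](scale0r 0) (homE _ _ hf) expr0n eqn0Ngt d0 mul0r. Qed.

Lemma comp_comp i f x : pol f -> comp i (comp i f) x = comp i f x.
Proof. by move=> pf; rewrite (comp_id _ (hom_comp i pf)). Qed.

End Taylor.

(** * Directional derivatives *)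

Section Derivative.
Variable K : fieldType.
Hypothesis Kinf : infinite_field K.
Variable V : lmodType K.
Implicit Types (f g l : V -> K) (x v : V).

Lemma D_cst c x v : D (fun _ : V => c) x v = 0.
Proof. by rewrite /D tp_cst // coefC. Qed.

Lemma D_lin l x v : lin l -> D l x v = l v.
Proof. by move=> hl; rewrite /D tp_lin // coefD coefC coefZ coefX /= mulr1 add0r. Qed.

Lemma D_add f g x v : pol f -> pol g -> D (fun x => f x + g x) x v = D f x v + D g x v.
Proof. by move=> pf pg; rewrite /D tp_add // coefD. Qed.

Lemma D_sub f g x v : pol f -> pol g -> D (fun x => f x - g x) x v = D f x v - D g x v.
Proof. by move=> pf pg; rewrite /D tp_sub // coefB. Qed.

Lemma D_scale c f x v : pol f -> D (fun x => c * f x) x v = c * D f x v.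
Proof. by move=> pf; rewrite /D tp_scale // coefZ. Qed.

Lemma D_mul f g x v : pol f -> pol g ->
  D (fun x => f x * g x) x v = f x * D g x v + D f x v * g x.
Proof.
move=> pf pg; rewrite /D tp_mul // coefM big_ord_recl big_ord1 /=.
by rewrite !tp_coef0.
Qed.

Lemma D_sum (I : Type) (r : seq I) (P : pred I) (F : I -> V -> K) x v :
  (forall i, P i -> pol (F i)) ->
  D (fun x => \sum_(i <- r | P i) F i x) x v = \sum_(i <- r | P i) D (F i) x v.
Proof. by move=> h; rewrite /D tp_sum // coef_sum. Qed.

Lemma D_linr f x : pol f -> lin (D f x).
Proof.
move=> pf a u v; elim: pf x => [c|l hl|g h pg IHg ph IHh|g h pg IHg ph IHh] x.
- by rewrite !D_cst mulr0 addr0.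
- by rewrite !D_lin.
- by rewrite !D_add // IHg IHh mulrDr addrACA.
- rewrite !D_mul // IHg IHh !mulrDr !mulrDl addrACA; congr (_ + _ + (_ + _)).
  + by rewrite mulrCA.
  + by rewrite mulrA.
Qed.

Lemma pol_D2 f : pol f -> pol (fun p : V * V => D f p.1 p.2).
Proof. by move=> pf; apply: (pol_tc Kinf 1 pf). Qed.

Lemma pol_D f v : pol f -> pol (fun x => D f x v).
Proof.
move=> pf; apply: (pol_comp _ (pol_D2 pf) (s := fun x => (x, v))).
by apply: polm_pair; [exact: polm_linm | exact: polm_cst].
Qed.

Lemma D_exp f n x v : pol f -> D (fun x => f x ^+ n) x v = n%:R * f x ^+ n.-1 * D f x v.
Proof.
move=> pf; elim: n => [|n IH]; first by rewrite D_cst !mul0r.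
rewrite (_ : (fun x => _) = (fun x => f x * f x ^+ n)); last first.
  by apply: functional_extensionality => y; rewrite exprS.
rewrite D_mul ?IH //; last exact: pol_exp.
case: n IH => [|n] IH /=.
  by rewrite !mul0r mulr0 add0r expr0 !mulr1 mul1r.
rewrite -[n.+2%:R]natr1 -[n.+1%:R]natr1 exprS; ring.
Qed.

Lemma hom_D d f v : hom d.+1 f -> hom d (fun x => D f x v).
Proof.
move=> hf; have pf := hom_pol hf; split=> [|t x]; first exact: pol_D.
have E : forall s, s != 0 -> D f (s *: x) v = s ^+ d * D f x v.
  move=> s s0; rewrite /D.
  rewrite (tp_unique Kinf (P := s ^+ d.+1 *: (tp f x v \Po (s^-1 *: 'X)))) //; last first.
    move=> u; rewrite hornerZ horner_comp hornerZ hornerX -tpE // -(homE _ _ hf).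
    by rewrite scalerDr !scalerA mulrA mulfV // mul1r.
  rewrite coefZ comp_polyE coef_sum.
  rewrite (eq_bigr (fun j : 'I__ => (tp f x v)`_j * (s^-1 ^+ j * (1%N == j)%:R))); last first.
    by move=> j _; rewrite coefZ exprZn coefZ coefXn.
  case: (ltnP 1 (size (tp f x v))) => hi.
    rewrite (bigD1 (Ordinal hi)) //= mulr1 big1 ?addr0 => [|j].
      by rewrite expr1 mulrCA exprSr -mulrA mulfV // mulr1 mulrC.
    by rewrite -val_eqE /= eq_sym => /negPf ->; rewrite !mulr0.
  rewrite [RHS](_ : _ = 0); last by rewrite nth_default // mulr0.
  rewrite big1 ?mulr0 // => j _; case: eqP => [E|_]; last by rewrite !mulr0.
  by move: (ltn_ord j); rewrite -E ltnNge hi.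
pose P := tp (fun x => D f x v) 0 x; pose Q := D f x v *: 'X^d.
have pD := pol_D v pf.
(* The scaling law is known only for [s != 0]; the factor ['X] covers [s = 0] and is cancelled in
   [{poly K}]. *)
have : 'X * (P - Q) = 0.
  apply: (poly_fun0 Kinf) => s; rewrite hornerM hornerX hornerD hornerN /P -tpE // add0r.
  rewrite hornerZ hornerXn; have [->|s0] := eqVneq s 0; first by rewrite mul0r.
  by rewrite E // mulrC [D _ _ _ * _]mulrC subrr mul0r.
move/eqP; rewrite mulf_eq0 polyX_eq0 /= subr_eq0 => /eqP PQ.
by have := tpE 0 x t pD; rewrite add0r -/P PQ hornerZ hornerXn mulrC.
Qed.

Lemma hom0_D f x v : hom 0 f -> D f x v = 0.
Proof.
move=> hf; have -> : f = (fun _ => f 0).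
  by apply: functional_extensionality => y; rewrite (hom0_cst Kinf y hf).
by rewrite D_cst.
Qed.

End Derivative.

Section DerivativeComp.
Variable K : fieldType.
Hypothesis Kinf : infinite_field K.

Lemma D_comp (V W : lmodType K) (s : W -> V) (f : V -> K) (ds : W -> W -> V) (x v : W) :
  polm s -> pol f ->
  (forall l, lin l -> D (fun w => l (s w)) x v = l (ds x v)) ->
  D (fun w => f (s w)) x v = D f (s x) (ds x v).
Proof.
move=> ps pf hs; elim: pf => [c|l hl|g h pg IHg ph IHh|g h pg IHg ph IHh].
- by rewrite !D_cst.
- by rewrite hs // D_lin.
- by rewrite !D_add ?IHg ?IHh //; apply: pol_comp.
- by rewrite !D_mul ?IHg ?IHh //; apply: pol_comp.
Qed.

Lemma D_linm (V W : lmodType K) (s : W -> V) (f : V -> K) (x v : W) :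
  linm s -> pol f -> D (fun w => f (s w)) x v = D f (s x) (s v).
Proof.
move=> hs pf; rewrite (@D_comp _ _ s f (fun _ v => s v)) //; first exact: polm_linm.
by move=> l hl; rewrite D_lin //; apply: lin_linm.
Qed.

Lemma D_shift (V : lmodType K) (f : V -> K) a x v : pol f -> D (fun w => f (a + w)) x v = D f (a + x) v.
Proof.
move=> pf; rewrite (@D_comp _ _ (fun w => a + w) f (fun _ v => v)) //.
  by apply: polm_add; [exact: polm_cst | exact: polm_linm].
move=> l hl; rewrite (_ : (fun w => l (a + w)) = (fun w => l a + l w)); last first.
  by apply: functional_extensionality => w; rewrite linD.
by rewrite D_add ?D_cst ?D_lin ?add0r //; [exact: pol_cst | exact: pol_lin].
Qed.

End DerivativeComp.

Ltac lm := repeat first [ assumption | apply: linm_zero | apply: linm_id | apply: linm_pair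
  | apply: linm_add | apply: linm_scale | apply: linm_fst | apply: linm_snd
  | apply: (linm_comp (linm_fst _ _)) | apply: (linm_comp (linm_snd _ _)) ].

(** * Functions on products and bihomogeneity *)

Section Partial.
Variable K : fieldType.
Hypothesis Kinf : infinite_field K.

Lemma pol_linm (V W : lmodType K) (s : V -> W) (f : W -> K) :
  linm s -> pol f -> pol (fun x => f (s x)).
Proof. by move=> hs; apply: pol_comp; apply: polm_linm. Qed.

Lemma hom_linm (V W : lmodType K) d (s : V -> W) (f : W -> K) :
  linm s -> hom d f -> hom d (fun x => f (s x)).
Proof.
move=> hs [pf hf]; split=> [|t x]; first exact: pol_linm.
by rewrite linmZ // hf.
Qed.

Lemma polm_fix1 (V W : lmodType K) (x : V) : polm (fun y : W => (x, y)).
Proof. by apply: polm_pair; [exact: polm_cst | exact: polm_linm]. Qed.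

Lemma polm_fix2 (V W : lmodType K) (y : W) : polm (fun x : V => (x, y)).
Proof. by apply: polm_pair; [exact: polm_linm | exact: polm_cst]. Qed.

Lemma pol_fix1 (V W : lmodType K) (f : V * W -> K) x : pol f -> pol (fun y => f (x, y)).
Proof. by apply: pol_comp; apply: polm_fix1. Qed.

Lemma pol_fix2 (V W : lmodType K) (f : V * W -> K) y : pol f -> pol (fun x => f (x, y)).
Proof. by apply: pol_comp; apply: polm_fix2. Qed.

Lemma pol_shift (V : lmodType K) (f : V -> K) a : pol f -> pol (fun x => f (a + x)).
Proof.
by apply: pol_comp; apply: polm_add; [exact: polm_cst | exact: polm_linm].
Qed.

Lemma tp_linm (V W : lmodType K) (s : V -> W) (f : W -> K) x v :
  linm s -> pol f -> tp (fun x => f (s x)) x v = tp f (s x) (s v).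
Proof.
move=> hs pf; apply: (tp_unique Kinf) => [|t]; first exact: pol_linm.
by rewrite linmD // linmZ // tpE.
Qed.

Lemma comp_linm (V W : lmodType K) (s : V -> W) (f : W -> K) i x :
  linm s -> pol f -> comp i (fun x => f (s x)) x = comp i f (s x).
Proof. by move=> hs pf; rewrite /comp tp_linm // linm0. Qed.

Lemma tp_fix2 (V W : lmodType K) (f : V * W -> K) x v y :
  pol f -> tp (fun x => f (x, y)) x v = tp f (x, y) (v, 0).
Proof.
move=> pf; apply: (tp_unique Kinf) => [|t]; first exact: pol_fix2.
by rewrite -tpE //; congr f; congr pair; rewrite /= scaler0 addr0.
Qed.

Lemma tp_fix1 (V W : lmodType K) (f : V * W -> K) x y v :
  pol f -> tp (fun y => f (x, y)) y v = tp f (x, y) (0, v).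
Proof.
move=> pf; apply: (tp_unique Kinf) => [|t]; first exact: pol_fix1.
by rewrite -tpE //; congr f; congr pair; rewrite /= scaler0 addr0.
Qed.

Lemma pol_tcm (V W : lmodType K) (f : V -> K) (s u : W -> V) i :
  pol f -> polm s -> polm u -> pol (fun x => (tp f (s x) (u x))`_i).
Proof.
move=> pf ps pu.
by apply: (pol_comp _ (pol_tc Kinf i pf) (s := fun x => (s x, u x))); apply: polm_pair.
Qed.

Lemma pol_Dm (V W : lmodType K) (f : V -> K) (s u : W -> V) :
  pol f -> polm s -> polm u -> pol (fun x => D f (s x) (u x)).
Proof. exact: pol_tcm. Qed.

Lemma pol_comp2 (V W : lmodType K) (f : V * W -> K) i :
  pol f -> pol (fun p => comp i (fun y => f (p.1, y)) p.2).
Proof.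
move=> pf; apply: (@pol_ext _ _ (fun p => (tp f (p.1, 0) (0, p.2))`_i)).
  by apply: pol_tcm => //; apply: polm_linm; lm.
by move=> p; rewrite /comp tp_fix1.
Qed.

Lemma pol_comp1 (V W : lmodType K) (f : V * W -> K) i :
  pol f -> pol (fun p => comp i (fun x => f (x, p.2)) p.1).
Proof.
move=> pf; apply: (@pol_ext _ _ (fun p => (tp f (0, p.2) (p.1, 0))`_i)).
  by apply: pol_tcm => //; apply: polm_linm; lm.
by move=> p; rewrite /comp tp_fix2.
Qed.

Lemma comp2_bound (V W : lmodType K) (f : V * W -> K) : pol f ->
  exists N, (forall i x y, (N <= i)%N -> comp i (fun y => f (x, y)) y = 0) /\
    forall x y, f (x, y) = \sum_(i < N) comp i (fun y => f (x, y)) y.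
Proof.
move=> pf; have [N hN] := pol_tp_size Kinf pf; exists N; split=> [i x y Ni|x y].
  by rewrite /comp tp_fix1 // nth_default // (leq_trans (hN _ _)).
have pg := pol_fix1 x pf.
have <- : 0 + 1 *: y = y by rewrite scale1r add0r.
rewrite (tpE 0 y 1 pg) (horner_coef_wide _ (n := N)); last by rewrite tp_fix1.
by apply: eq_bigr => i _; rewrite expr1n mulr1 scale1r add0r.
Qed.

Lemma comp_scale_arg (V : lmodType K) (f : V -> K) i t x :
  pol f -> comp i (fun x => f (t *: x)) x = t ^+ i * comp i f x.
Proof.
move=> pf; rewrite comp_linm // ?(homE _ _ (hom_comp Kinf i pf)) //.
exact: linm_scale.
Qed.

(** By scaling the first argument, a nonzero component of degree [j] in it forces [t^(i+j) = t^d]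
    for all [t], so only [j = d - i] survives. *)
Lemma hom_complement (V W : lmodType K) (f : V * W -> K) d i y :
  hom d f -> (forall t x y, f (x, t *: y) = t ^+ i * f (x, y)) -> (i <= d)%N ->
  hom (d - i) (fun x => f (x, y)).
Proof.
move=> [pf hf] hi id; have pg y' := pol_fix2 y' pf.
have key t x : t ^+ i * f (t *: x, y) = t ^+ d * f (x, y).
  by rewrite -hi -hf.
have E j x : j != (d - i)%N -> comp j (fun x => f (x, y)) x = 0.
  move=> nj.
  have : ('X^(i + j) - 'X^d) * (comp j (fun x => f (x, y)) x)%:P = 0.
    apply: (poly_fun0 Kinf) => t; rewrite hornerM hornerC hornerD hornerN !hornerXn mulrBl.
    have pt : pol (fun x => f (t *: x, y)).
      by apply: (pol_linm (s := fun x : V => t *: x) _ (pg y)); apply: linm_scale.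
    rewrite exprD -mulrA -(comp_scale_arg j t x (pg y)) -(comp_scale Kinf) //.
    by rewrite (functional_extensionality _ _ (key t)) (comp_scale Kinf) // subrr.
  move/eqP; rewrite mulf_eq0 polyC_eq0 subr_eq0 => /orP [/eqP e|/eqP //].
  case/eqP: nj; have := congr1 (fun p : {poly K} => size p) e.
  by rewrite !size_polyXn => -[<-]; rewrite addKn.
split=> // t x; have [N [_ hN]] := comp_bound Kinf (pg y).
have S z M : (N <= M)%N -> (d - i < M)%N -> f (z, y) = comp (d - i) (fun x => f (x, y)) z.
  move=> NM dM; rewrite (hN M) // (bigD1 (Ordinal dM)) //= big1 ?addr0 // => j.
  by rewrite -val_eqE /= => nj; rewrite E.
have h1 : (N <= maxn N (d - i).+1)%N by apply: leq_maxl.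
have h2 : (d - i < maxn N (d - i).+1)%N by apply: leq_maxr.
by rewrite (S _ _ h1 h2) (S x _ h1 h2) (homE _ _ (hom_comp Kinf _ (pg y))).
Qed.

Lemma hom_excess (V W : lmodType K) (f : V * W -> K) d i x y :
  hom d f -> (forall t x y, f (x, t *: y) = t ^+ i * f (x, y)) -> (d < i)%N -> f (x, y) = 0.
Proof.
move=> [pf hf] hi di; have pg := pol_fix2 y pf.
have : 'X^i * tp (fun x => f (x, y)) 0 x - 'X^d * (f (x, y))%:P = 0.
  apply: (poly_fun0 Kinf) => t; rewrite hornerD hornerN !hornerM !hornerXn hornerC.
  by rewrite -(tpE 0 x t pg) add0r -hi -hf subrr.
move/eqP; rewrite subr_eq0 => /eqP /(congr1 (fun p : {poly K} => p`_d)).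
by rewrite coefXnM di coefXnM ltnn subnn coefC.
Qed.

Lemma hom_comp2 (V W : lmodType K) (f : V * W -> K) d i : hom d f ->
  hom d (fun p : V * W => comp i (fun y => f (p.1, y)) p.2).
Proof.
move=> hf; have pf := hom_pol hf; split=> [|t p]; first exact: pol_comp2.
rewrite -(comp_linm (s := fun y => t *: y)) /=; first last.
- exact: pol_fix1.
- exact: linm_scale.
rewrite -comp_scale; last exact: pol_fix1.
  by congr comp; apply: functional_extensionality => y; rewrite -(homE t _ hf).
exact: Kinf.
Qed.

Lemma comp2_scale (V W : lmodType K) (f : V * W -> K) i t x y : pol f ->
  comp i (fun y => f (x, y)) (t *: y) = t ^+ i * comp i (fun y => f (x, y)) y.
Proof. by move=> pf; rewrite (homE _ _ (hom_comp Kinf i (pol_fix1 x pf))). Qed.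

End Partial.

(** * Coordinates and expansion in monomials *)

Section Basis.
Variable K : fieldType.
Hypothesis Kinf : infinite_field K.
Variable V : vectType K.

Definition vb (i : 'I_(\dim {:V})) : V := (vbasis {:V})`_i.
Definition co (i : 'I_(\dim {:V})) (x : V) : K := coord (vbasis {:V}) i x.

Lemma lin_co i : lin (co i).
Proof. by move=> a x y; rewrite /co linearP. Qed.

Lemma co_sum x : x = \sum_i co i x *: vb i.
Proof. exact: (coord_vbasis (memvf x)). Qed.

Lemma co_vb i j : co i (vb j) = (i == j)%:R.
Proof. by rewrite /co /vb coord_free ?(basis_free (vbasisP _)) // eq_sym. Qed.

Lemma lin_vb (l : V -> K) x : lin l -> l x = \sum_i co i x * l (vb i).
Proof.
move=> hl; rewrite [in LHS](co_sum x) lin_sum //.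
by apply: eq_bigr => i _; rewrite linZ.
Qed.

Definition mon (m : seq 'I_(\dim {:V})) (x : V) : K := \prod_(i <- m) co i x.

Lemma hom_mon m : hom (size m) (mon m).
Proof.
elim: m => [|i m IH].
  by apply: (hom_ext (hom_cst _ 1)) => x; rewrite /mon big_nil.
rewrite -[size _]add1n.
apply: (hom_ext (hom_mul (hom_lin (lin_co i)) IH)) => x.
by rewrite /mon big_cons.
Qed.

Lemma pol_expand (X : lmodType K) (G : V * X -> K) : pol G ->
  exists L : seq (seq 'I_(\dim {:V}) * (X -> K)),
    (forall i, pol (nth ([::], fun _ => 0) L i).2) /\
    forall s x, G (s, x) = \sum_(p <- L) mon p.1 s * p.2 x.
Proof.
have P0 : pol (fun _ : X => 0 : K) by apply: pol_cst.
elim=> [c|l hl|g h _ [L [hL eL]] _ [M [hM eM]]|g h _ [L [hL eL]] _ [M [hM eM]]].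
- exists [:: ([::], fun _ => c)]; split=> [[|[|i]]|s x] //=; first exact: pol_cst.
  by rewrite big_seq1 /mon big_nil mul1r.
- exists (([::], fun x => l (0, x)) :: [seq ([:: i], fun _ => l (vb i, 0)) | i <- enum 'I_(\dim {:V})]).
  split=> [[|i]|s x] /=.
  + by apply: (pol_linm _ (pol_lin hl)); apply: linm_pair; [exact: linm_zero | exact: linm_id].
  + case: (ltnP i (size (enum 'I_(\dim {:V})))) => hi; last first.
      by rewrite nth_default // size_map.
    case E : (enum 'I_(\dim {:V})) hi => [//|j0 r] hi.
    by rewrite (nth_map j0) //=; apply: pol_cst.
  + rewrite big_cons /= /mon big_nil mul1r big_map big_enum /=.
    have h1 : lin (fun s => l (s, 0)).
      by apply: (lin_linm _ hl); apply: linm_pair; [exact: linm_id | exact: linm_zero].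
    have -> : l (s, x) = l (0, x) + l (s, 0).
      by rewrite -linD //; congr l; congr pair; rewrite /= ?add0r ?addr0.
    congr (_ + _); rewrite (lin_vb s h1).
    by apply: eq_bigr => i _; rewrite big_seq1.
- exists (L ++ M); split=> [i|s x].
    by rewrite nth_cat; case: ifP.
  by rewrite big_cat /= eL eM.
- exists [seq (p.1 ++ q.1, fun x => p.2 x * q.2 x) | p <- L, q <- M]; split.
    move=> i; set LL := [seq _ | p <- L, q <- M].
    have : forall p, List.In p LL -> pol p.2.
      have hin (L' : seq (seq 'I_(\dim {:V}) * (X -> K))) :
          (forall i, pol (nth ([::], fun _ => 0) L' i).2) -> forall p, List.In p L' -> pol p.2.
        move=> h' p; elim: L' h' => //= q L' IH h' [<-|]; first exact: (h' 0%N).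
        by apply: IH => j; apply: (h' j.+1).
      rewrite /LL; move: (hin _ hL) (hin _ hM); elim: (L) => //= p L' IH hp hq r.
      rewrite List.in_app_iff => -[|]; last first.
        by apply: IH => // q qL; apply: hp; right.
      elim: (M) hq => //= q M' IHM hq [<-|].
        by apply: pol_mul; [apply: hp; left | apply: hq; left].
      by apply: IHM => r' hr'; apply: hq; right.
    move=> h'; case: (ltnP i (size LL)) => hi; last by rewrite nth_default.
    apply: h'; elim: LL i hi => //= r LL IH [|i] hi; first by left.
    by right; apply: IH.
  move=> s x; rewrite eL eM big_allpairs_dep /= mulr_suml; apply: eq_bigr => p _.
  rewrite mulr_sumr; apply: eq_bigr => q _ /=.
  by rewrite /mon big_cat /= mulrACA.
Qed.

(** The index set depends on [\dim {:V}] and [n] alone, not on [X]. Expanding along a space of fixed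
    dimension in this way is a source of uniform bounds. *)
Lemma hom_expand (X : lmodType K) (G : V * X -> K) n :
  pol G -> (forall t s x, G (t *: s, x) = t ^+ n * G (s, x)) ->
  exists h : n.-tuple 'I_(\dim {:V}) -> X -> K,
    (forall d, pol (h d)) /\ forall s x, G (s, x) = \sum_(d : n.-tuple 'I_(\dim {:V})) mon d s * h d x.
Proof.
move=> pG hG; have [L [hL eL]] := pol_expand pG.
exists (fun (d : n.-tuple 'I_(\dim {:V})) x => \sum_(p <- L | p.1 == d) p.2 x); split=> [d|s x].
  elim: (L) hL => [|p L' IH] hL'.
    by apply: (pol_ext (pol_cst _ 0)) => x; rewrite big_nil.
  have hp := hL' 0%N; have {}IH := IH (fun i => hL' i.+1).
  case E: (p.1 == d :> seq _).
    by apply: (pol_ext (pol_add hp IH)) => x; rewrite big_cons E.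
  by apply: (pol_ext IH) => x; rewrite big_cons E.
have hGx : hom n (fun s => G (s, x)) by split; [exact: pol_fix2 | move=> t s'; apply: hG].
rewrite -(comp_id Kinf s hGx) (functional_extensionality _ _ (eL^~ x)).
rewrite (comp_sum Kinf); last first.
  by move=> p _; apply: pol_mul; [exact: (hom_pol (hom_mon _)) | exact: pol_cst].
transitivity (\sum_(p <- L) if size p.1 == n then mon p.1 s * p.2 x else 0).
  apply: eq_bigr => p _; rewrite (comp_homE Kinf (d := size p.1)) 1?eq_sym //.
  by rewrite -[size _]addn0; apply: hom_mul; [exact: hom_mon | exact: hom_cst].
elim: L {hL eL} => [|p L' IH].
  by rewrite big_nil big1 // => d _; rewrite big_nil mulr0.
rewrite big_cons IH; case: eqP => [sp|np].
  rewrite (bigD1 (Tuple (introT eqP sp))) //= [in RHS](bigD1 (Tuple (introT eqP sp))) //=.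
  rewrite addrA; congr (_ + _).
    by rewrite [in RHS]big_cons eqxx mulrDr.
  apply: eq_bigr => d nd; rewrite [in RHS]big_cons; case: eqP => // e.
  by case/eqP: nd; apply: val_inj.
rewrite add0r; apply: eq_bigr => d _; rewrite [in RHS]big_cons; case: eqP => // e.
by case: np; rewrite e size_tuple.
Qed.

End Basis.

Lemma dchoice (A : Type) (B : A -> Type) (R : forall x, B x -> Prop) :
  (forall x, exists y, R x y) -> exists f : forall x, B x, forall x, R x (f x).
Proof.
move=> h; exists (fun x => proj1_sig (constructive_indefinite_description _ (h x))).
by move=> x; case: constructive_indefinite_description.
Qed.

(** * Linear spaces of common zeros over a Brauer field *)

Section Brauer.
Variable K : fieldType.
Hypothesis Kinf : infinite_field K.
Hypothesis Kbr : brauer_field K.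

Definition comb (V : lmodType K) M (v : 'I_M -> V) (s : 'rV[K]_M) : V :=
  \sum_i s 0 i *: v i.

Definition indep (V : lmodType K) M (v : 'I_M -> V) : Prop :=
  forall s, comb v s = 0 -> s = 0.

Lemma linm_comb (V : lmodType K) M (v : 'I_M -> V) : linm (comb v).
Proof.
move=> a x y; rewrite /comb scaler_sumr -big_split /=.
by apply: eq_bigr => i _; rewrite !mxE scalerDl scalerA.
Qed.

Lemma comb_comb (V : lmodType K) M N (v : 'I_M -> V) (w : 'I_N -> 'rV[K]_M) s :
  comb (fun i => comb v (w i)) s = comb v (comb w s).
Proof.
rewrite /comb [in RHS]/=; symmetry.
rewrite -/(comb v _) (linm_sum _ _ _ (linm_comb v)).
by apply: eq_bigr => i _; rewrite (linmZ _ _ (linm_comb v)).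
Qed.

Lemma indep_comb (V : lmodType K) M N (v : 'I_M -> V) (w : 'I_N -> 'rV[K]_M) :
  indep v -> indep w -> indep (fun i => comb v (w i)).
Proof. by move=> hv hw s; rewrite comb_comb => /hv /hw. Qed.

Lemma dim_rV M : \dim {:'rV[K]_M} = M.
Proof. by rewrite dimvf /dim /= mul1n. Qed.

Lemma indep_exists (V : vectType K) M : (M <= \dim {:V})%N -> exists v : 'I_M -> V, indep v.
Proof.
move=> hM; exists (fun i => vb (widen_ord hM i)) => s hs.
apply/rowP => i; rewrite mxE.
have := congr1 (co (widen_ord hM i)) hs.
rewrite (lin0 (lin_co _)) /comb (lin_sum _ _ _ (lin_co _)).
rewrite (bigD1 i) //= big1 => [|j ji].
  by rewrite addr0 (linZ _ _ (lin_co _)) co_vb eqxx mulr1.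
rewrite (linZ _ _ (lin_co _)) co_vb -val_eqE /= eq_sym val_eqE.
by rewrite (negPf ji) mulr0.
Qed.

Definition zeroable (e M N : nat) := forall V : vectType K, (N <= \dim {:V})%N ->
  forall f : V -> K, hom e f -> exists v : 'I_M -> V, indep v /\ forall s, f (comb v s) = 0.

Lemma zeroable_leq e M N N' : (N <= N')%N -> zeroable e M N -> zeroable e M N'.
Proof. by move=> NN h V hV; apply: h; apply: leq_trans hV. Qed.

Lemma zeroable_all d : (forall e M, (1 <= e <= d)%N -> exists N, zeroable e M N) ->
  forall M, exists N, forall e, (1 <= e <= d)%N -> zeroable e M N.
Proof.
move=> h M; elim: d h => [|d IH] h; first by exists 0%N => e /andP[]; case: e.
have [e M' /andP[h1 h2]|N hN] := IH; first by apply: h; rewrite h1 leqW.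
have [N' hN'] := h d.+1 M (leqnn _).
exists (maxn N N') => e /andP[h1 h2].
move: h2; rewrite leq_eqVlt => /orP[/eqP -> | h2].
  by apply: zeroable_leq hN'; apply: leq_maxr.
by apply: (@zeroable_leq _ _ N); [apply: leq_maxl | apply: hN; rewrite h1].
Qed.

Definition zeroableL (d k M N : nat) := forall V : vectType K, (N <= \dim {:V})%N ->
  forall (I : finType) (f : I -> V -> K), (#|I| <= k)%N ->
  (forall i, exists e, (1 <= e <= d)%N /\ hom e (f i)) ->
  exists v : 'I_M -> V, indep v /\ forall i s, f i (comb v s) = 0.

(** One form is set aside: the others get a space of zeros of dimension [N1], large enough for the
    remaining form to have [M] independent directions of zeros inside it. *)
Lemma zeroableL_of d : (forall e M, (1 <= e <= d)%N -> exists N, zeroable e M N) ->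
  forall k M, exists N, zeroableL d k M N.
Proof.
move=> h k; elim: k => [|k IH] M.
  exists M => V hV I f hI _; have [v hv] := indep_exists hV.
  exists v; split=> // i; move: hI; rewrite leqn0 => /eqP /card0_eq /(_ i).
  by rewrite inE.
have [N1 hN1] := zeroable_all h M; have [N2 hN2] := IH N1.
exists (maxn N2 M) => V; rewrite geq_max => /andP[hV2 hVM] I f hI hf.
have [i0 _|noI] := pickP (xpredT : pred I); last first.
  have [v hv] := indep_exists hVM.
  by exists v; split=> // i; have := noI i.
have [||v [hv fv]] := hN2 V hV2 {i : I | i != i0} (fun i => f (val i)).
- by rewrite card_sig; have := cardC1 i0; rewrite /predC1 => ->; rewrite -ltnS; case: #|I| hI.
- by move=> i; apply: hf.
have [e [he hfe]] := hf i0.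
have [|w [hw fw]] := hN1 e he 'rV[K]_N1 _ _ (hom_linm (linm_comb v) hfe).
  by rewrite dim_rV.
exists (fun i => comb v (w i)); split; first exact: indep_comb.
move=> i s; rewrite comb_comb.
by have [->|ni] := eqVneq i i0; [exact: fw | exact: (fv (exist _ i ni))].
Qed.

Definition ext (V : lmodType K) m (v : 'I_m -> V) (x : V) (i : 'I_m.+1) : V :=
  if unlift ord0 i is Some j then v j else x.

Lemma comb_ext (V : lmodType K) m (v : 'I_m -> V) x s :
  comb (ext v x) s = s 0 ord0 *: x + comb v (\row_i s 0 (lift ord0 i)).
Proof.
rewrite /comb big_ord_recl {1}/ext unlift_none; congr (_ + _).
by apply: eq_bigr => i _; rewrite /ext liftK mxE.
Qed.

(** Brauer's argument. In [f (y + t x)] with [y] in the span already built, the coefficient of [t^j]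
    for [0 < j < e] is a combination of monomials in [y] whose coefficients are boundedly many forms
    of degree [j < e] in [x]. A common zero [x] of them, outside the span, splits off a diagonal
    term. *)
Lemma diagonalizable e : (0 < e)%N -> (forall k M, exists N, zeroableL e.-1 k M N) ->
  forall m, exists N, forall V : vectType K, (N <= \dim {:V})%N -> forall f, hom e f ->
    exists v : 'I_m -> V, indep v /\
      forall s, f (comb v s) = \sum_i s 0 i ^+ e * f (v i).
Proof.
move=> e0 hL; elim=> [|m [N0 IH]].
  exists 0%N => V _ f hf; exists (fun _ => 0); split.
    by move=> s _; apply/rowP => -[].
  by move=> s; rewrite big_ord0 /comb big_ord0 (hom_at0 hf).
(* [j] stands for degree [j.+1] in the new vector, hence the degrees from 1 to [e - 1]; the tuple is
   a monomial of complementary degree on the old span. *)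
pose T := {j : 'I_e.-1 & (e - j.+1).-tuple 'I_(\dim {:'rV[K]_m})}.
have [N1 hN1] := hL #|{: T}| 1%N.
exists (maxn N0 (N1 + m)) => V; rewrite geq_max => /andP[hV0 hV1] f hf.
have [v [hv fv]] := IH V hV0 f hf.
pose G (p : 'rV[K]_m * V) := f (comb v p.1 + p.2).
have hG : hom e G.
  apply: (hom_linm _ hf); apply: linm_add; last exact: linm_snd.
  by move=> a x y; apply: linm_comb.
have pG := hom_pol hG.
pose Gj j (p : 'rV[K]_m * V) := comp j (fun x => G (p.1, x)) p.2.
have hGj j t x y : Gj j (x, t *: y) = t ^+ j * Gj j (x, y) by apply: comp2_scale.
have hj (j : 'I_e.-1) : exists h : (e - j.+1).-tuple 'I_(\dim {:'rV[K]_m}) -> V -> K,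
    (forall d, hom j.+1 (h d)) /\ forall s x, Gj j.+1 (s, x) = \sum_d mon (tval d) s * h d x.
  have hc y : hom (e - j.+1) (fun s => Gj j.+1 (s, y)).
    apply: (hom_complement Kinf y (hom_comp2 Kinf j.+1 hG)); first exact: hGj.
    exact: leq_trans (ltn_ord j) (leq_pred e).
  have [h [ph eh]] := hom_expand Kinf (pol_comp2 Kinf j.+1 pG) (fun t s x => homE t s (hc x)).
  exists (fun d => comp j.+1 (h d)); split=> [d|s x]; first exact: hom_comp.
  transitivity (comp j.+1 (fun x => Gj j.+1 (s, x)) x).
    rewrite (comp_id Kinf (d := j.+1)) //; split; last by move=> t y; apply: hGj.
    exact: pol_fix1 (pol_comp2 Kinf j.+1 pG).
  have -> : (fun x => Gj j.+1 (s, x)) = (fun x => \sum_d mon (tval d) s * h d x).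
    by apply: functional_extensionality => z; apply: eh.
  rewrite (comp_sum Kinf) => [|d _]; last exact: pol_scale.
  by apply: eq_bigr => d _; rewrite (comp_scale Kinf).
have [h hh] := dchoice hj.
(* Looking for the new vector in a complement of the old span makes it independent; this costs at
   most [m] dimensions, hence the bound [N1 + m]. *)
pose S := (<<codom v>>^C)%VS.
have dS : (N1 <= \dim {: subvs_of S})%N.
  have hs : (\dim <<codom v>> <= m)%N.
    by rewrite (leq_trans (dim_span _)) // size_codom card_ord.
  rewrite dimvf /dim /= dimv_compl; lia.
pose F (t : T) (x : subvs_of S) : K := h (tag t) (tagged t) (vsval x).
have [[j d]|w [hw fw]] := hN1 (subvs_of S) dS T F (leqnn _).
  exists j.+1; split; first by rewrite ltn_ord.
  by apply: (hom_linm _ ((hh j).1 d)); apply: linm_linear.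
pose x := vsval (w ord0).
have x0 : x != 0.
  apply/negP => /eqP x0.
  have := hw (const_mx 1); rewrite /comb big_ord1 mxE scale1r.
  have -> : w ord0 = 0 by apply: val_inj; rewrite /= -/x x0.
  move=> /(_ erefl) /rowP /(_ ord0); rewrite !mxE => /eqP.
  by rewrite oner_eq0.
have Gx t y j : (0 < j < e)%N -> Gj j (y, t *: x) = 0.
  case: j => // j; rewrite ltnS leq0n /= => je.
  have je' : (j < e.-1)%N by rewrite -ltnS prednK.
  rewrite hGj ((hh (Ordinal je')).2) big1 ?mulr0 // => d _.
  have := fw (Tagged (fun j : 'I_e.-1 => (e - j.+1).-tuple 'I_(\dim {:'rV[K]_m}))
     (d : (e - (Ordinal je').+1).-tuple _)) (const_mx 1).
  rewrite /F /= /comb big_ord1 mxE scale1r => E.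
  by rewrite [h _ _ _]E mulr0.
have Fx t y : f (comb v y + t *: x) = f (comb v y) + t ^+ e * f x.
  have [N [hN eN]] := comp2_bound Kinf pG.
  rewrite -[LHS]/(G (y, t *: x)).
  have [M hM] : exists M, (maxn N e < M)%N by exists (maxn N e).+1.
  have -> : G (y, t *: x) = \sum_(i < M) Gj i (y, t *: x).
    rewrite eN -!(big_mkord xpredT (fun i => Gj i (y, t *: x))).
    rewrite [RHS](big_cat_nat (n := N)) //=; last first.
      by apply: ltnW; apply: leq_ltn_trans hM; apply: leq_maxl.
    rewrite [X in _ = _ + X]big_nat_cond [X in _ = _ + X]big1 ?addr0 // => i.
    by rewrite andbT => /andP[Ni _]; apply: hN.
  have eM : (e < M)%N by apply: leq_ltn_trans hM; apply: leq_maxr.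
  have M0 : (0 < M)%N by apply: leq_ltn_trans eM.
  rewrite (bigD1 (Ordinal M0)) //= (bigD1 (Ordinal eM)) /=; last first.
    by rewrite -val_eqE /= -lt0n.
  rewrite big1 ?addr0 => [|i /andP[i0 ie]].
    rewrite [in X in _ + X]hGj; congr (_ + _ * _).
      rewrite /Gj comp0 /=; last exact: pol_fix1.
      by rewrite /G /= addr0.
    pose f2 (p : 'rV[K]_m * V) := Gj e p.
    have hc : hom (e - e) (fun s => Gj e (s, x)).
      apply: (hom_complement Kinf x (hom_comp2 Kinf e hG)) => //.
      exact: hGj.
    have := hom0_cst Kinf y (f := fun s => Gj e (s, x)).
    rewrite subnn in hc => /(_ hc) ->.
    rewrite /Gj /= -(comp_id Kinf x hf); congr comp.
    apply: functional_extensionality => z; rewrite /G /= (linm0 (linm_comb v)).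
    by rewrite add0r.
  case: (ltnP i e) => ie'; first by rewrite Gx // ie' lt0n i0.
  have ei : (e < i)%N by rewrite ltn_neqAle ie' andbT eq_sym ie.
  exact: (@hom_excess _ Kinf _ _ (Gj i) e i y (t *: x) (hom_comp2 Kinf i hG) (hGj i) ei).
exists (ext v x); split.
  move=> s; rewrite comb_ext => E.
  have s0 : s 0 ord0 = 0.
    have xS : s 0 ord0 *: x \in S by rewrite memvZ ?subvsP.
    have xv : s 0 ord0 *: x \in <<codom v>>%VS.
      rewrite (_ : _ *: x = - comb v (\row_i s 0 (lift ord0 i))); last first.
        by apply/eqP; rewrite -addr_eq0 E.
      rewrite memvN /comb; apply: memv_suml => i _; apply: memvZ; apply: memv_span.
      exact: codom_f.
    have : s 0 ord0 *: x \in (<<codom v>> :&: S)%VS by rewrite memv_cap xv.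
    by rewrite capv_compl memv0 scaler_eq0 (negPf x0) orbF => /eqP.
  move: E; rewrite s0 scale0r add0r => /hv E.
  apply/rowP => i; rewrite mxE; case: (unliftP ord0 i) => [j ->|-> //].
  by have := congr1 (fun r : 'rV_m => r 0 j) E; rewrite !mxE.
move=> s; rewrite comb_ext addrC Fx fv big_ord_recl /ext unlift_none addrC.
by congr (_ + _); apply: eq_bigr => i _; rewrite liftK mxE.
Qed.

(** Diagonalize on [M] blocks of [n.+1] vectors, with [n] the Brauer bound, and take a nontrivial
    zero of the diagonal form of each block. A combination of these zeros scales block [b] by
    [s 0 b], whose [e]-th power factors out. *)
Lemma zeroable_exists e M : (0 < e)%N -> exists N, zeroable e M N.
Proof.
elim/ltn_ind: e M => e IH M e0.
have hL k M' : exists N, zeroableL e.-1 k M' N.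
  apply: zeroableL_of => e' M'' /andP[h1 h2]; apply: IH => //.
  by rewrite -[e]prednK // ltnS.
have [n hn] := Kbr e0.
have [N hN] := diagonalizable e0 hL (M * n.+1).
exists N => V hV f hf; have [v [hv fv]] := hN V hV f hf.
have ht (b : 'I_M) : exists t : 'I_n.+1 -> K,
    (exists i, t i != 0) /\ \sum_i f (v (mxvec_index b i)) * t i ^+ e = 0.
  exact: hn.
have [t hht] := dchoice ht.
pose A (s : 'rV[K]_M) : 'M[K]_(M, n.+1) := \matrix_(b, j) (s 0 b * t b j).
exists (fun b => comb v (mxvec (\matrix_(b', j) ((b' == b)%:R * t b j)))).
have E s : comb (fun b => mxvec (\matrix_(b', j) ((b' == b)%:R * t b j))) s = mxvec (A s).
  apply/rowP => i; case/mxvec_indexP: i => b' j; rewrite mxvecE mxE.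
  rewrite /comb summxE (bigD1 b') //= big1 ?addr0 => [|b nb].
    by rewrite mxE mxvecE mxE eqxx mul1r.
  by rewrite mxE mxvecE mxE eq_sym (negPf nb) mul0r mulr0.
split=> s.
  rewrite comb_comb E => /hv /(congr1 vec_mx); rewrite mxvecK linear0 => A0.
  apply/rowP => b; rewrite mxE; have [[j tj] _] := hht b.
  have := congr1 (fun B : 'M_(_, _) => B b j) A0; rewrite !mxE => /eqP.
  by rewrite mulf_eq0 (negPf tj) orbF => /eqP.
rewrite comb_comb E fv (reindex _ (curry_mxvec_bij _ _)) /=.
transitivity (\sum_b \sum_j mxvec (A s) 0 (mxvec_index b j) ^+ e * f (v (mxvec_index b j))).
  by rewrite pair_bigA; apply: eq_bigr => -[b j] _.
rewrite big1 // => b _.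
rewrite (eq_bigr (fun j => s 0 b ^+ e * (f (v (mxvec_index b j)) * t b j ^+ e))) => [|j _].
  by rewrite -mulr_sumr (hht b).2 mulr0.
by rewrite mxvecE mxE exprMn -mulrA; congr (_ * _); rewrite mulrC.
Qed.

Lemma zeroableL_exists d k M : exists N, zeroableL d k M N.
Proof. by apply: zeroableL_of => e M' /andP[e0 _]; apply: zeroable_exists. Qed.

(** A subspace of maximal dimension among those contained in [N] must exhaust [N]. *)
Lemma prop_vspace (V : vectType K) (N : V -> Prop) :
  N 0 -> (forall a x y, N x -> N y -> N (a *: x + y)) ->
  exists W : {vspace V}, forall x, x \in W <-> N x.
Proof.
move=> N0 NL.
pose Q n := exists W : {vspace V}, (forall x, x \in W -> N x) /\ \dim W = n.
have bQ n : Q n -> (n <= \dim {:V})%N.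
  by move=> [W [_ <-]]; apply: dimvS; apply: subvf.
have [n [[W [hW dW]] hn]] : exists n, Q n /\ forall n', Q n' -> (n' <= n)%N.
  have Q0 : Q 0%N by exists 0%VS; split; [move=> x; rewrite memv0 => /eqP -> | rewrite dimv0].
  have : forall k n, Q n -> (\dim {:V} - n < k)%N -> exists n, Q n /\ forall n', Q n' -> (n' <= n)%N.
    elim=> // k IH n Qn hk.
    have [[n' [Qn' nn']]|h] := classic (exists n', Q n' /\ (n < n')%N).
      by apply: (IH n' Qn'); have := bQ _ Qn'; lia.
    by exists n; split=> // n' Qn'; rewrite leqNgt; apply/negP => nn'; apply: h; exists n'.
  by move=> h; apply: (h _ 0%N Q0 (ltnSn _)).
exists W => x; split=> [/hW // | Nx].
have : (\dim (W + <[x]>) <= \dim W)%N.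
  rewrite dW; apply: hn; exists (W + <[x]>)%VS; split=> // y /memv_addP[w ww [z /vlineP[a ->] ->]].
  by rewrite addrC; apply: NL => //; apply: hW.
move=> h; have /eqP -> : W == (W + <[x]>)%VS by rewrite -dimv_leqif_eq ?addvSl // eqn_leq h dimvS ?addvSl.
by apply: (subvP (addvSr _ _)); apply: memv_line.
Qed.

(** Linear functions for [q = 1]; for [q] a power of the characteristic, also sums such as
    [sum c_i l_i^q]. *)
Definition qadd (V : lmodType K) q (f : V -> K) :=
  forall a x y, f (a *: x + y) = a ^+ q * f x + f y.

Lemma qadd0 (V : lmodType K) q (f : V -> K) : qadd q f -> f 0 = 0.
Proof. by move=> /(_ 1 0 0); rewrite scaler0 add0r expr1n mul1r => /eqP; rewrite eq_sym -subr_eq0 addrK => /eqP. Qed.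

Lemma qaddD (V : lmodType K) q (f : V -> K) x y : qadd q f -> f (x + y) = f x + f y.
Proof. by move=> /(_ 1 x y); rewrite scale1r expr1n mul1r. Qed.

Lemma qaddZ (V : lmodType K) q (f : V -> K) a x : qadd q f -> f (a *: x) = a ^+ q * f x.
Proof. by move=> h; have := h a x 0; rewrite !addr0 (qadd0 h) addr0. Qed.

Lemma qadd_sum (V : lmodType K) q (f : V -> K) (I : Type) (r : seq I) (P : pred I) (g : I -> V) :
  qadd q f -> f (\sum_(i <- r | P i) g i) = \sum_(i <- r | P i) f (g i).
Proof. by move=> h; apply: (big_morph f (fun x y => qaddD x y h) (qadd0 h)). Qed.

Lemma qadd_linm (V W : lmodType K) q (f : V -> K) (l : W -> V) : linm l -> qadd q f -> qadd q (fun x => f (l x)).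
Proof. by move=> hl hf a x y; rewrite hl hf. Qed.

Lemma vsval_linm (V : vectType K) (W : {vspace V}) : linm (vsval : subvs_of W -> V).
Proof. exact: linm_linear. Qed.

(** A complement of the space [W] of common zeros carries no nontrivial common zero, so its
    dimension is below the Brauer bound. Counting equations is not enough for [q > 1]: a single
    equation [x^p + c y^p = 0], with [c] not a [p]-th power, has only the zero solution. *)
Lemma codim_lt d k : exists N, forall (V : vectType K) (I : finType) (q : I -> nat) (f : I -> V -> K),
  (#|I| <= k)%N -> (forall i, (1 <= q i <= d)%N /\ pol (f i) /\ qadd (q i) (f i)) ->
  exists W : {vspace V}, (forall x, x \in W <-> forall i, f i x = 0) /\ (\dim W^C < N)%N.
Proof.
have [N hN] := zeroableL_exists d k 1.
exists N.+1 => V I q f hI hf.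
have [||W hW] := @prop_vspace V (fun x => forall i, f i x = 0).
- by move=> i; apply: qadd0 (hf i).2.2.
- by move=> a x y hx hy i; rewrite (hf i).2.2 hx hy mulr0 addr0.
exists W; split=> //; rewrite ltnNge; apply/negP => hC.
have [|i|v [hv fv]] := hN (subvs_of (W^C)) _ I (fun i x => f i (vsval x)) hI.
- by rewrite dimvf /dim /= ltnW.
- exists (q i); have [h1 [h2 h3]] := hf i; split=> //; split; first exact: (pol_linm (@vsval_linm _ _)).
  by move=> t x; rewrite linearZ /= (qaddZ _ _ h3).
pose x := vsval (v ord0).
have xW : x \in W.
  apply/hW => i; have := fv i (const_mx 1).
  by rewrite /comb big_ord1 mxE scale1r.
have : x \in (W :&: W^C)%VS by rewrite memv_cap xW subvsP.
rewrite capv_compl memv0 => /eqP x0.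
have := hv (const_mx 1); rewrite /comb big_ord1 mxE scale1r.
have -> : v ord0 = 0 by apply: val_inj; rewrite /= -/x x0.
by move=> /(_ erefl) /rowP /(_ ord0); rewrite !mxE => /eqP; rewrite oner_eq0.
Qed.

Lemma decomp (V : vectType K) (W : {vspace V}) :
  exists (a : V -> subvs_of W) (b : V -> subvs_of (W^C)),
    [/\ linm a, linm b, forall x, x = vsval (a x) + vsval (b x) & forall t, b (vsval t) = t].
Proof.
exists (fun x => vsproj W (daddv_pi W (W^C) x)), (fun x => vsproj (W^C) (daddv_pi (W^C) W x)); split.
- by apply: linm_comp; apply: linm_linear.
- by apply: linm_comp; apply: linm_linear.
- move=> x; rewrite !vsprojK ?memv_pi // daddv_pi_add ?capv_compl //.
  by rewrite addv_complf memvf.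
move=> t; apply: val_inj; rewrite /= vsprojK ?memv_pi // daddv_pi_id ?subvsP //.
by rewrite capvC capv_compl.
Qed.

End Brauer.

(** * Ideals and strength *)

Section Ideals.
Variable K : fieldType.
Hypothesis Kinf : infinite_field K.

Section OneSpace.
Variable V : lmodType K.
Implicit Types (I : finType) (f g h : V -> K).

Definition ideal I (J : {set I}) (P : I -> V -> K) g : Prop :=
  exists q : I -> V -> K, (forall i, pol (q i)) /\ forall x, g x = \sum_(i in J) q i x * P i x.

Lemma ideal_ext I (J : {set I}) P g h : ideal J P g -> g =1 h -> ideal J P h.
Proof. by move=> [q [pq e]] gh; exists q; split=> // x; rewrite -gh. Qed.

Lemma ideal0 I (J : {set I}) P : ideal J P (fun _ => 0).
Proof. by exists (fun _ _ => 0); split=> [i|x]; [exact: pol_cst | rewrite big1 // => i _; rewrite mul0r]. Qed.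

Lemma ideal_add I (J : {set I}) P g h : ideal J P g -> ideal J P h -> ideal J P (fun x => g x + h x).
Proof.
move=> [q [pq e]] [r [pr e']]; exists (fun i x => q i x + r i x); split=> [i|x]; first exact: pol_add.
by rewrite e e' -big_split; apply: eq_bigr => i _; rewrite mulrDl.
Qed.

Lemma ideal_mul I (J : {set I}) P g h : pol h -> ideal J P g -> ideal J P (fun x => h x * g x).
Proof.
move=> ph [q [pq e]]; exists (fun i x => h x * q i x); split=> [i|x]; first exact: pol_mul.
by rewrite e mulr_sumr; apply: eq_bigr => i _; rewrite mulrA.
Qed.

Lemma ideal_scale I (J : {set I}) P g c : ideal J P g -> ideal J P (fun x => c * g x).
Proof. by move=> hg; apply: ideal_mul hg; apply: pol_cst. Qed.

Lemma ideal_sub I (J : {set I}) P g h : ideal J P g -> ideal J P h -> ideal J P (fun x => g x - h x).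
Proof.
move=> hg hh; apply: ideal_ext (ideal_add hg (ideal_scale (-1) hh)) _ => x.
by rewrite mulN1r.
Qed.

Lemma ideal_sum I (J : {set I}) P (T : Type) (r : seq T) (Q : pred T) (F : T -> V -> K) :
  (forall t, Q t -> ideal J P (F t)) -> ideal J P (fun x => \sum_(t <- r | Q t) F t x).
Proof.
move=> h; elim: r => [|t r IH].
  by apply: ideal_ext (ideal0 J P) _ => x; rewrite big_nil.
case Qt: (Q t); last by apply: ideal_ext IH _ => x; rewrite big_cons Qt.
by apply: ideal_ext (ideal_add (h t Qt) IH) _ => x; rewrite big_cons Qt.
Qed.

Lemma ideal_gen I (J : {set I}) P i : i \in J -> ideal J P (P i).
Proof.
move=> iJ; exists (fun j _ => (j == i)%:R); split=> [j|x]; first exact: pol_cst.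
rewrite (bigD1 i) //= eqxx mul1r big1 ?addr0 // => j /andP[_ /negPf ->].
by rewrite mul0r.
Qed.

Lemma ideal_trans I I' (J : {set I}) (J' : {set I'}) P P' g :
  (forall i, i \in J -> ideal J' P' (P i)) -> ideal J P g -> ideal J' P' g.
Proof.
move=> h [q [pq e]]; apply: (ideal_ext (g := fun x => \sum_(i in J) q i x * P i x)) => [|x]; last by rewrite e.
by apply: ideal_sum => i iJ; apply: ideal_mul (pq i) (h i iJ).
Qed.

Lemma ideal_vanish I (J : {set I}) P g x : ideal J P g -> (forall i, i \in J -> P i x = 0) -> g x = 0.
Proof. by move=> [q [_ e]] h; rewrite e big1 // => i iJ; rewrite h ?mulr0. Qed.

Lemma ideal_pol I (J : {set I}) P g : (forall i, pol (P i)) -> ideal J P g -> pol g.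
Proof.
move=> pP [q [pq e]]; apply: (pol_ext (f := fun x => \sum_(i in J) q i x * P i x)) => [|x]; last by rewrite e.
by apply: pol_sum => i _; apply: pol_mul.
Qed.

Lemma ideal_comp I (J : {set I}) A e g k : (forall i, hom (e i) (A i)) -> ideal J A g -> ideal J A (comp k g).
Proof.
move=> hA [q [pq eg]].
exists (fun i => if (e i <= k)%N then comp (k - e i) (q i) else fun _ => 0); split.
  by move=> i; case: ifP => _; [exact: pol_comp_i | exact: pol_cst].
have -> : g = fun x => \sum_(i in J) q i x * A i x by apply: functional_extensionality.
move=> x; rewrite (comp_sum Kinf) => [|i _]; last by apply: pol_mul => //; apply: hom_pol (hA i).
apply: eq_bigr => i _; rewrite (comp_mul Kinf) //; last exact: hom_pol (hA i).
case: ifP => h.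
  have h' : (k - e i < k.+1)%N by rewrite ltnS leq_subr.
  rewrite (bigD1 (Ordinal h')) //= subKn // (comp_id Kinf x (hA i)) big1 ?addr0 // => j jn.
  rewrite (comp_neq Kinf x (hA i)) ?mulr0 //; apply/eqP => E; move/eqP: jn; apply.
  by apply: val_inj => /=; rewrite -E subKn // -ltnS ltn_ord.
rewrite mul0r big1 // => j _; rewrite (comp_neq Kinf x (hA i)) ?mulr0 //.
by apply/eqP => E; move: h; rewrite -E leq_subr.
Qed.

(** Stronger than primality of the ideal generated by [P]: the product is only assumed to vanish at
    rational zeros. With [g = h] it says that the ideal contains everything vanishing at them, which
    is how density is obtained in the end. *)
Definition prime I (J : {set I}) (P : I -> V -> K) : Prop :=
  forall g h, pol g -> pol h -> (forall x, (forall i, i \in J -> P i x = 0) -> g x * h x = 0) ->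
    ideal J P g \/ ideal J P h.

Definition smooth I (J : {set I}) (P : I -> V -> K) x0 : Prop :=
  (forall i, i \in J -> P i x0 = 0) /\
  forall c : I -> K, (forall v, \sum_(i in J) c i * D (P i) x0 v = 0) -> forall i, i \in J -> c i = 0.

Definition Nice I (J : {set I}) (P : I -> V -> K) : Prop := prime J P /\ exists x0, smooth J P x0.

Lemma prime_vanish I (J : {set I}) P g : prime J P -> pol g ->
  (forall x, (forall i, i \in J -> P i x = 0) -> g x = 0) -> ideal J P g.
Proof. by move=> h pg hg; have [|//|//] := h g g pg pg => x hx; rewrite hg ?mul0r. Qed.

(** Strength at most [S], with factors of positive complementary degrees. For [d <= 1] there are no
    such factors, only the zero function qualifies, and strong linear forms are just independent
    ones. *)
Inductive lowstr (d : nat) : nat -> (V -> K) -> Prop :=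
| lowstr_nil S f : (forall x, f x = 0) -> lowstr d S f
| lowstr_cons S a g h f f' : (0 < a < d)%N -> hom a g -> hom (d - a) h -> lowstr d S f ->
    (forall x, f' x = g x * h x + f x) -> lowstr d S.+1 f'.

Lemma lowstr_ext d S f g : lowstr d S f -> f =1 g -> lowstr d S g.
Proof.
case=> [{}S {}f f0|{}S a u v h {}f had hu hv hh e] fg; first by apply: lowstr_nil => x; rewrite -fg.
by apply: (lowstr_cons had hu hv hh) => x; rewrite -fg.
Qed.

Lemma lowstr_leq d S S' f : (S <= S')%N -> lowstr d S f -> lowstr d S' f.
Proof.
move=> hS h; elim: h S' hS => [{}S {}f f0|{}S a u v h {}f had hu hv _ IH e] S' hS; first exact: lowstr_nil.
case: S' hS => // S' hS; exact: (lowstr_cons had hu hv (IH _ hS) e).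
Qed.

Lemma lowstr_add d S S' f g : lowstr d S f -> lowstr d S' g -> lowstr d (S + S') (fun x => f x + g x).
Proof.
move=> hf hg; elim: hf => [{}S {}f f0|{}S a u v h {}f had hu hv _ IH e].
  by apply: lowstr_ext (lowstr_leq (leq_addl S S') hg) _ => x; rewrite f0 add0r.
by rewrite addSn; apply: (lowstr_cons had hu hv IH) => x; rewrite e addrA.
Qed.

Lemma lowstr_prod d a g h : (0 < a < d)%N -> hom a g -> hom (d - a) h -> lowstr d 1 (fun x => g x * h x).
Proof. by move=> had hg hh; apply: (lowstr_cons had hg hh (lowstr_nil d 0 (fun x => erefl 0))) => x; rewrite addr0. Qed.

Lemma lowstr_zero d S : lowstr d S (fun _ => 0).
Proof. exact: lowstr_nil. Qed.

Lemma lowstr_sum d S (T : Type) (r : seq T) (Q : pred T) (F : T -> V -> K) :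
  (forall t, Q t -> lowstr d S (F t)) -> lowstr d (size r * S) (fun x => \sum_(t <- r | Q t) F t x).
Proof.
move=> h; elim: r => [|t r IH]; first by apply: lowstr_nil => x; rewrite big_nil.
rewrite mulSn; case Qt: (Q t); last first.
  by apply: lowstr_ext (lowstr_leq (leq_addl _ _) IH) _ => x; rewrite big_cons Qt.
by apply: lowstr_ext (lowstr_add (h t Qt) IH) _ => x; rewrite big_cons Qt.
Qed.

Lemma lowstr_sumT d S S' (T : finType) (Q : pred T) (F : T -> V -> K) : (#|T| * S <= S')%N ->
  (forall t, Q t -> lowstr d S (F t)) -> lowstr d S' (fun x => \sum_(t | Q t) F t x).
Proof.
move=> hS h; apply: lowstr_leq hS _.
have := lowstr_sum (index_enum T) h; rewrite cardT enumT.
by congr (lowstr d (size _ * S)); rewrite /index_enum; case: index_enum_key.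
Qed.

Lemma lowstr_hom d S f : lowstr d S f -> hom d f.
Proof.
elim=> [{}S {}f f0|{}S a u v h {}f /andP[_ /ltnW had] hu hv _ IH e].
  by apply: hom_ext (hom_zero V d) _ => x; rewrite f0.
have huv := hom_mul hu hv; rewrite subnKC // in huv.
by apply: hom_ext (hom_add huv IH) _ => x; rewrite e.
Qed.

Lemma lowstr_comp_mul d a g h : (0 < a < d)%N -> hom a g -> pol h ->
  lowstr d 1 (comp d (fun x => g x * h x)).
Proof.
move=> had hg ph; apply: lowstr_ext (lowstr_prod had hg (hom_comp Kinf (d - a) ph)) _ => x.
rewrite (comp_mul Kinf) //; last exact: hom_pol hg.
have h' : (a < d.+1)%N by lia.
rewrite (bigD1 (Ordinal h')) //= (comp_id Kinf x hg) big1 ?addr0 // => j jn.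
by rewrite (comp_neq Kinf x hg) ?mul0r //; apply: contraNneq jn => E; apply/eqP/val_inj.
Qed.

Lemma lowstr_factors d S f : lowstr d S f -> exists (s : nat) (a : 'I_s -> nat) (g h : 'I_s -> V -> K),
  [/\ (s <= S)%N, forall i, [/\ (0 < a i < d)%N, hom (a i) (g i) & hom (d - a i) (h i)]
    & forall x, f x = \sum_i g i x * h i x].
Proof.
elim=> [{}S {}f f0|{}S a u v h {}f had hu hv _ [s [b [g [k [sS hb e]]]]] e'].
  by exists 0%N, (fun _ => 0%N), (fun _ _ => 0), (fun _ _ => 0); split=> // [[]//|x]; rewrite big_ord0.
pose E T (x : T) (y : 'I_s -> T) (i : 'I_s.+1) := if unlift ord0 i is Some j then y j else x.
exists s.+1, (E _ a b), (E _ u g), (E _ v k); split=> // [i|x].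
  by rewrite /E; case: (unlift ord0 i).
rewrite e' e big_ord_recl /E unlift_none; congr (_ + _).
by apply: eq_bigr => i _; rewrite liftK.
Qed.

Definition strong C I (J : {set I}) (e : I -> nat) (A : I -> V -> K) : Prop :=
  forall (n : nat) (c : I -> K), (forall i, i \in J -> c i != 0 -> e i = n) ->
    (exists2 i, i \in J & c i != 0) -> ~ lowstr n C (fun x => \sum_(i in J) c i * A i x).

(** A regular sequence in every order: each [A i] is a nonzerodivisor modulo any subfamily omitting
    it. This lets indices be eliminated in any order. *)
Definition regular I (J0 : {set I}) (A : I -> V -> K) : Prop :=
  forall (J : {set I}) i q, J \subset J0 -> i \in J0 -> i \notin J -> pol q ->
    ideal J A (fun x => q x * A i x) -> ideal J A q.

Lemma regular_of I (J0 : {set I}) (A : I -> V -> K) : (forall i, pol (A i)) ->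
  (forall (J : {set I}) i, J \subset J0 -> i \in J0 -> i \notin J -> prime J A) ->
  (forall (J : {set I}) i, J \subset J0 -> i \in J0 -> i \notin J -> ~ ideal J A (A i)) -> regular J0 A.
Proof.
move=> pA hp hn J i q JJ iJ0 iJ pq hq.
have [x hx|//|h] := hp J i JJ iJ0 iJ q (A i) pq (pA i); first exact: (ideal_vanish hq hx).
by case: (hn J i JJ iJ0 iJ).
Qed.

(* By homogeneity a relation [A i = sum q_j A_j] reduces to a combination of forms of the same degree plus
products of forms of positive degree. *)
Lemma ideal_lowstr I (J : {set I}) A e i : (forall j, (0 < e j)%N) -> (forall j, hom (e j) (A j)) ->
  ideal J A (A i) -> exists c : I -> K, (forall j, c j != 0 -> j \in J /\ e j = e i) /\
    lowstr (e i) #|I| (fun x => A i x - \sum_j c j * A j x).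
Proof.
move=> e0 hA /(ideal_comp (e i) hA) [q [pq E]].
pose c j := if (j \in J) && (e j == e i) then comp 0 (q j) 0 else 0.
exists c; split=> [j|].
  by rewrite /c; case: andP => [[-> /eqP]//|]; rewrite eqxx.
pose F j := comp (e i) (fun x => q j x * A j x).
have ls : lowstr (e i) #|I| (fun x => \sum_(j in [set j in J | (e j < e i)%N]) F j x).
  apply: (lowstr_sumT (S := 1)) => [|j]; first by rewrite muln1.
  rewrite inE => /andP[_ h]; apply: (lowstr_ext (f := comp (e i) (fun x => A j x * q j x))).
    by apply: lowstr_comp_mul (hA j) (pq j); rewrite e0.
  by move=> x; rewrite /F; congr comp; apply: functional_extensionality => y; rewrite mulrC.
apply: lowstr_ext ls _ => x.
have Ex : A i x = \sum_(j in J) F j x.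
  rewrite -(comp_id Kinf x (hA i)) -(comp_comp Kinf) ?E; last exact: hom_pol (hA i).
  rewrite (_ : comp (e i) (A i) = fun x => \sum_(j in J) q j x * A j x); last exact: functional_extensionality.
  by rewrite (comp_sum Kinf) // => j _; apply: pol_mul => //; apply: hom_pol (hA j).
rewrite Ex [X in _ = X - _](bigID (fun j => (e j < e i)%N)) /=.
have -> : \sum_(j in [set j in J | (e j < e i)%N]) F j x = \sum_(j in J | (e j < e i)%N) F j x.
  by apply: eq_bigl => j; rewrite inE.
rewrite -[LHS]addr0 -addrA; congr (_ + _); apply/eqP; rewrite eq_sym subr_eq0; apply/eqP.
rewrite big_mkcond /=; apply: eq_bigr => j _; rewrite /c.
case jJ: (j \in J) => /=; last by rewrite mul0r.
rewrite -leqNgt; case: ltngtP => h; rewrite /F ?(comp_mul Kinf) //; try exact: hom_pol (hA j).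
- rewrite mul0r big1 // => k _; rewrite (comp_neq Kinf x (hA j)) ?mulr0 //; apply/eqP => E'.
  by have := leq_subr k (e i); rewrite E' leqNgt h.
- by rewrite mul0r.
rewrite big_ord_recl /= subn0 h (comp_id Kinf x (hA j)) big1 ?addr0.
  by rewrite !comp0.
move=> k _; rewrite (comp_neq Kinf x (hA j)) ?mulr0 // /bump /=; have := e0 j; lia.
Qed.

Lemma strong_nideal I (J0 J : {set I}) A e i : (forall j, (0 < e j)%N) -> (forall j, hom (e j) (A j)) ->
  strong #|I| J0 e A -> J \subset J0 -> i \in J0 -> i \notin J -> ~ ideal J A (A i).
Proof.
move=> e0 hA hs JJ iJ0 iJ /(ideal_lowstr e0 hA) [c [hc hl]].
pose c' j := (j == i)%:R - c j.
have ci : c i = 0 by apply/eqP; apply: contraNT iJ => /hc [].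
apply: (hs (e i) c').
- move=> j _; rewrite /c'; have [-> // | ji] := eqVneq j i.
  by rewrite sub0r oppr_eq0 => /hc [].
- by exists i; rewrite // /c' eqxx ci subr0 oner_eq0.
apply: lowstr_ext hl _ => x.
rewrite [X in _ - X](bigID [in J0]) /= [X in _ - (_ + X)]big1 ?addr0; last first.
  move=> j nj; have [->|/hc [jJ _]] := eqVneq (c j) 0; first by rewrite mul0r.
  by rewrite (subsetP JJ) in nj.
rewrite (bigD1 i) //= ci mul0r add0r [in RHS](bigD1 i) //= /c' eqxx ci subr0 mul1r; congr (_ + _).
by rewrite -sumrN; apply: eq_bigr => j /andP[_ /negPf ->]; rewrite sub0r mulNr.
Qed.

End OneSpace.

Lemma ideal_linm (V W : lmodType K) (I : finType) (J : {set I}) (P : I -> V -> K) g (s : W -> V) :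
  polm s -> ideal J P g -> ideal J (fun i x => P i (s x)) (fun x => g (s x)).
Proof. by move=> ps [q [pq e]]; exists (fun i x => q i (s x)); split=> [i|x]; [exact: pol_comp | rewrite e]. Qed.

Lemma lowstr_linm (V W : lmodType K) d S (f : V -> K) (s : W -> V) :
  linm s -> lowstr d S f -> lowstr d S (fun x => f (s x)).
Proof.
move=> ls; elim=> [{}S {}f f0|{}S a u v h {}f had hu hv _ IH e]; first exact: lowstr_nil.
by apply: (lowstr_cons had (hom_linm ls hu) (hom_linm ls hv) IH) => x; rewrite e.
Qed.

End Ideals.

(** * Leading forms of ideal elements *)

Section TopForms.
Variable K : fieldType.
Hypothesis Kinf : infinite_field K.

Definition dense (V : lmodType K) (D : V -> Prop) : Prop :=
  forall f, pol f -> (exists y, f y != 0) -> exists y, D y /\ f y != 0.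

(** A vector space is irreducible: if two nonzero polynomials witness that neither [D1] nor [D2] is
    dense, their product vanishes on [D] without being zero. *)
Lemma dense_or (V : lmodType K) (D D1 D2 : V -> Prop) : dense D ->
  (forall y, D y -> D1 y \/ D2 y) -> dense D1 \/ dense D2.
Proof.
move=> hD h; have [|n1] := classic (dense D1); first by left.
right=> f2 p2 [y2 f2y]; apply: NNPP => n2; apply: n1 => f1 p1 [y1 f1y]; apply: NNPP => n1.
have [z] := pol_domain Kinf p1 p2 f1y f2y; move=> hz.
have [|y [Dy]] := hD _ (pol_mul p1 p2); first by exists z.
rewrite mulf_eq0 negb_or => /andP[h1 h2].
by case: (h y Dy) => ?; [apply: n1; exists y | apply: n2; exists y].
Qed.

Lemma dense_eq0 (V : lmodType K) (D : V -> Prop) f : dense D -> pol f -> (forall y, D y -> f y = 0) ->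
  forall y, f y = 0.
Proof.
move=> hD pf h y; apply/eqP; apply: NNPP => /negP fy.
have [|z [Dz]] := hD f pf; first by exists y.
by rewrite h ?eqxx.
Qed.

Lemma comp_mul_top (U : lmodType K) N e (q P : U -> K) x : pol q -> pol P ->
  (forall l x, (N < l + e)%N -> comp l q x = 0) -> (forall l x, (e < l)%N -> comp l P x = 0) ->
  comp N (fun x => q x * P x) x = (if (e <= N)%N then comp (N - e) q x else 0) * comp e P x.
Proof.
move=> pq pP hq hP; rewrite (comp_mul Kinf) //; case: leqP => eN.
  have h : (N - e < N.+1)%N by lia.
  rewrite (bigD1 (Ordinal h)) //= subKn // big1 ?addr0 // => j jn.
  have [jl|jl] := ltnP (N - j) e.+1; last by rewrite hP ?mulr0.
  rewrite hq ?mul0r //; have := ltn_ord j; move: jn; rewrite -val_eqE /=; lia.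
by rewrite mul0r big1 // => j _; rewrite hq ?mul0r //; lia.
Qed.

Lemma ideal_hom (U : lmodType K) (I : finType) (J : {set I}) (A : I -> U -> K) e g k :
  (forall i, hom (e i) (A i)) -> ideal J A g -> hom k g ->
  exists b : I -> U -> K, [/\ forall i, pol (b i),
    forall i, if (e i <= k)%N then hom (k - e i) (b i) else b i = fun _ => 0 & forall x, g x = \sum_(i in J) b i x * A i x].
Proof.
move=> hA [q [pq eg]] hg.
exists (fun i => if (e i <= k)%N then comp (k - e i) (q i) else fun _ => 0); split.
- by move=> i; case: ifP => _; [exact: pol_comp_i | exact: pol_cst].
- by move=> i /=; case: ifP => h //; rewrite h //; apply: (hom_comp Kinf).
move=> x; rewrite -(comp_id Kinf x hg).
have -> : g = fun x => \sum_(i in J) q i x * A i x by apply: functional_extensionality.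
rewrite (comp_sum Kinf) => [|i _]; last by apply: pol_mul => //; apply: hom_pol (hA i).
apply: eq_bigr => i _; rewrite (comp_mul Kinf) //; last exact: hom_pol (hA i).
case: ifP => h.
  have h' : (k - e i < k.+1)%N by rewrite ltnS leq_subr.
  rewrite (bigD1 (Ordinal h')) //= subKn // (comp_id Kinf x (hA i)) big1 ?addr0 // => j jn.
  rewrite (comp_neq Kinf x (hA i)) ?mulr0 //; apply/eqP => E; move/eqP: jn; apply.
  by apply: val_inj => /=; rewrite -E subKn // -ltnS ltn_ord.
rewrite mul0r big1 // => j _; rewrite (comp_neq Kinf x (hA i)) ?mulr0 //.
by apply/eqP => E; move: h; rewrite -E leq_subr.
Qed.

Section Syzygies.
Variables (U : lmodType K) (I : finType) (J0 : {set I}) (e : I -> nat) (A P : I -> U -> K).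
Hypothesis hA : forall i, hom (e i) (A i).
Hypothesis pP : forall i, pol (P i).
Hypothesis hP : forall i l x, i \in J0 -> (e i < l)%N -> comp l (P i) x = 0.
Hypothesis PA : forall i x, i \in J0 -> comp (e i) (P i) x = A i x.
Hypothesis rA : regular J0 A.

(* Eliminates the leading forms of the coefficients one index at a time, by Koszul syzygies. *)
Lemma lower_top n (J : {set I}) N (q : I -> U -> K) : (#|J| <= n)%N -> J \subset J0 -> (forall i, pol (q i)) ->
  (forall i l x, i \in J0 -> (N < l + e i)%N -> comp l (q i) x = 0) ->
  (forall i l x, i \in J0 -> i \notin J -> (N <= l + e i)%N -> comp l (q i) x = 0) ->
  (forall x, comp N (fun x => \sum_(i in J0) q i x * P i x) x = 0) ->
  exists q' : I -> U -> K, [/\ forall i, pol (q' i),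
    forall i l x, i \in J0 -> (N <= l + e i)%N -> comp l (q' i) x = 0 &
    forall x, \sum_(i in J0) q' i x * P i x = \sum_(i in J0) q i x * P i x].
Proof.
elim: n J q => [|n IH] J q.
  rewrite leqn0 cards_eq0 => /eqP -> _ pq _ hq _.
  by exists q; split=> // i l x iJ; apply: hq; rewrite ?inE.
move=> cJ JJ pq hq hq' h0.
have [J00|[i0 iJ]] := set_0Vmem J.
  by exists q; split=> // i l x i0; apply: hq'; rewrite ?J00 ?inE.
have iJ0 : i0 \in J0 by apply: (subsetP JJ).
pose a i := if (e i <= N)%N then comp (N - e i) (q i) else fun _ => 0.
have pa i : pol (a i) by rewrite /a; case: ifP => _; [exact: pol_comp_i | exact: pol_cst].
have ea i x : i \in J0 -> comp N (fun x => q i x * P i x) x = a i x * A i x.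
  move=> ii; rewrite (comp_mul_top (e := e i)) //; last by move=> l y; apply: hP.
    by rewrite PA // /a; case: ifP.
  by move=> l y; apply: hq.
have ez x : \sum_(i in J) a i x * A i x = 0.
  rewrite -[RHS](h0 x) (comp_sum Kinf); last by move=> i _; apply: pol_mul.
  rewrite [RHS](bigID [in J]) /= [X in _ = _ + X]big1 ?addr0.
    apply: eq_big => [i|i ii]; last by rewrite ea // (subsetP JJ).
    by case iJ': (i \in J); rewrite ?andbF // (subsetP JJ).
  move=> i /andP[ii ni]; rewrite ea // /a; case: ifP => h; rewrite ?mul0r //.
  by rewrite (hq' i) ?mul0r // subnK.
have e_i0 x : a i0 x * A i0 x = - \sum_(i in J :\ i0) a i x * A i x.
  by have := ez x; rewrite (big_setD1 i0) //= => /eqP; rewrite addr_eq0 => /eqP.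
(* The relation between leading forms puts [a i0 * A i0] in the ideal of the other [A i]; regularity
   cancels [A i0]. *)
have [b [pb hb eb]] : exists b : I -> U -> K, [/\ forall i, pol (b i),
    forall i, if (e i + e i0 <= N)%N then hom (N - (e i + e i0)) (b i) else b i = fun _ => 0 &
    forall x, a i0 x = \sum_(i in J :\ i0) b i x * A i x].
  have [eN|eN] := leqP (e i0) N; last first.
    exists (fun _ _ => 0); split; [by move=> i; exact: pol_cst | move=> i | move=> y].
      by rewrite leqNgt ltn_addl.
    by rewrite /a leqNgt eN big1 // => i _; rewrite mul0r.
  have [||b [pb hb eb]] := ideal_hom (k := N - e i0) hA (J := J :\ i0) (g := a i0).
  - apply: (rA (i := i0)) => //; rewrite ?inE ?eqxx //; first exact: subset_trans (subD1set _ _) JJ.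
    exists (fun i x => - a i x); split=> [i|x]; first exact: pol_opp.
    by rewrite e_i0 -sumrN; apply: eq_bigr => i _; rewrite mulNr.
  - by rewrite /a eN; apply: (hom_comp Kinf).
  exists b; split=> // i; have := hb i.
  have -> : (e i <= N - e i0)%N = (e i + e i0 <= N)%N by rewrite leq_subRL // addnC.
  by rewrite addnC subnDA.
have pbP i j : pol (fun x => b i x * P j x) by apply: pol_mul.
have bP i j l x : j \in J0 -> (N + e j < l + e i + e i0)%N -> comp l (fun x => b i x * P j x) x = 0.
  move=> jJ h; rewrite (comp_mul Kinf) // big1 // => k _; have := hb i; case: ifP => hN hb'.
    rewrite (comp_homE Kinf hb'); case: eqP => [E|]; last by rewrite mul0r.
    by rewrite hP ?mulr0 //; have := ltn_ord k; lia.
  by rewrite hb' (comp_neq Kinf x (hom_zero U k.+1)) ?mul0r // neq_ltn ltnSn.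
have bPt i l x : i \in J0 -> (l + e i0 = N)%N -> comp l (fun x => b i x * P i x) x = b i x * A i x.
  move=> iJ' lN; rewrite (comp_mul_top (e := e i)) //; first last.
  - by move=> l' y h; apply: hP.
  - move=> l' y h; have := hb i; case: ifP => hN hb'.
      by rewrite (comp_homE Kinf hb') ifN //; apply/eqP => E; lia.
    by rewrite hb' (comp_neq Kinf y (hom_zero U l'.+1)) // neq_ltn ltnSn.
  rewrite PA //; congr (_ * _); have := hb i; have -> : (e i + e i0 <= N)%N = (e i <= l)%N by lia.
  case: ifP => hN hb'; last by rewrite hb'.
  rewrite (comp_homE Kinf hb') ifT //; apply/eqP; lia.
(* The trivial relations [P j * P i0 = P i0 * P j], weighted by [b j], cancel the leading part of
   [q i0] at the expense of the other coefficients, without changing the sum. *)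
pose c i x := if i == i0 then \sum_(j in J :\ i0) b j x * P j x else 0.
pose c' i x := if i \in J :\ i0 then b i x * P i0 x else 0.
have pc i : pol (c i).
  rewrite /c; case: (i == i0); last exact: pol_cst.
  by apply: pol_sum => j _.
have pc' i : pol (c' i) by rewrite /c'; case: (i \in _); [exact: pbP | exact: pol_cst].
have cc i l x : comp l (fun x => q i x - c i x + c' i x) x =
    comp l (q i) x - (if i == i0 then \sum_(j in J :\ i0) comp l (fun x => b j x * P j x) x else 0)
    + (if i \in J :\ i0 then comp l (fun x => b i x * P i0 x) x else 0).
  have z : comp l (fun _ : U => 0) x = 0 :> K by rewrite (comp_neq Kinf x (hom_zero U l.+1)) // neq_ltn ltnSn.
  rewrite (comp_add Kinf) ?(comp_sub Kinf) //; last exact: pol_sub.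
  congr (_ - _ + _); rewrite /c /c'; last by case: (i \in _).
  by case: (i == i0); rewrite ?(comp_sum Kinf).
have eS x : \sum_(i in J0) (q i x - c i x + c' i x) * P i x = \sum_(i in J0) q i x * P i x.
  under eq_bigr do rewrite mulrDl mulrBl.
  rewrite big_split /= sumrB -[RHS]addr0 -[LHS]addrA; congr (_ + _).
  have JJ' : J :\ i0 \subset J0 by apply: subset_trans (subD1set _ _) JJ.
  have -> : \sum_(i in J0) c' i x * P i x = \sum_(i in J :\ i0) b i x * P i0 x * P i x.
    rewrite (big_setID (J :\ i0)) /= (setIidPr JJ') [X in _ + X]big1 ?addr0 => [|i].
      by apply: eq_bigr => i ii; rewrite /c' ii.
    by rewrite inE => /andP[/negPf ni _]; rewrite /c' ni mul0r.
  rewrite (bigD1 i0) //= [X in - (_ + X)]big1 ?addr0 => [|i /andP[_ /negPf ni]]; last by rewrite /c ni mul0r.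
  rewrite /c eqxx mulr_suml addrC -sumrB big1 // => i ii; ring.
have JiJ j : j \in J :\ i0 -> j \in J0 by rewrite inE => /andP[_ /(subsetP JJ)].
have [||||||q' [pq' hq'' eq']] := IH (J :\ i0) (fun i x => q i x - c i x + c' i x).
- by move: cJ; rewrite (cardsD1 i0) iJ.
- exact: subset_trans (subD1set _ _) JJ.
- by move=> i; apply: pol_add => //; apply: pol_sub.
- move=> i l x ii h; rewrite cc hq // sub0r.
  rewrite [X in - X](_ : _ = 0); last first.
    by case: eqP => // E; rewrite big1 // => j jJ; apply: bP; [exact: JiJ | subst; lia].
  by rewrite oppr0 add0r; case: ifP => // iJ'; apply: bP => //; lia.
- move=> i l x ii; rewrite in_setD1 => ni h; rewrite cc in_setD1 (negPf ni) addr0.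
  have [E|ni0] := eqVneq i i0; last first.
    by rewrite subr0 hq' //; move: ni; rewrite ni0.
  subst i; have [h'|h'] := ltnP N (l + e i0).
    by rewrite hq // big1 ?subr0 // => j jJ; apply: bP; [exact: JiJ | lia].
  have lN : (l + e i0 = N)%N by lia.
  have -> : \sum_(j in J :\ i0) comp l (fun x => b j x * P j x) x = \sum_(j in J :\ i0) b j x * A j x.
    by apply: eq_bigr => j jJ; apply: bPt; [exact: JiJ | ].
  rewrite -eb /a ifT; last lia.
  have -> : (N - e i0 = l)%N by lia.
  by rewrite subrr.
- by move=> x; rewrite -[RHS](h0 x); congr comp; apply: functional_extensionality => y.
by exists q'; split=> // x; rewrite eq'.
Qed.

(** If the products [q i * P i] reach a degree [N > k], the part of degree [N] of their sum is zero
    and [lower_top] lowers [N]. Once [N <= k], the components of degree [k] exhibit the combination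
    of the [A i]. The induction is on [N - k]. *)
Lemma top_form g k : ideal J0 P g -> (forall l x, (k < l)%N -> comp l g x = 0) -> ideal J0 A (comp k g).
Proof.
move=> [q [pq eg]] hg.
have {}eg : g = fun x => \sum_(i in J0) q i x * P i x by apply: functional_extensionality.
have [N hN] : exists N, forall i l x, i \in J0 -> (N < l + e i)%N -> comp l (q i) x = 0.
  have h i : exists n, forall l x, (n <= l)%N -> comp l (q i) x = 0.
    by have [n [hn _]] := comp_bound Kinf (pq i); exists n.
  have [n hn] := dchoice h.
  exists (\sum_i (n i + e i))%N => i l x _; rewrite (bigD1 i) //= => h'; apply: hn; lia.
have [M hM] : exists M, M = (N - k)%N by exists (N - k)%N.
elim: M N q pq eg hN hM => [|M IH] N q pq eg hN hM.
  have hN' i l x : i \in J0 -> (k < l + e i)%N -> comp l (q i) x = 0.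
    by move=> ii h; apply: hN => //; lia.
  exists (fun i => if (e i <= k)%N then comp (k - e i) (q i) else fun _ => 0); split.
    by move=> i; case: ifP => _; [exact: pol_comp_i | exact: pol_cst].
  move=> x; rewrite eg (comp_sum Kinf); last by move=> i _; apply: pol_mul.
  apply: eq_bigr => i ii; rewrite (comp_mul_top (e := e i)) ?PA //; first by case: ifP.
    by move=> l y; apply: hN'.
  by move=> l y; apply: hP.
have [|||||q' [pq' hq' eq']] := @lower_top #|J0| J0 N q _ _ pq => //.
- by move=> i l x ii; rewrite ii.
- by move=> x; rewrite -eg hg //; lia.
apply: (IH N.-1 q') => //; last lia.
- by rewrite eg; apply: functional_extensionality => x; rewrite eq'.
by move=> i l x ii h; apply: hq' => //; lia.
Qed.

End Syzygies.
End TopForms.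

(** * Ideal membership in families *)

Section Family.
Variable K : fieldType.
Hypothesis Kinf : infinite_field K.

(** Elimination of terms. A first coefficient vanishing on [D] is zero by density. Otherwise the
    value of the sum at a point [y1] of [D], which satisfies [a], takes the place of [w ord0], and
    the remaining sum is one term shorter. *)
Lemma separate (Y : vectType K) (U : lmodType K) (D : Y -> Prop) (a : (U -> K) -> Prop) :
  dense D -> (forall f g c, a f -> a g -> a (fun x => c * f x + g x)) ->
  forall n (p : 'I_n -> Y -> K) (w : 'I_n -> U -> K), (forall i, pol (p i)) ->
  (forall y, D y -> a (fun u => \sum_i p i y * w i u)) ->
  exists m (p' : 'I_m -> Y -> K) (w' : 'I_m -> U -> K), [/\ forall i, pol (p' i), forall i, a (w' i) &
    forall y u, \sum_i p i y * w i u = \sum_i p' i y * w' i u].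
Proof.
move=> hD ha; elim=> [|n IH] p w pp hy.
  by exists 0%N, p, w; split=> // -[].
have [[y1 [Dy1 py1]]|h'] := classic (exists y, D y /\ p ord0 y != 0); last first.
  have h y : D y -> p ord0 y = 0.
    by move=> Dy; apply/eqP; apply: NNPP => /negP hy'; apply: h'; exists y.
  have p0 := dense_eq0 hD (pp ord0) h.
  have e y u : \sum_i p i y * w i u = \sum_i p (lift ord0 i) y * w (lift ord0 i) u.
    by rewrite big_ord_recl p0 mul0r add0r.
  have [||m [p' [w' [h1 h2 h3]]]] := IH (fun i => p (lift ord0 i)) (fun i => w (lift ord0 i)).
  - by move=> i.
  - move=> y Dy; have := hy y Dy; congr a; apply: functional_extensionality => u; exact: e.
  by exists m, p', w'; split=> // y u; rewrite e.
pose G y u := \sum_i p i y * w i u.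
pose r y := p ord0 y / p ord0 y1.
have pr : pol r by apply: pol_mul => //; apply: pol_cst.
have e y u : G y u = r y * G y1 u + \sum_i (p (lift ord0 i) y - r y * p (lift ord0 i) y1) * w (lift ord0 i) u.
  rewrite /G !big_ord_recl mulrDr mulrA /r divfK // -addrA; congr (_ + _).
  by rewrite mulr_sumr -big_split /=; apply: eq_bigr => i _; ring.
have [||m [p' [w' [h1 h2 h3]]]] := IH (fun i y => p (lift ord0 i) y - r y * p (lift ord0 i) y1) (fun i => w (lift ord0 i)).
- by move=> i; apply: pol_sub => //; apply: pol_mul => //; apply: pol_cst.
- move=> y Dy; have := ha _ _ (- r y) (hy _ Dy1) (hy _ Dy); congr a.
  by apply: functional_extensionality => u; rewrite -!/(G _ _) (e y u) mulNr addrA addNr add0r.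
exists m.+1, (fun i => if unlift ord0 i is Some j then p' j else r),
  (fun i => if unlift ord0 i is Some j then w' j else G y1); split.
- by move=> i; case: (unlift ord0 i).
- by move=> i; case: (unlift ord0 i) => // ; apply: hy.
move=> y u; rewrite -/(G _ _) e h3 big_ord_recl unlift_none; congr (_ + _).
by apply: eq_bigr => i _; rewrite liftK.
Qed.

(** Induction on the degree of [g] in [u]. The leading forms [A] do not depend on [y], so the top
    part of [g] is, over [D], in the ideal of [A]; after separation of variables it is removed by an
    element of the ideal of [P] over the whole family. *)
Lemma family_ideal (Y U : vectType K) (I : finType) (J : {set I}) (e : I -> nat) (A : I -> U -> K)
    (P : I -> Y * U -> K) (D : Y -> Prop) g :
  (forall i, hom (e i) (A i)) -> (forall i, pol (P i)) ->
  (forall i l y u, i \in J -> (e i < l)%N -> comp l (fun u => P i (y, u)) u = 0) ->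
  (forall i y u, i \in J -> comp (e i) (fun u => P i (y, u)) u = A i u) -> regular J A ->
  dense D -> pol g -> (forall y, D y -> ideal J (fun i u => P i (y, u)) (fun u => g (y, u))) -> ideal J P g.
Proof.
move=> hA pP hP PA rA hD pg hg.
have [N [hN _]] := comp2_bound Kinf pg.
elim: N g pg hg hN => [|N IH] g pg hg hN.
  apply: ideal_ext (ideal0 _ _) _ => -[y u].
  have [N [_ eN]] := comp2_bound Kinf pg.
  by rewrite eN big1 // => i _; apply: hN.
pose gN (p : Y * U) := comp N (fun u => g (p.1, u)) p.2.
have pgN : pol gN by apply: pol_comp2.
have hgN y : D y -> ideal J A (fun u => gN (y, u)).
  move=> Dy; apply: (top_form Kinf hA (fun i => pol_fix1 y (pP i))) (hg y Dy) _ => //.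
  - by move=> i l x; apply: hP.
  - by move=> i x; apply: PA.
  - by move=> l x; apply: hN.
have [L [pL eL]] := pol_expand pgN.
have [|||m [p [w [pp hw ew]]]] := @separate Y U D (ideal J A) hD _ (size L)
    (fun i => mon (nth ([::], fun _ => 0) L i).1) (fun i => (nth ([::], fun _ => 0) L i).2).
- by move=> f h c hf hh; apply: ideal_add hh; apply: ideal_scale.
- by move=> i; apply: hom_pol (hom_mon _).
- move=> y Dy; apply: ideal_ext (hgN y Dy) _ => u.
  by rewrite eL (big_nth ([::], fun _ => 0)) big_mkord.
have {}ew y u : gN (y, u) = \sum_i p i y * w i u.
  by rewrite eL (big_nth ([::], fun _ => 0)) big_mkord ew.
have pw i : pol (w i) by apply: ideal_pol (hw i) => j; apply: hom_pol (hA j).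
have hb i := ideal_hom Kinf hA (ideal_comp Kinf N hA (hw i)) (hom_comp Kinf N (pw i)).
have [b hb'] := dchoice hb.
(* [s] lies in the ideal of [P] and has the same part of degree [N] in [u] as [g], so [g - s] has
   smaller degree and still satisfies the hypothesis over [D]. *)
pose s (q : Y * U) := \sum_(i < m) p i q.1 * \sum_(j in J) b i j q.2 * P j q.
have pps i : pol (fun q : Y * U => p i q.1) by exact: (pol_linm (f := p i) (@linm_fst K Y U) (pp i)).
have pb i j : pol (fun q : Y * U => b i j q.2).
  by have [h _ _] := hb' i; exact: (pol_linm (f := b i j) (@linm_snd K Y U) (h j)).
have ps : pol s.
  by apply: pol_sum => i _; apply: pol_mul => //; apply: pol_sum => j _; apply: pol_mul.
have is_ : ideal J P s.
  apply: ideal_sum => i _; apply: ideal_mul => //; apply: ideal_sum => j jJ.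
  by apply: ideal_mul => //; apply: ideal_gen.
have pbi i j : pol (b i j) by have [] := hb' i.
have cs l y u : (N <= l)%N -> comp l (fun u => s (y, u)) u = if l == N then gN (y, u) else 0.
  move=> Nl.
  have pbP i j : pol (fun u => b i j u * P j (y, u)) by apply: pol_mul (pbi i j) (pol_fix1 y (pP j)).
  rewrite (comp_sum Kinf) /=; last by move=> i _; apply: pol_scale; apply: pol_sum => j _.
  have cb i j : j \in J -> comp l (fun u => b i j u * P j (y, u)) u = if l == N then b i j u * A j u else 0.
    move=> jJ; have [_ /(_ j) h _] := hb' i.
    rewrite (comp_mul_top Kinf (e := e j)) //; first last.
    - by move=> l' x; apply: hP.
    - move=> l' x h'; move: h; case: ifP => h bh; last first.
        by rewrite bh (comp_neq Kinf x (hom_zero U l'.+1)) // neq_ltn ltnSn.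
      by rewrite (comp_neq Kinf x bh) //; apply/eqP => E; lia.
    - exact: pol_fix1.
    rewrite PA //; move: h; case: ifP => h bh.
      rewrite ifT; last by apply: leq_trans Nl.
      rewrite (comp_homE Kinf bh); have -> : (l - e j == N - e j)%N = (l == N) by apply/eqP/eqP; lia.
      by case: eqP => _; rewrite ?mul0r.
    rewrite bh; case: (l == N); rewrite ?mul0r; case: ifP => _; rewrite ?mul0r //.
      by rewrite (comp_neq Kinf u (hom_zero U (l - e j).+1)) ?mul0r // neq_ltn ltnSn.
    by rewrite (comp_neq Kinf u (hom_zero U (l - e j).+1)) ?mul0r // neq_ltn ltnSn.
  transitivity (\sum_(i < m) p i y * \sum_(j in J) (if l == N then b i j u * A j u else 0)).
    apply: eq_bigr => i _; rewrite (comp_scale Kinf); last by apply: pol_sum => j _.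
    by rewrite (comp_sum Kinf) //; congr (_ * _); apply: eq_bigr => j jJ; apply: cb.
  case: eqP => E; last by rewrite big1 // => i _; rewrite big1 ?mulr0.
  rewrite [RHS]/gN /= -(comp_comp Kinf N u (pol_fix1 y pg)).
  rewrite (_ : comp N (fun u => g (y, u)) = fun u => \sum_i p i y * w i u); last first.
    by apply: functional_extensionality => x; rewrite -ew.
  rewrite (comp_sum Kinf); last by move=> i _; apply: pol_scale.
  apply: eq_bigr => i _; rewrite (comp_scale Kinf) //; congr (_ * _).
  by have [_ _ ->] := hb' i.
apply: (ideal_ext (g := fun q => (g q - s q) + s q)) => [|q]; last by rewrite subrK.
apply: ideal_add (is_); apply: IH; first exact: pol_sub.
- move=> y Dy; apply: ideal_sub (hg y Dy) _.
  by apply: (ideal_linm (s := fun u => (y, u)) _ is_); apply: polm_fix1.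
move=> l y u Nl; rewrite (comp_sub Kinf); try exact: pol_fix1.
rewrite cs //; case: eqP => [->|lN]; first by rewrite /gN subrr.
by rewrite hN ?subr0 //; lia.
Qed.

End Family.

(** * Normal forms and their polarizations *)

Section Frobenius.
Variable K : fieldType.
Hypothesis Kinf : infinite_field K.

Lemma hom_tc (V : lmodType K) d (f : V -> K) i : hom d f ->
  hom d (fun p : V * V => (tp f p.1 p.2)`_i).
Proof.
move=> hf; have pf := hom_pol hf; split; first exact: pol_tc.
move=> t [x w] /=; have -> : tp f (t *: x) (t *: w) = t ^+ d *: tp f x w; last by rewrite coefZ.
apply: tp_unique => // s; rewrite hornerZ -tpE // -(homE t _ hf); congr f.
by rewrite scalerDr !scalerA mulrC.
Qed.

Lemma tc_mul (V : lmodType K) (f g : V -> K) i x w : pol f -> pol g ->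
  (tp (fun x => f x * g x) x w)`_i = \sum_(j < i.+1) (tp f x w)`_j * (tp g x w)`_(i - j).
Proof. by move=> pf pg; rewrite (tp_mul Kinf) // coefM. Qed.

Lemma tc_excess (V : lmodType K) d (f : V -> K) i x w : hom d f -> (d < i)%N -> (tp f x w)`_i = 0.
Proof.
move=> hf di; have pf := hom_pol hf.
apply: (@hom_excess K Kinf V V (fun p => (tp f p.1 p.2)`_i) d i x w) => //; first exact: hom_tc.
by move=> t y z /=; rewrite tp_scalev.
Qed.

Lemma tc_hom_base (V : lmodType K) d (f : V -> K) i w : hom d f -> (i <= d)%N ->
  hom (d - i) (fun x => (tp f x w)`_i).
Proof.
move=> hf di; have pf := hom_pol hf.
apply: (@hom_complement K Kinf V V (fun p => (tp f p.1 p.2)`_i) d i w) => //; first exact: hom_tc.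
by move=> t y z /=; rewrite tp_scalev.
Qed.

(** For [s != 0], [f (y + s u) = s^d f (u + s^-1 y)]: the Taylor coefficients are read in reverse
    order. *)
Lemma comp_shift (V : lmodType K) d (f : V -> K) k y u : hom d f ->
  comp k (fun u => f (y + u)) u = if (k <= d)%N then (tp f u y)`_(d - k) else 0.
Proof.
move=> hf; have pf := hom_pol hf.
pose Q := \poly_(j < d.+1) (tp f u y)`_(d - j).
have -> : (if (k <= d)%N then (tp f u y)`_(d - k) else 0) = Q`_k by rewrite coef_poly ltnS.
rewrite /comp; have -> // : tp (fun u => f (y + u)) 0 u = Q; apply: (mulfI (monic_neq0 (monicX K))); apply: (poly_fun_inj Kinf) => s.
rewrite !hornerE -tpE ?add0r; last exact: pol_shift.
have [->|s0] := eqVneq s 0; first by rewrite !mul0r.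
congr (_ * _); rewrite horner_poly.
have -> : y + s *: u = s *: (u + s^-1 *: y) by rewrite scalerDr scalerA divff // scale1r addrC.
rewrite (homE _ _ hf) tpE //.
rewrite (@horner_coef_wide _ d.+1); last first.
  by apply/leq_sizeP => j; apply: tc_excess.
rewrite mulr_sumr (reindex_inj rev_ord_inj) /=; apply: eq_bigr => j _.
have jd := ltn_ord j; rewrite subSS mulrCA; congr (_ * _).
by rewrite exprVn -expfB_cond ?(negPf s0) ?subKn //; lia.
Qed.

(** Encoded by additivity of the [q]-th power, so that characteristic zero, where [q = 1], needs no
    separate treatment. *)
Definition frob (q : nat) : Prop := (0 < q)%N /\ forall x y : K, (x + y) ^+ q = x ^+ q + y ^+ q.

Lemma frob1 : frob 1. Proof. by split=> // x y; rewrite !expr1. Qed.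

Lemma frob_mul q r : frob q -> frob r -> frob (q * r).
Proof. by move=> [q0 hq] [r0 hr]; split=> [|x y]; rewrite ?muln_gt0 ?q0 // !exprM hq hr. Qed.

Lemma frob0 q : frob q -> (0 : K) ^+ q = 0.
Proof. by case=> q0 _; rewrite expr0n; case: q q0. Qed.

Lemma frobN q (x : K) : frob q -> (- x) ^+ q = - x ^+ q.
Proof.
move=> hq; apply/eqP; rewrite eq_sym -subr_eq0 -opprD oppr_eq0 -(proj2 hq) subrr.
by rewrite frob0.
Qed.

Lemma frobB q (x y : K) : frob q -> (x - y) ^+ q = x ^+ q - y ^+ q.
Proof. by move=> hq; rewrite (proj2 hq) frobN. Qed.

Lemma frob_sum q (I : Type) (r : seq I) (P : pred I) (F : I -> K) : frob q ->
  (\sum_(i <- r | P i) F i) ^+ q = \sum_(i <- r | P i) F i ^+ q.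
Proof. by move=> hq; apply: (big_morph (fun x => x ^+ q) (proj2 hq) (frob0 hq)). Qed.

Lemma coef_frob q (P : {poly K}) j : frob q ->
  (P ^+ q)`_j = if (q %| j)%N then P`_(j %/ q)%N ^+ q else 0.
Proof.
move=> hq; have q0 := proj1 hq.
have -> : P ^+ q = \sum_(k < size P) (P`_k ^+ q) *: 'X^(q * k).
  apply: (poly_fun_inj Kinf) => t; rewrite horner_exp horner_coef frob_sum // horner_sum.
  by apply: eq_bigr => k _; rewrite !hornerE exprMn -exprM mulnC.
rewrite coef_sum; case: ifP => [/dvdnP[k ->]|nd].
  rewrite mulnK // mulnC.
  under eq_bigr do rewrite coefZ coefXn eqn_pmul2l // eq_sym.
  have [kP|kP] := ltnP k (size P).
    rewrite (bigD1 (Ordinal kP)) //= eqxx mulr1 big1 ?addr0 // => i ik.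
    by rewrite -val_eqE /= in ik; rewrite (negPf ik) mulr0.
  rewrite big1 => [|i _]; first by rewrite nth_default ?frob0.
  by rewrite ltn_eqF ?mulr0 //; apply: leq_trans kP.
rewrite big1 // => k _; rewrite coefZ coefXn; case: eqP => [E|_]; last by rewrite mulr0.
by move: nd; rewrite E dvdn_mulr.
Qed.

Lemma tp_exp (V : lmodType K) (f : V -> K) n x v : pol f -> tp (fun x => f x ^+ n) x v = tp f x v ^+ n.
Proof. by move=> pf; apply: tp_unique => [//||t]; [exact: pol_exp | rewrite horner_exp -tpE]. Qed.

Lemma D_frob (V : lmodType K) (f : V -> K) q x v : frob q -> (1 < q)%N -> pol f ->
  D (fun x => f x ^+ q) x v = 0.
Proof. by move=> hq q1 pf; rewrite /D tp_exp // coef_frob // gtnNdvd. Qed.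

(** The degree is [1 + q e] and the number of terms is unbounded. For [e = 0] these are linear
    forms. The pair [(q, e)] is part of the data and not determined by [f]. *)
Definition nf (V : lmodType K) (q e : nat) (f : V -> K) : Prop :=
  exists n (l a : 'I_n -> V -> K), [/\ forall i, lin (l i), forall i, hom e (a i) &
    forall x, f x = \sum_i l i x * a i x ^+ q].

Lemma nf_hom (V : lmodType K) q e (f : V -> K) : nf q e f -> hom (1 + q * e) f.
Proof.
move=> [n [l [a [hl ha ef]]]]; apply: (hom_ext (f := fun x => \sum_i l i x * a i x ^+ q)) => [|x]; last by rewrite ef.
apply: hom_sum => i _; apply: hom_mul; first exact: hom_lin.
by rewrite mulnC; apply: hom_exp.
Qed.

Lemma nf_add (V : lmodType K) q e (f g : V -> K) : nf q e f -> nf q e g -> nf q e (fun x => f x + g x).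
Proof.
move=> [n [l [a [hl ha ef]]]] [m [l' [a' [hl' ha' eg]]]].
exists (n + m)%N, (fun i => match split i with inl j => l j | inr j => l' j end),
  (fun i => match split i with inl j => a j | inr j => a' j end); split.
- by move=> i; case: split.
- by move=> i; case: split.
move=> x; rewrite ef eg big_split_ord; congr (_ + _); apply: eq_bigr => i _.
  by rewrite (unsplitK (inl i)).
by rewrite (unsplitK (inr i)).
Qed.

Lemma nf_scale (V : lmodType K) q e c (f : V -> K) : nf q e f -> nf q e (fun x => c * f x).
Proof.
move=> [n [l [a [hl ha ef]]]]; exists n, (fun i x => c * l i x), a; split=> // [i s x y|x].
  by rewrite hl mulrDr mulrCA.
by rewrite ef mulr_sumr; apply: eq_bigr => i _; rewrite mulrA.
Qed.

Lemma nf_zero (V : lmodType K) q e : nf q e (fun _ : V => 0).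
Proof. by exists 0%N, (fun _ _ => 0), (fun _ _ => 0); split=> [[]//|[]//|x]; rewrite big_ord0. Qed.

Lemma nf_sum (V : lmodType K) q e (I : Type) (r : seq I) (P : pred I) (F : I -> V -> K) :
  (forall i, P i -> nf q e (F i)) -> nf q e (fun x => \sum_(i <- r | P i) F i x).
Proof.
move=> h; elim: r => [|i r IH].
  by have := nf_zero V q e; congr nf; apply: functional_extensionality => x; rewrite big_nil.
case Pi: (P i).
  have := nf_add (h i Pi) IH; congr nf; apply: functional_extensionality => x; by rewrite big_cons Pi.
by have := IH; congr nf; apply: functional_extensionality => x; rewrite big_cons Pi.
Qed.

Lemma nf_linm (V W : lmodType K) q e (s : W -> V) (f : V -> K) : linm s -> nf q e f -> nf q e (fun x => f (s x)).
Proof.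
move=> hs [n [l [a [hl ha ef]]]]; exists n, (fun i x => l i (s x)), (fun i x => a i (s x)); split=> [i|i|x].
- exact: lin_linm.
- exact: hom_linm.
by rewrite ef.
Qed.

Lemma nf_hom1 (V : vectType K) e (f : V -> K) : hom e.+1 f -> nf 1 e f.
Proof.
move=> hf; pose G (p : V * V) := f p.1.
have pG : pol G by exact: (pol_linm (f := f) (@linm_fst K V V) (hom_pol hf)).
have [|h [ph eh]] := @hom_expand K Kinf V V G e.+1 pG; first by move=> t s x; rewrite /G /= (homE _ _ hf).
have -> : f = fun x => \sum_(d : e.+1.-tuple 'I_(\dim {:V})) co (thead d) x * (h d 0 * mon (behead d) x) ^+ 1.
  apply: functional_extensionality => x; rewrite -[LHS]/(G (x, 0)) eh; apply: eq_bigr => d _.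
  by rewrite expr1 /mon {1}(tuple_eta d) big_cons /=; ring.
apply: nf_sum => d _; exists 1%N, (fun _ => co (thead d)), (fun _ x => h d 0 * mon (behead d) x); split.
- by move=> _; apply: lin_co.
- move=> _; apply: hom_scale; have := hom_mon (behead d); by rewrite size_behead size_tuple.
by move=> x; rewrite big_ord1.
Qed.

Section Coefficients.
Variables (V : lmodType K) (q e : nat) (f : V -> K).
Hypothesis hq : frob q.
Hypothesis hf : nf q e f.

Lemma nf_tc_small i u y : (1 < i < q)%N -> (tp f u y)`_i = 0.
Proof.
case: hf => n [l [a [hl ha ef]]] /andP[i1 iq].
have pa j : pol (a j) := hom_pol (ha j).
have -> : f = fun x => \sum_i l i x * a i x ^+ q by apply: functional_extensionality.
rewrite (tp_sum Kinf) => [|j _]; last by apply: pol_mul; [exact: pol_lin | exact: pol_exp].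
rewrite coef_sum big1 // => j _; rewrite (tp_mul Kinf); [|exact: pol_lin|exact: pol_exp].
rewrite (tp_lin Kinf) // tp_exp // mulrDl coefD coefCM -scalerAl coefZ coefXM.
rewrite !coef_frob //; case: i i1 iq => // i i1 iq /=.
by rewrite !gtnNdvd ?mulr0 ?addr0 //; lia.
Qed.

(** For [q > 1] the power [a_i^q] contributes only exponents divisible by [q], so the coefficient of
    [t^q] in [l_i a_i^q] is [l_i u] times the [q]-th power of [D a_i]; for [q = 1] the coefficient
    is the derivative of [f]. *)
Lemma nf_qadd u : qadd q (fun y => (tp f u y)`_q).
Proof.
case: hf => n [l [a [hl ha ef]]].
have pa j : pol (a j) := hom_pol (ha j).
have [q1|q1] := leqP q 1.
  have -> : q = 1%N by case: hq; lia.
  by move=> c x y; rewrite expr1; apply: (D_linr Kinf); apply: hom_pol (nf_hom hf).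
have E y : (tp f u y)`_q = \sum_i l i u * (D (a i) u y) ^+ q.
  have -> : f = fun x => \sum_i l i x * a i x ^+ q by apply: functional_extensionality.
  rewrite (tp_sum Kinf) => [|j _]; last by apply: pol_mul; [exact: pol_lin | exact: pol_exp].
  rewrite coef_sum; apply: eq_bigr => j _; rewrite (tp_mul Kinf); [|exact: pol_lin|exact: pol_exp].
  rewrite (tp_lin Kinf) // tp_exp // mulrDl coefD coefCM -scalerAl coefZ coefXM !coef_frob // dvdnn divnn.
  have -> : (0 < q)%N by lia.
  by rewrite gtn_eqF ?gtnNdvd ?mulr0 ?addr0 //; lia.
move=> c x y; rewrite !E mulr_sumr -big_split; apply: eq_bigr => i _.
by rewrite (D_linr Kinf u (pa i)) (proj2 hq) exprMn mulrDr mulrCA.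
Qed.

Lemma nf_D u v : (1 < q)%N -> forall n (l a : 'I_n -> V -> K), (forall i, lin (l i)) -> (forall i, hom e (a i)) ->
  (forall x, f x = \sum_i l i x * a i x ^+ q) -> D f u v = \sum_i l i v * a i u ^+ q.
Proof.
move=> q1 n l a hl ha ef; have pa j : pol (a j) := hom_pol (ha j).
have -> : f = fun x => \sum_i l i x * a i x ^+ q by apply: functional_extensionality.
have pla j : pol (fun x => l j x * a j x ^+ q) by apply: pol_mul; [exact: pol_lin | exact: pol_exp].
rewrite (D_sum Kinf) //; apply: eq_bigr => i _.
by rewrite (D_mul Kinf) ?D_frob ?mulr0 ?add0r ?(D_lin Kinf) //; [exact: pol_lin | exact: pol_exp].
Qed.

Lemma nf_D_flat u v w : (1 < q)%N -> D (fun u => D f u v) u w = 0.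
Proof.
move=> q1; case: hf => n [l [a [hl ha ef]]].
have -> : (fun u => D f u v) = fun u => \sum_i l i v * a i u ^+ q.
  by apply: functional_extensionality => x; apply: nf_D.
have pa j : pol (fun u => a j u ^+ q) by apply: pol_exp; apply: hom_pol (ha j).
rewrite (D_sum Kinf) => [|i _]; last exact: pol_scale.
rewrite big1 // => i _; rewrite (D_scale Kinf) // D_frob ?mulr0 //; exact: hom_pol (ha i).
Qed.

End Coefficients.

(* [F3 q f (v, (y, u))] is the coefficient of [s t^q] in [f (u + t y + s v)]. *)
Definition F3 (V : lmodType K) (q : nat) (f : V -> K) (p : V * (V * V)) : K :=
  D (fun u => (tp f u p.2.1)`_q) p.2.2 p.1.

Section F3.
Variable V : lmodType K.
Implicit Types f g : V -> K.

Lemma pol_tc1 f i z : pol f -> pol (fun u => (tp f u z)`_i).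
Proof. by move=> pf; exact: (pol_tcm Kinf i pf (polm_linm (@linm_id K V)) (polm_cst V z)). Qed.

Lemma F3E q f p : pol f ->
  F3 q f p = (tp (fun z : V * V => (tp f z.1 z.2)`_q) (p.2.2, p.2.1) (p.1, 0))`_1.
Proof. by move=> pf; rewrite /F3 /D -(@tp_fix2 K Kinf V V _ p.2.2 p.1 p.2.1) //; apply: pol_tc. Qed.

Lemma pol_F3 q f : pol f -> pol (F3 q f).
Proof.
move=> pf; have -> : F3 q f = fun p => (tp (fun z : V * V => (tp f z.1 z.2)`_q) (p.2.2, p.2.1) (p.1, 0))`_1.
  by apply: functional_extensionality => p; apply: F3E.
apply: (@pol_tcm K Kinf (V * V)%type (V * (V * V))%type _ (fun p => (p.2.2, p.2.1)) (fun p => (p.1, 0))).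
- exact: pol_tc.
- by apply: polm_linm; lm.
- by apply: polm_linm; lm.
Qed.

Lemma hom_F3 q d f : hom d f -> hom d (F3 q f).
Proof.
move=> hf; have -> : F3 q f = fun p => (tp (fun z : V * V => (tp f z.1 z.2)`_q) (p.2.2, p.2.1) (p.1, 0))`_1.
  by apply: functional_extensionality => p; apply: F3E; apply: hom_pol hf.
have h := hom_tc 1 (hom_tc q hf).
by apply: (@hom_linm K (V * (V * V))%type _ d (fun p => ((p.2.2, p.2.1), (p.1, 0))) _ _ h); lm.
Qed.

Lemma F3_lin q f y u : pol f -> lin (fun v => F3 q f (v, (y, u))).
Proof. by move=> pf; exact: (D_linr Kinf u (pol_tc1 q y pf)). Qed.

Lemma F3_scale_u q d f v y t u : hom d f -> (q < d)%N ->
  F3 q f (v, (y, t *: u)) = t ^+ (d - q.+1) * F3 q f (v, (y, u)).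
Proof.
move=> hf qd; have h := tc_hom_base (i := q) y hf (ltnW qd).
have e : (d - q = (d - q.+1).+1)%N by lia.
by rewrite e in h; rewrite /F3 /= (homE _ _ (hom_D Kinf v h)).
Qed.

Lemma F3_qadd q f v u : pol f -> (forall u, qadd q (fun y => (tp f u y)`_q)) ->
  qadd q (fun y => F3 q f (v, (y, u))).
Proof.
move=> pf h a x y; rewrite /F3 /=.
have pp z := pol_tc1 q z pf.
have -> : (fun u => (tp f u (a *: x + y))`_q) = fun u => a ^+ q * (tp f u x)`_q + (tp f u y)`_q.
  by apply: functional_extensionality => z; apply: h.
by rewrite (D_add Kinf) ?(D_scale Kinf) //; apply: pol_scale.
Qed.

Lemma F3_add q f g p : pol f -> pol g -> F3 q (fun x => f x + g x) p = F3 q f p + F3 q g p.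
Proof.
move=> pf pg; rewrite /F3.
have pp (h : V -> K) z : pol h -> pol (fun u => (tp h u z)`_q).
  by move=> ph; apply: pol_tc1.
have -> : (fun u => (tp (fun x => f x + g x) u p.2.1)`_q) = fun u => (tp f u p.2.1)`_q + (tp g u p.2.1)`_q.
  by apply: functional_extensionality => z; rewrite (tp_add Kinf) // coefD.
by rewrite (D_add Kinf) //; apply: pp.
Qed.

Lemma F3_scale q c f p : pol f -> F3 q (fun x => c * f x) p = c * F3 q f p.
Proof.
move=> pf; rewrite /F3.
have -> : (fun u => (tp (fun x => c * f x) u p.2.1)`_q) = fun u => c * (tp f u p.2.1)`_q.
  by apply: functional_extensionality => z; rewrite (tp_scale Kinf) // coefZ.
by rewrite (D_scale Kinf) //; exact: pol_tc1.
Qed.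

Lemma F3_zero q p : F3 q (fun _ : V => 0) p = 0 :> K.
Proof.
rewrite /F3; have -> : (fun u => (tp (fun _ : V => 0 : K) u p.2.1)`_q) = fun _ => 0.
  by apply: functional_extensionality => z; rewrite (tp_cst Kinf) coefC if_same.
exact: D_cst.
Qed.

Lemma F3_sum q (I : Type) (r : seq I) (P : pred I) (F : I -> V -> K) p : (forall i, P i -> pol (F i)) ->
  F3 q (fun x => \sum_(i <- r | P i) F i x) p = \sum_(i <- r | P i) F3 q (F i) p.
Proof.
move=> pF; elim: r => [|i r IH].
  rewrite [RHS]big_nil -[RHS](F3_zero q p); congr (F3 _ _ _); apply: functional_extensionality => x.
  by rewrite big_nil.
rewrite big_cons; case Pi: (P i).
  rewrite -IH -F3_add; [|exact: pF|exact: pol_sum].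
  by congr (F3 _ _ _); apply: functional_extensionality => x; rewrite big_cons Pi.
by rewrite -IH; congr (F3 _ _ _); apply: functional_extensionality => x; rewrite big_cons Pi.
Qed.

Lemma F3_mul q f g p : pol f -> pol g -> F3 q (fun x => f x * g x) p =
  \sum_(j < q.+1) ((tp f p.2.2 p.2.1)`_j * F3 (q - j) g p + F3 j f p * (tp g p.2.2 p.2.1)`_(q - j)).
Proof.
move=> pf pg; have pp (h : V -> K) i z : pol h -> pol (fun u => (tp h u z)`_i).
  by move=> ph; apply: pol_tc1.
rewrite {1}/F3.
have -> : (fun u => (tp (fun x => f x * g x) u p.2.1)`_q) =
    fun u => \sum_(j < q.+1) (tp f u p.2.1)`_j * (tp g u p.2.1)`_(q - j).
  by apply: functional_extensionality => z; apply: tc_mul.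
rewrite (D_sum Kinf) => [|j _]; last by apply: pol_mul; apply: pp.
by apply: eq_bigr => j _; rewrite (D_mul Kinf) //; apply: pp.
Qed.

(** Product rule: a product [u * v] yields two products for each of the [q.+1] ways of distributing
    [t^q], and polarizing preserves the total degree of each factor. *)
Lemma F3_lowstr q d S f : lowstr d S f -> lowstr d (S * (2 * q.+1)) (F3 q f).
Proof.
elim=> [{}S {}f f0|{}S a u v h {}f had hu hv hh IH e].
  have -> : f = fun _ => 0 by apply: functional_extensionality.
  by apply: lowstr_nil => p; apply: F3_zero.
have [[pu pv] ph] := (hom_pol hu, hom_pol hv, hom_pol (lowstr_hom hh)).
have E p : F3 q f p = (\sum_(j < q.+1) ((tp u p.2.2 p.2.1)`_j * F3 (q - j) v p
                       + F3 j u p * (tp v p.2.2 p.2.1)`_(q - j))) + F3 q h p.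
  rewrite -F3_mul // -F3_add //; last exact: pol_mul.
  by congr (F3 _ _ _); apply: functional_extensionality.
apply: (lowstr_ext (f := fun p : V * (V * V) => (\sum_(j < q.+1) ((tp u p.2.2 p.2.1)`_j * F3 (q - j) v p
                       + F3 j u p * (tp v p.2.2 p.2.1)`_(q - j))) + F3 q h p)) => [|p]; last by rewrite E.
rewrite mulSn.
apply: lowstr_add IH; apply: (lowstr_sumT (S := 2)); first by rewrite card_ord mulnC.
have hl : linm (fun p : V * (V * V) => (p.2.2, p.2.1)) by lm.
move=> j _; rewrite -[2%N]/(1 + 1)%N; apply: lowstr_add; apply: (lowstr_prod had).
- exact: (hom_linm hl (hom_tc j hu)).
- exact: hom_F3.
- exact: hom_F3.
- exact: (hom_linm hl (hom_tc (q - j) hv)).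
Qed.

(** Between the constant term and [t^q], a normal form expands in [t] with a linear term only, whose
    derivative in the base point vanishes. This tells apart normal forms of equal degree but
    different exponents. *)
Lemma F3_nf q q0 e f p : frob q -> nf q e f -> (0 < q0 < q)%N -> F3 q0 f p = 0.
Proof.
move=> hq hf /andP[q00 q0q]; rewrite /F3.
have [E|q01] := eqVneq q0 1%N; first by rewrite E; apply: (nf_D_flat hq hf); lia.
have -> : (fun u => (tp f u p.2.1)`_q0) = fun _ => 0.
  by apply: functional_extensionality => u; apply: (nf_tc_small hq hf); lia.
exact: D_cst.
Qed.

End F3.

Lemma F3_linm (V W : lmodType K) q (f : V -> K) (s : W -> V) p : linm s -> pol f ->
  F3 q (fun x => f (s x)) p = F3 q f (s p.1, (s p.2.1, s p.2.2)).
Proof.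
move=> hs pf; rewrite /F3 /=.
have -> : (fun u => (tp (fun x => f (s x)) u p.2.1)`_q) = fun u => (tp f (s u) (s p.2.1))`_q.
  by apply: functional_extensionality => z; rewrite tp_linm.
rewrite (D_linm Kinf (f := fun u => (tp f u (s p.2.1))`_q)) //.
exact: pol_tc1.
Qed.

End Frobenius.

(** * Expansion at points of maximal rank *)

Section MaxRank.
Variable K : fieldType.
Hypothesis Kinf : infinite_field K.

(** The determinant of the bordered matrix is [\det M] times the Schur complement of [M]. *)
Lemma det_bordered r (M : 'M[K]_r) (u : 'cV_r) (g : 'rV_r) (s : 'M_1) : M \in unitmx ->
  \det (block_mx s g u M) = 0 -> s 0 0 = (g *m invmx M *m u) 0 0.
Proof.
move=> uM.
have -> : block_mx s g u M = block_mx 1%:M (g *m invmx M) 0 1%:M *m block_mx (s - g *m invmx M *m u) 0 u M.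
  rewrite mulmx_block !mul1mx !mul0mx !add0r subrK.
  by rewrite -mulmxA mulVmx // mulmx1.
rewrite det_mulmx det_ublock !det1 !mul1r det_lblock => /eqP.
have dM : \det M != 0 by rewrite -unitfE -unitmxE.
by rewrite mulf_eq0 (negPf dM) orbF det_mx11 mxE [X in _ + X]mxE subr_eq0 => /eqP.
Qed.

Section Rank.
Variables (X : Type) (W Y : Type) (f : X -> W -> Y -> K).

(** For fixed [w] the [f x w] are functions on [Y]. The condition says that at some [w] in [S], [r]
    members with index in [P] are independent; it is phrased by a minor because a nonzero minor is
    an open condition on [w]. *)
Definition rkge (P : X -> Prop) (S : W -> Prop) r : Prop :=
  exists w (k : 'I_r -> X) (y : 'I_r -> Y),
    [/\ S w, forall i, P (k i) & \det (\matrix_(i, j) f (k i) w (y j)) != 0].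

(** Bordering the nonzero minor by the row of [x] and the column of [z] gives a minor of size
    [r.+1], which vanishes since the rank is maximal. *)
Lemma rk_span (P : X -> Prop) (S : W -> Prop) r w (k : 'I_r -> X) (y : 'I_r -> Y) : ~ rkge P S r.+1 ->
  S w -> (forall i, P (k i)) -> \det (\matrix_(i, j) f (k i) w (y j)) != 0 ->
  forall x z, P x -> f x w z =
    \sum_i (\sum_j f x w (y j) * invmx (\matrix_(i, j) f (k i) w (y j)) j i) * f (k i) w z.
Proof.
move=> nr Sw Pk; set M := \matrix_(i, j) _ => dM x z Px.
have uM : M \in unitmx by rewrite unitmxE unitfE.
have := @det_bordered r M (\col_i f (k i) w z) (\row_j f x w (y j)) (f x w z)%:M uM.
rewrite !mxE eqxx mulr1n => -> //.
  rewrite ?mxE; apply: eq_bigr => i _; rewrite ?mxE; congr (_ * _).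
  by apply: eq_bigr => j _; rewrite !mxE.
apply/eqP; apply: NNPP => /negP h; apply: nr.
exists w, (fun i : 'I_(1 + r) => match split i with inl _ => x | inr j => k j end),
  (fun i : 'I_(1 + r) => match split i with inl _ => z | inr j => y j end); split=> // [i|].
  by case: split.
rewrite (_ : \matrix_(i, j) _ = block_mx (f x w z)%:M (\row_j f x w (y j)) (\col_i f (k i) w z) M) //.
apply/matrixP => i j; rewrite !mxE; case: (split i) => i'; rewrite !mxE; case: (split j) => j'; rewrite !mxE //.
by rewrite !ord1 eqxx mulr1n.
Qed.

Lemma rk_max (P : X -> Prop) (S : W -> Prop) R : (exists w, S w) -> ~ rkge P S R.+1 ->
  exists r, [/\ (r <= R)%N, rkge P S r & ~ rkge P S r.+1].
Proof.
move=> [w Sw]; elim: R => [|R IH] h.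
  exists 0%N; split=> //; exists w, (fun i : 'I_0 => match i with Ordinal _ h => False_rect _ (notF h) end),
    (fun i : 'I_0 => match i with Ordinal _ h => False_rect _ (notF h) end).
  by split=> // [[]//|]; rewrite det_mx00 oner_eq0.
have [h'|h'] := classic (rkge P S R.+1); first by exists R.+1.
by have [r [rR h1 h2]] := IH h'; exists r; split=> //; apply: leqW.
Qed.

Lemma rk_bound (P : X -> Prop) (S : W -> Prop) (T : finType) (a : X -> W -> T -> K) (h : T -> W -> Y -> K) r :
  (forall x w y, P x -> f x w y = \sum_t a x w t * h t w y) -> (#|T| < r)%N -> ~ rkge P S r.
Proof.
move=> e Tr [w [k [y [_ Pk /negP]]]]; apply.
set M := \matrix_(i, j) _.
have -> : M = (\matrix_(i < r, j < #|T|) a (k i) w (enum_val j)) *m (\matrix_(i < #|T|, j < r) h (enum_val i) w (y j)).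
  apply/matrixP => i j; rewrite !mxE e // (reindex (@enum_val T T)) /=; last exact: onW_bij (enum_val_bij T).
  by apply: eq_bigr => t _; rewrite !mxE.
set A := (X in X *m _); set B := (X in _ *m X).
apply: contraT; rewrite -unitfE -unitmxE -row_free_unit /row_free => /eqP E.
have := leq_trans (mxrankM_maxr A B) (rank_leq_row B).
by rewrite E leqNgt Tr.
Qed.

End Rank.

Lemma pol_det (W : lmodType K) r (M : W -> 'M[K]_r) : (forall i j, pol (fun w => M w i j)) ->
  pol (fun w => \det (M w)).
Proof.
by move=> h; apply: pol_sum => s _; apply: pol_scale; apply: pol_prod => i _.
Qed.

Lemma pol_adj (W : lmodType K) r (M : W -> 'M[K]_r) i j : (forall i j, pol (fun w => M w i j)) ->
  pol (fun w => (\adj (M w)) i j).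
Proof.
move=> h; have -> : (fun w => (\adj (M w)) i j) =
    fun w => (-1) ^+ (j + i) * \det (row' j (col' i (M w))).
  by apply: functional_extensionality => w; rewrite mxE.
apply: pol_scale; apply: pol_det => a b.
have -> : (fun w => row' j (col' i (M w)) a b) = fun w => M w (lift j a) (lift i b).
  by apply: functional_extensionality => w; rewrite !mxE.
exact: h.
Qed.

(* Expansion at a point [w0] where the family has maximal rank.  If [G] is a fixed combination of the family that
vanishes at [w0], Cramer's rule writes [Delta^2 G = sum_i E_i f_i] with [E_i w0 = 0], so each homogeneous component
of [G (w0 + w)] has few terms, each with a factor of positive degree depending on [w] only. *)
Lemma expand_max_rank (X : Type) (W Y : lmodType K) (f : X -> W -> Y -> K) R :
  (forall x, pol (fun p : W * Y => f x p.1 p.2)) -> ~ rkge f (fun _ => True) (fun _ => True) R.+1 ->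
  exists w0, forall (N : finType) (m : N -> K) (x : N -> X), (forall y, \sum_i m i * f (x i) w0 y = 0) ->
  forall e, exists (T : finType) (a : T -> nat) (psi : T -> W -> K) (chi : T -> W * Y -> K),
    [/\ (#|T| <= R.+1 * e)%N, forall t, (1 <= a t <= e)%N /\ hom (a t) (psi t), forall t, pol (chi t) &
      forall w y, comp e (fun w => \sum_i m i * f (x i) (w0 + w) y) w = \sum_t psi t w * chi t (w, y)].
Proof.
move=> pf nR; have [|r [rR [w0 [k [z [_ _ d0]]]] nr]] := rk_max _ nR; first by exists 0.
exists w0 => N m x Gw0 e.
pose G w y := \sum_i m i * f (x i) w y.
pose M w := \matrix_(i, j) f (k i) w (z j).
pose E i w := \det (M w) * \sum_j G w (z j) * (\adj (M w)) j i.
have pf1 t y : pol (fun w => f t w y) := pol_fix2 y (pf t).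
have pM i j : pol (fun w => M w i j).
  have -> : (fun w => M w i j) = fun w => f (k i) w (z j) by apply: functional_extensionality => w; rewrite mxE.
  exact: pf1.
have pG1 y : pol (fun w => G w y) by apply: pol_sum => i _; apply: pol_scale.
have pE i : pol (E i).
  apply: pol_mul; first exact: pol_det.
  by apply: pol_sum => j _; apply: pol_mul => //; apply: pol_adj.
have Efw w y : \det (M w) ^+ 2 * G w y = \sum_i E i w * f (k i) w y.
  have [d|d] := eqVneq (\det (M w)) 0.
    by rewrite d expr0n mul0r big1 // => i _; rewrite /E d !mul0r.
  rewrite {1}/G mulr_sumr.
  have h i := @rk_span X W Y f (fun _ => True) (fun _ => True) r w k z nr I (fun _ => I) d (x i) y I.
  under eq_bigr => i _ do rewrite h.
  rewrite -/(M w).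
  transitivity (\sum_i \sum_j (\det (M w) ^+ 2 * (m i * (\sum_l f (x i) w (z l) * invmx (M w) l j) * f (k j) w y))).
    by apply: eq_bigr => i _; rewrite !mulr_sumr; apply: eq_bigr => j _; rewrite mulrA.
  rewrite exchange_big /=; apply: eq_bigr => j _.
  rewrite -mulr_sumr -mulr_suml mulrA; congr (_ * _); rewrite /E expr2 -mulrA; congr (_ * _).
  rewrite mulr_sumr /G.
  transitivity (\sum_i \sum_l m i * f (x i) w (z l) * (\adj (M w)) l j).
    apply: eq_bigr => i _; rewrite mulrCA !mulr_sumr; apply: eq_bigr => l _.
    rewrite /invmx unitmxE unitfE d mxE; field.
    exact: d.
  by rewrite exchange_big /=; apply: eq_bigr => l _; rewrite mulr_suml.
have E0 i : E i w0 = 0 by rewrite /E big1 ?mulr0 // => j _; rewrite /G Gw0 mul0r.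
pose d w := \det (M (w0 + w)) ^+ 2.
have pd : pol d by apply: pol_exp; apply: (pol_shift (f := fun w => \det (M w))); apply: pol_det.
pose E' i w := E i (w0 + w).
have pE' i : pol (E' i) by apply: pol_shift.
have pf' t y : pol (fun w => f t (w0 + w) y) by apply: (pol_shift (f := fun w => f t w y)).
have pG' y : pol (fun w => G (w0 + w) y) by apply: (pol_shift (f := fun w => G w y)).
have pGp : pol (fun p : W * Y => G (w0 + p.1) p.2).
  apply: pol_sum => i _; apply: pol_scale.
  apply: (pol_comp (s := fun p : W * Y => (w0 + p.1, p.2)) _ (pf (x i))).
  by apply: polm_pair; [apply: polm_add; [exact: polm_cst | apply: polm_linm; lm] | apply: polm_linm; lm].
have pfp t : pol (fun p : W * Y => f t (w0 + p.1) p.2).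
  apply: (pol_comp (s := fun p : W * Y => (w0 + p.1, p.2)) _ (pf t)).
  by apply: polm_pair; [apply: polm_add; [exact: polm_cst | apply: polm_linm; lm] | apply: polm_linm; lm].
have dd : d 0 != 0 by rewrite /d addr0 expf_neq0.
(* The terms in ['I_r * 'I_e] come from the [E i], which have no constant part at [w0]; the terms in
   ['I_e] come from moving the nonconstant components of [Delta^2] to the other side. *)
exists ('I_r * 'I_e + 'I_e)%type, (fun t : 'I_r * 'I_e + 'I_e => match t with inl p => (val p.2).+1 | inr j => (val j).+1 end),
  (fun t : 'I_r * 'I_e + 'I_e => match t with inl p => comp p.2.+1 (E' p.1) | inr j => comp j.+1 d end),
  (fun (t : 'I_r * 'I_e + 'I_e) p => match t with inl q => (d 0)^-1 * comp (e - q.2.+1) (fun w => f (k q.1) (w0 + w) p.2) p.1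
              | inr j => - (d 0)^-1 * comp (e - j.+1) (fun w => G (w0 + w) p.2) p.1 end); split.
- by rewrite card_sum card_prod !card_ord mulSn addnC leq_add2l leq_mul2r rR orbT.
- by move=> [[i j]|j] /=; (split; first by rewrite ltn_ord); apply: (hom_comp Kinf).
- move=> [[i j]|j] /=; apply: pol_scale.
    exact: (pol_comp1 Kinf (e - j.+1) (pfp (k i))).
  exact: (pol_comp1 Kinf (e - j.+1) pGp).
move=> w y; rewrite -/(fun w => G (w0 + w) y).
have := comp_mul Kinf e w pd (pG' y).
have -> : (fun w => d w * G (w0 + w) y) = fun w => \sum_i E' i w * f (k i) (w0 + w) y.
  by apply: functional_extensionality => u; rewrite /d Efw.
rewrite (comp_sum Kinf); last by move=> i _; apply: pol_mul.
have cE i : comp e (fun w => E' i w * f (k i) (w0 + w) y) w =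
    \sum_(j < e) comp j.+1 (E' i) w * comp (e - j.+1) (fun w => f (k i) (w0 + w) y) w.
  by rewrite (comp_mul Kinf) // big_ord_recl comp0 // {1}/E' addr0 E0 mul0r add0r.
under eq_bigr => i _ do rewrite cE.
rewrite big_ord_recl subn0 (comp0 _ pd) => eq1.
have {eq1} -> : comp e (fun w => G (w0 + w) y) w = (d 0)^-1 * (\sum_i \sum_(j < e) comp j.+1 (E' i) w *
    comp (e - j.+1) (fun w => f (k i) (w0 + w) y) w -
    \sum_(j < e) comp j.+1 d w * comp (e - j.+1) (fun w => G (w0 + w) y) w).
  by apply: (mulfI dd); rewrite mulVKf // eq1 addrK.
rewrite big_sumType /= mulrBr; congr (_ + _).
  rewrite -(pair_bigA _ (fun (i : 'I_r) (j : 'I_e) => comp j.+1 (E' i) w * ((d 0)^-1 * comp (e - j.+1) (fun w => f (k i) (w0 + w) y) w))) /=.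
  rewrite mulr_sumr; apply: eq_bigr => i _; rewrite mulr_sumr; apply: eq_bigr => j _; ring.
by rewrite mulr_sumr -sumrN; apply: eq_bigr => j _; ring.
Qed.

End MaxRank.

(** * Polarized families and their ranks *)

Section PolarizedFamily.
Variable K : fieldType.
Hypothesis Kinf : infinite_field K.

(** A maximal independent set among the [b z] and points [y j] separating it are chosen. Subtracting
    from [x] the right combination of the [y j] leaves a vector killed by all [b z], hence by [f];
    the coefficients of the combination are linear in the [b z x]. *)
Lemma qadd_span (V : vectType K) (Z : Type) (b : Z -> V -> K) q (f : V -> K) : frob K q ->
  (forall z, lin (b z)) -> qadd q f -> (forall y, (forall z, b z y = 0) -> f y = 0) ->
  exists n (m : 'I_n -> K) (z : 'I_n -> Z), forall y, f y = \sum_i m i * b (z i) y ^+ q.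
Proof.
move=> hq hb hf h.
pose g z (_ : unit) y := b z y.
have nR : ~ rkge g (fun _ => True) (fun _ => True) #|'I_(\dim {:V})|.+1.
  apply: (rk_bound (a := fun z _ i => b z (vb i)) (h := fun i _ y => co i y)) => // z w y _.
  by rewrite /g (lin_vb y (hb z)); apply: eq_bigr => i _; rewrite mulrC.
have [|r [_ [w [k [y [_ _ d0]]]] nr]] := rk_max _ nR; first by exists tt.
set M := \matrix_(i, j) _ in d0.
have uM : M \in unitmx by rewrite unitmxE unitfE.
exists r, (fun i => \sum_j (invmx M) j i ^+ q * f (y j)), k => x.
pose c := invmx M *m (\col_i b (k i) x).
have hc i : \sum_j c j 0 * b (k i) (y j) = b (k i) x.
  have := congr1 (fun A : 'cV_r => A i 0) (mulKVmx uM (\col_i b (k i) x)).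
  rewrite !mxE => <-; rewrite -/c; apply: eq_bigr => j _; by rewrite !mxE mulrC.
have fy : f (x - \sum_j c j 0 *: y j) = 0.
  apply: h => z.
  rewrite -[b z _]/(g z w _) (@rk_span K Z unit V g (fun _ => True) (fun _ => True) r w k y nr I (fun _ => I) d0) //.
  rewrite big1 // => i _; rewrite /g (linB _ _ (hb _)) (lin_sum _ _ _ (hb _)).
  by under [X in _ - X]eq_bigr do rewrite (linZ _ _ (hb _)); rewrite hc subrr mulr0.
rewrite -{1}(subrK (\sum_j c j 0 *: y j) x) (qaddD _ _ hf) fy add0r (qadd_sum _ _ _ hf).
transitivity (\sum_j \sum_i (invmx M j i) ^+ q * f (y j) * b (k i) x ^+ q).
  apply: eq_bigr => j _; rewrite (qaddZ _ _ hf) /c mxE (frob_sum _ _ _ hq) mulr_suml.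
  by apply: eq_bigr => i _; rewrite !mxE exprMn; ring.
by rewrite exchange_big /=; apply: eq_bigr => i _; rewrite mulr_suml.
Qed.

Lemma D_comp_comm (V : lmodType K) (f : V -> K) k x v : pol f ->
  D (comp k.+1 f) x v = comp k (fun x => D f x v) x.
Proof.
move=> pf; have [N [_ hN]] := comp_bound Kinf pf.
pose M := (maxn N k.+2).
have e : f = fun x => \sum_(i < M) comp i f x.
  by apply: functional_extensionality => y; apply: hN; apply: leq_maxl.
have -> : (fun x => D f x v) = fun x => \sum_(i < M) D (comp i f) x v.
  apply: functional_extensionality => y; rewrite {1}e (D_sum Kinf) // => i _; exact: pol_comp_i.
have pDi i : pol (fun x => D (comp i f) x v) by apply: (pol_D Kinf); apply: pol_comp_i.
rewrite (comp_sum Kinf) //.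
have kM : (k.+1 < M)%N by apply: leq_maxr.
rewrite (bigD1 (Ordinal kM)) //= big1 ?addr0 => [|[i iM] /=].
  by rewrite (comp_id Kinf x (hom_D Kinf v (hom_comp Kinf k.+1 pf))).
rewrite -val_eqE /= => ik; case: i ik {iM} => [|i] ik.
  have -> : (fun x => D (comp 0 f) x v) = fun _ => 0.
    by apply: functional_extensionality => y; apply: (hom0_D Kinf); apply: hom_comp.
  by rewrite (comp_neq Kinf x (hom_zero V k.+1)) // neq_ltn ltnSn.
by rewrite (comp_neq Kinf x (hom_D Kinf v (hom_comp Kinf i.+1 pf))) // eq_sym.
Qed.

Lemma sum_pad (T : finType) B (F : T -> K) : (#|T| <= B)%N ->
  \sum_t F t = \sum_(b < B) if insub (val b) is Some i then F (enum_val (i : 'I_#|T|)) else 0.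
Proof.
move=> h; rewrite (reindex (@enum_val T T)) /=; last exact: onW_bij (enum_val_bij T).
pose g b := if insub b is Some i then F (enum_val (i : 'I_#|T|)) else 0.
transitivity (\sum_(i < #|T|) g i); first by apply: eq_bigr => i _; rewrite /g valK.
rewrite (big_ord_widen B g h) big_mkcond /=; apply: eq_bigr => b _.
by rewrite -/(g b); case: ifP => // bT; rewrite /g insubF.
Qed.

Lemma expand_bounded d M : exists B, forall (X : lmodType K) (G : 'rV[K]_M * X -> K) n, (n <= d)%N -> pol G ->
  (forall t s x, G (t *: s, x) = t ^+ n * G (s, x)) ->
  exists (a : 'I_B -> 'rV[K]_M -> K) (h : 'I_B -> X -> K), forall s x, G (s, x) = \sum_b a b s * h b x.
Proof.
exists (\sum_(n < d.+1) #|{: n.-tuple 'I_(\dim {:'rV[K]_M})}|)%N => X G n nd pG hG.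
have [h [_ eh]] := hom_expand Kinf pG hG.
exists (fun b s => if insub (val b) is Some i then mon (val (enum_val (i : 'I_#|{: n.-tuple 'I_(\dim {:'rV[K]_M})}|))) s else 0),
  (fun b x => if insub (val b) is Some i then h (enum_val (i : 'I_#|{: n.-tuple 'I_(\dim {:'rV[K]_M})}|)) x else 0) => s x.
rewrite eh (sum_pad (B := \sum_(n < d.+1) #|{: n.-tuple 'I_(\dim {:'rV[K]_M})}|)).
  by apply: eq_bigr => b _; case: insub => [i|]; rewrite ?mul0r.
by rewrite (bigD1 (Ordinal (nd : (n < d.+1)%N))) //= leq_addr.
Qed.

(** The condition is on polarizations because strength of the forms is not enough: the form
    [sum x_i y_i^p], taken with [q = 1], has zero polarization in characteristic [p]. *)
Definition hs (V : lmodType K) (I : finType) (J : {set I}) (q e : I -> nat) (f : I -> V -> K) S : Prop :=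
  forall q' e' (c : I -> K), (forall i, i \in J -> c i != 0 -> q i = q' /\ e i = e') ->
    (exists2 i, i \in J & c i != 0) ->
    ~ lowstr (1 + q' * e') S (fun p => \sum_(i in J) c i * F3 q' (f i) p).

Definition free2 M (s t : 'rV[K]_M) := forall a b, a *: s + b *: t = 0 -> a = 0 /\ b = 0.

Lemma free2_dual M (s t : 'rV[K]_M) : free2 s t -> exists l : 'rV[K]_M -> K, [/\ lin l, l s = 0 & l t = 1].
Proof.
move=> h; have [a0 sa0] : exists a, s 0 a != 0.
  apply: NNPP => n; have [|/eqP] := h 1 0; last by rewrite oner_eq0.
  rewrite scale1r scale0r addr0; apply/rowP => a; rewrite mxE; apply/eqP; apply: NNPP => /negP sa.
  by apply: n; exists a.
pose t' := t - (t 0 a0 / s 0 a0) *: s.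
have [a1 ta1] : exists a, t' 0 a != 0.
  apply: NNPP => n; have [|_ /eqP] := h (- (t 0 a0 / s 0 a0)) 1; last by rewrite oner_eq0.
  rewrite scale1r scaleNr addrC -/t'; apply/rowP => a; rewrite [RHS]mxE; apply/eqP; apply: NNPP => /negP sa.
  by apply: n; exists a.
exists (fun x => (x 0 a1 - x 0 a0 / s 0 a0 * s 0 a1) / t' 0 a1); split.
- by move=> a x y; rewrite !mxE; ring.
- by rewrite divff // mul1r subrr mul0r.
have -> : t 0 a1 - t 0 a0 / s 0 a0 * s 0 a1 = t' 0 a1 by rewrite !mxE.
by rewrite divff.
Qed.

Lemma free2C M (s t : 'rV[K]_M) : free2 s t -> free2 t s.
Proof. by move=> h a b; rewrite addrC => /h []. Qed.

Lemma comb_lin (V : lmodType K) M (l : 'rV[K]_M -> K) (v : V) s : lin l ->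
  comb (fun a => l (delta_mx 0 a) *: v) s = l s *: v.
Proof.
move=> hl; rewrite {2}(row_sum_delta s) (lin_sum _ _ _ hl) scaler_suml.
by apply: eq_bigr => a _; rewrite (linZ _ _ hl) scalerA.
Qed.

Lemma linm_combw (V : lmodType K) M (s : 'rV[K]_M) : linm (fun w : {ffun 'I_M -> V} => comb w s).
Proof.
move=> a x y; rewrite /comb scaler_sumr -big_split; apply: eq_bigr => i _.
by rewrite !ffunE scalerDr !scalerA mulrC.
Qed.

Lemma polm_comb2 (V X : lmodType K) M :
  polm (fun p : 'rV[K]_M * ({ffun 'I_M -> V} * X) => comb p.2.1 p.1).
Proof.
apply: polm_sum => i _; apply: polm_scale.
  by apply: pol_lin => a x y; rewrite /= !mxE.
by apply: polm_linm => a x y; rewrite /= !ffunE.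
Qed.

Lemma comb_add (V : lmodType K) M (v w : 'I_M -> V) s : comb (fun i => v i + w i) s = comb v s + comb w s.
Proof. by rewrite /comb -big_split; apply: eq_bigr => i _; rewrite scalerDr. Qed.

Section Family.
Variables (V : vectType K) (I : finType) (J : {set I}) (q e : I -> nat) (f : I -> V -> K) (M : nat).
Hypothesis hq : forall i, frob K (q i).
Hypothesis he : forall i, (0 < e i)%N.
Hypothesis hf : forall i, nf (q i) (e i) (f i).
Let pf i : pol (f i) := hom_pol (nf_hom (hf i)).
Let W := {ffun 'I_M -> V}.

(** Functions of [y] attached to a tuple [w] of vectors: the polarizations along combinations of
    [w], and the derivatives whose kernels constrain [y]. The derivatives are raised to the power
    [q j] to match the additivity of the polarization of [f j]. *)
Definition fam (x : I * 'rV[K]_M * 'rV[K]_M + I * 'rV[K]_M * I) (w : W) (y : V) : K :=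
  match x with
  | inl (i, s, t) => F3 (q i) (f i) (comb w s, (y, comb w t))
  | inr (i, t, j) => if (1 < q i)%N then D (f i) (comb w t) y ^+ q j else 0
  end.

Lemma pol_fam x : pol (fun p : W * V => fam x p.1 p.2).
Proof.
have h s : linm (fun p : W * V => comb p.1 s).
  by exact: (linm_comp (@linm_fst K _ V) (@linm_combw V M s)).
case: x => [[[i s] t]|[[i t] j]] /=.
  apply: (pol_comp (s := fun p : W * V => (comb p.1 s, (p.2, comb p.1 t))) _ (pol_F3 Kinf (q i) (pf i))).
  by apply: polm_linm; apply: linm_pair => //; apply: linm_pair => //; apply: linm_snd.
case: (1 < q i)%N; last exact: pol_cst.
by apply: pol_exp; apply: (pol_Dm Kinf (pf i)); apply: polm_linm => //; apply: linm_snd.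
Qed.

(** Linearity in [s] and homogeneity in [t] factor the family through boundedly many functions of
    [(w, y)], whatever [V] is. The bound [d * d + d] on degrees leaves room for the derivatives
    raised to the power [q j]. *)
Lemma fam_bound d B : (forall i, (q i * e i <= d)%N) ->
  (forall (X : lmodType K) (G : 'rV[K]_M * X -> K) n, (n <= d * d + d)%N -> pol G ->
    (forall t s x, G (t *: s, x) = t ^+ n * G (s, x)) ->
    exists (a : 'I_B -> 'rV[K]_M -> K) (h : 'I_B -> X -> K), forall s x, G (s, x) = \sum_b a b s * h b x) ->
  ~ rkge fam (fun _ => True) (fun _ => True) #|{: I * 'I_M * 'I_B + I * I * 'I_B}|.+1.
Proof.
move=> hd hB.
have qd i : (q i <= d)%N by apply: leq_trans (hd i); rewrite leq_pmulr.
have h1 (p : I * 'I_M) : exists ah : ('I_B -> 'rV[K]_M -> K) * ('I_B -> W * V -> K), forall t (w : W) (y : V),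
    F3 (q p.1) (f p.1) (w p.2, (y, comb w t)) = \sum_b ah.1 b t * ah.2 b (w, y).
  have [|||a [h eah]] := hB (W * V)%type (fun r => F3 (q p.1) (f p.1) (r.2.1 p.2, (r.2.2, comb r.2.1 r.1)))
      (1 + q p.1 * e p.1 - (q p.1).+1)%N.
  - by have := hd p.1; lia.
  - apply: (pol_comp _ (pol_F3 Kinf (q p.1) (pf p.1))); apply: polm_pair.
      by apply: polm_linm => b x y; rewrite /= !ffunE.
    by apply: polm_pair; [apply: polm_linm; lm | exact: polm_comb2].
  - move=> t s [w y] /=; rewrite (linmZ _ _ (linm_comb _)); apply: (F3_scale_u Kinf) (nf_hom (hf _)) _.
    by have := he p.1; have := proj1 (hq p.1); nia.
  by exists (a, h) => t w y; rewrite -eah.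
have h2 (p : I * I) : exists ah : ('I_B -> 'rV[K]_M -> K) * ('I_B -> W * V -> K), forall t (w : W) (y : V),
    fam (inr (p.1, t, p.2)) w y = \sum_b ah.1 b t * ah.2 b (w, y).
  have [|||a [h eah]] := hB (W * V)%type (fun r => fam (inr (p.1, r.1, p.2)) r.2.1 r.2.2) (q p.1 * e p.1 * q p.2)%N.
  - by apply: leq_trans (leq_addr _ _); apply: leq_mul.
  - rewrite /=; case: (1 < q p.1)%N; last exact: pol_cst.
    by apply: pol_exp; apply: (pol_Dm Kinf (pf p.1)); [exact: polm_comb2 | apply: polm_linm; lm].
  - move=> t s [w y] /=; case: ifP => _; last by rewrite mulr0.
    by rewrite (linmZ _ _ (linm_comb _)) (homE _ _ (hom_D Kinf y (nf_hom (hf p.1)))) exprMn [in RHS]exprM.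
  by exists (a, h) => t w y; rewrite -eah.
have [b1 hb1] := dchoice h1; have [b2 hb2] := dchoice h2.
pose a (x : I * 'rV[K]_M * 'rV[K]_M + I * 'rV[K]_M * I) (t : I * 'I_M * 'I_B + I * I * 'I_B) :=
  match x, t with
  | inl (i, s, t0), inl (i', k, b) => if i' == i then s 0 k * (b1 (i', k)).1 b t0 else 0
  | inr (i, t0, j), inr (i', j', b) => if (i' == i) && (j' == j) then (b2 (i', j')).1 b t0 else 0
  | _, _ => 0
  end.
pose h (t : I * 'I_M * 'I_B + I * I * 'I_B) (w : W) (y : V) :=
  match t with
  | inl (i, k, b) => (b1 (i, k)).2 b (w, y)
  | inr (i, j, b) => (b2 (i, j)).2 b (w, y)
  end.
apply: (rk_bound (a := fun x _ => a x) (h := h)) => // x w y _; rewrite big_sumType /=.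
case: x => [[[i s] t]|[[i t] j]].
  rewrite [X in _ + X]big1 ?addr0 => [|[[i' j'] b] _]; last by rewrite mul0r.
  transitivity (\sum_(p : I * 'I_M) \sum_b a (inl (i, s, t)) (inl (p, b)) * h (inl (p, b)) w y); last first.
    by rewrite pair_bigA; apply: eq_bigr => -[p b] _.
  transitivity (\sum_i' \sum_k \sum_b a (inl (i, s, t)) (inl (i', k, b)) * h (inl (i', k, b)) w y); last first.
    by rewrite pair_bigA; apply: eq_bigr => -[i' k] _.
  rewrite (bigD1 i) //= [X in _ + X]big1 ?addr0 => [|i' /negPf ni]; last first.
    by rewrite big1 // => k _; rewrite big1 // => b _; rewrite ni mul0r.
  rewrite {1}/comb (lin_sum _ _ _ (F3_lin Kinf (q i) y (comb w t) (pf i))); apply: eq_bigr => k _.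
  rewrite (linZ _ _ (F3_lin Kinf (q i) y (comb w t) (pf i))) (hb1 (i, k)) mulr_sumr.
  by apply: eq_bigr => b _; rewrite eqxx mulrA.
rewrite [X in X + _]big1 ?add0r => [|[[i' j'] b] _]; last by rewrite mul0r.
transitivity (\sum_(p : I * I) \sum_b a (inr (i, t, j)) (inr (p, b)) * h (inr (p, b)) w y); last first.
  by rewrite pair_bigA; apply: eq_bigr => -[p b] _.
rewrite (bigD1 (i, j)) //= [X in _ + X]big1 ?addr0 => [|[i' j'] /negPf ni]; last first.
  by rewrite big1 // => b _; rewrite -xpair_eqE ni mul0r.
have := hb2 (i, j) t w y; rewrite /= => ->; apply: eq_bigr => b _.
by rewrite !eqxx.
Qed.

End Family.

End PolarizedFamily.

(** * Generic tuples of vectors *)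

Section GenericSpan.
Variable K : fieldType.
Hypothesis Kinf : infinite_field K.

Lemma D_sub_affine (V W : lmodType K) (H : W -> K) (s : V -> W) a x v : linm s -> pol H ->
  D (fun x => H (a + s x)) x v = D H (a + s x) (s v).
Proof.
move=> hs pH; rewrite (D_linm Kinf (f := fun w => H (a + w))) //; last exact: pol_shift.
by rewrite (D_shift Kinf).
Qed.

(** The tuple is a point of maximal rank of [fam]. If the conclusion failed there for some [c], [s],
    [t], a combination of the family would vanish at that point, and [expand_max_rank] would bound
    the strength of the polarization of the [c]-combination. *)
Lemma generic_span d m M : exists S, forall (V : vectType K) (I : finType) (J : {set I}) (q e : I -> nat) (f : I -> V -> K),
  (#|I| <= m)%N -> (forall i, frob K (q i)) -> (forall i, (0 < e i)%N) -> (forall i, (q i * e i <= d)%N) ->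
  (forall i, nf (q i) (e i) (f i)) -> hs J q e f S ->
  exists w : 'I_M -> V, forall q' e' (c : I -> K), (forall i, i \in J -> c i != 0 -> q i = q' /\ e i = e') ->
    (exists2 i, i \in J & c i != 0) -> forall s t, free2 s t ->
    exists y, (forall i t', i \in J -> (1 < q i)%N -> D (f i) (comb w t') y = 0) /\
      \sum_(i in J) c i * F3 q' (f i) (comb w s, (y, comb w t)) != 0.
Proof.
have [B hB] := expand_bounded Kinf (d * d + d) M.
(* [expand_max_rank] gives at most [R.+1 * d] terms, with [R] the rank bound for [fam], and a final
   product rule doubles them. *)
exists (2 * ((m * M * B + m * m * B).+2 * d))%N => V I J q e f hI hq he hd hf hs0.
pose R := #|{: I * 'I_M * 'I_B + I * I * 'I_B}|.
have hR : (R <= m * M * B + m * m * B)%N.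
  rewrite /R card_sum !card_prod !card_ord; apply: leq_add; rewrite leq_mul2r; apply/orP; right.
    by rewrite leq_mul2r hI orbT.
  exact: leq_mul.
have [w0 hw0] := expand_max_rank Kinf (pol_fam Kinf hf) (fam_bound (M := M) Kinf hq he hf hd hB).
exists w0 => q' e' c hc [i1 i1J ci1] s t st; apply: NNPP => nex.
have [q1 e1] := hc i1 i1J ci1.
have pf i : pol (f i) := hom_pol (nf_hom (hf i)).
have hq' : frob K q' by rewrite -q1.
have q0 : (0 < q')%N := proj1 hq'.
have e0 : (0 < e')%N by rewrite -e1.
have de : (q' * e' <= d)%N by rewrite -q1 -e1.
pose W : lmodType K := {ffun 'I_M -> V}.
pose Fc (v y u : V) := \sum_(i in J) c i * F3 q' (f i) (v, (y, u)).
have Fc_lin y u : lin (fun v => Fc v y u).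
  move=> a x z; rewrite /Fc mulr_sumr -big_split /=; apply: eq_bigr => i _.
  by rewrite (F3_lin Kinf q' y u (pf i)) mulrDr mulrCA.
have Fc_qadd v u : qadd q' (fun y => Fc v y u).
  move=> a x y; rewrite /Fc mulr_sumr -big_split /=; apply: eq_bigr => i iJ.
  have [->|ci] := eqVneq (c i) 0; first by rewrite !mul0r mulr0 addr0.
  have [qi ei] := hc i iJ ci.
  rewrite (F3_qadd Kinf v u (pf i)) ?mulrDr ?(mulrCA (c i)) // => z.
  by rewrite -qi; apply: nf_qadd.
have Fc_scale v y u a : Fc v y (a *: u) = a ^+ (q' * e' - q') * Fc v y u.
  rewrite /Fc mulr_sumr; apply: eq_bigr => i iJ.
  have [->|ci] := eqVneq (c i) 0; first by rewrite !mul0r mulr0.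
  have [qi ei] := hc i iJ ci.
  rewrite (@F3_scale_u K Kinf V q' (1 + q' * e')) ?(mulrCA (c i)) //; last by nia.
    by rewrite -qi -ei; apply: nf_hom.
have pFc3 : pol (fun p : V * (V * V) => Fc p.1 p.2.1 p.2.2).
  apply: pol_sum => i _; apply: pol_scale; apply: (pol_ext (pol_F3 Kinf q' (pf i))) => -[v [y u]] //.
pose b (z : I * 'rV[K]_M) y := if (z.1 \in J) && (1 < q z.1)%N then D (f z.1) (comb w0 z.2) y else 0.
(* Without a suitable [y], the additive function [Fc (comb w0 s) y (comb w0 t)] of [y] vanishes on
   the common kernel of the derivatives, hence is a combination of their [q']-th powers. The
   difference is a combination of [fam] vanishing at [w0]. *)
have [||||n [mu [z eFc]]] := @qadd_span K V _ b q' (fun y => Fc (comb w0 s) y (comb w0 t)) => //.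
- move=> z; rewrite /b; case: (_ && _); first exact: D_linr.
  by move=> a x y; rewrite mulr0 addr0.
- move=> y hy; apply: NNPP => Fy; apply: nex; exists y; split; last by apply/eqP.
  by move=> i t' iJ qi; have := hy (i, t'); rewrite /b /= iJ qi.
pose mm (k : I + 'I_n) := match k with inl i => if i \in J then c i else 0
  | inr k => if (z k).1 \in J then - mu k else 0 end.
pose xx (k : I + 'I_n) : I * 'rV[K]_M * 'rV[K]_M + I * 'rV[K]_M * I :=
  match k with inl i => inl (i, s, t) | inr k => inr ((z k).1, (z k).2, i1) end.
pose E (w : W) y := \sum_(k < n) (if (z k).1 \in J then mu k else 0) *
   (if (1 < q (z k).1)%N then D (f (z k).1) (comb w (z k).2) y ^+ q' else 0).
have eG (w : W) y : \sum_k mm k * fam q f (xx k) w y = Fc (comb w s) y (comb w t) - E w y.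
  rewrite big_sumType /=; congr (_ + _).
    rewrite /Fc [RHS]big_mkcond; apply: eq_bigr => i _; case: ifP => [iJ|_]; last by rewrite mul0r.
    have [->|ci] := eqVneq (c i) 0; first by rewrite !mul0r.
    by have [-> _] := hc i iJ ci.
  by rewrite /E -sumrN; apply: eq_bigr => k _; rewrite q1; case: ifP; rewrite ?mulNr ?mul0r ?oppr0.
pose ee := (1 + q' * e' - q')%N.
have [|T [a [psi [chi [cT hpsi pchi eT]]]]] := hw0 _ mm xx _ ee.
  move=> y; rewrite eG eFc /E -sumrB big1 // => k _; rewrite /b.
  by case: (_ \in J); case: (1 < _)%N => /=; rewrite ?mul0r ?(frob0 hq') ?mulr0 subrr.
have [l1 [hl1 l1t l1s]] := free2_dual (free2C st).
have [l2 [hl2 l2s l2t]] := free2_dual st.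
(* The tuple whose combinations along [s] and [t] are the two prescribed vectors; it exists because
   [s] and [t] are independent. *)
pose Wf (p : V * V) : W := [ffun i => l1 (delta_mx 0 i) *: p.1 + l2 (delta_mx 0 i) *: p.2].
have lWf : linm Wf.
  move=> k x y; apply/ffunP => i; rewrite !ffunE /= !scalerDr !scalerA.
  by rewrite ![k * _]mulrC addrACA.
have cW p r : comb (Wf p) r = l1 r *: p.1 + l2 r *: p.2.
  rewrite -(comb_lin p.1 r hl1) -(comb_lin p.2 r hl2) -comb_add /comb.
  by apply: eq_bigr => i _; rewrite ffunE.
have cWs p : comb (Wf p) s = p.1 by rewrite cW l1s l2s scale1r scale0r addr0.
have cWt p : comb (Wf p) t = p.2 by rewrite cW l1t l2t scale1r scale0r add0r.
pose Ph y (w : W) := Fc (comb w s) y (comb w t).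
have pcb r : polm (fun w : W => comb w r) by apply: polm_linm; apply: linm_combw.
have hPh y : hom ee (Ph y).
  split.
    apply: (pol_comp (s := fun w : W => (comb w s, (y, comb w t))) _ pFc3).
    by apply: polm_pair => //; apply: polm_pair => //; apply: polm_cst.
  move=> k w; rewrite /Ph !(linmZ _ _ (linm_combw _)) (linZ _ _ (Fc_lin _ _)) Fc_scale mulrA -exprS.
  by congr (_ ^+ _ * _); rewrite /ee; nia.
have pE y : pol (fun w => E w y).
  apply: pol_sum => k _; apply: pol_scale; case: (1 < _)%N; last exact: pol_cst.
  by apply: pol_exp; apply: (pol_Dm Kinf) => //; apply: polm_cst.
(* [E] is built from powers of derivatives of members with [q i > 1], and these have zero derivative
   in [w]; differentiating removes [E] from the expansion. *)
have DE y w v : D (fun w => E w y) w v = 0.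
  rewrite (D_sum Kinf) => [|k _]; last first.
    apply: pol_scale; case: (1 < _)%N; last exact: pol_cst.
    by apply: pol_exp; apply: (pol_Dm Kinf) => //; apply: polm_cst.
  rewrite big1 // => k _; rewrite (D_scale Kinf); last first.
    case: (1 < _)%N; last exact: pol_cst.
    by apply: pol_exp; apply: (pol_Dm Kinf) => //; apply: polm_cst.
  case qk: (1 < q (z k).1)%N; last by rewrite (D_cst Kinf) mulr0.
  have pD : pol (fun x => D (f (z k).1) x y) by apply: pol_D.
  have pD' : pol (fun w : W => D (f (z k).1) (comb w (z k).2) y) by apply: (pol_comp (pcb _) pD).
  rewrite (D_exp Kinf) // (D_linm Kinf (f := fun x => D (f (z k).1) x y) w v (linm_combw (z k).2)) //.
  by rewrite (nf_D_flat Kinf (hq _) (hf _) _ _ _ qk) !mulr0.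
pose E' y (w : W) := E (w0 + w) y.
have pE' y : pol (E' y) by apply: (pol_shift (f := fun w => E w y)).
pose H y := comp ee (E' y).
have pH y : pol (H y) by apply: pol_comp_i.
have DH y w v : D (H y) w v = 0.
  have eeS : ee = (ee.-1).+1 by rewrite /ee; nia.
  rewrite /H eeS (D_comp_comm Kinf) //.
  have -> : (fun w => D (E' y) w v) = fun _ => 0.
    by apply: functional_extensionality => x; rewrite (D_shift Kinf (f := fun w => E w y)) // DE.
  by rewrite (comp_neq Kinf w (hom_zero W ee)) // neq_ltn; apply/orP; left; rewrite /ee; nia.
(* [Fc] is linear in [v], so it is its own derivative in [v]; and it is homogeneous of degree [ee]
   in [w], so the component of degree [ee] at [w0] recovers it exactly. *)
have key (v y u : V) : Fc v y u = D (fun x => \sum_k psi k (Wf (x, u)) * chi k (Wf (x, u), y)) 0 v.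
  have -> : (fun x => \sum_k psi k (Wf (x, u)) * chi k (Wf (x, u), y)) =
      fun x => Fc x y u - H y (Wf (0, u) + Wf (x, 0)).
    apply: functional_extensionality => x; rewrite -eT.
    have -> : (fun w => \sum_i mm i * fam q f (xx i) (w0 + w) y) = fun w => Ph y (w0 + w) - E' y w.
      by apply: functional_extensionality => w; rewrite eG.
    have pPh : pol (fun w => Ph y (w0 + w)) by apply: pol_shift; apply: hom_pol (hPh y).
    rewrite (comp_sub Kinf ee _ pPh (pE' y)) -/(H y _).
    have -> : comp ee (fun w => Ph y (w0 + w)) (Wf (x, u)) = Fc x y u; last congr (_ - H y _).
      rewrite (comp_shift Kinf ee w0 (Wf (x, u)) (hPh y)) leqnn subnn (tp_coef0 _ _ (hom_pol (hPh y))).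
      by rewrite /Ph cWs cWt.
    rewrite -(linmD (0, u) (x, 0) lWf); congr (Wf _).
    by rewrite /GRing.add /=; congr (_, _); rewrite ?add0r ?addr0.
  have lW0 : linm (fun x : V => Wf (x, 0)).
    by apply: (linm_comp _ lWf); apply: linm_pair; [exact: linm_id | exact: linm_zero].
  rewrite (D_sub Kinf); last 2 first.
  - exact: pol_lin.
  - by apply: (pol_comp (s := fun x => Wf (0, u) + Wf (x, 0)) _ (pH y)); apply: polm_add; [exact: polm_cst | exact: polm_linm].
  by rewrite (D_lin Kinf _ _ (Fc_lin y u)) (D_sub_affine (Wf (0, u)) 0 v lW0 (pH y)) DH subr0.
have ppsi k : pol (psi k) by have [_ /hom_pol] := hpsi k.
pose T0 (p : V * (V * V)) := (0 : V, p.2).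
have lT0 : linm T0 by apply: linm_pair; lm.
pose G1 k (r : V * (V * V)) := chi k (Wf (r.1, r.2.2), r.2.1).
have pG1 k : pol (G1 k).
  apply: (pol_comp (s := fun r : V * (V * V) => (Wf (r.1, r.2.2), r.2.1)) _ (pchi k)).
  apply: polm_pair; last by apply: polm_linm; lm.
  by apply: polm_linm; apply: (linm_comp _ lWf); lm.
pose G2 k (r : V * (V * V)) := psi k (Wf (r.1, r.2.2)).
have hG2 k : hom (a k) (G2 k).
  have [_ h] := hpsi k.
  by apply: (hom_linm (s := fun r : V * (V * V) => Wf (r.1, r.2.2)) _ h); apply: (linm_comp _ lWf); lm.
pose Q (G : V * (V * V) -> K) (p : V * (V * V)) := (tp G (T0 p) (p.1, 0))`_1.
have pQ G : pol G -> pol (Q G).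
  by move=> pG; apply: (pol_tcm Kinf 1 pG); apply: polm_linm => //; lm.
have hQ k : hom (a k) (Q (G2 k)).
  have h := hom_tc Kinf 1 (hG2 k).
  by apply: (hom_linm (s := fun p : V * (V * V) => (T0 p, (p.1, 0))) _ h); lm.
have key2 (p : V * (V * V)) : Fc p.1 p.2.1 p.2.2 =
    \sum_k (G2 k (T0 p) * Q (G1 k) p + Q (G2 k) p * G1 k (T0 p)).
  case: p => v [y u]; rewrite key /= (D_sum Kinf) => [|k _]; last first.
    exact: (pol_fix2 (y, u) (pol_mul (hom_pol (hG2 k)) (pG1 k))).
  apply: eq_bigr => k _; rewrite (D_mul Kinf); last 2 first.
  - exact: (pol_fix2 (y, u) (hom_pol (hG2 k))).
  - exact: (pol_fix2 (y, u) (pG1 k)).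
  congr (_ * _ + _ * _).
    exact: (congr1 (fun P : {poly K} => P`_1) (tp_fix2 Kinf 0 v (y, u) (pG1 k))).
  exact: (congr1 (fun P : {poly K} => P`_1) (tp_fix2 Kinf 0 v (y, u) (hom_pol (hG2 k)))).
apply: (hs0 q' e' c hc); first by exists i1.
pose d' := (1 + q' * e')%N.
have hFc : hom d' (fun p : V * (V * V) => \sum_(i in J) c i * F3 q' (f i) p).
  split; first by apply: pol_sum => i _; apply: pol_scale; apply: pol_F3.
  move=> k p; rewrite mulr_sumr; apply: eq_bigr => i iJ.
  have [->|ci] := eqVneq (c i) 0; first by rewrite !mul0r mulr0.
  have [qi ei] := hc i iJ ci.
  by rewrite (homE _ _ (hom_F3 Kinf q' (nf_hom (hf i)))) qi ei mulrCA.
have hT0 k : hom (a k) (fun p => G2 k (T0 p)) by apply: hom_linm.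
have pT0 k : pol (fun p => G1 k (T0 p)) by apply: (pol_linm lT0).
have ak k : (0 < a k < d')%N by have [] := hpsi k; rewrite /d' /ee; nia.
apply: (lowstr_ext (f := fun p => \sum_k (comp d' (fun p => G2 k (T0 p) * Q (G1 k) p) p +
     comp d' (fun p => Q (G2 k) p * G1 k (T0 p)) p))).
  apply: (lowstr_sumT (S := 2)); last first.
    by move=> k _; rewrite -[2%N]/(1 + 1)%N; apply: lowstr_add; apply: lowstr_comp_mul => //; apply: pQ.
  rewrite mulnC leq_mul2l /=; apply: leq_trans cT _; apply: leq_mul; last by rewrite /ee; nia.
  by apply: leq_trans (_ : R.+1 <= _)%N; rewrite ?ltnS ?(leqW hR).
move=> p; rewrite -(comp_id Kinf p hFc).
have -> : (fun p : V * (V * V) => \sum_(i in J) c i * F3 q' (f i) p) =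
   fun p => \sum_k (G2 k (T0 p) * Q (G1 k) p + Q (G2 k) p * G1 k (T0 p)).
  apply: functional_extensionality => r; rewrite -key2.
  by apply: eq_bigr => i _; case: r => ? [].
have pm1 k : pol (fun p => G2 k (T0 p) * Q (G1 k) p) by apply: pol_mul (hom_pol (hT0 k)) (pQ _ _).
have pm2 k : pol (fun p => Q (G2 k) p * G1 k (T0 p)) by apply: pol_mul (hom_pol (hQ k)) (pT0 k).
rewrite (comp_sum Kinf) => [|k _]; last exact: pol_add.
by apply: eq_bigr => k _; rewrite (comp_add Kinf).
Qed.

End GenericSpan.

(** * Interpolation and stabilizing ranks *)

Section RankChain.
Variable K : fieldType.
Hypothesis Kinf : infinite_field K.

(** The coefficient functions of the expansion span the values of [G] through a matrix of bounded
    rank, so boundedly many points [z b] suffice to interpolate. The terms are then values of [G]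
    itself, not abstract coefficients. *)
Lemma expand_points d M : exists B, forall (X : lmodType K) (G : 'rV[K]_M * X -> K) n, (n <= d)%N -> pol G ->
  (forall t s x, G (t *: s, x) = t ^+ n * G (s, x)) ->
  exists (r : nat) (a : 'I_r -> 'rV[K]_M -> K) (z : 'I_r -> 'rV[K]_M), (r <= B)%N /\
    forall s x, G (s, x) = \sum_b a b s * G (z b, x).
Proof.
have [B hB] := expand_bounded Kinf d M.
exists B => X G n nd pG hG; have [a [h eG]] := hB X G n nd pG hG.
pose f s (_ : unit) b := a b s.
have nR : ~ rkge f (fun _ => True) (fun _ => True) B.+1.
  apply: (rk_bound (T := 'I_B) (a := fun s _ b => a b s) (h := fun b _ b' => (b == b')%:R)); last by rewrite card_ord.
  move=> s w b _; rewrite (bigD1 b) //= eqxx mulr1 big1 ?addr0 // => b' /negPf ->.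
  by rewrite mulr0.
have [|r [rB [w [k [y [_ _ d0]]]] nr]] := rk_max _ nR; first by exists tt.
exists r, (fun i s => \sum_j f s w (y j) * invmx (\matrix_(i, j) f (k i) w (y j)) j i), k; split=> // s x.
rewrite eG; under [RHS]eq_bigr do rewrite eG mulr_sumr.
rewrite exchange_big /=; apply: eq_bigr => b _.
rewrite -[a b s]/(f s w b) (rk_span nr I (fun _ => I) d0 b I) mulr_suml.
by apply: eq_bigr => i _; rewrite mulrA.
Qed.

Lemma left_kernel a D (A : 'M[K]_(a, D)) : (D < a)%N -> exists s : 'rV_a, s != 0 /\ s *m A = 0.
Proof.
move=> Da; have nf : kermx A != 0.
  rewrite kermx_eq0 /row_free; apply/eqP => E.
  by have := rank_leq_col A; rewrite E leqNgt Da.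
have /rowV0Pn[s /sub_kermxP sA s0] := nf.
by exists s.
Qed.
Hypothesis Kbr : brauer_field K.

(* The ranks of the families formed by the first [k a] rows stabilise at some [k]; rows with index in
[k a, (k + 1) a) are then constrained by the earlier ones at every point of the affine space. *)
Lemma rank_chain d m : exists R, forall (V Y : lmodType K) (N1 : vectType K) (C : finType) (q : C -> nat)
    (g : C -> V -> Y -> K) (i1 : N1 -> Y) (c : Y) (phi : N1 -> K) (x : 'I_R -> V),
  (#|C| <= m)%N -> (forall k, (1 <= q k <= d)%N) -> (forall k y, lin (fun v => g k v y)) ->
  (forall k v, pol (g k v)) -> (forall k v, qadd (q k) (g k v)) -> linm i1 -> pol phi -> (exists n, phi n != 0) ->
  exists n, phi n != 0 /\ forall p : C -> K, (forall i, \sum_k p k * g k (x i) (c + i1 n) = 0) ->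
    forall q0, exists s : 'rV[K]_R, s != 0 /\ forall y, \sum_(k | q k == q0) p k * g k (comb x s) (i1 y) = 0.
Proof.
have [a ha] := codim_lt Kinf Kbr d (m * m).
(* [m.+1] blocks of [a] rows: the rank is at most [m], so it cannot grow with each of the blocks.
   The size [a] exceeds the codimension of the kernel of [m * m] additive functions. *)
exists (m.+1 * a)%N => V Y N1 C q g i1 c phi x hC hq hlin hpol hqadd hi1 pphi [n0 phin0].
pose f (i : 'I_(m.+1 * a)) n k := g k (x i) (c + i1 n).
pose P k (i : 'I_(m.+1 * a)) := (i < k * a)%N : Prop.
have pfi i k : pol (fun n => f i n k).
  by apply: (pol_comp (s := fun n => c + i1 n) _ (hpol k (x i))); apply: polm_add; [exact: polm_cst | exact: polm_linm].
have bnd k r : (m < r)%N -> ~ rkge f (P k) (fun _ => True) r.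
  move=> mr; apply: (rk_bound (T := C) (a := f) (h := fun k _ k' => (k == k')%:R)); last exact: leq_ltn_trans mr.
  move=> i n b _; rewrite (bigD1 b) //= eqxx mulr1 big1 ?addr0 // => b' /negPf ->.
  by rewrite mulr0.
have [k [r [km hr nr]]] : exists k r, [/\ (k <= m)%N, rkge f (P k) (fun _ => True) r
     & ~ rkge f (P k.+1) (fun _ => True) r.+1].
  apply: NNPP => H.
  suff H2 k : (k <= m.+1)%N -> rkge f (P k) (fun _ => True) k by apply: (bnd m.+1 m.+1) => //; apply: H2.
  elim: k => [|k IH] km.
    exists n0, (fun i : 'I_0 => match i with Ordinal _ h => False_rect _ (notF h) end),
      (fun i : 'I_0 => match i with Ordinal _ h => False_rect _ (notF h) end).
    by split=> // [[]//|]; rewrite det_mx00 oner_eq0.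
  apply: NNPP => H'; apply: H; exists k, k; split=> //; apply: IH; exact: ltnW.
have rm : (r <= m)%N by rewrite leqNgt; apply/negP => /(bnd k).
have [n1 [kap [sig [_ Pk d1]]]] := hr.
have pdet : pol (fun n => \det (\matrix_(i, j) f (kap i) n (sig j))).
  apply: pol_det => i j; apply: (pol_ext (pfi (kap i) (sig j))) => n; by rewrite mxE.
have [n] := pol_domain Kinf pdet pphi d1 phin0.
rewrite mulf_eq0 negb_or => /andP[dn phin]; exists n; split=> // p hp q0.
(* Moving [n] inside [Wn] changes none of the rows [kap], so the minor stays nonzero and every row
   of the next block stays a combination of them; [p] therefore kills its variation along [Wn]. *)
have [|t|Wn [hWn dWn]] := ha N1 ('I_r * C)%type (fun t => q t.2) (fun t y => g t.2 (x (kap t.1)) (i1 y)).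
- by rewrite card_prod card_ord leq_mul.
- split; first exact: hq.
  split; last by apply: qadd_linm.
  by apply: (pol_linm hi1).
have key i y : P k.+1 i -> y \in Wn -> \sum_k p k * g k (x i) (i1 y) = 0.
  move=> Pi /hWn yW.
  have e j k' : f (kap j) (n + y) k' = f (kap j) n k'.
    have z : g k' (x (kap j)) (i1 y) = 0 by exact: (yW (j, k')).
    by rewrite /f (linmD _ _ hi1) addrA (qaddD (c + i1 n) _ (hqadd k' _)) z addr0.
  have dny : \det (\matrix_(i, j) f (kap i) (n + y) (sig j)) != 0.
    by rewrite (_ : \matrix_(i, j) _ = \matrix_(i, j) f (kap i) n (sig j)) //; apply/matrixP => ? ?; rewrite !mxE e.
  have Pk' j : P k.+1 (kap j) by apply: leq_trans (Pk j) _; rewrite mulSn leq_addl.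
  have h b := rk_span nr I Pk' dny b Pi.
  have : \sum_k p k * f i (n + y) k = 0.
    under eq_bigr => b _ do rewrite h mulr_sumr.
    rewrite exchange_big big1 //= => j _.
    under eq_bigr => b _ do rewrite e mulrCA.
    by rewrite -mulr_sumr hp mulr0.
  move=> E; transitivity (\sum_k p k * f i (n + y) k - \sum_k p k * g k (x i) (c + i1 n)); last by rewrite E hp subrr.
  rewrite -sumrB; apply: eq_bigr => b _; rewrite /f (linmD _ _ hi1) addrA (qaddD (c + i1 n) _ (hqadd b _)).
  by rewrite mulrDr addrC addKr.
(* Replacing [y] by [t *: y] separates the summands by their exponent of homogeneity. *)
have key2 i y : P k.+1 i -> y \in Wn -> \sum_(k | q k == q0) p k * g k (x i) (i1 y) = 0.
  move=> Pi yW; pose Q : {poly K} := \sum_k (p k * g k (x i) (i1 y)) *: 'X^(q k).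
  have Q0 : Q = 0.
    apply: (poly_fun0 Kinf) => t; rewrite /Q horner_sum -[RHS](key i (t *: y) Pi); last exact: memvZ.
    apply: eq_bigr => b _; rewrite !hornerE (linmZ _ _ hi1) (qaddZ _ _ (hqadd b _)); ring.
  have Qq : Q`_q0 = 0 by rewrite Q0 coef0.
  rewrite -[RHS]Qq /Q coef_sum big_mkcond; apply: eq_bigr => b _; rewrite coefZ coefXn eq_sym.
  by case: eqP => _; rewrite ?mulr1 ?mulr0.
have [al [be [lal lbe eab _]]] := decomp Wn.
pose F i y := \sum_(k | q k == q0) p k * g k (x i) (i1 y).
have Fadd i : qadd q0 (F i).
  move=> t y z; rewrite /F mulr_sumr -big_split /=; apply: eq_bigr => b /eqP qb.
  by rewrite hi1 (hqadd b) qb mulrDr mulrCA.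
pose D := \dim {: subvs_of (Wn^C)}.
have aD : (D < a)%N by rewrite /D dimvf /dim /=.
have oI (j : 'I_a) : (k * a + j < m.+1 * a)%N.
  have : (k * a + a <= m.+1 * a)%N by rewrite -mulSnr leq_mul2r ltnS km orbT.
  by have := ltn_ord j; lia.
(* Only a complement of [Wn], of dimension [D < a], is left: the [a] rows of the block have a
   nontrivial combination vanishing on its basis, and additivity extends this to the whole
   complement. *)
pose A := \matrix_(j < a, l < D) F (Ordinal (oI j)) (vsval (vb l)).
have [s [s0 sA]] := left_kernel A aD.
pose s' : 'rV[K]_(m.+1 * a) := \row_i if (k * a <= i)%N then (if insub (i - k * a)%N is Some j then s 0 j else 0) else 0.
have s'E j : s' 0 (Ordinal (oI j)) = s 0 j by rewrite mxE /= leq_addr addKn valK.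
have s'S (G : 'I_(m.+1 * a) -> K) : \sum_i s' 0 i * G i = \sum_j s 0 j * G (Ordinal (oI j)).
  rewrite (bigID (fun i : 'I__ => (k * a <= i < k * a + a)%N)) /= [X in _ + X]big1 ?addr0; last first.
    move=> i h; rewrite mxE; case: ifP => h1; last by rewrite mul0r.
    move: h; rewrite h1 /= -leqNgt => h; rewrite insubF ?mul0r //; apply/negbTE; rewrite -leqNgt; lia.
  rewrite (reindex_onto (fun j => Ordinal (oI j)) (fun i => insubd (Ordinal (leq_ltn_trans (leq0n _) aD)) (i - k * a)%N)) /=.
    apply: eq_big => [j|j _]; last by rewrite s'E.
    by rewrite leq_addr ltn_add2l ltn_ord addKn valKd eqxx.
  by move=> i /andP[h1 h2]; apply: val_inj; rewrite /= insubdK ?subnKC // -topredE /=; lia.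
exists s'; split.
  apply: contraNneq s0 => s'0; apply/eqP/rowP => j; by rewrite -s'E s'0 !mxE.
move=> y; transitivity (\sum_i s' 0 i * F i y).
  under [RHS]eq_bigr do rewrite mulr_sumr.
  rewrite exchange_big /=; apply: eq_bigr => b _; rewrite /comb (lin_sum _ _ _ (hlin b _)) mulr_sumr.
  by apply: eq_bigr => i _; rewrite (linZ _ _ (hlin b _)) mulrCA.
rewrite s'S (eab y).
have FE (j : 'I_a) : F (Ordinal (oI j)) (vsval (al y) + vsval (be y)) = \sum_l co l (be y) ^+ q0 * A j l.
  have Pj : P k.+1 (Ordinal (oI j)) by rewrite /P /= mulSnr ltn_add2l ltn_ord.
  rewrite (qaddD _ _ (Fadd _)) [F _ (vsval (al y))]key2 // ?subvsP // add0r.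
  rewrite {1}(co_sum (be y)) linear_sum (qadd_sum _ _ _ (Fadd _)); apply: eq_bigr => l _.
  by rewrite linearZ /= (qaddZ _ _ (Fadd _)) mxE.
under eq_bigr do rewrite FE mulr_sumr.
rewrite exchange_big big1 //= => l _.
have := congr1 (fun B : 'rV_D => B 0 l) sA; rewrite !mxE => E.
under eq_bigr do rewrite mulrCA.
by rewrite -mulr_sumr E mulr0.
Qed.

End RankChain.

(** * Restriction to subspaces *)

Section Restriction.
Variable K : fieldType.
Hypothesis Kinf : infinite_field K.

Lemma expand_points_pad d M : exists B, forall (X : lmodType K) (G : 'rV[K]_M * X -> K) n, (n <= d)%N -> pol G ->
  (forall t s x, G (t *: s, x) = t ^+ n * G (s, x)) ->
  exists (a : 'I_B -> 'rV[K]_M -> K) (z : 'I_B -> 'rV[K]_M),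
    forall s x, G (s, x) = \sum_b a b s * G (z b, x).
Proof.
have [B hB] := expand_points Kinf d M; exists B => X G n nd pG hG.
have [r [a [z [rB e]]]] := hB X G n nd pG hG.
exists (fun b s => if insub (val b) is Some i then a i s else 0), (fun b => if insub (val b) is Some i then z i else 0) => s x.
rewrite e; pose g b := if insub b is Some i then a (i : 'I_r) s * G (z i, x) else 0.
transitivity (\sum_(i < r) g i); first by apply: eq_bigr => i _; rewrite /g valK.
rewrite (big_ord_widen B g rB) big_mkcond /=; apply: eq_bigr => b _; rewrite /g.
case: ltnP => h; first by case: insubP => [i _ _ //|]; rewrite h.
by rewrite insubF ?mul0r //; apply/negbTE; rewrite -leqNgt.
Qed.

Lemma Nice_empty (V : lmodType K) (I : finType) (P : I -> V -> K) : Nice set0 P.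
Proof.
split=> [g h pg ph gh|]; last first.
  by exists 0; split=> [i|c _ i]; rewrite inE.
have z f : (forall x, f x = 0) -> ideal (set0 : {set I}) P f.
  by move=> f0; apply: (ideal_ext (ideal0 _ _)) => x; rewrite f0.
have [[x gx]|ng] := classic (exists x, g x != 0); last first.
  by left; apply: z => x; apply/eqP; apply: NNPP => /negP gx; apply: ng; exists x.
right; apply: z => y; apply/eqP; apply: NNPP => /negP hy.
have [x'] := pol_domain Kinf pg ph gx hy.
by rewrite gh ?eqxx // => i; rewrite inE.
Qed.

Lemma strong_sub (V : lmodType K) (I : finType) (J J' : {set I}) C C' e (A : I -> V -> K) :
  J' \subset J -> (C' <= C)%N -> strong C J e A -> strong C' J' e A.
Proof.
move=> JJ CC h n c hc [i iJ ci] hl.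
apply: (h n (fun i => if i \in J' then c i else 0)).
- by move=> j jJ; case: ifP => jJ'; [apply: hc | rewrite eqxx].
- by exists i; [exact: (subsetP JJ) | rewrite iJ].
apply: lowstr_ext (lowstr_leq CC hl) _ => x.
rewrite [RHS](big_setID J') /= (setIidPr JJ) [X in _ = _ + X]big1 ?addr0.
  by apply: eq_bigr => j ->.
by move=> j; rewrite inE => /andP[/negPf -> _]; rewrite mul0r.
Qed.

Lemma hs_sub (V : lmodType K) (I : finType) (J J' : {set I}) S S' q e (f : I -> V -> K) :
  J' \subset J -> (S' <= S)%N -> hs J q e f S -> hs J' q e f S'.
Proof.
move=> JJ SS h q' e' c hc [i iJ ci] hl.
apply: (h q' e' (fun i => if i \in J' then c i else 0)).
- by move=> j jJ; case: ifP => jJ'; [apply: hc | rewrite eqxx].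
- by exists i; [exact: (subsetP JJ) | rewrite iJ].
apply: lowstr_ext (lowstr_leq SS hl) _ => x.
rewrite [RHS](big_setID J') /= (setIidPr JJ) [X in _ = _ + X]big1 ?addr0.
  by apply: eq_bigr => j ->.
by move=> j; rewrite inE => /andP[/negPf -> _]; rewrite mul0r.
Qed.

(** By Taylor expansion the difference is a polynomial in [l x] without constant term, hence
    divisible by the linear form [l]. *)
Lemma lowstr_shift1 (X X' : lmodType K) d (F : X' -> K) (p : X -> X') (l : X -> K) v : (1 < d)%N ->
  hom d F -> linm p -> lin l -> lowstr d 1 (fun x => F (p x + l x *: v) - F (p x)).
Proof.
move=> d1 hF hp hl; have pF := hom_pol hF.
pose g x := \sum_(i < d) l x ^+ i * (tp F (p x) v)`_i.+1.
have ph i : pol (fun x => (tp F (p x) v)`_i) by apply: (pol_tcm Kinf i pF (polm_linm hp) (polm_cst X v)).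
have hg : hom (d - 1) g.
  apply: hom_sum => i _; have := ltn_ord i => id.
  have h1 : hom (1 * i) (fun x => l x ^+ i) by apply: hom_exp; apply: hom_lin.
  have h2 := hom_linm hp (tc_hom_base Kinf (i := i.+1) v hF id).
  have := hom_mul h1 h2; congr hom; lia.
apply: (lowstr_ext (f := fun x => l x * g x)) => [|x].
  apply: lowstr_prod hg; last exact: hom_lin.
  by rewrite d1.
rewrite tpE // (@horner_coef_wide _ d.+1); last first.
  by apply/leq_sizeP => j; apply: (tc_excess Kinf).
rewrite big_ord_recl expr0 mulr1 tp_coef0 // [RHS]addrC addKr mulr_sumr.
by apply: eq_bigr => i _; rewrite /bump /= exprS; ring.
Qed.

Lemma lowstr_shift (X X' : lmodType K) d (F : X' -> K) (T : finType) (p : X -> X') (l : T -> X -> K) (v : T -> X') :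
  (1 < d)%N -> hom d F -> linm p -> (forall t, lin (l t)) ->
  lowstr d #|T| (fun x => F (p x + \sum_t l t x *: v t) - F (p x)).
Proof.
move=> d1 hF hp hl.
have h (r : seq T) : lowstr d (size r) (fun x => F (p x + \sum_(t <- r) l t x *: v t) - F (p x)).
  elim: r => [|t r IH].
    by apply: lowstr_nil => x; rewrite big_nil addr0 subrr.
  have hs : linm (fun x => p x + \sum_(t <- r) l t x *: v t).
    apply: linm_add => //; apply: linm_bigsum => u a x y.
    by rewrite (hl u) scalerDl scalerA.
  apply: lowstr_ext (lowstr_add (lowstr_shift1 (v t) d1 hF hs (hl t)) IH) _ => x.
  by rewrite big_cons subrKA -addrA [X in F (p x + X)]addrC.
have := h (index_enum T); congr (lowstr d _ _).
by rewrite cardT enumT /index_enum; case: index_enum_key.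
Qed.

Section HS.
Variables (V : vectType K) (I : finType) (q e : I -> nat) (f : I -> V -> K).
Hypothesis hq : forall i, frob K (q i).
Hypothesis he : forall i, (0 < e i)%N.
Hypothesis hf : forall i, nf (q i) (e i) (f i).
Let pf i : pol (f i) := hom_pol (nf_hom (hf i)).

Lemma hom_Fc (J : {set I}) q' e' (c : I -> K) : (forall i, i \in J -> c i != 0 -> q i = q' /\ e i = e') ->
  hom (1 + q' * e') (fun p => \sum_(i in J) c i * F3 q' (f i) p).
Proof.
move=> hc; split; first by apply: pol_sum => i _; apply: pol_scale; apply: pol_F3.
move=> k p; rewrite mulr_sumr; apply: eq_bigr => i iJ.
have [->|ci] := eqVneq (c i) 0; first by rewrite !mul0r mulr0.
have [qi ei] := hc i iJ ci.
by rewrite (homE _ _ (hom_F3 Kinf q' (nf_hom (hf i)))) qi ei mulrCA.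
Qed.

(** Each vector differs from its projection to [W] by fewer than [k] directions. There are three
    arguments, so the polarization differs from that of the restriction by fewer than [3 * k]
    products with a linear factor. *)
Lemma hs_restrict (J : {set I}) (W : {vspace V}) S k : (\dim W^C < k)%N -> hs J q e f (S + 3 * k) ->
  hs J q e (fun i (n : subvs_of W) => f i (vsval n)) S.
Proof.
move=> kW h q' e' c hc [i0 i0J ci0] hl; apply: (h q' e' c hc); first by exists i0.
have [q0 e0] := hc i0 i0J ci0.
have d1 : (1 < 1 + q' * e')%N by have := he i0; have := proj1 (hq i0); rewrite q0 e0; nia.
have hF := hom_Fc hc.
set F := (fun p : V * (V * V) => _) in hF *.
have [a [b [la lb eab _]]] := decomp W.
pose D := \dim {: subvs_of (W^C)}.
pose w (l : 'I_D) : V := vsval (vb l).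
have eb x : x = vsval (a x) + \sum_l co l (b x) *: w l.
  rewrite {1}(eab x); congr (_ + _); rewrite {1}(co_sum (b x)) linear_sum.
  by apply: eq_bigr => l _; rewrite linearZ.
pose p3 (p : V * (V * V)) : V * (V * V) := (vsval (a p.1), (vsval (a p.2.1), vsval (a p.2.2))).
have lva : linm (fun x : V => vsval (a x) : V) by apply: (linm_comp la); apply: vsval_linm.
have lp3 : linm p3.
  by apply: linm_pair; [|apply: linm_pair]; apply: (linm_comp _ lva); lm.
pose l3 (t : 'I_D + ('I_D + 'I_D)) (p : V * (V * V)) :=
  match t with inl l => co l (b p.1) | inr (inl l) => co l (b p.2.1) | inr (inr l) => co l (b p.2.2) end.
pose v3 (t : 'I_D + ('I_D + 'I_D)) : V * (V * V) :=
  match t with inl l => (w l, (0, 0)) | inr (inl l) => (0, (w l, 0)) | inr (inr l) => (0, (0, w l)) end.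
have ll3 t : lin (l3 t).
  have lcb l (s : V * (V * V) -> V) : linm s -> lin (fun p => co l (b (s p))).
    by move=> hs'; exact: (lin_linm (l := fun x => co l (b x)) hs' (lin_linm lb (lin_co l))).
  case: t => [l|[l|l]].
  - exact: (lcb l (fun p => p.1) (@linm_fst K _ _)).
  - by apply: (lcb l (fun p => p.2.1)); exact: (linm_comp (@linm_snd K V (V * V)%type) (@linm_fst K V V)).
  - by apply: (lcb l (fun p => p.2.2)); exact: (linm_comp (@linm_snd K V (V * V)%type) (@linm_snd K V V)).
have e3 p : p = p3 p + \sum_t l3 t p *: v3 t.
  case: p => x [y z]; rewrite !big_sumType /=.
  have s0 (m : V -> V * (V * V)) x' : linm m -> \sum_l co l (b x') *: m (w l) = m (\sum_l co l (b x') *: w l).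
    move=> lm; rewrite (linm_sum _ _ _ lm); apply: eq_bigr => l _; exact: esym (linmZ _ _ lm).
  have lA : linm (fun x : V => (x, (0, 0)) : V * (V * V)) by apply: linm_pair; [exact: linm_id | exact: linm_zero].
  have lB : linm (fun x : V => (0, (x, 0)) : V * (V * V)).
    by apply: linm_pair; [exact: linm_zero | apply: linm_pair; [exact: linm_id | exact: linm_zero]].
  have lC : linm (fun x : V => (0, (0, x)) : V * (V * V)).
    by apply: linm_pair; [exact: linm_zero | apply: linm_pair; [exact: linm_zero | exact: linm_id]].
  have s1 := s0 _ x lA; have s2 := s0 _ y lB; have s3 := s0 _ z lC.
  have add3 (r s : V * (V * V)) : r + s = (r.1 + s.1, (r.2.1 + s.2.1, r.2.2 + s.2.2)) by case: r s => ? [? ?] [? [? ?]].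
  by rewrite s1 s2 s3 !add3 /= !add0r !addr0 -!eb.
have cT : (#|{: 'I_D + ('I_D + 'I_D)}| <= 3 * k)%N.
  have : (D < k)%N by rewrite /D dimvf /dim /=.
  rewrite !card_sum !card_ord; lia.
have l1 : lowstr (1 + q' * e') S (fun p => F (p3 p)).
  pose a3 (p : V * (V * V)) := (a p.1, (a p.2.1, a p.2.2)).
  have la3 : linm a3 by apply: linm_pair; [|apply: linm_pair]; apply: (linm_comp _ la); lm.
  apply: lowstr_ext (lowstr_linm la3 hl) _ => p; rewrite /F; apply: eq_bigr => i _.
  by rewrite (F3_linm Kinf) //; apply: vsval_linm.
apply: lowstr_ext (lowstr_add l1 (lowstr_leq cT (lowstr_shift v3 d1 hF lp3 ll3))) _ => p.
by rewrite addrC subrK -e3.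
Qed.

Lemma nideal_relation (J J' : {set I}) i : J' \subset J -> i \in J -> i \notin J' -> ideal J' f (f i) ->
  exists c : I -> K, [/\ c i != 0, forall j, c j != 0 -> j \in J /\ (q j * e j = q i * e i)%N &
    lowstr (1 + q i * e i) #|I| (fun x => \sum_(j in J) c j * f j x)].
Proof.
move=> JJ iJ iJ' /(ideal_lowstr Kinf (e := fun i => (1 + q i * e i)%N) _ (fun i => nf_hom (hf i))) [//|c [hc hl]].
have ci : c i = 0 by apply/eqP; apply: contraNT iJ' => /hc [].
have c'J j : (j == i)%:R - c j != 0 -> j \in J /\ (q j * e j = q i * e i)%N.
  have [-> // | ji] := eqVneq j i.
  rewrite sub0r oppr_eq0 => /hc [/(subsetP JJ) -> E]; split=> //; lia.
exists (fun j => (j == i)%:R - c j); split=> //; first by rewrite eqxx ci subr0 oner_eq0.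
apply: (lowstr_ext hl) => x; rewrite (bigD1 i) //= ci mul0r add0r [RHS](bigD1 i) //=.
rewrite eqxx ci subr0 mul1r -sumrN; congr (_ + _); rewrite [RHS]big_mkcond [LHS]big_mkcond; apply: eq_bigr => j _.
case: (eqVneq j i) => [->|ji] /=; first by rewrite andbF.
rewrite andbT; have := c'J j; rewrite (negPf ji) !sub0r oppr_eq0; have [-> _|cj /(_ isT) [-> _]] := eqVneq (c j) 0.
  by rewrite oppr0 !mul0r oppr0 if_same.
by rewrite mulNr.
Qed.

(* The polarization [F3 q'], with [q'] the smallest exponent occurring, kills the members of larger exponent. *)
Lemma relation_class (J : {set I}) d m N i (c' : I -> K) : (forall j, c' j != 0 -> (q j <= d)%N) -> c' i != 0 ->
  (forall j, c' j != 0 -> j \in J /\ (q j * e j = m)%N) -> lowstr (1 + m) N (fun x => \sum_(j in J) c' j * f j x) ->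
  exists q' e' (c : I -> K), [/\ (q' * e')%N = m, forall j, j \in J -> c j != 0 -> q j = q' /\ e j = e',
    exists2 j, j \in J & c j != 0 & lowstr (1 + q' * e') (N * (2 * d.+1)) (fun p => \sum_(j in J) c j * F3 q' (f j) p)].
Proof.
move=> qd c'i c'J hl.
pose j0 := [arg min_(j < i | c' j != 0) q j].
have [c'j0 minj] : c' j0 != 0 /\ forall j, c' j != 0 -> (q j0 <= q j)%N.
  by rewrite /j0; case: arg_minnP.
have [j0J dj0] := c'J j0 c'j0.
pose c2 j := if q j == q j0 then c' j else 0.
exists (q j0), (e j0), c2; split=> //.
- move=> j jJ; rewrite /c2; case: (q j =P q j0) => [E|]; last by rewrite eqxx.
  move=> /c'J [_]; rewrite -dj0 E => /eqP; rewrite eqn_pmul2l ?(proj1 (hq j0)) // => /eqP ->.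
  by split.
- by exists j0; rewrite // /c2 eqxx.
have {}hl := F3_lowstr Kinf (q j0) hl.
rewrite dj0; apply: lowstr_ext (lowstr_leq _ hl) _.
  by rewrite leq_mul2l; apply/orP; right; rewrite leq_mul2l /= ltnS qd.
move=> p; rewrite (F3_sum Kinf) => [|j _]; last exact: pol_scale.
apply: eq_bigr => j _; rewrite (F3_scale Kinf) // /c2.
have [c0|c0] := eqVneq (c' j) 0; first by rewrite c0 if_same !mul0r.
case: (q j =P q j0) => // qj; rewrite mul0r.
rewrite (F3_nf Kinf p (hq j) (hf j)) ?mulr0 //.
by rewrite (proj1 (hq j0)) /= ltn_neqAle minj // andbT; apply/eqP => E; apply: qj.
Qed.

Lemma hs_nideal (J J' : {set I}) S d i : (forall i, (q i <= d)%N) -> (#|I| * (2 * d.+1) <= S)%N ->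
  hs J q e f S -> J' \subset J -> i \in J -> i \notin J' -> ~ ideal J' f (f i).
Proof.
move=> qd hS h JJ iJ iJ' /(nideal_relation JJ iJ iJ') [c' [c'i c'J hl]].
have [q' [e' [c [_ hc hx hl']]]] := relation_class (fun j _ => qd j) c'i c'J hl.
by apply: (h q' e' c hc hx); apply: lowstr_leq hS hl'.
Qed.

End HS.
End Restriction.

(** * Primality of strong tuples of normal forms *)

Section Slices.
Variable K : fieldType.
Hypothesis Kinf : infinite_field K.

(** Strength is asked of the leading forms [A] only. Lower terms in [P] must be allowed, since
    slices produce them. *)
Definition strong_nice d := forall m, exists C, forall (V : vectType K) (I : finType) (J : {set I}) (e : I -> nat)
  (A P : I -> V -> K), (#|I| <= m)%N -> (forall i, (1 <= e i <= d)%N) -> (forall i, hom (e i) (A i)) ->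
  (forall i, pol (P i)) -> (forall i x, i \in J -> comp (e i) (P i) x = A i x) ->
  (forall i l x, i \in J -> (e i < l)%N -> comp l (P i) x = 0) -> strong C J e A -> Nice J P.

Lemma comb_linm (V W : lmodType K) n (x : 'I_n -> V) (l : V -> W) s : linm l ->
  comb (fun i => l (x i)) s = l (comb x s).
Proof. by move=> hl; rewrite /comb (linm_sum _ _ _ hl); apply: eq_bigr => i _; rewrite (linmZ _ _ hl). Qed.

Lemma comb_delta R t (s : 'rV[K]_R) : comb (fun i => delta_mx 0 (lshift t i)) s = row_mx s 0 :> 'rV[K]_(R + t).
Proof.
rewrite [RHS]row_sum_delta big_split_ord /= [X in _ + X]big1 ?addr0 => [|i _]; last by rewrite row_mxEr mxE scale0r.
by apply: eq_bigr => i _; rewrite row_mxEl.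
Qed.

Section Slice.
Variables (d m M M2 R t B C : nat).
Hypothesis hT : forall (V : vectType K) (I : finType) (J : {set I}) (e : I -> nat)
  (A P : I -> V -> K), (#|I| <= m)%N -> (forall i, (1 <= e i <= d)%N) -> (forall i, hom (e i) (A i)) ->
  (forall i, pol (P i)) -> (forall i x, i \in J -> comp (e i) (P i) x = A i x) ->
  (forall i l x, i \in J -> (e i < l)%N -> comp l (P i) x = 0) -> strong C J e A -> Nice J P.
Hypothesis mC : (m <= C)%N.
Hypothesis ht : zeroableL K d (2 * C) 1 t.
Hypothesis hB : forall (X : lmodType K) (G : 'rV[K]_t * X -> K) n, (n <= d)%N -> pol G ->
  (forall t s x, G (t *: s, x) = t ^+ n * G (s, x)) ->
  exists (a : 'I_B -> 'rV[K]_t -> K) (z : 'I_B -> 'rV[K]_t),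
    forall s x, G (s, x) = \sum_b a b s * G (z b, x).
Hypothesis hR : forall (V Y : lmodType K) (N1 : vectType K) (C : finType) (q : C -> nat)
    (g : C -> V -> Y -> K) (i1 : N1 -> Y) (c : Y) (phi : N1 -> K) (x : 'I_R -> V),
  (#|C| <= m * B)%N -> (forall k, (1 <= q k <= d)%N) -> (forall k y, lin (fun v => g k v y)) ->
  (forall k v, pol (g k v)) -> (forall k v, qadd (q k) (g k v)) -> linm i1 -> pol phi -> (exists n, phi n != 0) ->
  exists n, phi n != 0 /\ forall p : C -> K, (forall i, \sum_k p k * g k (x i) (c + i1 n) = 0) ->
    forall q0, exists s : 'rV[K]_R, s != 0 /\ forall y, \sum_(k | q k == q0) p k * g k (comb x s) (i1 y) = 0.
Hypothesis hM2 : zeroableL K d m (R + t) M2.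

Variables (V O : vectType K) (I : finType) (J : {set I}) (q e : I -> nat) (f : I -> V * O -> K).
Hypothesis hI : (#|I| <= m)%N.
Hypothesis hq : forall i, frob K (q i).
Hypothesis he : forall i, (0 < e i)%N.
Hypothesis hd : forall i, (q i * e i <= d)%N.
Hypothesis hf : forall i, nf (q i) (e i) (f i).
Variables (w : 'I_M -> V) (z : 'I_M2 -> 'rV[K]_M).
Hypothesis hw : forall q' e' (c : I -> K), (forall i, i \in J -> c i != 0 -> q i = q' /\ e i = e') ->
    (exists2 i, i \in J & c i != 0) -> forall s t, free2 s t ->
    exists y, (forall i t', i \in J -> (1 < q i)%N -> D (fun v => f i (v, 0)) (comb w t') y = 0) /\
      \sum_(i in J) c i * F3 q' (fun v => f i (v, 0)) (comb w s, (y, comb w t)) != 0.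
Hypothesis zi : indep z.
Hypothesis zf : forall i s, f i (comb w (comb z s), 0) = 0.
Variable N2 : {vspace V}.
Hypothesis hN2 : forall n, n \in N2 -> forall i s, i \in J ->
  (tp (f i) (comb w (comb z s), 0) (n, 0))`_(q i) = 0 /\ D (f i) (comb w (comb z s), 0) (n, 0) = 0.

Let pf i : pol (f i) := hom_pol (nf_hom (hf i)).
Let emb (v : V) : V * O := (v, 0).
Let lemb : linm emb. Proof. by apply: linm_pair; [exact: linm_id | exact: linm_zero]. Qed.
Let pfV i : pol (fun v => f i (v, 0)). Proof. exact: (pol_linm lemb (pf i)). Qed.

Let wU s := comb w (comb z s).
Let lwU : linm wU. Proof. exact: (linm_comp (linm_comb z) (linm_comb w)). Qed.

(** The directions [z3] kill the derivatives along [(y1, o)], and [y0] is found by moving [y1] in a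
    space that keeps this. If a combination of leading forms had low strength, its factors would
    have a common zero [tau] among the last [t] directions; its differential vanishes there.
    [rank_chain] converts this into one nonzero combination of the first [R] directions along which
    the polarization vanishes for all admissible [y], against the genericity of [w]. *)
Lemma slice_point (o : O) (phi : V -> K) y1 : pol phi -> phi y1 != 0 ->
  exists y0 (z3 : 'I_(R + t) -> 'rV[K]_M2), [/\ phi y0 != 0,
    forall i s, i \in J -> (1 < q i)%N -> D (f i) (wU (comb z3 s), 0) (y0, o) = 0 &
    strong C J (fun i => (1 + q i * e i - q i)%N) (fun i s => (tp (f i) (wU (comb z3 s), 0) (y0, o))`_(q i))].
Proof.
move=> pphi phi1; pose c : V * O := (y1, o).
have [||z3 [z3i z3B]] := hM2 (V := 'rV[K]_M2) _
    (f := fun i s => if (1 < q i)%N then D (f i) (emb (wU s)) c else 0) hI.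
- by rewrite dim_rV.
- move=> i; exists (q i * e i)%N; split; first by rewrite muln_gt0 (proj1 (hq i)) he hd.
  case: (1 < q i)%N; last exact: hom_zero.
  exact: (hom_linm (linm_comp lwU lemb) (hom_D Kinf c (nf_hom (hf i)))).
pose x (i : 'I_R) := wU (comb z3 (delta_mx 0 (lshift t i))).
pose wT (tau : 'rV[K]_t) := wU (comb z3 (row_mx 0 tau)).
have lrow2 : linm (fun tau : 'rV[K]_t => row_mx 0 tau : 'rV[K]_(R + t)).
  by move=> a u v; rewrite scale_row_mx scaler0 add_row_mx addr0.
have lrow1 : linm (fun tau : 'rV[K]_R => row_mx tau 0 : 'rV[K]_(R + t)).
  by move=> a u v; rewrite scale_row_mx scaler0 add_row_mx addr0.
have lz3 : linm (fun s => wU (comb z3 s)) by exact: (linm_comp (linm_comb z3) lwU).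
have lwT : linm wT by exact: (linm_comp lrow2 lz3).
have xE s : comb x s = wU (comb z3 (row_mx s 0)).
  by rewrite -(comb_delta t s) -(comb_linm _ s lz3).
have hexp i : exists ab : ('I_B -> 'rV[K]_t -> K) * ('I_B -> 'rV[K]_t), forall s v Y,
    F3 (q i) (f i) (emb v, (Y, emb (wT s))) = \sum_b ab.1 b s * F3 (q i) (f i) (emb v, (Y, emb (wT (ab.2 b)))).
  have [|||a [z' h]] := hB (X := (V * (V * O))%type)
      (G := fun r => F3 (q i) (f i) (emb r.2.1, (r.2.2, emb (wT r.1)))) (n := (1 + q i * e i - (q i).+1)%N).
  - by have := hd i; lia.
  - apply: (pol_linm _ (pol_F3 Kinf (q i) (pf i))).
    apply: linm_pair; first by apply: (linm_comp _ lemb); exact: (linm_comp (@linm_snd K _ _) (@linm_fst K _ _)).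
    apply: linm_pair; first exact: (linm_comp (@linm_snd K _ _) (@linm_snd K _ _)).
    by apply: (linm_comp _ lemb); exact: (linm_comp (@linm_fst K _ _) lwT).
  - move=> k s [v Y] /=; rewrite (linmZ _ _ lwT) (linmZ _ _ lemb); apply: (F3_scale_u Kinf) (nf_hom (hf _)) _.
    by have := he i; have := proj1 (hq i); nia.
  by exists (a, z') => s v Y; apply: (h s (v, Y)).
have [ab hab] := dchoice hexp.
pose g (k : I * 'I_B) v Y := F3 (q k.1) (f k.1) (emb v, (Y, emb (wT ((ab k.1).2 k.2)))).
have [||N1 hN1] := @prop_vspace K V (fun y => forall i t', i \in J -> (1 < q i)%N ->
    D (fun v => f i (v, 0)) (comb w t') y = 0).
- by move=> i t' _ _; apply: (lin0 (D_linr Kinf _ (pfV i))).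
- by move=> a y y' hy hy' i t' iJ qi; rewrite (D_linr Kinf _ (pfV i)) hy // hy' // mulr0 addr0.
pose i1 (n : subvs_of N1) := emb (vsval n).
have li1 : linm i1 by exact: (linm_comp (@vsval_linm K V N1) lemb).
have hC : (#|{: I * 'I_B}| <= m * B)%N by rewrite card_prod card_ord leq_mul2r hI orbT.
have hqd (k : I * 'I_B) : (1 <= q k.1 <= d)%N.
  by rewrite (proj1 (hq _)) /=; apply: leq_trans (hd k.1); rewrite leq_pmulr.
have glin k Y : lin (fun v => g k v Y) by exact: (lin_linm lemb (F3_lin Kinf (q k.1) Y _ (pf k.1))).
have gpol k v : pol (g k v).
  apply: (pol_comp (s := fun Y => (emb v, (Y, _))) _ (pol_F3 Kinf (q k.1) (pf k.1))).
  apply: polm_pair; first exact: polm_cst.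
  by apply: polm_pair; [apply: polm_linm; exact: linm_id | exact: polm_cst].
have gqadd k v : qadd (q k.1) (g k v).
  by apply: (F3_qadd Kinf) => // u; apply: (nf_qadd Kinf (hq k.1) (hf k.1)).
have pphi1 : pol (fun n : subvs_of N1 => phi (y1 + vsval n)).
  by apply: (pol_linm (@vsval_linm K V N1) (f := fun v => phi (y1 + v))); apply: pol_shift.
have phi1' : exists n : subvs_of N1, phi (y1 + vsval n) != 0 by exists 0; rewrite linear0 addr0.
have [n [phin hn]] := hR c x hC hqd glin gpol gqadd li1 pphi1 phi1'.
have cn : c + i1 n = (y1 + vsval n, o) by transitivity (y1 + vsval n, o + (0 : O)); [ | rewrite addr0].
exists (y1 + vsval n), z3; split=> // [i s iJ qi|].
  rewrite -cn (linD _ _ (D_linr Kinf _ (pf i))).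
  have := z3B i s; rewrite qi => ->; rewrite add0r.
  have /hN1 /(_ i (comb z (comb z3 s)) iJ qi) := subvsP n.
  by rewrite (D_linm Kinf (f := f i) _ _ lemb).
move=> D0 cc hcc [i0 i0J ci0] hl.
have [s [a [g1 [g2 [sC hg eg]]]]] := lowstr_factors hl.
have D0d : (D0 <= d)%N by rewrite -(hcc i0 i0J ci0); have := hd i0; have := proj1 (hq i0); lia.
(* At most [C] products have at most [2 * C] factors, all of positive degree at most [d]. *)
have [|||v0 [v0i v0F]] := ht (V := 'rV[K]_t) _ (I := ('I_s + 'I_s)%type)
   (f := fun k tau => match k with inl k => g1 k (row_mx 0 tau) | inr k => g2 k (row_mx 0 tau) end).
- by rewrite dim_rV.
- by rewrite card_sum !card_ord; lia.
- move=> [k|k]; have [ak h1 h2] := hg k.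
    by exists (a k); split; [lia | exact: (hom_linm lrow2 h1)].
  by exists (D0 - a k)%N; split; [lia | exact: (hom_linm lrow2 h2)].
pose tau := v0 ord0.
have tauE : comb v0 (const_mx 1) = tau by rewrite /comb big_ord1 mxE scale1r.
have tau0 : tau != 0.
  apply/eqP => E; have := v0i (const_mx 1); rewrite tauE => /(_ E) /rowP /(_ ord0).
  by rewrite !mxE => /eqP; rewrite oner_eq0.
pose u0 : 'rV[K]_(R + t) := row_mx 0 tau.
pose Y0 : V * O := (y1 + vsval n, o).
have gu k : g1 k u0 = 0 by rewrite /u0 -tauE; apply: (v0F (inl k)).
have gu' k : g2 k u0 = 0 by rewrite /u0 -tauE; apply: (v0F (inr k)).
pose At i s := (tp (f i) (wU (comb z3 s), 0) Y0)`_(q i).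
have lez : linm (fun s => emb (wU (comb z3 s))) by exact: (linm_comp lz3 lemb).
have pA i : pol (At i) by apply: (pol_tcm Kinf (q i) (pf i) (polm_linm lez) (polm_cst _ Y0)).
have pt1 i : pol (fun u => (tp (f i) u Y0)`_(q i)).
  exact: (pol_tcm Kinf (q i) (pf i) (polm_linm (@linm_id K _)) (polm_cst _ Y0)).
(* The differential of [sum g1 * g2] vanishes at a common zero of all factors; that of the leading
   forms is their polarization in the directions [sg] and [tau]. *)
have DA sg : \sum_(i in J) cc i * F3 (q i) (f i) (emb (wU (comb z3 sg)), (Y0, emb (wT tau))) = 0.
  transitivity (D (fun s => \sum_(i in J) cc i * At i s) u0 sg).
    rewrite (D_sum Kinf) => [|i _]; last exact: pol_scale.
    apply: eq_bigr => i _; rewrite (D_scale Kinf) //; congr (_ * _).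
    by rewrite /At (D_linm Kinf (f := fun u => (tp (f i) u Y0)`_(q i)) u0 sg lez).
  have -> : (fun s => \sum_(i in J) cc i * At i s) = fun s => \sum_k g1 k s * g2 k s.
    by apply: functional_extensionality => r; rewrite -eg.
  rewrite (D_sum Kinf) => [|k _]; last by have [_ h1 h2] := hg k; apply: pol_mul (hom_pol h1) (hom_pol h2).
  rewrite big1 // => k _; have [_ h1 h2] := hg k.
  by rewrite (D_mul Kinf _ _ (hom_pol h1) (hom_pol h2)) gu gu' mul0r mulr0 addr0.
pose c1 j := if j \in J then cc j else 0.
pose p (k : I * 'I_B) := c1 k.1 * (ab k.1).1 k.2 tau.
have pS (Q : pred I) v Y : \sum_(k | Q k.1) p k * g k v Y =
    \sum_(i in J | Q i) cc i * F3 (q i) (f i) (emb v, (Y, emb (wT tau))).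
  transitivity (\sum_(i | Q i) \sum_b p (i, b) * g (i, b) v Y).
    by rewrite pair_big /=; apply: eq_big => [k|[i b] _] //=; rewrite andbT.
  rewrite [RHS]big_mkcondl; apply: eq_bigr => i _; rewrite (hab i) /p /g /c1 /=.
  under eq_bigr do rewrite -mulrA.
  by rewrite -mulr_sumr; case: ifP => _ //; rewrite mul0r.
have [|s0 [s00 hs0]] := hn p _ (q i0).
  move=> i; rewrite cn [LHS](pS xpredT (x i) Y0) -[RHS](DA (delta_mx 0 (lshift t i))); apply: eq_bigl => i'; exact: andbT.
(* Only members with exponent [q i0] are kept. Their leading forms have equal degree [1 + q e - q],
   so they also share [e] and form a single type. *)
pose c2 i := if q i == q i0 then cc i else 0.
pose S1 := comb z (comb z3 (row_mx s0 0)); pose T1 := comb z (comb z3 (row_mx 0 tau)).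
have [|||y [hy1 hy2]] := @hw (q i0) (e i0) c2 _ _ S1 T1.
- move=> i iJ; rewrite /c2; case: (q i =P q i0) => [E|]; last by rewrite eqxx.
  move=> ci; split=> //; have := hcc i iJ ci; rewrite -(hcc i0 i0J ci0) E => E'.
  have q00 := proj1 (hq i0).
  have h1 : (q i0 * e i = q i0 * e i0)%N.
    have := leq_pmulr (q i0) (he i); have := leq_pmulr (q i0) (he i0); move: E'.
    by move: (q i0 * e i)%N (q i0 * e i0)%N (q i0) => ? ? ?; lia.
  by move/eqP: h1; rewrite eqn_pmul2l // => /eqP.
- by exists i0; rewrite // /c2 eqxx.
- move=> al be; rewrite /S1 /T1 -!(linmZ _ _ (linm_comb _)) -!(linmD _ _ (linm_comb _)) => /zi /z3i.
  rewrite !scale_row_mx !scaler0 add_row_mx add0r addr0 => /eqP; rewrite row_mx_eq0 !scaler_eq0.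
  by rewrite (negPf s00) (negPf tau0) !orbF => /andP[/eqP -> /eqP ->].
have yN : y \in N1 by apply/hN1.
move/eqP: hy2; apply; have := hs0 (vsproj N1 y); rewrite (pS (fun i => q i == q i0)) => h0.
rewrite -[RHS]h0 big_mkcondr; apply: eq_bigr => i _; rewrite /c2 (F3_linm Kinf (f := f i) _ _ lemb) //=.
case: (q i =P q i0) => [->|_]; last by rewrite mul0r.
by rewrite xE /i1 vsprojK.
Qed.

(* On [y0 + N2 + U], where [U] is the image of [wU (comb z3 _)], all the other terms of the expansion along [U]
vanish or have lower degree: the leading form of [f i] is the coefficient [At i] of [t^q] in [f i (u + t y0)], of
degree [1 + q e - q] in [u], and does not depend on the component in [N2]. *)
Lemma slice_nice (o : O) (k : I -> K) (g h : V -> K) (phi : V -> K) y1 : pol g -> pol h ->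
  (forall v, (forall i, i \in J -> f i (v, o) - k i = 0) -> g v * h v = 0) -> pol phi -> phi y1 != 0 ->
  exists y0, [/\ phi y0 != 0,
    ideal J (fun i (n : subvs_of N2) => f i (y0 + vsval n, o) - k i) (fun n => g (y0 + vsval n)) \/
    ideal J (fun i (n : subvs_of N2) => f i (y0 + vsval n, o) - k i) (fun n => h (y0 + vsval n)) &
    exists x0, smooth J (fun i v => f i (v, o) - k i) x0].
Proof.
move=> pg ph ghz pphi phi1.
have [y0 [z3 [phi0 B0 sA]]] := slice_point o pphi phi1.
exists y0.
pose et i := (1 + q i * e i - q i)%N.
pose At i s := (tp (f i) (wU (comb z3 s), 0) (y0, o))`_(q i).
have lz3 : linm (fun s => wU (comb z3 s)) by exact: (linm_comp (linm_comb z3) lwU).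
have lez : linm (fun s => emb (wU (comb z3 s))) by exact: (linm_comp lz3 lemb).
have qe i : (q i <= q i * e i)%N by rewrite leq_pmulr.
have hA i : hom (et i) (At i).
  have qi : (q i <= 1 + q i * e i)%N by apply: leq_trans (qe i) _; rewrite leq_addl.
  exact: (hom_linm lez (tc_hom_base Kinf (y0, o) (nf_hom (hf i)) qi)).
have het i : (1 <= et i <= d)%N.
  rewrite /et; have := hd i; have := qe i; have := proj1 (hq i).
  by move: (q i * e i)%N (q i) => ? ?; lia.
pose P i (r : subvs_of N2 * 'rV[K]_(R + t)) := f i (y0 + vsval r.1 + wU (comb z3 r.2), o) - k i.
have lr : linm (fun r : subvs_of N2 * 'rV[K]_(R + t) => vsval r.1 + wU (comb z3 r.2)).
  apply: linm_add; first by exact: (linm_comp (@linm_fst K _ _) (@vsval_linm K V N2)).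
  exact: (linm_comp (@linm_snd K _ _) lz3).
have pmr : polm (fun r : subvs_of N2 * 'rV[K]_(R + t) => y0 + vsval r.1 + wU (comb z3 r.2)).
  move=> l hl; apply: (pol_ext (f := fun r => l y0 + l (vsval r.1 + wU (comb z3 r.2)))) => [|r].
    by apply: pol_add; [exact: pol_cst | apply: (pol_linm lr); apply: pol_lin].
  by rewrite -(linD _ _ hl) addrA.
have pP i : pol (P i).
  apply: pol_sub; last exact: pol_cst.
  apply: (pol_comp (s := fun r => (_, o)) _ (pf i)); apply: polm_pair => //; exact: polm_cst.
have cP i l n s : (0 < l)%N -> comp l (fun s => P i (n, s)) s =
    if (l <= 1 + q i * e i)%N then (tp (f i) (emb (wU (comb z3 s))) (y0 + vsval n, o))`_(1 + q i * e i - l) else 0.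
  move=> l0; have pfs : pol (fun s => f i (y0 + vsval n + wU (comb z3 s), o)).
    apply: (pol_comp (s := fun s => (_, o)) _ (pf i)); apply: polm_pair; last exact: polm_cst.
    by apply: polm_add; [exact: polm_cst | exact: polm_linm].
  rewrite /P (comp_sub Kinf) //; last exact: pol_cst.
  rewrite (comp_neq Kinf s (hom_cst _ _)) ?subr0 -?lt0n //.
  rewrite -(comp_shift Kinf _ _ _ (nf_hom (hf i))).
  rewrite -(comp_linm Kinf l s lez (f := fun u => f i ((y0 + vsval n, o) + u))); last exact: pol_shift.
  congr comp; apply: functional_extensionality => s'; congr (f i _).
  by rewrite /emb; transitivity (y0 + vsval n + wU (comb z3 s'), o + (0 : O)); [rewrite addr0 | ].
have addn n : (y0 + vsval n, o) = (y0, o) + emb (vsval n) :> V * O.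
  by transitivity (y0 + vsval n, o + (0 : O)); [rewrite addr0 | ].
(* Degrees above [et i] correspond to powers of [t] below [q i]. The constant term vanishes because
   [f i] is zero along [U], the linear term by the choice of [N2] and of [z3], and the powers in
   between by the shape of normal forms. *)
have hP i l n s : i \in J -> (et i < l)%N -> comp l (fun s => P i (n, s)) s = 0.
  move=> iJ el; rewrite cP; last exact: leq_ltn_trans el.
  case: leqP => // ld.
  have lq : (1 + q i * e i - l < q i)%N by move: el ld (qe i); rewrite /et; move: (q i * e i)%N (q i) => ? ?; lia.
  move: lq; case jE : (1 + q i * e i - l)%N => [|[|j]] lq.
  - by rewrite tp_coef0 //; apply: zf.
  - rewrite -[_`_1]/(D (f i) (emb (wU (comb z3 s))) (y0 + vsval n, o)) addn.
    rewrite (linD _ _ (D_linr Kinf _ (pf i))) B0 // add0r.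
    by have [] := hN2 (subvsP n) (comb z3 s) iJ.
  - by rewrite (nf_tc_small Kinf (hq i) (hf i)).
have PA i n s : i \in J -> comp (et i) (fun s => P i (n, s)) s = At i s.
  move=> iJ; have /andP[e1 ed] := het i; rewrite cP // leq_subr subKn; last exact: leq_trans (qe i) (leq_addl _ _).
  rewrite addn (qaddD _ _ (nf_qadd Kinf (hq i) (hf i) _)).
  by have [-> _] := hN2 (subvsP n) (comb z3 s) iJ; rewrite addr0.
have niceS n : Nice J (fun i s => P i (n, s)).
  apply: (hT hI het hA) sA => [i|i s|i l s]; [exact: pol_fix1 | exact: PA | exact: hP].
have regA : regular J At.
  apply: regular_of => [i|J' i JJ iJ iJ'|J' i JJ iJ iJ']; first exact: hom_pol (hA i).
    apply: (proj1 (hT (J := J') hI het hA (fun i => hom_pol (hA i)) _ _ _)).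
    - by move=> j x jJ; rewrite (comp_id Kinf x (hA j)).
    - by move=> j l x jJ el; rewrite (comp_neq Kinf x (hA j)) // neq_ltn el orbT.
    - exact: strong_sub sA.
  apply: (strong_nideal Kinf (J0 := J) _ hA) => // [j|]; first by have /andP[] := het j.
  by apply: strong_sub sA => //; apply: leq_trans mC.
split=> //.
- pose G (u : V -> K) (r : subvs_of N2 * 'rV[K]_(R + t)) := u (y0 + vsval r.1 + wU (comb z3 r.2)).
  have pG u : pol u -> pol (G u) by move=> pu; apply: (pol_comp pmr pu).
  (* All translates of [U] by [n] in [N2] share the leading forms [At], so membership spreads over
     [N2]; putting the coordinate along [U] equal to 0 gives the statement on [y0 + N2]. *)
  have fin u : pol u -> dense (fun n => ideal J (fun i s => P i (n, s)) (fun s => G u (n, s))) ->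
      ideal J (fun i (n : subvs_of N2) => f i (y0 + vsval n, o) - k i) (fun n => u (y0 + vsval n)).
    move=> pu dn.
    have := family_ideal Kinf hA pP hP (fun i n s => PA i n s) regA dn (pG u pu) (fun n hn => hn).
    move=> /(@ideal_linm K _ _ _ _ _ _ (fun n => (n, 0)) (@polm_fix2 K _ _ 0)).
    have e0 n : y0 + vsval n + wU (comb z3 0) = y0 + vsval n :> V.
      by rewrite (linm0 lz3) addr0.
    by congr ideal; do ?[apply: functional_extensionality => ?]; rewrite /P /G /= e0.
  have [||dg|dh] := @dense_or K Kinf _ (fun _ => True)
      (fun n => ideal J (fun i s => P i (n, s)) (fun s => G g (n, s)))
      (fun n => ideal J (fun i s => P i (n, s)) (fun s => G h (n, s))).
  + by move=> u _ [n un]; exists n.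
  + move=> n _; have [pr _] := niceS n; apply: pr; do ?[exact: (pol_fix1 n (pG _ _))].
    by move=> s hs; apply: ghz.
  + by left; apply: fin.
  + by right; apply: fin.
have [_ [s0 [s0z s0i]]] := niceS 0.
have P0 i s : P i (0, s) = f i (y0 + wU (comb z3 s), o) - k i.
  by rewrite /P [vsval _](linm0 (@vsval_linm K V N2)) addr0.
exists (y0 + wU (comb z3 s0)); split.
  by move=> i iJ; have := s0z i iJ; rewrite P0.
move=> c hc i iJ; apply: s0i iJ => s.
rewrite -[RHS](hc (wU (comb z3 s))); apply: eq_bigr => j _; congr (_ * _).
rewrite -(D_sub_affine Kinf y0 s0 s lz3 (H := fun v => f j (v, o) - k j)); last first.
  by apply: pol_sub; [exact: pol_fix2 | exact: pol_cst].
by congr (D _ _ _); apply: functional_extensionality => r; rewrite P0.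
Qed.

End Slice.
End Slices.

(** * Primality for normal forms of degree at least two *)

Section NiceCore.
Variable K : fieldType.
Hypothesis Kinf : infinite_field K.
Hypothesis Kbr : brauer_field K.

Lemma Nice_ext (V : lmodType K) (I : finType) (J : {set I}) (P Q : I -> V -> K) :
  (forall i, i \in J -> P i =1 Q i) -> Nice J P -> Nice J Q.
Proof.
move=> PQ [pP [x [x0 xi]]]; split.
  move=> g h pg ph gh.
  have tr u : ideal J P u -> ideal J Q u.
    move=> [r [pr er]]; exists r; split=> // y; rewrite er; apply: eq_bigr => i iJ; by rewrite PQ.
  have [|/tr|/tr] := pP g h pg ph; [|by left|by right].
  by move=> y hy; apply: gh => i iJ; rewrite -PQ // hy.
exists x; split=> [i iJ|c hc]; first by rewrite -PQ // x0.
apply: xi => v; rewrite -[RHS](hc v); apply: eq_bigr => i iJ; congr (_ * D _ _ _).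
by apply: functional_extensionality => y; apply: PQ.
Qed.

(** The factor [O] allows translations [o] in directions where no strength is assumed. The induction
    on the size of [J] serves to show that the restrictions to [N2], which are the leading forms
    there, are a regular sequence. *)
Theorem nice_nf_core d : strong_nice K d -> forall m n, exists S, forall (V O : vectType K) (I : finType) (J : {set I})
    (q e : I -> nat) (f : I -> V * O -> K), (#|I| <= m)%N -> (#|J| <= n)%N -> (forall i, frob K (q i)) ->
  (forall i, (0 < e i)%N) -> (forall i, (q i * e i <= d)%N) -> (forall i, nf (q i) (e i) (f i)) ->
  hs J q e (fun i v => f i (v, 0)) S -> forall o k, Nice J (fun i v => f i (v, o) - k i).
Proof.
move=> hT m; elim=> [|n [S0 IH]].
  exists 0%N => V O I J q e f _; rewrite leqn0 cards_eq0 => /eqP -> _ _ _ _ _ o k; exact: (Nice_empty Kinf).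
(* The constants are chosen backwards: [C] is the strength needed on slices, [t] makes the [2 * C]
   factors vanish, [B] interpolates along [t] directions, [R] feeds [rank_chain], [M2] leaves
   [R + t] directions with vanishing derivatives, [M] leaves [M2] directions of common zeros, and
   [k2] bounds the codimension of [N2]. *)
have [C0 hC0] := hT m; pose C := maxn C0 m.
have [t ht] := zeroableL_exists Kinf Kbr d (2 * C) 1.
have [B hB] := expand_points_pad Kinf d t.
have [R hR] := rank_chain Kinf Kbr d (m * B).
have [M2 hM2] := zeroableL_exists Kinf Kbr d m (R + t).
have [M hM] := zeroableL_exists Kinf Kbr d.+1 m M2.
have [Sg hSg] := generic_span Kinf d m M.
have [B2 hB2] := expand_points_pad Kinf d M2.
have [k2 hk2] := codim_lt Kinf Kbr d (m * B2 + m * B2).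
(* [S0] serves the smaller families and [m * (2 * d.+1)] excludes ideal relations, both on [N2];
   restriction to [N2] costs [3 * k2]. *)
pose S1 := maxn S0 (m * (2 * d.+1)).
exists (maxn Sg (S1 + 3 * k2)) => V O I J q e f hI hJ hq he hd hf hs0 o k.
pose emb (v : V) : V * O := (v, 0).
have lemb : linm emb by apply: linm_pair; [exact: linm_id | exact: linm_zero].
have pf i : pol (f i) := hom_pol (nf_hom (hf i)).
have hfV i : nf (q i) (e i) (fun v => f i (emb v)) by apply: nf_linm.
have q0 i : (0 < q i)%N := proj1 (hq i).
have qe i : (q i <= q i * e i)%N by rewrite leq_pmulr.
have qd i : (q i <= d)%N by apply: leq_trans (qe i) (hd i).
have [w hw] := hSg V I J q e (fun i v => f i (emb v)) hI hq he hd hfV (hs_sub (subxx J) (leq_maxl _ _) hs0).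
have [||z [zi zf]] := hM 'rV[K]_M _ I (fun i s => f i (emb (comb w s))) hI.
- by rewrite dim_rV.
- move=> i; exists (1 + q i * e i)%N; split; first by rewrite /= ltnS hd.
  exact: (hom_linm (linm_comb w) (nf_hom (hfV i))).
pose wU s := comb w (comb z s).
have lwU : linm wU by exact: (linm_comp (linm_comb z) (linm_comb w)).
have lew : linm (fun s => emb (wU s)) by exact: (linm_comp lwU lemb).
have lz : linm (fun p : 'rV[K]_M2 * (V * O) => emb (wU p.1)) by exact: (linm_comp (@linm_fst K _ _) lew).
have h1 i : exists az : ('I_B2 -> 'rV[K]_M2 -> K) * ('I_B2 -> 'rV[K]_M2), forall s Y,
    (tp (f i) (emb (wU s)) Y)`_(q i) = \sum_b az.1 b s * (tp (f i) (emb (wU (az.2 b))) Y)`_(q i).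
  have [|||a [z' h]] := hB2 (V * O)%type (fun p => (tp (f i) (emb (wU p.1)) p.2)`_(q i)) (1 + q i * e i - q i)%N.
  - by have := hd i; have := q0 i; move: (q i * e i)%N (q i) => ? ?; lia.
  - by apply: (pol_tcm Kinf) => //; apply: polm_linm => //; exact: linm_snd.
  - move=> u s Y /=; rewrite (linmZ _ _ lwU) (linmZ _ _ lemb).
    have qi : (q i <= 1 + q i * e i)%N by apply: leq_trans (qe i) (leq_addl _ _).
    exact: homE (tc_hom_base Kinf Y (nf_hom (hf i)) qi).
  by exists (a, z') => s Y; apply: (h s Y).
have h2 i : exists az : ('I_B2 -> 'rV[K]_M2 -> K) * ('I_B2 -> 'rV[K]_M2), forall s Y,
    D (f i) (emb (wU s)) Y = \sum_b az.1 b s * D (f i) (emb (wU (az.2 b))) Y.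
  have [|||a [z' h]] := hB2 (V * O)%type (fun p => D (f i) (emb (wU p.1)) p.2) (q i * e i)%N.
  - exact: hd.
  - by apply: (pol_Dm Kinf) => //; apply: polm_linm => //; exact: linm_snd.
  - by move=> u s Y /=; rewrite (linmZ _ _ lwU) (linmZ _ _ lemb) (homE _ _ (hom_D Kinf Y (nf_hom (hf i)))).
  by exists (a, z') => s Y; apply: (h s Y).
have [az haz] := dchoice h1; have [az' haz'] := dchoice h2.
(* By interpolation in [s], the conditions defining [N2] are imposed at [B2] points only, which
   bounds its codimension. *)
have [||N2 [hN2 cN2]] := hk2 V (I * 'I_B2 + I * 'I_B2)%type (fun x => match x with inl p => q p.1 | inr p => 1%N end)
    (fun x n => match x with inl p => (tp (f p.1) (emb (wU ((az p.1).2 p.2))) (emb n))`_(q p.1)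
                | inr p => D (f p.1) (emb (wU ((az' p.1).2 p.2))) (emb n) end).
- by rewrite card_sum !card_prod card_ord leq_add // leq_mul2r hI orbT.
- move=> [[i b]|[i b]] /=.
    split; first by rewrite q0 qd.
    split; last exact: (qadd_linm lemb (nf_qadd Kinf (hq i) (hf i) _)).
    by apply: (pol_tcm Kinf _ (pf i)); [exact: polm_cst | exact: polm_linm].
  split; first by apply: leq_trans (qd i); rewrite q0.
  split; first by apply: (pol_Dm Kinf (pf i)); [exact: polm_cst | exact: polm_linm].
  by move=> a x y; rewrite expr1 lemb; apply: (D_linr Kinf).
have hN2' n0 : n0 \in N2 -> forall i s, i \in J ->
    (tp (f i) (comb w (comb z s), 0) (n0, 0))`_(q i) = 0 /\ D (f i) (comb w (comb z s), 0) (n0, 0) = 0.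
  move=> /hN2 h i s _; split.
    by rewrite [LHS]haz big1 // => b _; have /= -> := h (inl (i, b)); rewrite mulr0.
  by rewrite [LHS]haz' big1 // => b _; have /= -> := h (inr (i, b)); rewrite mulr0.
have hTC (V' : vectType K) (I' : finType) (J' : {set I'}) (e' : I' -> nat) (A P : I' -> V' -> K) :
    (#|I'| <= m)%N -> (forall i, (1 <= e' i <= d)%N) -> (forall i, hom (e' i) (A i)) ->
    (forall i, pol (P i)) -> (forall i x, i \in J' -> comp (e' i) (P i) x = A i x) ->
    (forall i l x, i \in J' -> (e' i < l)%N -> comp l (P i) x = 0) -> strong C J' e' A -> Nice J' P.
  by move=> a1 a2 a3 a4 a5 a6 /(strong_sub (subxx J') (leq_maxl _ _)); apply: hC0.
have SL := fun g h phi y1 => @slice_nice K Kinf d m M M2 R t B C hTC (leq_maxr _ _) ht hB hR hM2 V O I J q e f hI hq he hd hf w z hw zi zf N2 hN2' o k g h phi y1.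
have smo : exists x0, smooth J (fun i v => f i (v, o) - k i) x0.
  have [|||||y0 [_ _ //]] := SL (fun _ => 0) (fun _ => 0) (fun _ => 1) 0; try exact: pol_cst.
    by move=> v _; rewrite mul0r.
  exact: oner_neq0.
split=> // g h pg ph ghz.
pose fN i (x : subvs_of N2) := f i (emb (vsval x)).
have hfN i : nf (q i) (e i) (fN i) by apply: (nf_linm (@vsval_linm K V N2) (hfV i)).
have hsN : hs J q e fN S1.
  by apply: (hs_restrict Kinf hq he hfV cN2); apply: hs_sub hs0 => //; apply: leq_maxr.
have regN : regular J fN.
  apply: regular_of => [i|J' i JJ iJ iJ'|J' i JJ iJ iJ']; first exact: hom_pol (nf_hom (hfN i)).
    have lv : linm (fun p : subvs_of N2 * O => (vsval p.1, p.2) : V * O).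
      by apply: linm_pair; [exact: (linm_comp (@linm_fst K _ _) (@vsval_linm K V N2)) | exact: linm_snd].
    have cJ' : (#|J'| <= n)%N.
      rewrite -ltnS; apply: leq_trans hJ; apply: proper_card; apply/properP; split=> //; by exists i.
    have [pr _] := IH (subvs_of N2) O I J' q e (fun i p => f i (vsval p.1, p.2)) hI cJ' hq he hd
       (fun i => nf_linm lv (hf i)) (hs_sub JJ (leq_maxl _ _) hsN) 0 (fun _ => 0).
    by move: pr; congr prime; do 2![apply: functional_extensionality => ?]; rewrite subr0.
  by apply: (hs_nideal Kinf hq hfN qd _ hsN JJ iJ iJ'); apply: leq_trans (leq_maxr _ _); rewrite leq_mul2r hI orbT.
have [a [b [la lb eab bK]]] := decomp N2.
pose P i (r : subvs_of (N2^C) * subvs_of N2) := f i (vsval r.1 + vsval r.2, o) - k i.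
have lr : linm (fun r : subvs_of (N2^C) * subvs_of N2 => vsval r.1 + vsval r.2 : V).
  apply: linm_add; first exact: (linm_comp (@linm_fst K _ _) (@vsval_linm K V _)).
  exact: (linm_comp (@linm_snd K _ _) (@vsval_linm K V _)).
have pP i : pol (P i).
  apply: pol_sub; last exact: pol_cst.
  by apply: (pol_comp (s := fun r => (_, o)) _ (pf i)); apply: polm_pair; [exact: polm_linm | exact: polm_cst].
have lev : linm (fun x : subvs_of N2 => emb (vsval x)) by exact: (linm_comp (@vsval_linm K V N2) lemb).
have cP i l th x : (0 < l)%N -> comp l (fun x => P i (th, x)) x =
    if (l <= 1 + q i * e i)%N then (tp (f i) (emb (vsval x)) (vsval th, o))`_(1 + q i * e i - l) else 0.
  move=> l0; rewrite /P (comp_sub Kinf); last exact: pol_cst; last first.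
    apply: (pol_comp (s := fun x => (_, o)) _ (pf i)); apply: polm_pair; last exact: polm_cst.
    by apply: polm_add; [exact: polm_cst | apply: polm_linm; exact: vsval_linm].
  rewrite (comp_neq Kinf x (hom_cst _ _)) ?subr0 -?lt0n //.
  rewrite -(comp_shift Kinf _ _ _ (nf_hom (hf i))).
  rewrite -(comp_linm Kinf l x lev (f := fun u => f i ((vsval th, o) + u))); last exact: pol_shift.
  congr comp; apply: functional_extensionality => x'; congr (f i _).
  by rewrite /emb; transitivity (vsval th + vsval x', o + (0 : O)); [rewrite addr0 | ].
pose G (u : V -> K) (r : subvs_of (N2^C) * subvs_of N2) := u (vsval r.1 + vsval r.2).
have fin u : pol u -> dense (fun th => ideal J (fun i x => P i (th, x)) (fun x => G u (th, x))) ->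
    ideal J (fun i v => f i (v, o) - k i) u.
  move=> pu dn.
  have pG : pol (G u) by exact: (pol_linm lr pu).
  have hP i l th x : i \in J -> (1 + q i * e i < l)%N -> comp l (fun x => P i (th, x)) x = 0.
    by move=> _ el; rewrite (cP i l th x (leq_ltn_trans (leq0n _) el)) leqNgt el.
  have PA i th x : i \in J -> comp (1 + q i * e i) (fun x => P i (th, x)) x = fN i x.
    by move=> _; rewrite (cP i _ th x (ltn0Sn _)) leqnn subnn (tp_coef0 _ _ (pf i)).
  have := family_ideal Kinf (fun i => nf_hom (hfN i)) pP hP PA regN dn pG (fun n hn => hn).
  have pba : polm (fun v => (b v, a v)) by apply: polm_linm; apply: linm_pair.
  move=> /(ideal_linm pba).
  have e0 v : vsval (b v) + vsval (a v) = v by rewrite addrC -eab.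
  by congr ideal; do ?[apply: functional_extensionality => ?]; rewrite /P /G /= e0.
have [||dg|dh] := @dense_or K Kinf _
    (fun th => ideal J (fun i x => P i (th, x)) (fun x => G g (th, x)) \/ ideal J (fun i x => P i (th, x)) (fun x => G h (th, x)))
    (fun th => ideal J (fun i x => P i (th, x)) (fun x => G g (th, x)))
    (fun th => ideal J (fun i x => P i (th, x)) (fun x => G h (th, x))) => //; last 2 first.
- by left; apply: fin.
- by right; apply: fin.
(* A translate of [N2] is good if [g] or [h] is in the ideal on it. To find one where [u] is
   nonzero, [u] is passed to [slice_nice] as the open condition [phi]. *)
move=> u pu [th1 uth1].
have [||y0 [uy0 gh0 _]] := SL g h (fun v => u (b v)) (vsval th1) pg ph ghz.
- exact: (pol_linm lb pu).
- by rewrite bK.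
exists (b y0); split=> //.
have pt : polm (fun x : subvs_of N2 => - a y0 + x).
  by apply: polm_add; [exact: polm_cst | apply: polm_linm; exact: linm_id].
have e1 x : y0 + vsval (- a y0 + x) = vsval (b y0) + vsval x :> V.
  by rewrite linearD linearN addrA {1}(eab y0) [_ + vsval (b y0)]addrC addrK.
case: gh0 => /(ideal_linm pt) gh0; [left | right]; move: gh0;
  by congr ideal; do ?[apply: functional_extensionality => ?]; rewrite /P /G /= e1.
Qed.

End NiceCore.

(** * Primality including linear members *)

Section NiceNormalForms.
Variable K : fieldType.
Hypothesis Kinf : infinite_field K.
Hypothesis Kbr : brauer_field K.

Lemma ideal_diff (X V : lmodType K) (I : finType) (J : {set I}) (P : I -> X -> K) (s s' : X -> V) g :
  polm s -> polm s' -> (forall l, lin l -> ideal J P (fun x => l (s x) - l (s' x))) -> pol g ->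
  ideal J P (fun x => g (s x) - g (s' x)).
Proof.
move=> ps ps' hl; elim=> [c|l ll|{}g h pg IHg ph IHh|{}g h pg IHg ph IHh].
- by apply: (ideal_ext (ideal0 J P)) => x; rewrite subrr.
- exact: hl.
- by apply: (ideal_ext (ideal_add IHg IHh)) => x; rewrite opprD addrACA.
apply: (ideal_ext (g := fun x => g (s x) * (h (s x) - h (s' x)) + h (s' x) * (g (s x) - g (s' x)))) => [|x]; last by ring.
by apply: ideal_add; apply: ideal_mul => //; apply: (pol_comp (s := _)).
Qed.

Lemma nf_lin (V : lmodType K) q (f : V -> K) : nf q 0 f -> lin f.
Proof.
move=> [n [l [a [hl ha ef]]]] c x y; rewrite !ef mulr_sumr -big_split; apply: eq_bigr => i _ /=.
by rewrite !(hom0_cst Kinf _ (ha i)) hl mulrDl mulrA.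
Qed.

Lemma lin_dual (V : vectType K) (I : finType) (L : {set I}) (f : I -> V -> K) : (forall i, i \in L -> lin (f i)) ->
  (forall c : I -> K, (forall x, \sum_(i in L) c i * f i x = 0) -> forall i, i \in L -> c i = 0) ->
  exists v : I -> V, forall i j, i \in L -> j \in L -> f i (v j) = (i == j)%:R.
Proof.
move=> hl hi.
have h j : exists v, j \in L -> forall i, i \in L -> f i v = (i == j)%:R.
  case jL: (j \in L); last by exists 0.
  suff [v [v0 vj]] : exists v, (forall i, i \in L -> i != j -> f i v = 0) /\ f j v != 0.
    exists ((f j v)^-1 *: v) => _ i iL; rewrite (linZ _ _ (hl i iL)).
    by have [->|ij] := eqVneq i j; [rewrite mulVf | rewrite (v0 i iL ij) mulr0].
  apply: NNPP => nex.
  pose b i x := if (i \in L) && (i != j) then f i x else 0.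
  have [|||n [mu [z e]]] := @qadd_span K V I b 1 (f j) (frob1 K).
  - move=> i; rewrite /b; case iL: (i \in L) => /=; last by move=> a x y; rewrite mulr0 addr0.
    by case: (i != j); [exact: hl | move=> a x y; rewrite mulr0 addr0].
  - by move=> a x y; rewrite expr1; apply: (hl j jL).
  - move=> y hy; apply/eqP; apply: NNPP => /negP fy; apply: nex; exists y; split=> // i iL ij.
    by have := hy i; rewrite /b iL ij.
  pose c i := (i == j)%:R - \sum_(k | (z k == i) && (i != j)) mu k.
  have := hi c _ j jL; rewrite /c eqxx big1 => [|k]; last by rewrite andbF.
  rewrite subr0 => /(_ _)/eqP; rewrite oner_eq0 => E; apply/notF/E => x.
  have -> : \sum_(i in L) ((i == j)%:R - \sum_(k | (z k == i) && (i != j)) mu k) * f i x =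
     f j x - \sum_k mu k * b (z k) x.
    under eq_bigr do rewrite mulrBl; rewrite sumrB; congr (_ - _).
      by rewrite (bigD1 j) //= eqxx mul1r big1 ?addr0 // => i /andP[_ /negPf ->]; rewrite mul0r.
    under eq_bigr do rewrite mulr_suml.
    rewrite (exchange_big_dep xpredT) //=; apply: eq_bigr => k _; rewrite /b.
    case: andP => [[zL zj]|nz]; last first.
      by rewrite big1 ?mulr0 // => i /andP[iL /andP[/eqP E1 ij]]; case: nz; rewrite E1.
    rewrite (big_pred1 (z k)) // => i /=; rewrite [RHS]eq_sym; have [<-|] := eqVneq (z k) i; last by rewrite andbF.
    by rewrite zL zj.
  by rewrite e; under [X in X - _]eq_bigr do rewrite expr1; rewrite subrr.
have [v hv] := dchoice h; exists v => i j iL jL; exact: hv.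
Qed.

(** Linear members have no useful polarization; for them strength is replaced by linear
    independence. *)
Definition hsN (V : lmodType K) (I : finType) (J : {set I}) (q e : I -> nat) (f : I -> V -> K) S : Prop :=
  (forall q' e' (c : I -> K), (0 < e')%N -> (forall i, i \in J -> c i != 0 -> q i = q' /\ e i = e') ->
    (exists2 i, i \in J & c i != 0) -> ~ lowstr (1 + q' * e') S (fun p => \sum_(i in J) c i * F3 q' (f i) p)) /\
  (forall c : I -> K, (forall i, i \in J -> c i != 0 -> e i = 0%N) -> (forall x, \sum_(i in J) c i * f i x = 0) ->
     forall i, i \in J -> c i = 0).

(** The linear members cut out a translate of a subspace [W] of bounded codimension. Restriction to
    [W] keeps the other members strong, and the translation is the vector [o] of [nice_nf_core]. *)
Theorem nice_nf d : strong_nice K d -> forall m, exists S, forall (V : vectType K) (I : finType) (J : {set I})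
    (q e : I -> nat) (f : I -> V -> K), (#|I| <= m)%N -> (forall i, frob K (q i)) ->
  (forall i, (q i * e i <= d)%N) -> (forall i, nf (q i) (e i) (f i)) ->
  hsN J q e f S -> forall k, Nice J (fun i v => f i v - k i).
Proof.
move=> hT m; have [S0 hS0] := nice_nf_core Kinf Kbr hT m m.
have [k2 hk2] := codim_lt Kinf Kbr 1 m.
exists (S0 + 3 * k2)%N => V I J q e f hI hq hd hf [hs1 hs2] k.
pose L := [set i in J | e i == 0%N]; pose J2 := J :\: L.
have LJ i : i \in L -> i \in J by rewrite inE => /andP[].
have eL i : i \in L -> e i = 0%N by rewrite inE => /andP[_ /eqP].
have flin i : e i = 0%N -> lin (f i) by move=> E; have := hf i; rewrite E; apply: nf_lin.
have pf i : pol (f i) := hom_pol (nf_hom (hf i)).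
have e2 i : i \in J2 -> (0 < e i)%N by rewrite !inE lt0n => /andP[]; case: (i \in J).
have indL (c : I -> K) : (forall x, \sum_(i in L) c i * f i x = 0) -> forall i, i \in L -> c i = 0.
  move=> hc i iL; have := hs2 (fun i => if i \in L then c i else 0).
  move=> /(_ _ _ i (LJ i iL)); rewrite iL; apply=> [j _|x].
    by case: ifP => [/eL //|]; rewrite eqxx.
  rewrite -[RHS](hc x) [LHS](bigID [in L]) /= [X in _ + X]big1 ?addr0 => [|j /andP[_ /negPf ->]]; last by rewrite mul0r.
  apply: eq_big => [j|j /andP[_ ->] //]; by case jL: (j \in L); rewrite ?andbF // LJ.
have [v hv] := lin_dual (fun i iL => flin i (eL i iL)) indL.
have [|W [hW cW]] := hk2 V I (fun _ => 1%N) (fun i x => if i \in L then f i x else 0) hI.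
- move=> i; split=> //; case iL: (i \in L); have := eL i; rewrite iL => E; last by split; [exact: pol_cst | move=> a x y; rewrite mulr0 addr0].
  by split; [exact: pf | move=> a x y; rewrite expr1; apply: flin; apply: E].
have {}hW x : x \in W <-> forall i, i \in L -> f i x = 0.
  rewrite hW; split=> h i; [move=> iL; have := h i; by rewrite iL | by case: ifP => // /h].
(* Indices outside [J2] receive the zero form of type [(1, 1)], so that the hypotheses of
   [nice_nf_core] hold for every index. This type needs [0 < d]; for [d = 0] the set [J2] is
   empty. *)
pose q2 i := if i \in J2 then q i else 1%N; pose e2' i := if i \in J2 then e i else 1%N.
pose f2 i (x : V) := if i \in J2 then f i x else 0.
have hq2 i : frob K (q2 i) by rewrite /q2; case: ifP => _ //; apply: frob1.
have he2 i : (0 < e2' i)%N by rewrite /e2'; case: ifP => // /e2.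
have hd2 : (0 < d)%N -> forall i, (q2 i * e2' i <= d)%N.
  by move=> d0 i; rewrite /q2 /e2'; case: ifP => // _; rewrite muln1.
have hf2 i : nf (q2 i) (e2' i) (f2 i).
  by rewrite /q2 /e2' /f2; case: (i \in J2) => //; apply: nf_zero.
have hs2' : hs J2 q2 e2' f2 (S0 + 3 * k2).
  move=> q' e' c hc [i iJ2 ci] hl.
  have [qi ei] := hc i iJ2 ci.
  apply: (hs1 q' e' (fun i => if i \in J2 then c i else 0)).
  - by rewrite -ei he2.
  - move=> j jJ; case: ifP => jJ2; last by rewrite eqxx.
    by move=> cj; have := hc j jJ2 cj; rewrite /q2 /e2' jJ2.
  - by exists i; [move: iJ2; rewrite inE => /andP[] | rewrite iJ2].
  apply: lowstr_ext hl _ => p.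
  rewrite [RHS](bigID [in J2]) /= [X in _ = _ + X]big1 ?addr0 => [|j /andP[_ /negPf ->]]; last by rewrite mul0r.
  apply: eq_big => [j|j jJ2]; first by case jJ2: (j \in J2); rewrite ?andbF //; move: jJ2; rewrite inE => /andP[_ ->].
  by rewrite jJ2 /f2 jJ2.
have hsW := hs_restrict Kinf hq2 he2 hf2 cW hs2'.
(* A point where the linear members take the prescribed values [k i]. *)
pose o := \sum_(i in L) k i *: v i.
have lwo : linm (fun p : subvs_of W * V => vsval p.1 + p.2).
  by apply: linm_add; [exact: (linm_comp (@linm_fst K _ _) (@vsval_linm K V W)) | exact: linm_snd].
have cJ2 : (#|J2| <= m)%N by apply: leq_trans hI; apply: max_card.
have hsW' : hs J2 q2 e2' (fun i (x : subvs_of W) => f2 i (vsval x + 0)) S0.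
  by move: hsW; congr hs; do 2![apply: functional_extensionality => ?]; rewrite /= addr0.
have [pr [w0 [w0z w0i]]] : Nice J2 (fun i (w : subvs_of W) => f2 i (vsval w + o) - k i).
  have [d0|d0] := posnP d; last first.
    exact: (hS0 (subvs_of W) V I J2 q2 e2' (fun i p => f2 i (vsval p.1 + p.2)) hI cJ2 hq2 he2 (hd2 d0)
      (fun i => nf_linm lwo (hf2 i)) hsW' o k).
  suff -> : J2 = set0 by apply: (Nice_empty Kinf).
  apply/setP => i; rewrite [RHS]inE; apply/negP => iJ2; have := hd i.
  by rewrite d0 leqn0 muln_eq0 !eqn0Ngt (proj1 (hq i)) e2.
pose p x := x - \sum_(i in L) f i x *: v i.
have pW x : p x \in W.
  apply/hW => i iL; rewrite /p (linB _ _ (flin i (eL i iL))) (lin_sum _ _ _ (flin i (eL i iL))).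
  rewrite (bigD1 i) //= (linZ _ _ (flin i (eL i iL))) hv // eqxx mulr1 big1 ?addr0 ?subrr // => j /andP[jL ji].
  by rewrite (linZ _ _ (flin i (eL i iL))) hv // eq_sym (negPf ji) mulr0.
have lp : linm p.
  move=> a x y; rewrite /p (_ : \sum_(i in L) f i (a *: x + y) *: v i =
      a *: \sum_(i in L) f i x *: v i + \sum_(i in L) f i y *: v i).
    by rewrite scalerBr opprD addrACA.
  rewrite scaler_sumr -big_split /=; apply: eq_bigr => i iL.
  by rewrite (flin i (eL i iL)) scalerDl scalerA.
pose pw x := vsproj W (p x).
have lpw : linm pw by apply: (linm_comp lp); apply: linm_linear.
have pwE x : vsval (pw x) = p x by rewrite vsprojK.
have foL i : i \in L -> f i o = k i.
  move=> iL; have fl := flin i (eL i iL); rewrite /o (lin_sum _ _ _ fl) (bigD1 i) //= (linZ _ _ fl) hv //.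
  rewrite eqxx mulr1 big1 ?addr0 // => j /andP[jL ji]; by rewrite (linZ _ _ fl) hv // eq_sym (negPf ji) mulr0.
have pms : polm (fun x => p x + o) by apply: polm_add; [exact: polm_linm | exact: polm_cst].
(* Modulo the ideal, a function may be evaluated at the projection of [x] to the affine subspace. *)
have dif u : pol u -> ideal J (fun i x => f i x - k i) (fun x => u x - u (p x + o)).
  apply: (ideal_diff (s := fun x => x)) => //; first by apply: polm_linm; exact: linm_id.
  move=> l hl; apply: (ideal_ext (g := fun x => \sum_(i in L) l (v i) * (f i x - k i))) => [|x].
    by apply: ideal_sum => i iL; apply: ideal_scale; exact: (ideal_gen (fun i x => f i x - k i) (LJ i iL)).
  rewrite -(linB _ _ hl) (_ : x - (p x + o) = \sum_(i in L) (f i x - k i) *: v i).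
    by rewrite (lin_sum _ _ _ hl); apply: eq_bigr => i _; rewrite (linZ _ _ hl) mulrC.
  rewrite opprD addrA opprB addrCA subrr addr0 /o -sumrB.
  by apply: eq_bigr => i _; rewrite scalerBl.
split.
  move=> g h pg ph ghz.
  have tr u : pol u -> ideal J2 (fun i (w : subvs_of W) => f2 i (vsval w + o) - k i) (fun w : subvs_of W => u (vsval w + o)) ->
      ideal J (fun i x => f i x - k i) u.
    move=> pu hu; have {}hu := ideal_linm (polm_linm lpw) hu.
    apply: (ideal_ext (g := fun x => (u x - u (p x + o)) + u (p x + o))) => [|x]; last by rewrite subrK.
    apply: ideal_add (dif u pu) _.
    have {}hu : ideal J2 (fun i x => f2 i (p x + o) - k i) (fun x => u (p x + o)).
      by move: hu; congr ideal; do ?[apply: functional_extensionality => ?]; rewrite pwE.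
    apply: ideal_trans hu => i iJ2.
    have iJ : i \in J by move: iJ2; rewrite inE => /andP[].
    apply: (ideal_ext (ideal_sub (ideal_gen (fun i x => f i x - k i) iJ) (dif (f i) (pf i)))) => x.
    by rewrite /f2 iJ2; ring.
  have ps : polm (fun w : subvs_of W => vsval w + o) by apply: polm_add; [apply: polm_linm; exact: vsval_linm | exact: polm_cst].
  have [|hg|hh] := pr (fun w : subvs_of W => g (vsval w + o)) (fun w : subvs_of W => h (vsval w + o)) (pol_comp ps pg) (pol_comp ps ph).
  - move=> w hw; apply: ghz => i iJ; case iL: (i \in L).
      by rewrite (linD _ _ (flin i (eL i iL))) foL // (proj1 (hW (vsval w)) (subvsP w) i iL) add0r subrr.
    by have iJ2 : i \in J2 by [rewrite inE iL]; have := hw i iJ2; rewrite /= /f2 iJ2.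
  - by left; apply: tr.
  - by right; apply: tr.
exists (vsval w0 + o); split=> [i iJ|c hc].
  case iL: (i \in L).
    by rewrite (linD _ _ (flin i (eL i iL))) foL // (proj1 (hW (vsval w0)) (subvsP w0) i iL) add0r subrr.
  by have iJ2 : i \in J2 by [rewrite inE iL]; have := w0z i iJ2; rewrite /= /f2 iJ2.
have Dk i x y : D (fun v => f i v - k i) x y = D (f i) x y.
  by rewrite (D_sub Kinf) // ?(D_cst Kinf) ?subr0 //; exact: pol_cst.
have c2 i : i \in J2 -> c i = 0.
  move: i; apply: w0i => w; rewrite -[RHS](hc (vsval w)) [RHS](big_setID L) /= [X in _ = X + _]big1 ?add0r.
    apply: eq_bigr => i iJ2; congr (_ * _); rewrite Dk.
    have -> : (fun w : subvs_of W => f2 i (vsval w + o) - k i) = fun w => f i (o + vsval w) - k i.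
      by apply: functional_extensionality => r; rewrite /f2 iJ2 [vsval r + o]addrC.
    rewrite (D_sub Kinf); [|by apply: (pol_comp (s := fun w : subvs_of W => o + vsval w)) => //; apply: polm_add; [exact: polm_cst | apply: polm_linm; exact: vsval_linm]|exact: pol_cst].
    by rewrite (D_cst Kinf) subr0 (D_sub_affine Kinf o w0 w (@vsval_linm K V W) (pf i)) [o + _]addrC.
  move=> i; rewrite inE => /andP[iJ iL]; rewrite Dk (D_lin Kinf) ?(flin i (eL i iL)) //; last exact: flin (eL i iL).
  by rewrite (proj1 (hW (vsval w)) (subvsP w) i iL) mulr0.
move=> i iJ; case iL: (i \in L); last by apply: c2; rewrite inE iL.
apply: (indL c) iL => x; rewrite -[RHS](hc x) [RHS](big_setID L) /= [X in _ = _ + X]big1 ?addr0.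
  have -> : J :&: L = L by apply/setIidPr/subsetP.
  by apply: eq_bigr => j jL; rewrite Dk (D_lin Kinf) //; apply: flin (eL j jL).
by move=> j jJ2; rewrite c2 ?mul0r.
Qed.

End NiceNormalForms.

(** * Polynomial functions and multivariate polynomials *)

Section Mpoly.
Variable K : fieldType.
Hypothesis Kinf : infinite_field K.

(** Scaling one variable at a time isolates the terms with prescribed exponents in the variables
    listed in [s]. *)
Lemma meval_inj0 n (P : {mpoly K[n]}) : (forall v, P.@[v] = 0) -> P = 0.
Proof.
move=> hP.
have h (s : seq 'I_n) (m0 : 'X_{1.. n}) v :
    \sum_(m <- msupp P | all (fun l => m l == m0 l) s) P@_m * \prod_i v i ^+ m i = 0.
  elim: s v => [|l s IH] v; first by rewrite -[RHS](hP v) mevalE; apply: eq_bigl.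
  pose Q : {poly K} := \sum_(m <- msupp P | all (fun l => m l == m0 l) s) (P@_m * \prod_i v i ^+ m i) *: 'X^(m l).
  have Q0 : Q = 0.
    apply: (poly_fun0 Kinf) => t; rewrite /Q horner_sum -[RHS](IH (fun i => if i == l then t * v i else v i)).
    apply: eq_bigr => m _; rewrite !hornerE -mulrA; congr (_ * _).
    rewrite [in RHS](bigD1 l) //= eqxx exprMn (bigD1 l) //= mulrC mulrA; congr (_ * _).
    by apply: eq_bigr => i /negPf ->.
  have Ql : Q`_(m0 l) = 0 by rewrite Q0 coef0.
  rewrite -[RHS]Ql /Q coef_sum big_mkcond [RHS]big_mkcond; apply: eq_bigr => m _ /=.
  rewrite coefZ coefXn eq_sym; case: (m0 l == m l) => /=; last by case: ifP => _; rewrite ?mulr0.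
  by rewrite mulr1.
apply/mpolyP => m; rewrite mcoeff0; case mP: (m \in msupp P); last by apply: memN_msupp_eq0; rewrite mP.
have := h (enum 'I_n) m (fun _ => 1).
rewrite (eq_bigl (fun m' => m' == m)) => [|m'].
  rewrite -big_filter filter_pred1_uniq ?msupp_uniq // big_seq1 big1 ?mulr1 // => i _; exact: expr1n.
apply/allP/eqP => [h'|-> //]; apply/mnmP => i; apply/eqP; apply: h'; exact: mem_enum.
Qed.

Lemma pol_meval (V : lmodType K) n (c : 'I_n -> V -> K) (P : {mpoly K[n]}) : (forall i, lin (c i)) ->
  pol (fun x => P.@[fun i => c i x]).
Proof.
move=> hc; apply: (pol_ext (f := fun x => \sum_(m <- msupp P) P@_m * \prod_i c i x ^+ m i)) => [|x].
  apply: pol_sum => m _; apply: pol_scale; apply: pol_prod => i _; apply: pol_exp; exact: pol_lin.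
by rewrite mevalE.
Qed.

Lemma pol_mpoly (V : lmodType K) n (c : 'I_n -> V -> K) (b : 'I_n -> V) : (forall i, lin (c i)) ->
  (forall x, x = \sum_i c i x *: b i) -> (forall i j, c i (b j) = (i == j)%:R) -> forall f : V -> K, pol f ->
  exists P : {mpoly K[n]}, (forall x, f x = P.@[fun i => c i x]) /\
    forall l x, D f x (b l) = (P^`M(l)).@[fun i => c i x].
Proof.
move=> hc hb hcb f; elim=> [a|l hl|{}f g pf [P [eP dP]] pg [Q [eQ dQ]]|{}f g pf [P [eP dP]] pg [Q [eQ dQ]]].
- exists a%:MP; split=> [x|l x]; first by rewrite mevalC.
  by rewrite (D_cst Kinf) mderivC meval0.
- exists (\sum_i l (b i) *: 'X_i); split=> [x|j x].
    rewrite raddf_sum /= {1}(hb x) (lin_sum _ _ _ hl); apply: eq_bigr => i _.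
    by rewrite mevalZ mevalXU (linZ _ _ hl) mulrC.
  have -> : (\sum_i l (b i) *: 'X_i)^`M(j) = \sum_i (l (b i) *: 'X_i)^`M(j) :> {mpoly K[n]} by exact: raddf_sum.
  have -> : (\sum_i (l (b i) *: 'X_i)^`M(j)).@[fun i => c i x] = \sum_i ((l (b i) *: 'X_i : {mpoly K[n]})^`M(j)).@[fun i => c i x].
    exact: raddf_sum.
  rewrite (D_lin Kinf) // (bigD1 j) //= big1 ?addr0 => [|i ij].
    by rewrite mderivZ mderivX mevalZ mevalZ mnmE eqxx mevalX big1 ?mulr1 // => i _; rewrite mnmBE subnn.
  by rewrite mderivZ mderivX mnmE (negPf ij) scale0r scaler0 meval0.
- exists (P + Q); split=> [x|l x]; first by rewrite mevalD eP eQ.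
  by rewrite (D_add Kinf) // mderivD mevalD dP dQ.
exists (P * Q); split=> [x|l x]; first by rewrite mevalM eP eQ.
by rewrite (D_mul Kinf) // mderivM mevalD !mevalM dP dQ eP eQ addrC.
Qed.

Lemma frob_pchar p : p \in [pchar K] -> frob K p.
Proof.
move=> hp; split; first exact: prime_gt0 (pcharf_prime hp).
by move=> x y; have := pFrobenius_autD_comm hp (mulrC x y); rewrite !pFrobenius_autE.
Qed.

(** Every exponent occurring in [h] is zero in [K]. In characteristic zero this leaves nothing, and
    in characteristic [p] it makes each monomial a [p]-th power; the coefficients [c k] need not be
    [p]-th powers. *)
Lemma hom_zero_derivative (V : vectType K) i (h : V -> K) : (0 < i)%N -> hom i h -> (forall x v, D h x v = 0) ->
  (forall x, h x = 0) \/ exists p j n (c : 'I_n -> K) (g : 'I_n -> V -> K),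
    [/\ p \in [pchar K], i = (p * j)%N, forall k, hom j (g k) & forall x, h x = \sum_k c k * g k x ^+ p].
Proof.
move=> i0 hh Dh.
have [P [eP dP]] := pol_mpoly (@lin_co K V) (@co_sum K V) (@co_vb K V) (hom_pol hh).
have eval0 (Q : {mpoly K[\dim {:V}]}) : (forall x, Q.@[fun i => co i x] = 0) -> Q = 0.
  move=> hQ; apply: meval_inj0 => v; rewrite -[RHS](hQ (\sum_i v i *: vb i)).
  apply: meval_eq => l; rewrite (lin_sum _ _ _ (lin_co l)) (bigD1 l) //= big1 ?addr0 => [|j jl].
    by rewrite (linZ _ _ (lin_co l)) co_vb eqxx mulr1.
  by rewrite (linZ _ _ (lin_co l)) co_vb eq_sym (negPf jl) mulr0.
have dP0 l : P^`M(l) = 0 by apply: eval0 => x; rewrite -dP Dh.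
have hm m l : m \in msupp P -> (m l)%:R = 0 :> K.
  move=> mP; have [->//|ml] := posnP (m l).
  have sK : (m - U_(l) + U_(l))%MM = m by apply/mnmP => k; rewrite mnmDE mnmBE subnK // mnm1E; case: eqP => [<-|].
  have : P^`M(l)@_(m - U_(l)) = 0 by rewrite dP0 mcoeff0.
  rewrite mcoeff_deriv sK mnmBE mnm1E eqxx subn1 prednK // => E.
  have /eqP : P@_m * (m l)%:R = 0 by rewrite mulr_natr.
  by rewrite mulf_eq0 mcoeff_eq0 mP => /eqP.
have hx x : h x = \sum_(m <- msupp P | mdeg m == i) P@_m * \prod_l co l x ^+ m l.
  rewrite -(comp_id Kinf x hh).
  have pp m : hom (mdeg m) (fun x : V => P@_m * \prod_l co l x ^+ m l).
    apply: hom_scale; split; first by apply: pol_prod => l _; apply: pol_exp; apply: pol_lin; apply: lin_co.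
    move=> t y; rewrite mdegE -prodrXr -big_split; apply: eq_bigr => l _ /=.
    by rewrite (linZ _ _ (lin_co l)) exprMn.
  have -> : h = fun x => \sum_(m <- msupp P) P@_m * \prod_l co l x ^+ m l.
    by apply: functional_extensionality => y; rewrite eP mevalE.
  rewrite (comp_sum Kinf) => [|m _]; last exact: hom_pol (pp m).
  rewrite [RHS]big_mkcond; apply: eq_bigr => m _; rewrite (comp_homE Kinf (pp m)) eq_sym.
  by [].
have [[p hp]|np] := classic (exists p, p \in [pchar K]); last first.
  left=> x; rewrite hx big_seq_cond big1 // => m /andP[mP /eqP mi].
  suff m0 : m = 0%MM by move: i0; rewrite -mi m0 mdeg0.
  apply/mnmP => l; rewrite mnmE; apply/eqP; apply: contraT => ml.
  have /eqP := hm m l mP => E; case: np.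
  by have [|p hp] := natf0_pchar _ E; [rewrite lt0n | exists p].
have pd m l : m \in msupp P -> (p %| m l)%N by move=> /(hm m l)/eqP; rewrite (dvdn_pcharf hp).
have [/hasP[m1 m1P /eqP m1i]|/hasPn nm] := boolP (has (fun m => mdeg m == i) (msupp P)); last first.
  by left=> x; rewrite hx big_seq_cond big1 // => m /andP[mP mi]; have := nm m mP; rewrite mi.
right; exists p, (i %/ p)%N, (size [seq m <- msupp P | mdeg m == i]),
  (fun k => P@_(nth 0%MM [seq m <- msupp P | mdeg m == i] k)),
  (fun k x => \prod_l co l x ^+ (nth 0%MM [seq m <- msupp P | mdeg m == i] k l %/ p)%N).
have dm m : m \in msupp P -> mdeg m = (p * \sum_l m l %/ p)%N.
  by move=> mP; rewrite mdegE big_distrr /=; apply: eq_bigr => l _; rewrite mulnC divnK // pd.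
have p0 := prime_gt0 (pcharf_prime hp).
have ei m : m \in msupp P -> mdeg m = i -> (i %/ p)%N = (\sum_l m l %/ p)%N.
  by move=> mP <-; rewrite (dm _ mP) mulKn.
have pi : (p %| i)%N by rewrite -m1i dm // dvdn_mulr.
split=> // [|k|x]; first by rewrite mulnC divnK.
  have := ltn_ord k; move/(mem_nth 0%MM); rewrite mem_filter => /andP[/eqP mi mP].
  split; first by apply: pol_prod => l _; apply: pol_exp; apply: pol_lin; apply: lin_co.
  move=> t y; rewrite (ei _ mP mi) -prodrXr -big_split; apply: eq_bigr => l _ /=.
  by rewrite (linZ _ _ (lin_co l)) exprMn.
rewrite hx -big_filter (big_nth 0%MM) big_mkord; apply: eq_bigr => k _; congr (_ * _).
have := ltn_ord k; move/(mem_nth 0%MM); rewrite mem_filter => /andP[_ mP].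
by rewrite -prodrXl; apply: eq_bigr => l _; rewrite -exprM divnK // pd.
Qed.
Hypothesis Kbr : brauer_field K.

(** A family independent over the [q]-th powers is a diagonal form of degree [q] without nontrivial
    zero, so the Brauer bound limits its size; a maximal one is a basis of [K] over its [q]-th
    powers. *)
Lemma frob_basis q : frob K q -> exists n (eps : 'I_n -> K),
  (forall c, exists a : 'I_n -> K, c = \sum_i eps i * a i ^+ q) /\
  (forall a : 'I_n -> K, \sum_i eps i * a i ^+ q = 0 -> forall i, a i = 0).
Proof.
move=> hq; have [N hN] := Kbr (proj1 hq).
pose Q n := exists eps : 'I_n -> K, forall a : 'I_n -> K, \sum_i eps i * a i ^+ q = 0 -> forall i, a i = 0.
have bQ n : Q n -> (n <= N)%N.
  move=> [eps he]; rewrite leqNgt; apply/negP => /(hN _ eps)[x [[i xi] /he h]].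
  by rewrite h eqxx in xi.
have [n [Qn nQ]] : exists n, Q n /\ ~ Q n.+1.
  apply: NNPP => H; suff : Q N.+1 by move/bQ; rewrite ltnn.
  elim: N.+1 => [|k IH]; first by exists (fun _ => 0) => a _ [].
  by apply: NNPP => H'; apply: H; exists k.
have [eps he] := Qn; exists n, eps; split=> // c.
pose eps' (i : 'I_n.+1) := if unlift ord0 i is Some j then eps j else c.
have [a [ea [i ai]]] : exists a : 'I_n.+1 -> K, \sum_i eps' i * a i ^+ q = 0 /\ exists i, a i != 0.
  apply: NNPP => H; apply: nQ; exists eps' => a ea i; apply/eqP; apply: NNPP => /negP ai; apply: H.
  by exists a; split=> //; exists i.
move: ea; rewrite big_ord_recl {1}/eps' unlift_none => ea.
have e1 : \sum_i eps' (lift ord0 i) * a (lift ord0 i) ^+ q = \sum_i eps i * a (lift ord0 i) ^+ q.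
  by apply: eq_bigr => j _; rewrite /eps' liftK.
rewrite e1 in ea.
have a0 : a ord0 != 0.
  apply/negP => /eqP a0; move: ea; rewrite a0 (frob0 hq) mulr0 add0r => /he h.
  by move: ai; case: (unliftP ord0 i) => [j ->|->]; rewrite ?h ?a0 eqxx.
exists (fun j => - (a (lift ord0 j) / a ord0)).
apply: (mulIf (expf_neq0 q a0)); rewrite mulr_suml.
transitivity (- \sum_i eps i * a (lift ord0 i) ^+ q); first by apply/eqP; rewrite -addr_eq0 ea.
rewrite -sumrN; apply: eq_bigr => j _.
by rewrite (frobN _ hq) -mulrA mulNr -exprMn divfK // mulrN.
Qed.

End Mpoly.

(** * Formal sections *)

Section Local.
Variable K : fieldType.
Hypothesis Kinf : infinite_field K.

Section Order.
Variable V : lmodType K.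

Definition ord k (f : V -> K) : Prop := pol f /\ forall i x, (i < k)%N -> comp i f x = 0.

Lemma ord_leq k k' f : (k' <= k)%N -> ord k f -> ord k' f.
Proof. by move=> kk [pf hf]; split=> // i x ik; apply: hf; apply: leq_trans kk. Qed.

Lemma ord_add k f g : ord k f -> ord k g -> ord k (fun x => f x + g x).
Proof.
move=> [pf hf] [pg hg]; split=> [|i x ik]; first exact: pol_add.
by rewrite (comp_add Kinf) // hf // hg // addr0.
Qed.

Lemma ord_mul a b f g : ord a f -> ord b g -> ord (a + b) (fun x => f x * g x).
Proof.
move=> [pf hf] [pg hg]; split=> [|i x ik]; first exact: pol_mul.
rewrite (comp_mul Kinf) // big1 // => j _.
have [ja|ja] := ltnP j a; first by rewrite hf // mul0r.
by rewrite hg ?mulr0 //; have := ltn_ord j; lia.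
Qed.

Lemma ord_mul_l k f g : pol g -> ord k f -> ord k (fun x => g x * f x).
Proof. by move=> pg hf; apply: (@ord_mul 0) hf; split. Qed.

Lemma ord_cst0 k : ord k (fun _ => 0).
Proof.
split=> [|i x _]; first exact: pol_cst.
by rewrite (comp_neq Kinf x (hom_zero V i.+1)) // neq_ltn ltnSn.
Qed.

Lemma ord_ext k f g : ord k f -> f =1 g -> ord k g.
Proof. by move=> h /functional_extensionality <-. Qed.

Lemma ord_scale k c f : ord k f -> ord k (fun x => c * f x).
Proof. by apply: ord_mul_l; apply: pol_cst. Qed.

Lemma ord_sum k (I : Type) (r : seq I) (Q : pred I) (F : I -> V -> K) :
  (forall i, Q i -> ord k (F i)) -> ord k (fun x => \sum_(i <- r | Q i) F i x).
Proof.
move=> h; elim: r => [|i r IH]; first by apply: (ord_ext (ord_cst0 k)) => x; rewrite big_nil.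
case Qi: (Q i); last by apply: (ord_ext IH) => x; rewrite big_cons Qi.
by apply: (ord_ext (ord_add (h i Qi) IH)) => x; rewrite big_cons Qi.
Qed.

Lemma ord_1 f : pol f -> f 0 = 0 -> ord 1 f.
Proof. by move=> pf f0; split=> // -[|//] x _; rewrite comp0. Qed.

Lemma ord_D k f v : ord k.+1 f -> ord k (fun x => D f x v).
Proof.
move=> [pf hf]; split=> [|i x ik]; first exact: pol_D.
rewrite -(D_comp_comm Kinf) // (_ : comp i.+1 f = fun _ => 0) ?(D_cst Kinf) //.
by apply: functional_extensionality => y; apply: hf.
Qed.

Lemma ord_unit k u f : pol u -> pol f -> u 0 != 0 -> ord k (fun x => u x * f x) -> ord k f.
Proof.
move=> pu pf u0 [_ h]; split=> // i; elim/ltn_ind: i => i IH x ik.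
have := h i x ik; rewrite (comp_mul Kinf) // big_ord_recl subn0 comp0 // big1 ?addr0 => [/eqP|j _].
  by rewrite mulf_eq0 (negPf u0) => /eqP.
by rewrite lift0 IH ?mulr0 //; have := ltn_ord j; lia.
Qed.

Lemma ord_prod (T : Type) (m : seq T) (F : T -> V -> K) : (forall i, ord 1 (F i)) ->
  ord (size m) (fun x => \prod_(i <- m) F i x).
Proof.
move=> h; elim: m => [|i m IH].
  by split=> // ; apply: (pol_ext (pol_cst V 1)) => x; rewrite big_nil.
by apply: (ord_ext (ord_mul (h i) IH)) => x; rewrite big_cons.
Qed.

(** Congruence modulo the ideal of [P] plus the [k]-th power of the maximal ideal at the origin. *)
Definition imod k n (P : 'I_n -> V -> K) g : Prop :=
  exists q : 'I_n -> V -> K, (forall i, pol (q i)) /\ ord k (fun x => g x - \sum_i q i x * P i x).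

Section Imod.
Variables (n : nat) (P : 'I_n -> V -> K).
Hypothesis pP : forall i, pol (P i).

Lemma imod_ext k f g : imod k P f -> f =1 g -> imod k P g.
Proof. by move=> h /functional_extensionality <-. Qed.

Lemma imod_ord k g : ord k g -> imod k P g.
Proof.
move=> h; exists (fun _ _ => 0); split=> [i|]; first exact: pol_cst.
by apply: (ord_ext h) => x; rewrite big1 ?subr0 // => i _; rewrite mul0r.
Qed.

Lemma imod_leq k k' g : (k' <= k)%N -> imod k P g -> imod k' P g.
Proof. by move=> kk [q [pq h]]; exists q; split=> //; apply: ord_leq h. Qed.

Lemma imod_add k f g : imod k P f -> imod k P g -> imod k P (fun x => f x + g x).
Proof.
move=> [q [pq hf]] [r [pr hg]]; exists (fun i x => q i x + r i x); split=> [i|]; first exact: pol_add.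
apply: (ord_ext (ord_add hf hg)) => x; rewrite addrACA -opprD -big_split; congr (_ - _).
by apply: eq_bigr => i _; rewrite mulrDl.
Qed.

Lemma imod_mul k f h : pol h -> imod k P f -> imod k P (fun x => h x * f x).
Proof.
move=> ph [q [pq hf]]; exists (fun i x => h x * q i x); split=> [i|]; first exact: pol_mul.
apply: (ord_ext (ord_mul_l ph hf)) => x; rewrite mulrBr mulr_sumr; congr (_ - _).
by apply: eq_bigr => i _; rewrite mulrA.
Qed.

Lemma imod_mul1 k f h : ord 1 h -> imod k P f -> imod k.+1 P (fun x => h x * f x).
Proof.
move=> hh [q [pq hf]]; exists (fun i x => h x * q i x); split=> [i|]; first by apply: pol_mul => //; case: hh.
apply: (ord_ext (ord_mul hh hf)) => x; rewrite mulrBr mulr_sumr; congr (_ - _).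
by apply: eq_bigr => i _; rewrite mulrA.
Qed.

Lemma imod_scale k c f : imod k P f -> imod k P (fun x => c * f x).
Proof. by apply: imod_mul; apply: pol_cst. Qed.

Lemma imod_sub k f g : imod k P f -> imod k P g -> imod k P (fun x => f x - g x).
Proof. by move=> hf hg; apply: (imod_ext (imod_add hf (imod_scale (-1) hg))) => x; rewrite mulN1r. Qed.

Lemma imod_sum k (I : Type) (r : seq I) (Q : pred I) (F : I -> V -> K) :
  (forall i, Q i -> imod k P (F i)) -> imod k P (fun x => \sum_(i <- r | Q i) F i x).
Proof.
move=> h; elim: r => [|i r IH]; first by apply: (imod_ext (imod_ord (ord_cst0 k))) => x; rewrite big_nil.
case Qi: (Q i); last by apply: (imod_ext IH) => x; rewrite big_cons Qi.
by apply: (imod_ext (imod_add (h i Qi) IH)) => x; rewrite big_cons Qi.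
Qed.

Lemma imod_gen k i : imod k P (P i).
Proof.
exists (fun j _ => (j == i)%:R); split=> [j|]; first exact: pol_cst.
apply: (ord_ext (ord_cst0 k)) => x; rewrite (bigD1 i) //= eqxx mul1r big1 ?addr0 ?subrr // => j /negPf ->.
by rewrite mul0r.
Qed.

Lemma imod_diff (W : lmodType K) k (s s' : V -> W) g : polm s -> polm s' ->
  (forall l, lin l -> imod k P (fun x => l (s x) - l (s' x))) -> pol g ->
  imod k P (fun x => g (s x) - g (s' x)).
Proof.
move=> ps ps' hl; elim=> [c|l ll|{}g h pg IHg ph IHh|{}g h pg IHg ph IHh].
- by apply: (imod_ext (imod_ord (ord_cst0 k))) => x; rewrite subrr.
- exact: hl.
- by apply: (imod_ext (imod_add IHg IHh)) => x; rewrite opprD addrACA.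
apply: (imod_ext (f := fun x => g (s x) * (h (s x) - h (s' x)) + h (s' x) * (g (s x) - g (s' x)))) => [|x]; last by ring.
by apply: imod_add; apply: imod_mul => //; [exact: (pol_comp ps pg) | exact: (pol_comp ps' ph)].
Qed.

End Imod.

Lemma imod_ord0 k (P : 'I_0 -> V -> K) g : imod k P g -> ord k g.
Proof. by move=> [q [_ h]]; apply: (ord_ext h) => x; rewrite big_ord0 subr0. Qed.

End Order.

Lemma hom_monomials (V : vectType K) i (f : V -> K) : hom i f ->
  exists h : i.-tuple 'I_(\dim {:V}) -> K, forall x, f x = \sum_(d : i.-tuple 'I_(\dim {:V})) mon d x * h d.
Proof.
move=> hf; pose G (p : V * V) := f p.1.
have pG : pol G by exact: (pol_linm (f := f) (@linm_fst K V V) (hom_pol hf)).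
have [|h [ph eh]] := @hom_expand K Kinf V V G i pG; first by move=> t s x; rewrite /G /= (homE _ _ hf).
by exists (fun d => h d 0) => x; rewrite -(eh x 0).
Qed.

Lemma ord_comp (X : lmodType K) (V : vectType K) (s : X -> V) k f : polm s -> s 0 = 0 -> ord k f ->
  ord k (fun x => f (s x)).
Proof.
move=> ps s0 [pf hf]; have [N [_ hN]] := comp_bound Kinf pf.
apply: (ord_ext (f := fun x => \sum_(i < N) comp i f (s x))) => [|x]; last by rewrite -hN.
apply: ord_sum => i _; have [ik|ki] := ltnP i k.
  by apply: (ord_ext (ord_cst0 _ k)) => x; rewrite hf.
have [h eh] := hom_monomials (hom_comp Kinf i pf).
apply: (ord_ext (f := fun x => \sum_(d : i.-tuple 'I_(\dim {:V})) h d * mon d (s x))) => [|x]; last first.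
  by rewrite eh; apply: eq_bigr => d _; rewrite mulrC.
apply: ord_sum => d _; apply: ord_scale; apply: (ord_leq ki).
have := ord_prod (tval d) (F := fun l x => co l (s x)); rewrite size_tuple; apply=> l.
by apply: ord_1; [apply: ps; apply: lin_co | rewrite s0 (lin0 (lin_co l))].
Qed.

(** Every monomial of [r] has at least two factors, so each term of the telescoped difference
    carries a further factor of order 1 and the congruence improves by one order. *)
Lemma imod_diff1 (X : lmodType K) (V : vectType K) n (P : 'I_n -> X -> K) k (s s' : X -> V) r : polm s -> polm s' ->
  s 0 = 0 -> s' 0 = 0 -> ord 2 r -> (forall l, lin l -> imod k P (fun x => l (s x) - l (s' x))) ->
  imod k.+1 P (fun x => r (s x) - r (s' x)).
Proof.
move=> ps ps' s0 s0' [pr hr] hl; have [N [_ hN]] := comp_bound Kinf pr.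
apply: (imod_ext (f := fun x => \sum_(i < N) (comp i r (s x) - comp i r (s' x)))) => [|x]; last first.
  by rewrite sumrB -!hN.
apply: imod_sum => -[i iN] _ /=; have [i2|i2] := ltnP i 2.
  by apply: (imod_ext (imod_ord P (ord_cst0 X k.+1))) => x; rewrite !hr // subrr.
have [h eh] := hom_monomials (hom_comp Kinf i pr).
apply: (imod_ext (f := fun x => \sum_(d : i.-tuple 'I_(\dim {:V})) h d * (mon d (s x) - mon d (s' x)))) => [|x]; last first.
  by rewrite !eh -sumrB; apply: eq_bigr => d _; rewrite mulrC mulrBl.
apply: imod_sum => d _; apply: imod_scale.
case: d => [[|a m] /= /eqP sm]; first by rewrite -sm in i2.
apply: (imod_ext (f := fun x => mon m (s x) * (co a (s x) - co a (s' x)) + co a (s' x) * (mon m (s x) - mon m (s' x)))).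
  apply: imod_add; apply: imod_mul1.
  - have m1 : (1 <= size m)%N by rewrite -ltnS sm.
    apply: (ord_leq m1); apply: (ord_prod m (F := fun l x => co l (s x))) => l.
    by apply: ord_1; [apply: ps; apply: lin_co | rewrite s0 (lin0 (lin_co l))].
  - by apply: hl; apply: lin_co.
  - by apply: ord_1; [apply: ps'; apply: lin_co | rewrite s0' (lin0 (lin_co a))].
  - by apply: imod_diff => //; apply: hom_pol (hom_mon m).
by move=> x; rewrite /mon !big_cons; ring.
Qed.

(* A formal section of [P] at a point where its differentials are independent, modulo terms of order [k]. *)
Lemma local_section (V : vectType K) n (P : 'I_n -> V -> K) (w : 'I_n -> V) k : (forall i, pol (P i)) ->
  (forall i, P i 0 = 0) -> (forall i j, D (P i) 0 (w j) = (i == j)%:R) ->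
  exists s : V -> V, [/\ polm s, s 0 = 0, forall i, ord k (fun x => P i (s x)) &
    forall g, pol g -> imod k P (fun x => g x - g (s x))].
Proof.
move=> pP P0 Pw.
pose L i x := D (P i) 0 x.
have lL i : lin (L i) by apply: D_linr.
pose r i x := P i x - L i x.
have pr i : pol (r i) by apply: pol_sub => //; apply: pol_lin.
have r0 i : r i 0 = 0 by rewrite /r P0 (lin0 (lL i)) subrr.
have or i : ord 2 (r i).
  split=> // -[|[|//]] x _; rewrite (comp_sub Kinf) //; try exact: pol_lin.
    by rewrite !comp0 ?P0 ?(lin0 (lL i)) ?subrr //; exact: pol_lin.
  by rewrite (comp_id Kinf x (hom_lin (lL i))) subrr.
pose pi x := x - \sum_i L i x *: w i.
have lpi : linm pi.
  move=> a x y; rewrite /pi (_ : \sum_i L i (a *: x + y) *: w i = a *: \sum_i L i x *: w i + \sum_i L i y *: w i).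
    by rewrite scalerBr opprD addrACA.
  by rewrite scaler_sumr -big_split /=; apply: eq_bigr => i _; rewrite (lL i) scalerDl scalerA.
(* Iteration towards [s = pi - sum r i (s) w i]; applying [L i] to this equation gives
   [L i s = - r i s], that is [P i s = 0]. *)
pose sec := fix sec (t : nat) (x : V) {struct t} : V := if t is t'.+1 then pi x - \sum_i r i (sec t' x) *: w i else pi x.
have psec t : polm (sec t).
  elim: t => [|t IH] /=; first exact: polm_linm.
  move=> l hl; apply: (pol_ext (f := fun x => l (pi x) - \sum_i r i (sec t x) * l (w i))) => [|x]; last first.
    rewrite [in RHS](linB _ _ hl) (lin_sum _ _ _ hl); congr (_ - _).
    by apply: eq_bigr => i _; rewrite (linZ _ _ hl).
  apply: pol_sub; first by apply: (pol_linm lpi); apply: pol_lin.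
  by apply: pol_sum => i _; apply: pol_mul; [exact: (pol_comp IH (pr i)) | exact: pol_cst].
have sec0 t : sec t 0 = 0.
  elim: t => [|t IH] /=; first exact: linm0.
  by rewrite IH (linm0 lpi) big1 ?subr0 // => i _; rewrite r0 scale0r.
have Lw i j : L i (w j) = (i == j)%:R := Pw i j.
have Lsum i (c : 'I_n -> K) : L i (\sum_j c j *: w j) = c i.
  rewrite (lin_sum _ _ _ (lL i)) (bigD1 i) //= (linZ _ _ (lL i)) Lw eqxx mulr1 big1 ?addr0 // => j ji.
  by rewrite (linZ _ _ (lL i)) Lw eq_sym (negPf ji) mulr0.
have Lpi i x : L i (pi x) = 0 by rewrite /pi (linB _ _ (lL i)) Lsum subrr.
have LS i t x : L i (sec t.+1 x) = - r i (sec t x) by rewrite /= (linB _ _ (lL i)) Lsum Lpi sub0r.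
have lS t l x : lin l -> l (sec t.+1 x) = l (pi x) - \sum_i r i (sec t x) * l (w i).
  move=> hl; rewrite [LHS](linB (pi x) _ hl) (lin_sum _ _ _ hl); congr (_ - _).
  by apply: eq_bigr => i _; rewrite (linZ _ _ hl).
(* Since the [r i] have order 2, each iteration changes the section by terms of one order more. *)
have A t : forall l, lin l -> ord t.+2 (fun x => l (sec t.+1 x) - l (sec t x)).
  elim: t => [|t IH] l hl.
    apply: (ord_ext (f := fun x => \sum_i (- l (w i)) * r i (pi x))) => [|x]; last first.
      rewrite lS //= addrC addKr -sumrN; apply: eq_bigr => i _; ring.
    by apply: ord_sum => i _; apply: ord_scale; apply: (ord_comp (polm_linm lpi) (linm0 lpi) (or i)).
  apply: (ord_ext (f := fun x => \sum_i (- l (w i)) * (r i (sec t.+1 x) - r i (sec t x)))) => [|x]; last first.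
    rewrite (lS t.+1) // (lS t) //; set a := l (pi x); set S1 := (X in a - X - _); set S0 := (X in _ - (a - X)).
    have -> : a - S1 - (a - S0) = S0 - S1 by ring.
    by rewrite /S0 /S1 -sumrB; apply: eq_bigr => i _; ring.
  apply: ord_sum => i _; apply: ord_scale; apply: (imod_ord0 (P := fun _ _ => 0)).
  by apply: imod_diff1 => // l' hl'; apply: imod_ord; apply: IH.
have xs t x : x - sec t x = \sum_b (L b x - L b (sec t x)) *: w b.
  case: t => [|t].
    rewrite /= {1}/pi opprB addrC subrK; apply: eq_bigr => b _; by rewrite Lpi subr0.
  under [RHS]eq_bigr do rewrite LS opprK scalerDl.
  rewrite big_split /=; set S := \sum_i L i x *: w i; set R := \sum_i r i (sec t x) *: w i.
  rewrite -[pi x]/(x - S) opprB opprB addrCA [x + (S - x)]addrC subrK; exact: addrC.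
have l_imod t l m : lin l -> (forall b, imod m P (fun x => L b x - L b (sec t x))) -> imod m P (fun x => l x - l (sec t x)).
  move=> hl hb; apply: (imod_ext (f := fun x => \sum_b l (w b) * (L b x - L b (sec t x)))) => [|x].
    by apply: imod_sum => b _; apply: imod_scale.
  by rewrite -(linB _ _ hl) xs (lin_sum _ _ _ hl); apply: eq_bigr => b _; rewrite (linZ _ _ hl) mulrC.
have pid : polm (fun x : V => x) by apply: polm_linm; exact: linm_id.
(* The identity map satisfies the same fixed point equation modulo [P], so it agrees with the
   section to growing order. *)
have B t : forall b, imod t.+1 P (fun x => L b x - L b (sec t x)).
  elim: t => [|t IH] b.
    apply: imod_ord; apply: (ord_ext (f := L b)) => [|x]; last by rewrite /= Lpi subr0.
    by apply: ord_1; [exact: pol_lin | exact: lin0].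
  apply: (imod_ext (f := fun x => P b x - (r b x - r b (sec t x)))) => [|x]; last by rewrite LS /r; ring.
  apply: imod_sub; first exact: imod_gen.
  by apply: (imod_diff1 (s := fun x => x)) => // l hl; apply: l_imod.
exists (sec k); split=> // [i|g pg].
  apply: (@ord_leq V k.+2) => //; first by apply: leqW.
  apply: (ord_ext (f := fun x => - 1 * (L i (sec k.+1 x) - L i (sec k x)))) => [|x]; last by rewrite LS /r; ring.
  by apply: ord_scale; apply: A.
apply: (imod_diff (s := fun x => x)) => // l hl; apply: l_imod => // b.
by apply: (imod_leq (leqnSn k)).
Qed.

End Local.

(** * Normal forms of low strength *)

Section Weights.
Variable K : fieldType.
Hypothesis Kinf : infinite_field K.
Hypothesis Kbr : brauer_field K.

(** Polynomials in the [z i] of weighted degree at most [e]; a filtration rather than a grading, so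
    constants and lower terms are allowed. *)
Inductive alg (V : lmodType K) (I : Type) (w : I -> nat) (z : I -> V -> K) : nat -> (V -> K) -> Prop :=
| alg_cst e f c : (forall x, f x = c) -> alg w z e f
| alg_gen e f i : (w i <= e)%N -> (forall x, f x = z i x) -> alg w z e f
| alg_add e f g h : alg w z e f -> alg w z e g -> (forall x, h x = f x + g x) -> alg w z e h
| alg_mul e a b f g h : alg w z a f -> alg w z b g -> (a + b <= e)%N -> (forall x, h x = f x * g x) -> alg w z e h.

Lemma alg_pol (V : lmodType K) (I : Type) (w : I -> nat) (z : I -> V -> K) e f :
  (forall i, pol (z i)) -> alg w z e f -> pol f.
Proof.
move=> pz; elim=> [{}e {}f c fc|{}e {}f i _ fz|{}e {}f g h _ pf _ pg hh|{}e a b {}f g h _ pf _ pg _ hh].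
- by apply: (pol_ext (pol_cst V c)).
- by apply: (pol_ext (pz i)).
- by apply: (pol_ext (pol_add pf pg)).
- by apply: (pol_ext (pol_mul pf pg)).
Qed.

Lemma alg_ideal (V : lmodType K) (I : finType) (w : I -> nat) (z : I -> V -> K) e f :
  (forall i, pol (z i)) -> (forall i, z i 0 = 0) -> alg w z e f -> ideal [set: I] z (fun x => f x - f 0).
Proof.
move=> pz z0; elim=> [{}e {}f c fc|{}e {}f i _ fz|{}e {}f g h hf IHf hg IHg hh|{}e a b {}f g h hf IHf hg IHg _ hh].
- by apply: (ideal_ext (ideal0 _ _)) => x; rewrite !fc subrr.
- by apply: (ideal_ext (ideal_gen z (in_setT i))) => x; rewrite !fz z0 subr0.
- by apply: (ideal_ext (ideal_add IHf IHg)) => x; rewrite !hh opprD addrACA.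
apply: (ideal_ext (g := fun x => f x * (g x - g 0) + g 0 * (f x - f 0))) => [|x]; last by rewrite !hh; ring.
by apply: ideal_add; apply: ideal_mul => //; [apply: alg_pol hf | apply: pol_cst].
Qed.

(** The strength demanded may depend, through [G], on the number of normal forms produced; otherwise
    primality results, whose constants depend on that number, could not be applied to them. *)
Definition nf_regular d := forall (G : nat -> nat) N, exists N', forall (V : vectType K) (I : finType) (dg : I -> nat)
    (f : I -> V -> K), (#|I| <= N)%N -> (forall i, (1 <= dg i <= d)%N) -> (forall i, hom (dg i) (f i)) ->
  exists (I' : finType) (q e : I' -> nat) (z : I' -> V -> K), [/\ (#|I'| <= N')%N,
    forall i, [/\ frob K (q i), (q i * e i < d)%N & nf (q i) (e i) (z i)], hsN [set: I'] q e z (G #|I'|) &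
    forall i, alg (fun j => (1 + q j * e j)%N) z (dg i) (f i)].

(** [d] is one less than the degree of [f], so the factors obtained have degree at most [d]. *)
Definition split_nf d := forall q e S, frob K q -> (q * e = d)%N -> (0 < e)%N ->
  exists S', forall (V : vectType K) (f : V -> K), nf q e f -> lowstr d.+1 S (F3 q f) ->
    exists f' g, [/\ forall x, f x = f' x + g x, lowstr d.+1 S' g &
      (forall x, f' x = 0) \/ exists p e', [/\ (1 < p)%N, frob K (q * p), e = (p * e')%N & nf (q * p) e' f']].

Lemma F3_comm (V : lmodType K) q (f : V -> K) v y u : pol f ->
  F3 q f (v, (y, u)) = (tp (fun x => D f x v) u y)`_q.
Proof.
move=> pf; elim: pf q u => [c|l hl|{}f g pf IHf pg IHg|{}f g pf IHf pg IHg] q u.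
- rewrite /F3 /= (_ : (fun u => (tp (fun _ => c) u y)`_q) = fun _ => c%:P`_q); last first.
    by apply: functional_extensionality => x; rewrite (tp_cst Kinf).
  rewrite (D_cst Kinf) (_ : (fun x => D (fun _ => c) x v) = fun _ => 0); last first.
    by apply: functional_extensionality => x; rewrite (D_cst Kinf).
  by rewrite (tp_cst Kinf) coefC if_same.
- rewrite /F3 /= (_ : (fun u => (tp l u y)`_q) = fun u => (q == 0%N)%:R * l u + l y *+ (q == 1%N)); last first.
    apply: functional_extensionality => x; rewrite (tp_lin Kinf) // coefD coefC coefZ coefX.
    by rewrite mulr_natr; case: (q == 0%N); rewrite ?mul1r ?mul0r.
  rewrite (D_add Kinf); [|by apply: pol_scale; apply: pol_lin|exact: pol_cst].
  rewrite (D_cst Kinf) addr0 (D_scale Kinf) ?(D_lin Kinf) //; last exact: pol_lin.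
  rewrite (_ : (fun x => D l x v) = fun _ => l v); last by apply: functional_extensionality => x; rewrite (D_lin Kinf).
  by rewrite (tp_cst Kinf) coefC; case: (q == 0%N); rewrite ?mul1r ?mul0r.
- rewrite (F3_add Kinf) // IHf IHg.
  rewrite (_ : (fun x => D (fun x => f x + g x) x v) = fun x => D f x v + D g x v).
    by rewrite (tp_add Kinf) ?coefD //; apply: pol_D.
  by apply: functional_extensionality => x; rewrite (D_add Kinf).
rewrite (F3_mul Kinf) //=.
rewrite (_ : (fun x => D (fun x => f x * g x) x v) = fun x => f x * D g x v + D f x v * g x).
  have pDf := pol_D Kinf v pf; have pDg := pol_D Kinf v pg.
  rewrite (tp_add Kinf) ?coefD; [|exact: pol_mul|exact: pol_mul].
  rewrite !(tp_mul Kinf) // !coefM -big_split /=; apply: eq_bigr => j _.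
  by rewrite IHf IHg.
by apply: functional_extensionality => x; rewrite (D_mul Kinf).
Qed.

(** The partial derivatives of a normal form with [q > 1] are combinations of [q]-th powers with
    coefficients in [K]. Expanding these in a basis of [K] over its [q]-th powers absorbs them into
    the powers, up to the fixed [eps]. *)
Lemma D_frob_expansion (V : vectType K) q e (f : V -> K) n (eps : 'I_n -> K) : frob K q ->
  (forall c, exists a : 'I_n -> K, c = \sum_i eps i * a i ^+ q) -> nf q e f ->
  exists a : 'I_(\dim {:V}) * 'I_n -> V -> K, (forall k, hom e (a k)) /\
    forall l u, D f u (vb l) = \sum_i eps i * a (l, i) u ^+ q.
Proof.
move=> hq heps hf; have [q1|q1] := leqP q 1.
  have E : q = 1%N by case: hq; lia.
  subst q; have [c ec] := heps 1.
  have h : hom e.+1 f by have := nf_hom hf; rewrite mul1n add1n.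
  exists (fun k u => c k.2 * D f u (vb k.1)); split=> [k|l u].
    by apply: hom_scale; apply: (hom_D Kinf).
  rewrite -[LHS]mul1r [X in X * _]ec mulr_suml; apply: eq_bigr => i _ /=.
  by rewrite !expr1 mulrA.
have [m [l [b [hl hb ef]]]] := hf.
have [c hc] := dchoice (fun p : 'I_m * 'I_(\dim {:V}) => heps (l p.1 (vb p.2))).
exists (fun k u => \sum_j c (j, k.1) k.2 * b j u); split=> [k|j u].
  by apply: hom_sum => j _; apply: hom_scale.
rewrite (nf_D Kinf hq u (vb j) q1 hl hb ef).
under [RHS]eq_bigr => i _ do rewrite (frob_sum _ _ _ hq) mulr_sumr.
rewrite exchange_big /=; apply: eq_bigr => i _; rewrite (hc (i, j)) mulr_suml.
by apply: eq_bigr => k _; rewrite exprMn mulrA.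
Qed.

(* The factors not involving the linear argument [v] cut out the degenerate pairs [(y, u)]. *)
Lemma lowstr_lin_zeros (V : lmodType K) d S (F : V * (V * V) -> K) : lowstr d.+1 S F ->
  (forall p, lin (fun v => F (v, p))) -> exists (T : finType) (a : T -> nat) (G : T -> V * V -> K),
  [/\ (#|T| <= 2 * S)%N, forall t, (1 <= a t <= d)%N /\ hom (a t) (G t) &
    forall p, (forall t, G t p = 0) -> forall v, F (v, p) = 0].
Proof.
move=> hF hl; have [s [a [g [h [sS hgh eF]]]]] := lowstr_factors hF.
have l0 : linm (fun p : V * V => (0 : V, p)) by apply: linm_pair; lm.
exists ('I_s + 'I_s)%type, (fun t => match t with inl i => a i | inr i => (d.+1 - a i)%N end),
  (fun t p => match t with inl i => g i (0, p) | inr i => h i (0, p) end); split.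
- by rewrite card_sum !card_ord; lia.
- move=> [i|i]; have [ai hg hh] := hgh i; split; try lia.
    exact: (hom_linm l0 hg).
  exact: (hom_linm l0 hh).
move=> p hz v; rewrite -(D_lin Kinf 0 v (hl p)).
have -> : (fun v => F (v, p)) = fun v => \sum_i g i (v, p) * h i (v, p).
  by apply: functional_extensionality => x; rewrite eF.
have pg i : pol (fun v => g i (v, p)) by have [_ hg _] := hgh i; exact: (pol_fix2 p (hom_pol hg)).
have ph i : pol (fun v => h i (v, p)) by have [_ _ hh] := hgh i; exact: (pol_fix2 p (hom_pol hh)).
rewrite (D_sum Kinf) => [|i _]; last exact: pol_mul.
rewrite big1 // => i _; rewrite (D_mul Kinf) // (hz (inl i)) (hz (inr i)).
by rewrite mul0r mulr0 addr0.
Qed.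

Lemma pchar_basis : exists n, forall p, p \in [pchar K] -> exists eps : 'I_n -> K,
  forall c, exists a : 'I_n -> K, c = \sum_i eps i * a i ^+ p.
Proof.
have [[p hp]|np] := classic (exists p, p \in [pchar K]); last by exists 0%N => p hp; case: np; exists p.
have [n [eps [h _]]] := frob_basis Kbr (frob_pchar hp).
by exists n => p' hp'; have := pcharf_eq hp p'; rewrite hp' inE => /esym/eqP ->; exists eps.
Qed.

(** The form is a combination of [p]-th powers. Expanding its coefficients in a basis of [K] over
    the [p]-th powers regroups it into as many scaled [p]-th powers as the basis has elements, each
    of which is a product. *)
Lemma flat_lowstr : exists n, forall (V : vectType K) d (h : V -> K), hom d.+1 h -> (forall x v, D h x v = 0) ->
  lowstr d.+1 n h.
Proof.
have [n hn] := pchar_basis; exists n => V d h hh Dh.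
have [h0|[p [j [m [c [g [hp dE hg eh]]]]]]] := hom_zero_derivative Kinf (ltn0Sn d) hh Dh; first exact: lowstr_nil.
have [eps he] := hn p hp; have [a ha] := dchoice (fun k => he (c k)).
have fp := frob_pchar hp; have p1 := prime_gt1 (pcharf_prime hp).
have j0 : (0 < j)%N by move: dE; case: j {hg} => //; rewrite muln0.
pose de i x := \sum_k a k i * g k x.
have hde i : hom j (de i) by apply: hom_sum => k _; apply: hom_scale.
apply: (lowstr_ext (f := fun x => \sum_i de i x * (eps i * de i x ^+ p.-1))) => [|x]; last first.
  rewrite eh; under [RHS]eq_bigr => k _ do rewrite ha mulr_suml.
  rewrite exchange_big /=; apply: eq_bigr => i _.
  rewrite mulrCA -exprS prednK ?(ltnW p1) // (frob_sum _ _ _ fp) mulr_sumr.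
  by apply: eq_bigr => k _; rewrite exprMn mulrA.
apply: (lowstr_sumT (S := 1)); first by rewrite card_ord muln1.
move=> i _; apply: lowstr_prod (hde i) _; first by rewrite dE j0 /=; nia.
apply: hom_scale; have := hom_exp p.-1 (hde i); congr hom.
by rewrite dE -subn1 mulnBr muln1 mulnC.
Qed.

End Weights.

(** * Differentials on a nice zero set *)

Section GenericJacobian.
Variable K : fieldType.
Hypothesis Kinf : infinite_field K.

(** [x0] is a rational zero of [z] at which the differentials of [z] and of as many [al k] as
    possible are independent; [zz] collects these functions, made to vanish at [x0]. By maximality
    the other differentials depend on them at every rational zero where the minor [M] is
    invertible. *)
Lemma generic_jacobian (V : vectType K) (I X : finType) (z : I -> V -> K) (al : X -> V -> K) N :
  (forall i, pol (z i)) -> (forall k, pol (al k)) -> Nice [set: I] z ->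
  (forall s x (k : 'I_s -> X), (forall i, z i x = 0) ->
     (forall c : 'I_s -> K, (forall v, \sum_j c j * D (al (k j)) x v = 0) -> forall j, c j = 0) -> (s < N)%N) ->
  exists n (zz : 'I_n -> V -> K) x0 (w : 'I_n -> V) (u : V -> K) (E : X -> 'I_n -> V -> K),
  [/\ [/\ (n <= #|I| + N)%N, forall i, pol (zz i), forall i, zz i x0 = 0 & forall i j, D (zz i) x0 (w j) = (i == j)%:R],
    forall i, (exists i', zz i =1 z i') \/ (exists k c, forall x, zz i x = al k x - c),
    forall i', exists i, zz i =1 z i', [/\ pol u, u x0 != 0 & forall k i, pol (E k i)] &
    forall k v, ideal [set: I] z (fun x => u x * D (al k) x v - \sum_i E k i x * D (zz i) x v)].
Proof.
move=> pz pal [prz [xs [xs0 xsi]]] hN.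
pose Good s := exists x (k : 'I_s -> X), (forall i, z i x = 0) /\
  forall (c : I -> K) (c' : 'I_s -> K), (forall v, \sum_i c i * D (z i) x v + \sum_j c' j * D (al (k j)) x v = 0) ->
    (forall i, c i = 0) /\ (forall j, c' j = 0).
have G0 : Good 0%N.
  exists xs, (fun i : 'I_0 => match i with Ordinal _ h => False_rect _ (notF h) end).
  split=> [i|c c' h]; first exact: xs0.
  split=> [i|[]//]; apply: (xsi c) => // v; rewrite -[RHS](h v) big_ord0 addr0.
  by apply: eq_bigl => j; rewrite inE.
have GN s : Good s -> (s < N)%N.
  move=> [x [k [zx h]]]; apply: (hN s x k zx) => c hc.
  apply: (h (fun _ => 0) c _).2 => v; rewrite hc addr0 big1 // => i _; by rewrite mul0r.
have [s [[x0 [k [zx0 hi]]] nG]] : exists s, Good s /\ ~ Good s.+1.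
  apply: NNPP => H; suff : Good N by move/GN; rewrite ltnn.
  elim: N {hN GN} => [//|m IH]; apply: NNPP => H'; apply: H; by exists m.
have sN : (s < N)%N by apply: GN; exists x0, k.
pose F (a : I + 'I_s) x := match a with inl i => z i x | inr j => al (k j) x end.
have pF a : pol (F a) by case: a => [i|j]; [exact: pz | exact: pal].
have sumA (c : I + 'I_s -> K) x v : \sum_a c a * D (F a) x v =
   \sum_i c (inl i) * D (z i) x v + \sum_j c (inr j) * D (al (k j)) x v by rewrite big_sumType.
pose A : finType := (I + 'I_s)%type; pose n := #|A|.
pose zz (i : 'I_n) x := F (enum_val i) x - F (enum_val i) x0.
have pzz i : pol (zz i) by apply: pol_sub => //; exact: pol_cst.
have Dzz i x v : D (zz i) x v = D (F (enum_val i)) x v.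
  by rewrite (D_sub Kinf) ?(D_cst Kinf) ?subr0 //; exact: pol_cst.
have sumE (c : 'I_n -> K) x v : \sum_i c i * D (zz i) x v = \sum_(a : A) c (enum_rank a) * D (F a) x v.
  rewrite [RHS](reindex (@enum_val A A)) /=; last exact: onW_bij (enum_val_bij A).
  by apply: eq_bigr => i _; rewrite enum_valK Dzz.
have [|c hc i _|w hw] := @lin_dual K V _ [set: 'I_n] (fun i => D (zz i) x0).
- by move=> i _; apply: D_linr.
- have [|h1 h2] := hi (fun i => c (enum_rank (inl i))) (fun j => c (enum_rank (inr j))).
    move=> v; have := hc v; rewrite (eq_bigl xpredT) => [|j]; last by rewrite inE.
    by rewrite sumE sumA.
  by rewrite -(enum_valK i); case: (enum_val i) => [i'|j].
have {}hw i j : D (zz i) x0 (w j) = (i == j)%:R by apply: hw; rewrite inE.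
pose M x := \matrix_(i, j) D (zz i) x (w j).
have pM i j : pol (fun x => M x i j).
  have -> : (fun x => M x i j) = fun x => D (zz i) x (w j) by apply: functional_extensionality => x; rewrite mxE.
  exact: pol_D.
have M0 : M x0 = 1%:M by apply/matrixP => i j; rewrite !mxE hw.
pose E ka i x := \det (M x) * \sum_j D (al ka) x (w j) * (\adj (M x)) j i.
have pE ka i : pol (E ka i).
  apply: pol_mul; first exact: pol_det.
  by apply: pol_sum => j _; apply: pol_mul; [exact: pol_D | exact: pol_adj].
exists n, zz, x0, w, (fun x => \det (M x) ^+ 2), E; split.
- by split=> //; [rewrite /n card_sum card_ord leq_add2l ltnW | move=> i; rewrite /zz subrr].
- move=> i; rewrite /zz; case: (enum_val i) => [i'|j]; last by right; exists (k j), (al (k j) x0).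
  by left; exists i' => x; rewrite /= zx0 subr0.
- by move=> i'; exists (enum_rank (inl i')) => x; rewrite /zz enum_rankK /= zx0 subr0.
- by split=> //; [apply: pol_exp; exact: pol_det | rewrite M0 det1 expr1n oner_eq0].
(* It is enough to compare at rational zeros of [z]. The squared determinant, and the determinant
   inside [E], make both sides vanish where the minor degenerates. *)
move=> ka v; apply: (prime_vanish prz).
  apply: pol_sub; first by apply: pol_mul; [apply: pol_exp; exact: pol_det | exact: pol_D].
  by apply: pol_sum => i _; apply: pol_mul => //; exact: pol_D.
move=> x zx; have {}zx i : z i x = 0 by apply: zx; rewrite inE.
have [d0|d0] := eqVneq (\det (M x)) 0.
  by rewrite d0 expr0n mul0r sub0r big1 ?oppr0 // => i _; rewrite /E d0 !mul0r.
have uM : M x \in unitmx by rewrite unitmxE unitfE.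
have rowM (la : 'I_n -> K) (rr : 'I_n -> K) : (forall j, \sum_i la i * D (zz i) x (w j) = rr j) ->
    forall i, la i = \sum_j rr j * invmx (M x) j i.
  move=> h i; have := congr1 (fun B : 'rV_n => B 0 i) (mulmxK uM (\row_i la i)); rewrite !mxE => <-.
  apply: eq_bigr => j _; congr (_ * _); rewrite -h !mxE; apply: eq_bigr => l _; by rewrite !mxE.
suff key : D (al ka) x v = \sum_i (\sum_j D (al ka) x (w j) * invmx (M x) j i) * D (zz i) x v.
  rewrite key mulr_sumr -sumrB big1 // => i _; apply/eqP; rewrite subr_eq0 /E mulrA; apply/eqP; congr (_ * _).
  rewrite expr2 -mulrA; congr (_ * _); rewrite mulr_sumr; apply: eq_bigr => j _.
  by rewrite /invmx uM mxE mulrCA; congr (_ * _); rewrite mulrA mulfV // mul1r.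
apply: NNPP => nkey; apply: nG.
exists x, (fun i : 'I_s.+1 => if unlift ord0 i is Some j then k j else ka); split=> // c c' hc.
have hc' y : \sum_i c i * D (z i) x y + (c' ord0 * D (al ka) x y + \sum_j c' (lift ord0 j) * D (al (k j)) x y) = 0.
  rewrite -[RHS](hc y) big_ord_recl unlift_none; congr (_ + (_ + _)).
  by apply: eq_bigr => j _; rewrite liftK.
pose mu (i : 'I_n) := match enum_val i with inl i' => c i' | inr j => c' (lift ord0 j) end.
have hmu y : \sum_i mu i * D (zz i) x y = - (c' ord0 * D (al ka) x y).
  rewrite sumE sumA; apply/eqP; rewrite -addr_eq0 -addrA [X in _ + X]addrC.
  by rewrite -[X in _ == X](hc' y); apply/eqP; congr (_ + (_ + _)); apply: eq_bigr => i _; rewrite /mu enum_rankK.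
have c0 : c' ord0 = 0.
  apply/eqP; apply: contraT => c0; case: nkey.
  have hla y : \sum_i (- (mu i / c' ord0)) * D (zz i) x y = D (al ka) x y.
    apply: (mulfI c0); rewrite mulr_sumr -[RHS]opprK -hmu -sumrN; apply: eq_bigr => i _.
    by rewrite mulNr mulrN mulrA [c' ord0 * _]mulrC divfK.
  rewrite -{1}hla; apply: eq_bigr => i _; congr (_ * _).
  exact: (rowM (fun i => - (mu i / c' ord0)) (fun j => D (al ka) x (w j)) (fun j => hla (w j)) i).
have mu0 i : mu i = 0.
  rewrite (rowM mu (fun _ => 0)); first by rewrite big1 // => j _; rewrite mul0r.
  by move=> j; rewrite hmu c0 mul0r oppr0.
split=> [i|j]; first by have := mu0 (enum_rank (inl i)); rewrite /mu enum_rankK.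
case: (unliftP ord0 j) => [j' ->|-> //].
by have := mu0 (enum_rank (inr j')); rewrite /mu enum_rankK.
Qed.

End GenericJacobian.

(** * Splitting along a formal section *)

Section SplitLocal.
Variable K : fieldType.
Hypothesis Kinf : infinite_field K.

Lemma nf_one (V : lmodType K) q e (l a : V -> K) : lin l -> hom e a -> nf q e (fun x => l x * a x ^+ q).
Proof. by move=> hl ha; exists 1%N, (fun _ => l), (fun _ => a); split=> // x; rewrite big_ord1. Qed.

Lemma flat_nf (V : vectType K) q e (T : finType) (l c : T -> V -> K) : frob K q -> (0 < e)%N ->
  (forall t, lin (l t)) -> (forall t, hom e (c t)) -> (forall t x v, D (c t) x v = 0) ->
  (forall x, \sum_t l t x * c t x ^+ q = 0) \/
  exists p e', [/\ (1 < p)%N, frob K (q * p), e = (p * e')%N & nf (q * p) e' (fun x => \sum_t l t x * c t x ^+ q)].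
Proof.
move=> hq e0 hl hc Dc.
have [c0|nc0] := classic (forall t x, c t x = 0).
  by left=> x; rewrite big1 // => t _; rewrite c0 frob0 // mulr0.
have [t0 nt0] : exists t, ~ forall x, c t x = 0.
  by apply: NNPP => h; apply: nc0 => t; apply: NNPP => h'; apply: h; exists t.
right; have [//|[p [e' [_ [_ [_ [hp eE _ _]]]]]]] := hom_zero_derivative Kinf e0 (hc t0) (Dc t0).
have p1 := prime_gt1 (pcharf_prime hp); have fp := frob_pchar hp.
exists p, e'; split=> //; first exact: frob_mul.
apply: nf_sum => t _.
have [ct0|[p' [j [m [cc [g [hp' eE' hg ec]]]]]]] := hom_zero_derivative Kinf e0 (hc t) (Dc t).
  have -> : (fun x => l t x * c t x ^+ q) = fun _ => 0.
    by apply: functional_extensionality => x; rewrite ct0 frob0 // mulr0.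
  exact: nf_zero.
have E : p' = p by have := pcharf_eq hp p'; rewrite hp' inE => /esym/eqP.
subst p'; have Ej : j = e' by apply/eqP; rewrite -(eqn_pmul2l (ltnW p1)) -eE' -eE.
subst j.
have -> : (fun x => l t x * c t x ^+ q) = fun x => \sum_k cc k ^+ q * (l t x * g k x ^+ (q * p)).
  apply: functional_extensionality => x; rewrite ec (frob_sum _ _ _ hq) mulr_sumr; apply: eq_bigr => k _.
  by rewrite exprMn mulrCA mulnC exprM.
by apply: nf_sum => k _; apply: nf_scale; apply: nf_one.
Qed.

Lemma comp_frob (V : lmodType K) q e (b : V -> K) x : frob K q -> pol b ->
  comp (q * e) (fun x => b x ^+ q) x = comp e b x ^+ q.
Proof.
move=> hq pb; rewrite /comp (tp_exp Kinf) // coef_frob // dvdn_mulr // mulKn //; exact: proj1 hq.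
Qed.

Lemma imod_linm_ord (V X : vectType K) n (P : 'I_n -> V -> K) k g (s : X -> V) : polm s -> s 0 = 0 -> imod k P g ->
  (forall i, ord k (fun x => P i (s x))) -> ord k (fun x => g (s x)).
Proof.
move=> ps s0 [r [pr hr]] hP.
have h2 : ord k (fun x => \sum_i r i (s x) * P i (s x)).
  by apply: (ord_sum Kinf) => i _; apply: (ord_mul_l Kinf) => //; apply: pol_comp.
apply: (ord_ext (ord_add Kinf (ord_comp Kinf ps s0 hr) h2)) => x.
by rewrite subrK.
Qed.

(* Taylor expansion at [x0] along the formal section [s] of the common zeros of the [zz i]: the functions
[al k] become flat along [s], and the derivatives of [f] are determined by them. *)
Lemma local_split (V : vectType K) d q e n0 (eps : 'I_n0 -> K) (f : V -> K) (al : 'I_(\dim {:V}) * 'I_n0 -> V -> K)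
    (I : finType) (z : I -> V -> K) n (zz : 'I_n -> V -> K) x0 (w : 'I_n -> V) (u : V -> K)
    (E : 'I_(\dim {:V}) * 'I_n0 -> 'I_n -> V -> K) nfl :
  frob K q -> (q * e = d)%N -> (0 < e)%N -> hom d.+1 f -> (forall k, hom e (al k)) ->
  (forall l u, D f u (vb l) = \sum_i eps i * al (l, i) u ^+ q) ->
  (forall i, pol (zz i)) -> (forall i, zz i x0 = 0) -> (forall i j, D (zz i) x0 (w j) = (i == j)%:R) ->
  (forall i x, comp d.+1 (fun xi => zz i (x0 + xi)) x = 0) ->
  (forall i', exists i, zz i =1 z i') -> pol u -> u x0 != 0 -> (forall k i, pol (E k i)) ->
  (forall k v, ideal [set: I] z (fun x => u x * D (al k) x v - \sum_i E k i x * D (zz i) x v)) ->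
  (forall h : V -> K, hom d.+1 h -> (forall x v, D h x v = 0) -> lowstr d.+1 nfl h) ->
  exists f' g, [/\ forall x, f x = f' x + g x, lowstr d.+1 (nfl + n * d) g &
      (forall x, f' x = 0) \/ exists p e', [/\ (1 < p)%N, frob K (q * p), e = (p * e')%N & nf (q * p) e' f']].
Proof.
move=> hq qe e0 hf hal fE pzz zz0 zzw zzd zzz pu u0 pE hE hfl.
have q0 := proj1 hq; have pf := hom_pol hf; have pal k := hom_pol (hal k).
pose P i xi := zz i (x0 + xi).
have pP i : pol (P i) by apply: pol_shift.
have P0 i : P i 0 = 0 by rewrite /P addr0 zz0.
have Pw i j : D (P i) 0 (w j) = (i == j)%:R by rewrite -zzw /P (D_shift Kinf) // addr0.
have [s [ps s0 hs hsg]] := local_section Kinf d.+2 pP P0 Pw.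
pose sg xi := x0 + s xi.
have psg : polm sg by apply: polm_add => //; exact: polm_cst.
pose ds xi eta := \sum_l D (fun xi => co l (s xi)) xi eta *: vb l.
have pcs l : pol (fun xi => co l (s xi)) by apply: ps; apply: lin_co.
have Dsg (g : V -> K) xi eta : pol g -> D (fun xi => g (sg xi)) xi eta =
    \sum_l D (fun xi => co l (s xi)) xi eta * D g (sg xi) (vb l).
  move=> pg; rewrite (D_comp Kinf (ds := ds) psg pg).
    by rewrite (lin_sum _ _ _ (D_linr Kinf (sg xi) pg)); apply: eq_bigr => l _; rewrite (linZ _ _ (D_linr Kinf (sg xi) pg)).
  move=> l hl; rewrite (_ : (fun xi => l (sg xi)) = fun xi => l x0 + \sum_m co m (s xi) * l (vb m)); last first.
    by apply: functional_extensionality => y; rewrite /sg linD // -lin_vb.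
  have pp m : pol (fun xi => co m (s xi) * l (vb m)) by apply: pol_mul => //; apply: pol_cst.
  rewrite (D_add Kinf) ?(D_cst Kinf) ?add0r; [|exact: pol_cst|by apply: pol_sum].
  rewrite (D_sum Kinf) // (lin_sum _ _ _ hl); apply: eq_bigr => m _.
  by rewrite (linZ _ _ hl) (D_mul Kinf) // ?(D_cst Kinf) ?mulr0 ?add0r //; exact: pol_cst.
pose be k xi := al k (sg xi).
have pbe k : pol (be k) by apply: pol_comp.
(* The derivative of [al k] is, up to the unit [u] and the ideal of [z], a combination of the
   derivatives of the [zz i], and the [zz i] vanish to high order along the section. *)
have Dbe k eta : ord d.+1 (fun xi => D (be k) xi eta).
  apply: (@ord_unit K Kinf V _ (fun xi => u (sg xi))); rewrite ?/sg ?s0 ?addr0 //; try exact: pol_comp.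
    exact: pol_D.
  pose R l xi := u (sg xi) * D (al k) (sg xi) (vb l) - \sum_i E k i (sg xi) * D (zz i) (sg xi) (vb l).
  have oR l : ord d.+1 (R l).
    have [r [pr er]] := ideal_linm psg (hE k (vb l)).
    apply: (ord_ext (f := fun xi => \sum_(i in [set: I]) r i xi * z i (sg xi))) => [|xi]; last by rewrite /R er.
    apply: (ord_sum Kinf) => i' _; apply: (ord_mul_l Kinf) => //; have [i zi] := zzz i'.
    by apply: (ord_ext (ord_leq (leqnSn _) (hs i))) => xi; rewrite /P zi.
  have oP i : ord d.+1 (fun xi => E k i (sg xi) * D (fun xi => zz i (sg xi)) xi eta).
    by apply: (ord_mul_l Kinf); [apply: pol_comp | apply: (ord_D Kinf); apply: hs].
  apply: (ord_ext (f := fun xi => \sum_l D (fun xi => co l (s xi)) xi eta * R l xi +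
     \sum_i E k i (sg xi) * D (fun xi => zz i (sg xi)) xi eta)) => [|xi].
    apply: (ord_add Kinf); apply: (ord_sum Kinf) => // l _; apply: (ord_mul_l Kinf) => //; exact: pol_D.
  rewrite (Dsg (al k)) // /R; under eq_bigr do rewrite mulrBr; rewrite sumrB -addrA.
  rewrite mulr_sumr; under eq_bigr do rewrite mulrCA.
  rewrite -[RHS]addr0; congr (_ + _); apply/eqP; rewrite addrC subr_eq0; apply/eqP.
  under [RHS]eq_bigr do rewrite mulr_sumr; rewrite exchange_big; apply: eq_bigr => i _.
  by rewrite (Dsg (zz i)) // mulr_sumr; apply: eq_bigr => l _; rewrite mulrCA.
have cflat k j xi eta : (j <= d.+1)%N -> D (comp j (be k)) xi eta = 0.
  case: j => [|j] jd; first by apply: (hom0_D Kinf); apply: (hom_comp Kinf).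
  by rewrite (D_comp_comm Kinf) //; apply: (proj2 (Dbe k eta)).
(* [be k] is flat only up to order [d.+1]; its truncation is flat exactly. *)
pose b k xi := \sum_(j < d.+1) comp j (be k) xi.
have pcb k j : pol (comp j (be k)) by exact: (pol_comp_i Kinf j (pbe k)).
have pb k : pol (b k) by apply: pol_sum.
have Db k xi eta : D (b k) xi eta = 0.
  by rewrite (D_sum Kinf) // big1 // => j _; apply: cflat; apply: ltnW; apply: ltn_ord.
have bord k : ord d.+1 (fun xi => be k xi - b k xi).
  split=> [|i xi id]; first exact: pol_sub.
  rewrite (comp_sub Kinf) // (comp_sum Kinf) // (bigD1 (Ordinal id)) //= (comp_comp Kinf) //.
  rewrite big1 ?addr0 ?subrr // => j ji; apply: (comp_neq Kinf _ (hom_comp Kinf j (pbe k))).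
  by apply: contraNneq ji => E'; apply/eqP/val_inj.
have cb k xi : comp e (b k) xi = comp e (be k) xi.
  have ed : (e < d.+1)%N by rewrite -qe ltnS leq_pmull.
  by have := proj2 (bord k) e xi ed; rewrite (comp_sub Kinf) // => /eqP; rewrite subr_eq0 => /eqP.
pose Bs l xi := \sum_i eps i * b (l, i) xi ^+ q.
have pBs l : pol (Bs l) by apply: pol_sum => i _; apply: pol_scale; apply: pol_exp.
have DBs l xi eta : D (Bs l) xi eta = 0.
  rewrite (D_sum Kinf) => [|i _]; last by apply: pol_scale; apply: pol_exp.
  rewrite big1 // => i _; rewrite (D_scale Kinf); last exact: pol_exp.
  by rewrite (D_exp Kinf) // Db !mulr0.
have pcB l : pol (fun xi => co l xi * Bs l xi) by apply: pol_mul => //; apply: pol_lin; apply: lin_co.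
(* The [Bs l] are flat, so [sum co l * Bs l] has derivative [Bs l] along [vb l], as [f] has modulo
   [P]. Subtracting it leaves a function whose derivatives vanish along the section. *)
pose fh xi := f (x0 + xi) - \sum_l co l xi * Bs l xi.
have pfh : pol fh by apply: pol_sub; [exact: pol_shift | exact: pol_sum].
have Dfh l : imod d.+1 P (fun xi => D fh xi (vb l)).
  have h i : imod d.+1 P (fun xi => al (l, i) (x0 + xi) - b (l, i) xi).
    have h1 := imod_leq (leqnSn _) (hsg (fun xi => al (l, i) (x0 + xi)) (pol_shift x0 (pal (l, i)))).
    have h2 := imod_add Kinf h1 (imod_ord P (bord (l, i))).
    by apply: imod_ext h2 _ => xi; rewrite /be /sg /= addrA subrK.
  apply: (imod_ext (f := fun xi => \sum_i (eps i * (al (l, i) (x0 + xi) - b (l, i) xi) ^+ q.-1) *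
     (al (l, i) (x0 + xi) - b (l, i) xi))) => [|xi].
    apply: (imod_sum Kinf) => i _; apply: (imod_mul Kinf) => //; apply: pol_scale; apply: pol_exp.
    by apply: pol_sub => //; apply: pol_shift.
  rewrite (D_sub Kinf); [|exact: pol_shift|exact: pol_sum].
  rewrite (D_shift Kinf) // fE (D_sum Kinf) //.
  have -> : \sum_m D (fun xi => co m xi * Bs m xi) xi (vb l) = Bs l xi.
    rewrite (bigD1 l) //= big1 ?addr0 => [|m ml]; rewrite (D_mul Kinf) //; try (by apply: pol_lin; apply: lin_co);
      rewrite DBs mulr0 add0r (D_lin Kinf) ?co_vb; try exact: lin_co.
      by rewrite eqxx mul1r.
    by rewrite (negPf ml) mul0r.
  rewrite -sumrB; apply: eq_bigr => i _; rewrite -mulrBr -frobB // -mulrA; congr (_ * _).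
  by rewrite -exprSr prednK.
pose fs xi := fh (s xi).
have pfs : pol fs by apply: pol_comp.
(* Pulled back along the section, [fh] has derivatives of order [d.+1], so its component of degree
   [d.+1] has zero differential. *)
have flat xi eta : D (comp d.+1 fs) xi eta = 0.
  rewrite (D_comp_comm Kinf) //.
  suff [_ -> //] : ord d.+1 (fun xi => D fs xi eta).
  apply: (ord_ext (f := fun xi => \sum_l D (fun xi => co l (s xi)) xi eta * D fh (s xi) (vb l))) => [|y].
    apply: (ord_sum Kinf) => l _; apply: (ord_mul_l Kinf); first exact: pol_D.
    by apply: (imod_linm_ord ps s0 (Dfh l)) => i; apply: ord_leq (leqnSn _) (hs i).
  rewrite /fs (D_comp Kinf (ds := ds) ps pfh).
    by rewrite (lin_sum _ _ _ (D_linr Kinf (s y) pfh)); apply: eq_bigr => l _; rewrite (linZ _ _ (D_linr Kinf (s y) pfh)).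
  move=> l hl; rewrite (_ : (fun xi => l (s xi)) = fun xi => \sum_m co m (s xi) * l (vb m)); last first.
    by apply: functional_extensionality => y'; rewrite -lin_vb.
  have pp m : pol (fun xi => co m (s xi) * l (vb m)) by apply: pol_mul => //; apply: pol_cst.
  rewrite (D_sum Kinf) // (lin_sum _ _ _ hl); apply: eq_bigr => m _.
  by rewrite (linZ _ _ hl) (D_mul Kinf) // ?(D_cst Kinf) ?mulr0 ?add0r //; exact: pol_cst.
have [r [pr hr]] := hsg fh pfh.
pose f' xi := \sum_(t : 'I_(\dim {:V}) * 'I_n0) (eps t.2 * co t.1 xi) * comp e (be t) xi ^+ q.
have cB xi : comp d.+1 (fun xi => \sum_l co l xi * Bs l xi) xi = f' xi.
  rewrite (comp_sum Kinf) // /f'; transitivity (\sum_l \sum_i eps i * co l xi * comp e (be (l, i)) xi ^+ q).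
    2: by rewrite pair_big; apply: eq_bigr => -[].
  apply: eq_bigr => l _; have hl : hom 1 (@co K V l) by apply: hom_lin; exact: lin_co.
  rewrite (comp_mul Kinf) //; last exact: hom_pol hl.
  rewrite (bigD1 (Ordinal (isT : (1 < d.+2)%N))) //= big1 ?addr0 => [|j j1].
    rewrite (comp_id Kinf _ hl) subSS subn0 (comp_sum Kinf) => [|i _]; last by apply: pol_scale; apply: pol_exp.
    rewrite mulr_sumr; apply: eq_bigr => i _; rewrite (comp_scale Kinf); last exact: pol_exp.
    by rewrite -[in X in comp X]qe comp_frob // cb mulrCA mulrA.
  by rewrite (comp_neq Kinf _ hl) ?mul0r //; apply: contraNneq j1 => E'; apply/eqP/val_inj.
(* In degree [d.+1], [f] is [f'] plus a flat form plus the part coming from the ideal of [P]. Each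
   of the [n] generators gives only [d] products there, because it has no component of degree 0 or
   [d.+1]. *)
exists f', (fun xi => comp d.+1 fs xi + \sum_a comp d.+1 (fun xi => r a xi * P a xi) xi); split.
- move=> xi; have prP a : pol (fun xi => r a xi * P a xi) by apply: pol_mul.
  have := proj2 hr d.+1 xi (ltnSn _).
  rewrite (comp_sub Kinf); [|by apply: pol_sub|by apply: pol_sum].
  rewrite (comp_sub Kinf) // (comp_sum Kinf) // => /eqP; rewrite subr_eq0 subr_eq addrC => /eqP <-.
  rewrite /fh (comp_sub Kinf); [|exact: pol_shift|exact: pol_sum].
  by rewrite cB addrC subrK (comp_shift Kinf _ _ _ hf) leqnn subnn tp_coef0.
- apply: lowstr_add; first by apply: hfl => //; apply: (hom_comp Kinf).
  apply: (lowstr_sumT (S := d)) => [|a _]; first by rewrite card_ord.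
  apply: (lowstr_ext (f := fun xi => \sum_(j < d) comp j.+1 (r a) xi * comp (d.+1 - j.+1) (P a) xi)) => [|xi].
    apply: (lowstr_sumT (S := 1)) => [|j _]; first by rewrite card_ord muln1.
    have jd : (0 < j.+1 < d.+1)%N by have := ltn_ord j; lia.
    by apply: (lowstr_prod jd); apply: (hom_comp Kinf).
  rewrite (comp_mul Kinf) // big_ord_recl big_ord_recr /= subnn [comp 0 (P a) _]comp0 // P0 mulr0 addr0.
  by rewrite zzd mulr0 add0r.
apply: (flat_nf (T := ('I_(\dim {:V}) * 'I_n0)%type) (l := fun t xi => eps t.2 * co t.1 xi)) => //.
- by move=> t a x y; rewrite lin_co mulrDr mulrCA.
- by move=> t; apply: (hom_comp Kinf).
by move=> t x v; apply: cflat; rewrite -qe leqW // leq_pmull.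
Qed.

End SplitLocal.

(** * Splitting normal forms with degenerate polarization *)

Section SplitMain.
Variable K : fieldType.
Hypothesis Kinf : infinite_field K.
Hypothesis Kbr : brauer_field K.

(* On the zeros of the factors of [F3] free of [v] and [y], the differentials of the [al k] have bounded rank. *)
Lemma rank_bound (V : vectType K) d q n0 (eps : 'I_n0 -> K) (f : V -> K) (al : 'I_(\dim {:V}) * 'I_n0 -> V -> K)
    (T : finType) (a : T -> nat) (G : T -> V * V -> K) S Nz x s (k : 'I_s -> 'I_(\dim {:V}) * 'I_n0) :
  frob K q -> pol f -> (forall k, pol (al k)) -> (forall l u, D f u (vb l) = \sum_i eps i * al (l, i) u ^+ q) ->
  (forall a : 'I_n0 -> K, \sum_i eps i * a i ^+ q = 0 -> forall i, a i = 0) ->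
  zeroableL K d (S * d) 1 Nz -> (#|T| <= S)%N -> (forall t, (1 <= a t <= d)%N /\ hom (a t) (G t)) ->
  (forall p, (forall t, G t p = 0) -> forall v, F3 q f (v, p) = 0) -> (forall t, G t (0, x) = 0) ->
  (forall c : 'I_s -> K, (forall v, \sum_j c j * D (al (k j)) x v = 0) -> forall j, c j = 0) -> (s < Nz)%N.
Proof.
move=> hq pf pal fE heps hz hT hG hF3 Gx hk; rewrite ltnNge; apply/negP => sN.
have [|c hc i _|v hv] := @lin_dual K V _ [set: 'I_s] (fun j => D (al (k j)) x).
- by move=> i _; apply: D_linr.
- by apply: hk => v; rewrite -[RHS](hc v); apply: eq_bigl => j; rewrite inE.
have pG t : pol (fun y => G t (y, x)) := pol_fix2 x (hom_pol (hG t).2).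
(* As functions of [y] the [G t] have no constant term at [x] and degree at most [d], which leaves
   at most [S * d] forms on a space of dimension [s >= Nz]. *)
have [|||y [iy hy]] := hz 'rV[K]_s _ (T * 'I_d)%type (fun p b => comp p.2.+1 (fun y => G p.1 (y, x)) (comb v b)).
- by rewrite dim_rV.
- by rewrite card_prod card_ord leq_mul2r hT orbT.
- move=> [t j] /=; exists j.+1; split; first exact: ltn_ord.
  by apply: (hom_linm (linm_comb v)); apply: (hom_comp Kinf).
pose y0 := y ord0.
have y00 : y0 != 0.
  apply: contraTneq (oner_neq0 K) => y0E; have := iy (const_mx 1); rewrite /comb big_ord1 -/y0 y0E scaler0.
  by move=> /(_ erefl)/matrixP/(_ 0 0); rewrite !mxE => ->; rewrite eqxx.
have G0 t : G t (comb v y0, x) = 0.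
  have [N [hN1 hN2]] := comp_bound Kinf (pG t).
  rewrite (hN2 (maxn N d.+1) _ (leq_maxl _ _)) big1 // => -[[|j] jM] _ /=; first by rewrite comp0 // Gx.
  have [jd|jd] := ltnP j d.
    have := hy (t, Ordinal jd) (const_mx 1); rewrite /comb big_ord1 mxE scale1r -/y0 => <- //.
  rewrite /comp tp_fix2 //; last exact: hom_pol (hG t).2.
  have [/andP[_ ad] ht] := hG t.
  rewrite (@tc_excess K Kinf (V * V)%type (a t)) //=; lia.
(* At this degenerate pair the polarization is [sum eps_i] times [q]-th powers of the derivatives of
   [al (l, i)]. Independence of [eps] makes each derivative vanish, although [y0] is a nonzero
   combination of vectors dual to them. *)
have D0 l i : D (al (l, i)) x (comb v y0) = 0.
  have h := hF3 (comb v y0, x) G0 (vb l).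
  have E : \sum_i eps i * D (al (l, i)) x (comb v y0) ^+ q = 0.
    rewrite -[RHS]h (F3_comm Kinf) // (_ : (fun x => D f x (vb l)) = fun x => \sum_i eps i * al (l, i) x ^+ q).
      rewrite (tp_sum Kinf) => [|j _]; last by apply: pol_scale; apply: pol_exp.
      rewrite coef_sum; apply: eq_bigr => j _; rewrite (tp_scale Kinf) ?coefZ; last exact: pol_exp.
      by rewrite (tp_exp Kinf) // coef_frob // dvdnn divnn (proj1 hq).
    by apply: functional_extensionality => y1; rewrite fE.
  exact: heps E i.
case/eqP: y00; apply/rowP => j; rewrite mxE; have := D0 (k j).1 (k j).2; rewrite -surjective_pairing.
rewrite /comb (lin_sum _ _ _ (D_linr Kinf x (pal (k j)))) (bigD1 j) //= (linZ _ _ (D_linr Kinf x (pal (k j)))).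
rewrite hv ?inE // eqxx mulr1 big1 ?addr0 // => i ij.
by rewrite (linZ _ _ (D_linr Kinf x (pal (k j)))) hv ?inE // eq_sym (negPf ij) mulr0.
Qed.

(** The factors are used at [y = 0], where they are at most [2 * S] forms of degree at most [d] on
    [V]. They vanish on the common zeros of the strong normal forms [z] generating them, and these
    are nice by hypothesis. *)
Theorem split_nf_of d : strong_nice K d -> nf_regular K d -> split_nf K d.
Proof.
move=> hT hR q e S hq qe e0.
have [n0 [eps [heps ieps]]] := frob_basis Kbr hq.
have [G hG] := dchoice (nice_nf Kinf Kbr hT).
have [N' hN'] := hR G (2 * S)%N.
have [Nz hNz] := zeroableL_exists Kinf Kbr d (2 * S * d) 1.
have [nfl hfl] := flat_lowstr Kinf Kbr.
exists (nfl + (N' + Nz) * d)%N => V f hf hl.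
have hfd : hom d.+1 f by have := nf_hom hf; rewrite qe add1n.
have pf := hom_pol hfd.
have [al [hal fE]] := D_frob_expansion Kinf hq heps hf.
have [T [a [GG [hT1 hGG hz]]]] := lowstr_lin_zeros Kinf hl (fun p => F3_lin Kinf q p.1 p.2 pf).
have [|I' [q' [e' [z [hI' hz' hsz halg]]]]] := hN' V T a (fun t u => GG t (0, u)) hT1 (fun t => proj1 (hGG t)).
  by move=> t; apply: (hom_linm (s := fun u : V => (0, u)) _ (hGG t).2); apply: linm_pair; lm.
have nz i : nf (q' i) (e' i) (z i) by case: (hz' i).
have Nz0 : Nice [set: I'] z.
  apply: (Nice_ext (P := fun i v => z i v - 0)) => [i _ x|]; first by rewrite subr0.
  apply: (hG #|I'| V I' _ q' e' z (leqnn _)) => // i; case: (hz' i) => // _ h _; exact: ltnW.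
have pz i : pol (z i) := hom_pol (nf_hom (nz i)).
have z0 i : z i 0 = 0 by apply: (hom_at0 (nf_hom (nz i))).
have hrank s x (k : 'I_s -> 'I_(\dim {:V}) * 'I_n0) : (forall i, z i x = 0) ->
    (forall c : 'I_s -> K, (forall v, \sum_j c j * D (al (k j)) x v = 0) -> forall j, c j = 0) -> (s < Nz)%N.
  move=> zx; apply: (rank_bound hq pf (fun k => hom_pol (hal k)) fE ieps hNz hT1 hGG hz) => t.
  have := ideal_vanish (alg_ideal pz z0 (halg t)) (fun i _ => zx i).
  rewrite (hom_at0 (hGG t).2) ?subr0 //; by case/andP: (hGG t).1.
have [n [zz [x0 [w [u [E [[hn pzz zz0 zzw] zzc zzz [pu u0 pE] hE]]]]]]] := generic_jacobian Kinf pz (fun k => hom_pol (hal k)) Nz0 hrank.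
have zzd i x : comp d.+1 (fun xi => zz i (x0 + xi)) x = 0.
  case: (zzc i) => [[i' ei]|[k [c ei]]].
    rewrite (_ : (fun xi => zz i (x0 + xi)) = fun xi => z i' (x0 + xi)); last first.
      by apply: functional_extensionality => xi; rewrite ei.
    by rewrite (comp_shift Kinf _ _ _ (nf_hom (nz i'))); case: (hz' i') => _ h _; rewrite leqNgt ltnS add1n h.
  rewrite (_ : (fun xi => zz i (x0 + xi)) = fun xi => al k (x0 + xi) - c); last first.
    by apply: functional_extensionality => xi; rewrite ei.
  rewrite (comp_sub Kinf); [|exact: (pol_shift x0 (hom_pol (hal k)))|exact: pol_cst].
  rewrite (comp_neq Kinf _ (hom_cst V c)) // subr0 (comp_shift Kinf _ _ _ (hal k)).
  have ed : (e <= d)%N by rewrite -qe leq_pmull // (proj1 hq).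
  by rewrite leqNgt ltnS ed.
have [f' [g [ef hg hf']]] := local_split Kinf hq qe e0 hfd hal fE pzz zz0 zzw zzd zzz pu u0 pE hE (hfl V d).
exists f', g; split=> //; apply: lowstr_leq hg; rewrite leq_add2l leq_mul2r; apply/orP; right.
by apply: leq_trans hn _; rewrite leq_add2r.
Qed.

End SplitMain.

(** * Regularization *)

Section Regularize.
Variable K : fieldType.
Hypothesis Kinf : infinite_field K.

Section Alg.
Variables (V : lmodType K) (I : Type) (w : I -> nat) (z : I -> V -> K).

Lemma alg_ext e f g : alg w z e f -> f =1 g -> alg w z e g.
Proof. by move=> h /functional_extensionality <-. Qed.

Lemma alg_leq e e' f : (e <= e')%N -> alg w z e f -> alg w z e' f.
Proof.
move=> ee h; elim: h e' ee => [{}e {}f c fc|{}e {}f i wi fz|{}e {}f g h _ IHf _ IHg eh|{}e a b {}f g h hf _ hg _ ab eh] e' ee.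
- exact: alg_cst fc.
- exact: alg_gen (leq_trans wi ee) fz.
- exact: alg_add (IHf _ ee) (IHg _ ee) eh.
exact: alg_mul hf hg (leq_trans ab ee) eh.
Qed.

Lemma alg_scale e c f : alg w z e f -> alg w z e (fun x => c * f x).
Proof. by move=> h; apply: (alg_mul (a := 0) (b := e) (f := fun _ => c) (g := f)) => //; apply: (alg_cst _ _ _ (c := c)). Qed.

Lemma alg_sum e (T : Type) (r : seq T) (Q : pred T) (F : T -> V -> K) : (forall t, Q t -> alg w z e (F t)) ->
  alg w z e (fun x => \sum_(t <- r | Q t) F t x).
Proof.
move=> h; elim: r => [|t r IH]; first by apply: (alg_cst _ _ _ (c := 0)) => x; rewrite big_nil.
case Qt: (Q t); last by apply: (alg_ext IH) => x; rewrite big_cons Qt.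
by apply: (alg_add (h t Qt) IH) => x; rewrite big_cons Qt.
Qed.

End Alg.

Lemma alg_trans (V : lmodType K) (I I' : Type) (w : I -> nat) (z : I -> V -> K) (w' : I' -> nat) (z' : I' -> V -> K) e f :
  (forall i, alg w' z' (w i) (z i)) -> alg w z e f -> alg w' z' e f.
Proof.
move=> hz; elim=> [{}e {}f c fc|{}e {}f i wi fz|{}e {}f g h _ IHf _ IHg eh|{}e a b {}f g h _ IHf _ IHg ab eh].
- exact: alg_cst fc.
- by apply: alg_ext (alg_leq wi (hz i)) _ => x; rewrite fz.
- exact: alg_add IHf IHg eh.
exact: alg_mul IHf IHg ab eh.
Qed.

Lemma alg_solve (V : lmodType K) (T I : finType) (wt : T -> nat) (zt : T -> V -> K) (w : I -> nat) (z : I -> V -> K)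
    (c : T -> K) t0 r : c t0 != 0 -> (forall t, c t != 0 -> wt t = wt t0) -> (forall x, \sum_t c t * zt t x = r x) ->
  alg w z (wt t0) r -> (forall t, t != t0 -> alg w z (wt t) (zt t)) -> alg w z (wt t0) (zt t0).
Proof.
move=> c0 hc hr ar az.
apply: (alg_ext (f := fun x => (c t0)^-1 * (r x + (-1) * \sum_(t | t != t0) c t * zt t x))) => [|x].
  apply: alg_scale; apply: (alg_add (f := r) ar (g := fun x => -1 * \sum_(t | t != t0) c t * zt t x)) => //; apply: alg_scale.
  apply: alg_sum => t tt; have [E|ct] := eqVneq (c t) 0.
    by apply: (alg_cst _ _ _ (c := 0)) => x; rewrite E mul0r.
  by apply: alg_scale; rewrite -(hc t ct); apply: az.
by rewrite -hr (bigD1 t0) //= mulN1r addrK mulrA mulVf // mul1r.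
Qed.

(* Lexicographic: a form of higher degree, or of the same degree and smaller Frobenius exponent, has higher
level. *)
Definition lev (D q e : nat) : nat := (if e == 0 then 0 else (1 + q * e) * D.+1 - q)%N.

Definition nfl (V : lmodType K) D L (I : Type) (q e : I -> nat) (z : I -> V -> K) :=
  forall i, [/\ frob K (q i), (q i * e i < D)%N, (lev D (q i) (e i) < L)%N & nf (q i) (e i) (z i)].

Notation wt q e := (fun i => 1 + q i * e i)%N.

Definition degenerate (V : lmodType K) S (T : finType) (q e : T -> nat) (z : T -> V -> K) :=
  (exists q' e' (c : T -> K), [/\ (0 < e')%N, forall t, c t != 0 -> q t = q' /\ e t = e', exists t, c t != 0 &
    lowstr (1 + q' * e') S (fun p => \sum_t c t * F3 q' (z t) p)]) \/
  (exists c : T -> K, [/\ forall t, c t != 0 -> e t = 0%N, exists t, c t != 0 & forall x, \sum_t c t * z t x = 0]).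

Lemma not_hsN (V : lmodType K) S (T : finType) (q e : T -> nat) (z : T -> V -> K) :
  ~ hsN [set: T] q e z S -> degenerate S q e z.
Proof.
have sT (F : T -> K) : \sum_(t in [set: T]) F t = \sum_t F t by apply: eq_bigl => t; rewrite inE.
move=> h; apply: NNPP => h'; apply: h; split.
  move=> q' e' c e0 hc [t _ ct] hl; apply: h'; left; exists q', e', c; split=> //.
  - by move=> i; apply: hc.
  - by exists t.
  by apply: lowstr_ext hl _ => p.
move=> c hc hz t _; apply/eqP; apply: NNPP => /negP ct; apply: h'; right; exists c; split.
- by move=> i; apply: hc.
- by exists t.
by move=> x; rewrite -sT.
Qed.

(** A degenerate relation is solved for one member [z t0]. The right-hand side involves the factors
    of the low strength part and possibly one normal form of larger exponent, all of lower level;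
    [M] is thus twice a strength bound plus one. *)
Lemma reduce D L S : (forall d, (d < D)%N -> split_nf K d) -> exists M, forall (V : vectType K) (T : finType)
    (q e : T -> nat) (z : T -> V -> K), nfl D L.+1 q e z -> (forall t, lev D (q t) (e t) = L) -> degenerate S q e z ->
  exists t0 (X : finType) (qX eX : X -> nat) (zX : X -> V -> K), [/\ (#|X| <= M)%N, nfl D L qX eX zX &
    forall (I : finType) w (y : I -> V -> K), (forall t, t != t0 -> alg w y (wt q e t) (z t)) ->
      (forall x, alg w y (wt qX eX x) (zX x)) -> alg w y (wt q e t0) (z t0)].
Proof.
move=> hsp.
have hS (p : nat * nat) : exists S', (frob K p.1 /\ (p.1 * p.2 < D)%N /\ (0 < p.2)%N) -> forall (V : vectType K) (f : V -> K),
    nf p.1 p.2 f -> lowstr (p.1 * p.2).+1 S (F3 p.1 f) ->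
    exists f' g, [/\ forall x, f x = f' x + g x, lowstr (p.1 * p.2).+1 S' g &
      (forall x, f' x = 0) \/ exists p' e', [/\ (1 < p')%N, frob K (p.1 * p'), p.2 = (p' * e')%N & nf (p.1 * p') e' f']].
  have [[h1 [h2 h3]]|h] := classic (frob K p.1 /\ (p.1 * p.2 < D)%N /\ (0 < p.2)%N); last by exists 0%N => /h.
  by have [S' hS'] := hsp _ h2 p.1 p.2 S h1 erefl h3; exists S' => _; apply: hS'.
have {hS}[S' hS'] := dchoice hS.
(* The type of the relation is not known in advance, so the bound is taken over all types with [q]
   and [e] at most [D]. *)
exists (1 + 2 * \max_(p : 'I_D.+1 * 'I_D.+1) S' (p.1 : nat, p.2 : nat))%N => V T q e z hz hL [].
  move=> [q' [e' [c [e0 hc [t0 ct0] hl]]]].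
  have [qt et] := hc t0 ct0; have [hq hd _ _] := hz t0; rewrite qt et in hq hd.
  have q0 := proj1 hq.
  have hn : nf q' e' (fun x => \sum_t c t * z t x).
    apply: nf_sum => t _; have [->|ct] := eqVneq (c t) 0.
      have -> : (fun x => 0 * z t x) = fun _ => 0 by apply: functional_extensionality => x; rewrite mul0r.
      exact: nf_zero.
    by apply: nf_scale; have [<- <-] := hc t ct; case: (hz t).
  have pz t : pol (z t) by case: (hz t) => _ _ _ h; apply: hom_pol (nf_hom h).
  have [|f' [g [ef hg hf']]] := hS' (q', e') (conj hq (conj hd e0)) V _ hn.
    apply: lowstr_ext hl _ => p; rewrite (F3_sum Kinf) => [|t _]; last exact: pol_scale.
    by apply: eq_bigr => t _; rewrite (F3_scale Kinf).
  have /= [s [a [g1 [g2 [sS hgg eg]]]]] := lowstr_factors hg.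
  have qe1 : (q' <= q' * e')%N by rewrite leq_pmulr.
  have e1 : (e' <= q' * e')%N by rewrite leq_pmull.
  have sM : (s <= \max_(p : 'I_D.+1 * 'I_D.+1) S' (p.1 : nat, p.2 : nat))%N.
    apply: leq_trans sS _; have h1 : (q' < D.+1)%N by lia. have h2 : (e' < D.+1)%N by lia.
    exact: (leq_bigmax (Ordinal h1, Ordinal h2)).
  have LE : L = ((1 + q' * e') * D.+1 - q')%N by rewrite -(hL t0) qt et /lev eqn0Ngt e0.
  have levf b h : (0 < b < (q' * e').+1)%N -> hom b h -> [/\ frob K 1, (1 * b.-1 < D)%N, (lev D 1 b.-1 < L)%N & nf 1 b.-1 (h : V -> K)].
    move=> hb hh; split; [exact: frob1 | by lia | | by apply: (nf_hom1 Kinf); rewrite prednK //; lia].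
    rewrite LE /lev; move: (q' * e')%N hd qe1 hb => m hd qe1 hb.
    case: eqP => _; [nia | rewrite mul1n; case: b hb {hh} => // b hb /=; nia].
  pose X0 := ('I_s + 'I_s)%type.
  pose aX (x : X0) := match x with inl i => a i | inr i => ((q' * e').+1 - a i)%N end.
  pose hX (x : X0) := match x with inl i => g1 i | inr i => g2 i end.
  have haX x : (0 < aX x < (q' * e').+1)%N /\ hom (aX x) (hX x).
    by case: x => i /=; case: (hgg i) => h1 h2 h3; split=> //; move: h1; lia.
  have X0l x := levf _ _ (haX x).1 (haX x).2.
  have X0M : (#|{: X0}| <= 2 * \max_(p : 'I_D.+1 * 'I_D.+1) S' (p.1 : nat, p.2 : nat))%N.
    by rewrite card_sum !card_ord mul2n -addnn leq_add.
  have algg (I : finType) w (y : I -> V -> K) : (forall x, alg w y (1 + 1 * (aX x).-1) (hX x)) -> alg w y (1 + q' * e') g.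
    move=> hy; apply: (alg_ext (f := fun x => \sum_i g1 i x * g2 i x)) => [|x]; last by rewrite eg.
    apply: alg_sum => i _; have [ai _ _] := hgg i.
    apply: (alg_mul (f := g1 i) (g := g2 i) (a := a i) (b := (q' * e').+1 - a i)) => //.
    - by apply: alg_leq (hy (inl i)); rewrite mul1n /=; lia.
    - by apply: alg_leq (hy (inr i)); rewrite mul1n /=; lia.
    by lia.
  have fin (I : finType) w (y : I -> V -> K) : alg w y (1 + q' * e') f' ->
     (forall x, alg w y (1 + 1 * (aX x).-1) (hX x)) -> (forall t, t != t0 -> alg w y (wt q e t) (z t)) -> alg w y (wt q e t0) (z t0).
    move=> hf1 hy hzt; apply: (alg_solve (wt := wt q e) (c := c) (r := fun x => f' x + g x) ct0) => //.
    - by move=> t /hc [-> ->]; rewrite qt et.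
    - by rewrite qt et; apply: (alg_add hf1 (algg _ _ _ hy)).
  case: hf' => [f0|[p [e2 [p1 hqp ep nf']]]].
    exists t0, X0, (fun _ => 1%N), (fun x => (aX x).-1), hX; split=> //; first by apply: leq_trans X0M (leq_addl _ _).
    by move=> I w y h1 h2; apply: fin => //; apply: (alg_cst _ _ _ (c := 0)).
  exists t0, (option X0), (fun x => if x is Some _ then 1%N else (q' * p)%N),
    (fun x => if x is Some x then (aX x).-1 else e2), (fun x => if x is Some x then hX x else f'); split.
  - by rewrite card_option add1n ltnS.
  - move=> [x|] //; have e20 : (0 < e2)%N by move: e0; rewrite /= in ep; rewrite ep muln_gt0 => /andP[].
    rewrite /= in ep; split=> //; first by rewrite -mulnA -ep.
    rewrite LE /lev eqn0Ngt e20 -mulnA -ep /=; have h : (q' < q' * p)%N by rewrite ltn_Pmulr.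
    by move: (q' * e')%N (q' * p)%N hd qe1 h => m k *; nia.
  move=> I w y h1 h2; apply: fin => //; last by move=> x; apply: (h2 (Some x)).
  by have := h2 None; rewrite /= in ep *; rewrite -mulnA -ep.
move=> [c [hc [t0 ct0] h0]].
exists t0, void, (fun _ => 1%N), (fun _ => 0%N), (fun _ _ => 0); split=> [||I w y h1 _]; [by rewrite card_void | by case | ].
apply: (alg_solve (wt := wt q e) (c := c) (r := fun _ => 0) ct0) => //.
- by move=> t ct; rewrite !hc // !muln0.
by apply: (alg_cst _ _ _ (c := 0)).
Qed.

Definition regularizable D L := forall (G : nat -> nat) n, exists N', forall (V : vectType K) (I : finType) (q e : I -> nat)
    (z : I -> V -> K), (#|I| <= n)%N -> nfl D L q e z ->
  exists (I' : finType) (q' e' : I' -> nat) (z' : I' -> V -> K), [/\ (#|I'| <= N')%N, nfl D L q' e' z',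
    hsN [set: I'] q' e' z' (G #|I'|) & forall i, alg (wt q' e') z' (wt q e i) (z i)].

(** Induction on the number [k] of members of level [L]. If the family fails to be strong after its
    lower part has been regularized, the relation eliminates one member of level [L] at the cost of
    at most [M] new lower members. *)
Lemma regularize_step D L : (forall d, (d < D)%N -> split_nf K d) -> regularizable D L ->
  forall (G : nat -> nat) k n, exists N', forall (V : vectType K) (I T : finType) (q e : I -> nat) (z : I -> V -> K)
    (qT eT : T -> nat) (zT : T -> V -> K), (#|I| <= n)%N -> (#|T| <= k)%N -> nfl D L q e z ->
    nfl D L.+1 qT eT zT -> (forall t, lev D (qT t) (eT t) = L) ->
  exists (I' : finType) (q' e' : I' -> nat) (z' : I' -> V -> K), [/\ (#|I'| <= N')%N, nfl D L.+1 q' e' z',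
    hsN [set: I'] q' e' z' (G #|I'|), forall i, alg (wt q' e') z' (wt q e i) (z i) &
    forall i, alg (wt q' e') z' (wt qT eT i) (zT i)].
Proof.
move=> hsp hL G k n.
(* The lower members must stay strong enough after up to [k] members of level [L] are added to their
   number. *)
pose G' x := \max_(j < k.+1) G (x + j)%N.
elim: k n @G' => [|k IH] n G'; have [N1 hN1] := hL G' n.
  exists N1 => V I T q e z qT eT zT hI; rewrite leqn0 => /eqP/card0_eq T0 hz _ _.
  have [I' [q' [e' [z' [hI' hz' hs ha]]]]] := hN1 V I q e z hI hz.
  exists I', q', e', z'; split=> //; last by move=> t; have := T0 t; rewrite inE.
    by move=> i; have [? ? h ?] := hz' i; split=> //; apply: ltnW.
  by move: hs; rewrite /G' big_ord_recl big_ord0 maxn0 addn0.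
have [M hM] := reduce L (\max_(x < N1.+1) G' x) hsp; have [N2 hN2] := IH (n + M)%N.
exists (maxn (N1 + k.+1) N2) => V I T q e z qT eT zT hI hT hz hzT hlT.
have [I' [q' [e' [z' [hI' hz' hs ha]]]]] := hN1 V I q e z hI hz.
pose C := (I' + T)%type.
pose qC (x : C) := match x with inl i => q' i | inr t => qT t end.
pose eC (x : C) := match x with inl i => e' i | inr t => eT t end.
pose zC (x : C) := match x with inl i => z' i | inr t => zT t end.
have cC : #|{: C}| = (#|I'| + #|T|)%N by rewrite card_sum.
have sub : (G #|{: C}| <= G' #|I'|)%N.
  have h : (#|T| < k.+2)%N by []. by rewrite cC; apply: (leq_bigmax (Ordinal h)).
have sub2 : (G' #|I'| <= \max_(x < N1.+1) G' x)%N by apply: (leq_bigmax (Ordinal (hI' : (#|I'| < N1.+1)%N))).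
have [hsC|/not_hsN hd] := classic (hsN [set: C] qC eC zC (G #|{: C}|)).
  exists C, qC, eC, zC; split=> //.
  - by rewrite cC leq_max leq_add.
  - by case=> i; [have [? ? h ?] := hz' i; split=> //; apply: ltnW | apply: hzT].
  - by move=> i; apply: alg_trans (ha i) => j; apply: (alg_gen (i := inl j : C)).
  by move=> i; apply: (alg_gen (i := inr i : C)).
have sumC (F : C -> K) : \sum_x F x = \sum_i F (inl i) + \sum_t F (inr t) by rewrite big_sumType.
(* A type determines its level, so a relation involving some [inr t] contains no lower member; a
   relation without such a term contradicts the strength of the lower members. *)
have dT : degenerate (\max_(x < N1.+1) G' x) qT eT zT.
  have [hsA hsB] := hs.
  case: hd => [[q2 [e2 [c [e20 hc [x0 cx0] hl]]]]|[c [hc [x0 cx0] h0]]].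
    have [[t ct]|nT] := classic (exists t, c (inr t) != 0).
      left; exists q2, e2, (fun t => c (inr t)); split=> //; first by move=> s /hc.
        by exists t.
      apply: (lowstr_ext (lowstr_leq (leq_trans sub sub2) hl)) => p; rewrite sumC big1 ?add0r // => i _.
      have [->|ci] := eqVneq (c (inl i)) 0; first by rewrite mul0r.
      have [/= qi ei] := hc _ ci; have [/= qt et] := hc _ ct; have [_ _ h _] := hz' i.
      by move: h; rewrite qi ei -qt -et hlT ltnn.
    have cT t : c (inr t) = 0 by apply/eqP; apply: NNPP => /negP ct; apply: nT; exists t.
    case: (hsA q2 e2 (fun i => c (inl i)) e20) => [i _ /hc //||].
      by case: x0 cx0 => [i ci|t]; [exists i; rewrite ?inE | rewrite cT eqxx].
    apply: (lowstr_ext (lowstr_leq sub hl)) => p; rewrite sumC [X in _ + X]big1 ?addr0 => [|t _]; last by rewrite cT mul0r.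
    by apply: eq_bigl => i; rewrite inE.
  have [[t ct]|nT] := classic (exists t, c (inr t) != 0).
    right; exists (fun t => c (inr t)); split; first by move=> s /hc.
      by exists t.
    move=> x; rewrite -[RHS](h0 x) sumC [X in X + _]big1 ?add0r // => i _.
    have [->|ci] := eqVneq (c (inl i)) 0; first by rewrite mul0r.
    have [_ _ h _] := hz' i; move: (hc _ ci) (hc _ ct) (hlT t) h => /= ei et.
    by rewrite /lev ei et eqxx => <-.
  have cT t : c (inr t) = 0 by apply/eqP; apply: NNPP => /negP ct; apply: nT; exists t.
  case: x0 cx0 => [i|t]; last by rewrite cT eqxx.
  rewrite (hsB (fun i => c (inl i))) ?inE ?eqxx //; first by move=> j _ /hc.
  move=> x; rewrite -[RHS](h0 x) sumC [X in _ + X]big1 ?addr0 => [|t _]; last by rewrite cT mul0r.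
  by apply: eq_bigl => j; rewrite inE.
have [t0 [X [qX [eX [zX [hX hzX hred]]]]]] := hM V T qT eT zT hzT hlT dT.
pose T' := {t : T | t != t0}.
have [|||||I2 [q2 [e2 [z2 [hI2 hz2 hs2 ha2 haT]]]]] := hN2 V (I + X)%type T'
   (fun x => match x with inl i => q i | inr t => qX t end) (fun x => match x with inl i => e i | inr t => eX t end)
   (fun x => match x with inl i => z i | inr t => zX t end) (fun t => qT (val t)) (fun t => eT (val t)) (fun t => zT (val t)).
- by rewrite card_sum leq_add.
- rewrite card_sig -ltnS; apply: leq_trans hT; have := cardC1 t0; have : (0 < #|T|)%N by apply/card_gt0P; exists t0.
  rewrite (_ : #|[pred t | t != t0]| = #|predC1 t0|); first lia.
  by apply: eq_card => t; rewrite !inE.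
- by case.
- by move=> t; apply: hzT.
- by move=> t; apply: hlT.
exists I2, q2, e2, z2; split=> //; first by rewrite leq_max hI2 orbT.
  by move=> i; apply: (ha2 (inl i)).
move=> t; have h s : s != t0 -> alg (wt q2 e2) z2 (wt qT eT s) (zT s).
  by move=> hs'; apply: (haT (Sub s hs')).
have [->|] := eqVneq t t0; last exact: h.
by apply: hred => // x; apply: (ha2 (inr x)).
Qed.

Lemma regularizable_all D L : (forall d, (d < D)%N -> split_nf K d) -> regularizable D L.
Proof.
move=> hsp; elim: L => [|L IH] G n.
  exists n => V I q e z hI hz; exists I, q, e, z; split=> //.
    by split=> [q' e' c _ _ [i _]|c _ _ i _]; have [] := hz i.
  by move=> i; have [] := hz i.
have [N' hN'] := regularize_step hsp IH G n n.
exists N' => V I q e z hI hz.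
pose I1 := {i : I | (lev D (q i) (e i) < L)%N}; pose I2 := {i : I | ~~ (lev D (q i) (e i) < L)%N}.
have [|||||I' [q' [e' [z' [hI' hz' hs' ha hb]]]]] := hN' V I1 I2 (fun i => q (val i)) (fun i => e (val i)) (fun i => z (val i))
  (fun i => q (val i)) (fun i => e (val i)) (fun i => z (val i)).
- by apply: leq_trans hI; rewrite card_sig; apply: max_card.
- by apply: leq_trans hI; rewrite card_sig; apply: max_card.
- by move=> i; have [? ? ? ?] := hz (val i); split=> //; apply: (valP i).
- by move=> i; apply: hz.
- by move=> i; have [_ _ h _] := hz (val i); have := valP i; lia.
exists I', q', e', z'; split=> // i; case hi: (lev D (q i) (e i) < L)%N; first exact: (ha (Sub i hi)).
exact: (hb (Sub i (negbT hi))).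
Qed.

Theorem nf_regular_of D : (forall d, (d < D)%N -> split_nf K d) -> nf_regular K D.
Proof.
move=> hsp G N; have [N' hN'] := regularizable_all ((1 + D) * D.+1) hsp G N.
exists N' => V I dg f hI hdg hf.
have [|I' [q [e [z [hI' hz hs ha]]]]] := hN' V I (fun _ => 1%N) (fun i => (dg i).-1) f hI.
  move=> i; have hi := hdg i; split; [exact: frob1 | by lia | by rewrite /lev; case: eqP; nia | ].
  by apply: (nf_hom1 Kinf); rewrite prednK //; case/andP: hi.
exists I', q, e, z; split=> // i; first by have [] := hz i.
by have := ha i; rewrite mul1n add1n prednK //; case/andP: (hdg i).
Qed.

End Regularize.

(** * From normal forms to arbitrary strong tuples *)

Section Exchange.
Variable K : fieldType.
Hypothesis Kinf : infinite_field K.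

Lemma hsN_sub (V : lmodType K) (I : finType) (J J' : {set I}) S S' q e (f : I -> V -> K) :
  J' \subset J -> (S' <= S)%N -> hsN J q e f S -> hsN J' q e f S'.
Proof.
move=> JJ SS [h1 h2]; split=> [q' e' c e0 hc [i iJ ci] hl|c hc h0 i iJ].
  apply: (h1 q' e' (fun i => if i \in J' then c i else 0) e0).
  - by move=> j jJ; case: ifP => jJ'; [apply: hc | rewrite eqxx].
  - by exists i; [exact: (subsetP JJ) | rewrite iJ].
  apply: lowstr_ext (lowstr_leq SS hl) _ => p; rewrite [RHS](big_setID J') /= [X in _ = _ + X]big1 ?addr0.
    by rewrite (setIidPr JJ); apply: eq_bigr => j ->.
  by move=> j; rewrite inE => /andP[/negPf -> _]; rewrite mul0r.
have := h2 (fun i => if i \in J' then c i else 0); move=> /(_ _ _ i (subsetP JJ _ iJ)); rewrite iJ; apply.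
  by move=> j jJ; case: ifP => jJ'; [apply: hc | rewrite eqxx].
move=> x; rewrite -[RHS](h0 x) [LHS](big_setID J') /= [X in _ + X]big1 ?addr0.
  by rewrite (setIidPr JJ); apply: eq_bigr => j ->.
by move=> j; rewrite inE => /andP[/negPf -> _]; rewrite mul0r.
Qed.

Lemma lowstr1 (V : lmodType K) S (f : V -> K) : lowstr 1 S f -> forall x, f x = 0.
Proof. by case=> // {}S a g h f' f'' /andP[a0 a1]; lia. Qed.

Lemma hsN_nideal (V : vectType K) (I : finType) (J J' : {set I}) q e (f : I -> V -> K) S d i : (forall i, frob K (q i)) ->
  (forall i, nf (q i) (e i) (f i)) -> (forall i, q i * e i <= d)%N -> (#|I| * (2 * d.+1) <= S)%N ->
  hsN J q e f S -> J' \subset J -> i \in J -> i \notin J' -> ~ ideal J' f (f i).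
Proof.
move=> hq hf hd hS [h1 h2] JJ iJ iJ' /(nideal_relation Kinf hf JJ iJ iJ') [c [ci cJ hl]].
have [ei|ei] := posnP (e i).
  move: hl cJ; rewrite ei muln0 addn0 => /lowstr1 h0 cJ.
  have := h2 c _ h0 i iJ; move=> E; case/eqP: ci; apply: E => j _ /cJ [_ Ej].
  by have := proj1 (hq j); lia.
have qd j : c j != 0 -> (q j <= d)%N.
  move=> /cJ [_ E]; apply: leq_trans (hd j); rewrite leq_pmulr // lt0n; apply/eqP => ej; move: E.
  by rewrite ej muln0 => /esym/eqP; rewrite muln_eq0 -!leqn0 => /orP[]; have := proj1 (hq i); lia.
have [q' [e' [c2 [E hc hx hl']]]] := relation_class Kinf hq hf qd ci cJ hl.
apply: (h1 q' e' c2 _ hc hx); last exact: lowstr_leq hS hl'.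
by have := proj1 (hq i); nia.
Qed.

Section AlgLow.
Variables (V : lmodType K) (I : finType) (w : I -> nat) (z : I -> V -> K).
Implicit Types (f : V -> K).

Definition low e := {i : I | (w i < e)%N}.

Definition alg_low e a f := alg (fun i : low e => w (val i)) (fun i : low e => z (val i)) a f.

Lemma alg_lowI e a f : (a < e)%N -> alg w z a f -> alg_low e a f.
Proof.
move=> ae h; elim: h ae => [{}a {}f c fc|{}a {}f i wi fz|{}a {}f g h _ IHf _ IHg eh|{}a b c {}f g h _ IHf _ IHg ab eh] ae.
- exact: alg_cst fc.
- by apply: (alg_gen (i := Sub i (leq_ltn_trans wi ae) : low e)).
- exact: alg_add (IHf ae) (IHg ae) eh.
have be : (b < e)%N by lia. have ce : (c < e)%N by lia.
exact: alg_mul (IHf be) (IHg ce) ab eh.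
Qed.

Lemma alg_cst0 f : (forall i, (0 < w i)%N) -> alg w z 0 f -> exists c, forall x, f x = c.
Proof.
move=> w0; move E : 0%N => e h; elim: h E => [{}e {}f c fc|{}e {}f i wi fz|{}e {}f g h _ IHf _ IHg eh|{}e a b {}f g h _ IHf _ IHg ab eh] E.
- by exists c.
- by have := w0 i; lia.
- by have [c hc] := IHf E; have [c' hc'] := IHg E; exists (c + c') => x; rewrite eh hc hc'.
have [|c hc] := IHf; first by lia.
have [|c' hc'] := IHg; first by lia.
by exists (c * c') => x; rewrite eh hc hc'.
Qed.

(** Weights are positive, so in a product of weight [e] either one factor is constant or both
    involve only generators of weight below [e]. Generators of weight [e] therefore occur
    linearly. *)
Lemma alg_decomp e f : (forall i, (0 < w i)%N) -> alg w z e f -> exists (l : I -> K) R,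
  [/\ forall i, l i != 0 -> w i = e, alg_low e e R & forall x, f x = \sum_i l i * z i x + R x].
Proof.
move=> w0; elim=> [{}e {}f c fc|{}e {}f i wi fz|{}e {}f g h _ [l [R [hl hR ef]]] _ [l' [R' [hl' hR' eg]]] eh|
    {}e a b {}f g h hf IHf hg IHg ab eh].
- exists (fun _ => 0), f; split=> [i|//|x]; [by rewrite eqxx | exact: alg_cst fc | ].
  by rewrite big1 ?add0r // => i _; rewrite mul0r.
- move: wi; rewrite leq_eqVlt => /orP[/eqP E|we].
    exists (fun j => (j == i)%:R), (fun _ => 0); split=> [j|//|x].
    + by have [->|] := eqVneq j i; rewrite ?eqxx.
    + exact: alg_cst.
    rewrite addr0 (bigD1 i) //= eqxx mul1r big1 ?addr0 // => j /negPf ->; by rewrite mul0r.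
  exists (fun _ => 0), f; split=> [j|//|x]; [by rewrite eqxx | | ].
    by apply: (alg_gen (i := Sub i we : low e)) => //; apply: ltnW.
  by rewrite big1 ?add0r // => j _; rewrite mul0r.
- exists (fun i => l i + l' i), (fun x => R x + R' x); split=> [i|//|x].
  + by have [->|/hl //] := eqVneq (l i) 0; rewrite add0r => /hl'.
  + exact: alg_add hR hR' _.
  rewrite eh ef eg addrACA -big_split; congr (_ + _); apply: eq_bigr => i _; by rewrite mulrDl.
have scal u v c : (exists (l : I -> K) R, [/\ forall i, l i != 0 -> w i = e, alg_low e e R & forall x, u x = \sum_i l i * z i x + R x]) ->
    (forall x, v x = c * u x) -> exists (l : I -> K) R, [/\ forall i, l i != 0 -> w i = e, alg_low e e R & forall x, v x = \sum_i l i * z i x + R x].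
  move=> [l [R [hl hR eu]]] ev; exists (fun i => c * l i), (fun x => c * R x); split=> [i|//|x].
  + by rewrite mulf_eq0 negb_or => /andP[_ /hl].
  + exact: alg_scale.
  rewrite ev eu mulrDr mulr_sumr; congr (_ + _); apply: eq_bigr => i _; by rewrite mulrA.
have [ae|ae] := ltnP a e; last first.
  have E : a = e by lia.
  have [|c hc] := @alg_cst0 g w0; first by apply: alg_leq hg; lia.
  rewrite E in IHf; apply: (scal f h c) => // x; by rewrite eh hc mulrC.
have [be|be] := ltnP b e; last first.
  have E : b = e by lia.
  have [|c hc] := @alg_cst0 f w0; first by apply: alg_leq hf; lia.
  rewrite E in IHg; apply: (scal g h c) => // x; by rewrite eh hc.
exists (fun _ => 0), h; split=> [j|//|x]; first by rewrite eqxx.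
  exact: alg_mul (alg_lowI ae hf) (alg_lowI be hg) ab eh.
by rewrite big1 ?add0r // => j _; rewrite mul0r.
Qed.

Lemma alg_deg e f : (forall i, pol (z i)) -> (forall i l x, (w i < l)%N -> comp l (z i) x = 0) -> alg w z e f ->
  forall l x, (e < l)%N -> comp l f x = 0.
Proof.
move=> pz hz; elim=> [{}e {}f c fc|{}e {}f i wi fz|{}e {}f g h hf IHf hg IHg eh|{}e a b {}f g h hf IHf hg IHg ab eh] l x el.
- have -> : f = fun _ => c by apply: functional_extensionality.
  by rewrite (comp_neq Kinf x (hom_cst V c)) // -lt0n; lia.
- have -> : f = z i by apply: functional_extensionality.
  by apply: hz; lia.
- have -> : h = fun x => f x + g x by apply: functional_extensionality.
  by rewrite (comp_add Kinf) ?IHf ?IHg ?addr0 //; [apply: alg_pol hf | apply: alg_pol hg].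
have -> : h = fun x => f x * g x by apply: functional_extensionality.
rewrite (comp_mul Kinf) ?big1 //; [|apply: alg_pol hf|apply: alg_pol hg] => // j _.
have [aj|aj] := ltnP a j; first by rewrite IHf // mul0r.
by rewrite IHg ?mulr0 //; have := ltn_ord j; lia.
Qed.

Lemma alg_D e f x : (forall i, pol (z i)) -> alg w z e f -> exists M : I -> K, forall v, D f x v = \sum_i M i * D (z i) x v.
Proof.
move=> pz; elim=> [{}e {}f c fc|{}e {}f i wi fz|{}e {}f g h hf [M hM] hg [N hN] eh|{}e a b {}f g h hf [M hM] hg [N hN] ab eh].
- exists (fun _ => 0) => v; have -> : f = fun _ => c by apply: functional_extensionality.
  by rewrite (D_cst Kinf) big1 // => i _; rewrite mul0r.
- exists (fun j => (j == i)%:R) => v; have -> : f = z i by apply: functional_extensionality.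
  by rewrite (bigD1 i) //= eqxx mul1r big1 ?addr0 // => j /negPf ->; rewrite mul0r.
- exists (fun i => M i + N i) => v; have -> : h = fun x => f x + g x by apply: functional_extensionality.
  rewrite (D_add Kinf) ?hM ?hN; [|apply: alg_pol hf|apply: alg_pol hg] => //.
  by rewrite -big_split; apply: eq_bigr => i _; rewrite mulrDl.
exists (fun i => f x * N i + M i * g x) => v; have -> : h = fun x => f x * g x by apply: functional_extensionality.
rewrite (D_mul Kinf) ?hM ?hN; [|apply: alg_pol hf|apply: alg_pol hg] => //.
rewrite mulr_sumr mulr_suml -big_split; apply: eq_bigr => i _ /=; ring.
Qed.

(** Up to a constant, [R] is in the ideal of the lower generators, normalized to vanish at 0. In
    degree [e] each generator contributes fewer than [e] products, one for each positive degree
    below [e]. *)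
Lemma low_lowstr e R : (0 < e)%N -> (forall i, pol (z i)) -> (forall i l x, (w i < l)%N -> comp l (z i) x = 0) ->
  alg_low e e R -> lowstr e (#|I| * e) (comp e R).
Proof.
move=> e0 pz hz hR.
pose z' (i : low e) x := z (val i) x - z (val i) 0.
have pz' i : pol (z' i) by apply: pol_sub => //; apply: pol_cst.
have pR : pol R by apply: (alg_pol _ hR) => i.
have hR' : alg (fun i : low e => w (val i)) z' e R.
  apply: alg_trans hR => i; apply: (alg_add (f := z' i) (g := fun _ => z (val i) 0)) => [||x].
  - exact: alg_gen.
  - exact: alg_cst.
  by rewrite subrK.
have [|r [pr er]] := alg_ideal pz' _ hR'; first by move=> i; rewrite /z' subrr.
have pzr i : pol (fun x => z' i x * r i x) by apply: pol_mul.
have E x : comp e R x = \sum_i comp e (fun x => z' i x * r i x) x.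
  rewrite -(comp_sum Kinf) //; transitivity (comp e (fun x => R x - R 0) x).
    rewrite (comp_sub Kinf) //; last exact: pol_cst.
    by rewrite (comp_neq Kinf x (hom_cst V (R 0))) ?subr0 // -lt0n.
  congr comp; apply: functional_extensionality => y; rewrite er; apply: eq_big => [i|i _]; first by rewrite inE.
  by rewrite mulrC.
apply: (lowstr_ext (f := fun x => \sum_i comp e (fun x => z' i x * r i x) x)) => [|x]; last by rewrite E.
apply: (lowstr_sumT (S := e)) => [|i _]; first by rewrite leq_mul2r card_sig max_card orbT.
apply: (lowstr_ext (f := fun x => \sum_(j < e) (if (j.+1 < e)%N then comp j.+1 (z' i) x * comp (e - j.+1) (r i) x else 0))) => [|x].
  apply: (lowstr_sumT (S := 1)) => [|j _]; first by rewrite card_ord muln1.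
  case je: (j.+1 < e)%N; last exact: lowstr_zero.
  have je' : (0 < j.+1 < e)%N by rewrite je.
  by apply: (lowstr_prod je'); apply: (hom_comp Kinf).
have z'0 : z' i 0 = 0 by rewrite /z' subrr.
rewrite (comp_mul Kinf) // big_ord_recl comp0 // z'0 mul0r add0r; apply: eq_bigr => j _; rewrite lift0.
case je: (j.+1 < e)%N => //.
rewrite /z' (comp_sub Kinf) //; last exact: pol_cst.
rewrite (comp_neq Kinf x (hom_cst V _)) // subr0 hz ?mul0r //.
by move/negbT: je; rewrite -leqNgt; apply: leq_trans; apply: (valP i).
Qed.

End AlgLow.

Lemma alg_dep (V : lmodType K) (I : Type) (w : I -> nat) (z : I -> V -> K) e f x y : alg w z e f ->
  (forall i, z i x = z i y) -> f x = f y.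
Proof.
move=> h hz; elim: h => [{}e {}f c fc|{}e {}f i wi fz|{}e {}f g h _ IHf _ IHg eh|{}e a b {}f g h _ IHf _ IHg _ eh].
- by rewrite !fc.
- by rewrite !fz.
- by rewrite !eh IHf IHg.
by rewrite !eh IHf IHg.
Qed.

(** [phi] is the same polynomial expression with [z0] in place of [z]. *)
Lemma alg_mod (V : lmodType K) (I L : finType) (w : I -> nat) (z z0 : I -> V -> K) (J : {set L}) (P : L -> V -> K) e f :
  (forall i, pol (z i)) -> (forall i, pol (z0 i)) -> (forall i, ideal J P (fun x => z i x - z0 i x)) -> alg w z e f ->
  exists phi, [/\ alg w z0 e phi, ideal J P (fun x => f x - phi x) &
    forall x x', (forall i, z i x = z0 i x') -> f x = phi x'].
Proof.
move=> pz pz0 hz; elim=> [{}e {}f c fc|{}e {}f i wi fz|{}e {}f g h hf [u [hu iu xu]] hg [v [hv iv xv]] eh|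
    {}e a b {}f g h hf [u [hu iu xu]] hg [v [hv iv xv]] ab eh].
- exists f; split=> [||x x' _]; [exact: alg_cst fc | by apply: (ideal_ext (ideal0 J P)) => x; rewrite subrr | by rewrite !fc].
- exists (z0 i); split=> [||x x' h]; [by apply: (alg_gen (i := i)) | by apply: (ideal_ext (hz i)) => x; rewrite fz | by rewrite fz].
- exists (fun x => u x + v x); split=> [||x x' H]; [exact: alg_add hu hv _ | | by rewrite eh (xu _ _ H) (xv _ _ H)].
  by apply: (ideal_ext (ideal_add iu iv)) => x; rewrite eh opprD addrACA.
exists (fun x => u x * v x); split=> [||x x' H]; [exact: alg_mul hu hv ab _ | | by rewrite eh (xu _ _ H) (xv _ _ H)].
apply: (ideal_ext (g := fun x => f x * (g x - v x) + v x * (f x - u x))) => [|x]; last by rewrite eh; ring.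
by apply: ideal_add; apply: ideal_mul => //; [apply: alg_pol hf | apply: alg_pol hv].
Qed.

End Exchange.

(** * Exchange of generators and sweeping out the zero set *)

Section Step.
Variable K : fieldType.
Hypothesis Kinf : infinite_field K.

Section OneSpace.
Variables (V : vectType K) (I T : finType) (w : T -> nat) (z : T -> V -> K) (e : I -> nat) (A P : I -> V -> K) (J : {set I}).

(* [cur] is obtained from the coordinates [z] by replacing [z t] by [P i] whenever [rho t = Some i]. *)
Definition exchanged (J1 : {set I}) (cur : T -> V -> K) (rho : T -> option I) :=
  [/\ forall t i, rho t = Some i -> [/\ i \in J1, cur t =1 P i & w t = e i],
      forall i, i \in J1 -> exists2 t, rho t = Some i & forall s, rho s = Some i -> s = t,
      forall c : T -> K, exists x, forall t, cur t x = c t,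
      forall t, alg w cur (w t) (z t) &
      forall t, alg w z (w t) (cur t)].

Hypothesis w0 : forall t, (0 < w t)%N.
Hypothesis hz : forall t, hom (w t) (z t).
Hypothesis he : forall i, (0 < e i)%N.
Hypothesis pP : forall i, pol (P i).
Hypothesis hPA : forall i x, i \in J -> comp (e i) (P i) x = A i x.
Hypothesis aP : forall i, i \in J -> alg w z (e i) (P i).

(** A Steinitz exchange. If the linear part of [P j] in weight [e j] contains a generator not yet
    replaced, that generator is solved for. Otherwise [P j] minus a combination of exchanged [P k]
    is a polynomial in lower generators, and its leading form contradicts strength. *)
Lemma exchange (J1 : {set I}) j (cur : T -> V -> K) (rho : T -> option I) D C : (forall i, (e i <= D)%N) -> (#|T| * D <= C)%N -> strong C J e A ->
  J1 \subset J -> j \in J -> j \notin J1 -> exchanged J1 cur rho -> exists cur' rho', exchanged (j |: J1) cur' rho'.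
Proof.
move=> eD TC hs JJ jJ jJ1 [h1 h2 h3 h4 h5].
have pz t : pol (z t) := hom_pol (hz t).
have pc t : pol (cur t) := alg_pol pz (h5 t).
have dc t l x : (w t < l)%N -> comp l (cur t) x = 0.
  apply: (alg_deg Kinf pz _ (h5 t)) => i l' x' h; rewrite (comp_neq Kinf x' (hz i)) //.
  by apply/eqP => E; move: h; rewrite E ltnn.
have [l [R [hl hR eP]]] := alg_decomp w0 (alg_trans h4 (aP jJ)).
have [[t0 [lt0 rt0]]|nt] := classic (exists t0, l t0 != 0 /\ rho t0 = None).
  have wt0 := hl t0 lt0.
  pose cur' t := if t == t0 then P j else cur t.
  have c't t : t != t0 -> cur' t = cur t by rewrite /cur' => /negPf ->.
  exists cur', (fun t => if t == t0 then Some j else rho t); split.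
  - move=> t i; rewrite /cur'; case: eqP => [-> [<-]|_ /h1 [iJ ? ?]]; first by split; rewrite ?setU11.
    by split=> //; rewrite inE iJ orbT.
  - move=> i; rewrite !inE => /orP[/eqP ->|iJ1].
      exists t0 => [|s]; first by rewrite eqxx.
      by case: eqP => // _ /h1 []; rewrite (negPf jJ1).
    have [t rt ut] := h2 i iJ1; exists t => [|s].
      by case: eqP => // E; move: rt; rewrite E rt0.
    by case: eqP => [_ [E]|_]; [move: jJ1; rewrite E iJ1 | apply: ut].
  (* The value prescribed for [P j] is reached by adjusting the old generator [t0]; [R] involves
     lower weights only, so its value is already known from [x1]. *)
  - move=> c; have [x1 hx1] := h3 c.
    have [x2 hx2] := h3 (fun t => if t == t0 then (l t0)^-1 * (c t0 - \sum_(s | s != t0) l s * c s - R x1) else c t).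
    exists x2 => t; rewrite /cur'; case: eqP => [->|/eqP/negPf tt]; last by rewrite hx2 tt.
    have ER : R x2 = R x1.
      apply: (alg_dep hR) => -[s /= ws]; rewrite hx1 hx2; case: eqP => // E.
      by move: ws; rewrite E wt0 ltnn.
    rewrite eP ER (bigD1 t0) //= hx2 eqxx mulrA mulfV // mul1r.
    have -> : \sum_(s | s != t0) l s * cur s x2 = \sum_(s | s != t0) l s * c s.
      by apply: eq_bigr => s /negPf st; rewrite hx2 st.
    by rewrite addrAC subrK subrK.
  - move=> t; apply: alg_trans (h4 t) => {}t; have [->|tt] := eqVneq t t0.
      apply: (alg_solve (wt := w) (c := l) (r := fun x => P j x + -1 * R x) lt0).
      + by move=> s ls; rewrite !hl.
      + by move=> x; rewrite eP mulN1r addrK.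
      + rewrite wt0; apply: (alg_add (f := P j) (g := fun x => -1 * R x)) => //.
          by apply: (alg_gen (i := t0)) => [|x]; rewrite ?wt0 // /cur' eqxx.
        apply: alg_scale; apply: alg_trans hR => -[s /= ws]; apply: (alg_gen (i := s)) => // x.
        by rewrite c't //; apply: contraTneq ws => ->; rewrite wt0 ltnn.
      by move=> s st; apply: (alg_gen (i := s)) => // x; rewrite c't.
    by apply: (alg_gen (i := t)) => // x; rewrite c't.
  move=> t; rewrite /cur'; case: eqP => [->|_]; last exact: h5.
  by rewrite wt0; apply: aP.
exfalso.
pose c k := (k == j)%:R - \sum_(t | rho t == Some k) l t.
have hc k : c k != 0 -> k != j -> exists2 t, rho t = Some k & l t != 0.
  move=> ck kj; apply: NNPP => H; move: ck; rewrite /c (negPf kj) sub0r oppr_eq0 big1 ?eqxx // => t /eqP rt.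
  by apply/eqP; apply: NNPP => /negP lt; apply: H; exists t.
have cj : c j = 1.
  by rewrite /c eqxx big1 ?subr0 // => t /eqP /h1 []; rewrite (negPf jJ1).
have cK k : c k != 0 -> k \in J /\ e k = e j.
  have [->|kj] := eqVneq k j; first by [].
  move=> ck; have [t rt lt] := hc k ck kj; have [kJ1 _ wk] := h1 t k rt.
  by split; [apply: (subsetP JJ) | rewrite -wk hl].
apply: (hs (e j) c) => [k kJ /cK [] //||]; first by exists j; rewrite // cj oner_eq0.
have pR : pol R by apply: (alg_pol _ hR) => i; apply: pc.
have := low_lowstr Kinf (he j) pc dc hR => hlow.
have TC' : (#|T| * e j <= C)%N by apply: leq_trans TC; rewrite leq_mul2l eD orbT.
apply: (lowstr_ext (lowstr_leq TC' hlow)) => x.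
have EP y : R y = \sum_(k in J) c k * P k y.
  have -> : \sum_(k in J) c k * P k y = \sum_k c k * P k y.
    rewrite big_mkcond; apply: eq_bigr => k _; have [->|/cK [-> _] //] := eqVneq (c k) 0.
    by rewrite mul0r if_same.
  under eq_bigr do rewrite mulrBl; rewrite sumrB.
  rewrite (bigD1 j) //= eqxx mul1r big1 ?addr0 => [|k /negPf ->]; last by rewrite mul0r.
  rewrite eP; apply/eqP; rewrite eq_sym subr_eq addrC (inj_eq (addrI _)); apply/eqP.
  under eq_bigr do rewrite mulr_suml.
  rewrite (exchange_big_dep xpredT) //=; apply: eq_bigr => t _.
  case E: (rho t) => [k|].
    have [_ ck _] := h1 t k E; rewrite (big_pred1 k) ?ck // => i /=; by rewrite eq_sym; apply/eqP/eqP => [[]|->].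
  rewrite big_pred0 ?mulr0 // ; have [->|lt] := eqVneq (l t) 0; first by rewrite mul0r.
  by case: nt; exists t.
have -> : R = fun y => \sum_(k in J) c k * P k y by apply: functional_extensionality.
rewrite (comp_sum Kinf) => [|k _]; last exact: pol_scale.
apply: eq_bigr => k kJ; rewrite (comp_scale Kinf) //.
by have [->|/cK [_ <-]] := eqVneq (c k) 0; rewrite ?mul0r // hPA.
Qed.

Lemma exchange_all D C : (forall i, (e i <= D)%N) -> (#|T| * D <= C)%N -> strong C J e A ->
  (forall c : T -> K, exists x, forall t, z t x = c t) -> exists cur rho, exchanged J cur rho.
Proof.
move=> eD TC hs sz.
suff h n : (n <= #|J|)%N -> exists J1 : {set I}, [/\ J1 \subset J, #|J1| = n & exists cur rho, exchanged J1 cur rho].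
  have [J1 [JJ cJ [cur [rho h1]]]] := h _ (leqnn _).
  by exists cur, rho; have <- : J1 = J by apply/eqP; rewrite eqEcard JJ cJ leqnn.
elim: n => [|n IH] hn.
  exists set0; split; rewrite ?sub0set ?cards0 //; exists z, (fun _ => None); split=> //.
  - by move=> i; rewrite inE.
  - by move=> t; apply: (alg_gen (i := t)).
  by move=> t; apply: (alg_gen (i := t)).
have [J1 [JJ cJ [cur [rho h1]]]] := IH (ltnW hn).
have /properP[_ [j jJ jJ1]] : J1 \proper J by rewrite properEcard JJ cJ.
have [cur' [rho' h']] := exchange eD TC hs JJ jJ jJ1 h1.
exists (j |: J1); split; last by exists cur', rho'.
  by rewrite subUset sub1set jJ.
by rewrite cardsU1 jJ1 cJ.
Qed.

(** [phi t] is [z t] with the exchanged coordinates set to 0. For each [x'] the level set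
    [z = phi x'] is nice and contained in the zero set of [P], and modulo the ideal of [P] the
    functions [z t] and [phi t] agree. *)
Lemma nice_of_exchanged (cur : T -> V -> K) (rho : T -> option I) : exchanged J cur rho -> regular [set: T] z ->
  (forall k : T -> K, Nice [set: T] (fun t x => z t x - k t)) -> Nice J P.
Proof.
move=> [h1 h2 h3 h4 h5] rz nz.
have pz t : pol (z t) := hom_pol (hz t).
have pc t : pol (cur t) := alg_pol pz (h5 t).
pose cur0 t := if rho t is Some _ then fun _ : V => 0 else cur t.
have pc0 t : pol (cur0 t) by rewrite /cur0; case: (rho t) => // _; apply: pol_cst.
have hc t : ideal J P (fun x => cur t x - cur0 t x).
  rewrite /cur0; case E: (rho t) => [i|]; last by apply: (ideal_ext (ideal0 J P)) => x; rewrite subrr.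
  by have [iJ ci _] := h1 t i E; apply: (ideal_ext (ideal_gen P iJ)) => x; rewrite ci subr0.
have [phi hphi] := dchoice (fun t => alg_mod pc pc0 hc (h4 t)).
have pphi t : pol (phi t) by case: (hphi t) => h _ _; apply: alg_pol h.
have zero x x' i : (forall t, z t x = phi t x') -> i \in J -> P i x = 0.
  move=> hx iJ; have [x2 hx2] := h3 (fun t => cur0 t x').
  have zx t : z t x = z t x2 by rewrite hx; case: (hphi t) => _ _ /(_ x2 x' hx2).
  rewrite (alg_dep (aP iJ) zx); have [t rt _] := h2 i iJ; have [_ <- _] := h1 t i rt.
  by rewrite hx2 /cur0 rt.
split.
  move=> g h pg ph ghz.
  pose Q t (p : V * V) := z t p.2 - phi t p.1.
  have pQ t : pol (Q t).
    apply: pol_sub; first exact: (pol_linm (f := z t) (@linm_snd K V V)).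
    exact: (pol_linm (f := phi t) (@linm_fst K V V)).
  have fin u : pol u -> dense (fun x' => ideal [set: T] (fun t x => z t x - phi t x') u) -> ideal J P u.
    move=> pu du.
    have pu2 : pol (fun p : V * V => u p.2) by exact: (pol_linm (@linm_snd K V V)).
    have := family_ideal Kinf hz pQ _ _ rz du pu2 (fun y hy => hy).
    have comb1 t l y x : (0 < l)%N -> comp l (fun x => Q t (y, x)) x = comp l (z t) x.
      move=> l0; rewrite /Q /= (comp_sub Kinf) //; last exact: pol_cst.
      by rewrite (comp_neq Kinf x (hom_cst V _)) ?subr0 // -lt0n.
    case=> [t l y x _ tl|t y x _|r [pr er]].
    - by rewrite comb1 ?(comp_neq Kinf x (hz t)) //; [apply/eqP => E; move: tl; rewrite E ltnn | lia].
    - by rewrite comb1 // (comp_id Kinf x (hz t)).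
    (* Parameter and variable are identified: on the diagonal the generators [z t - phi t] belong to
       the ideal of [P]. *)
    apply: (ideal_ext (g := fun x => \sum_t r t (x, x) * (z t x - phi t x))) => [|x]; last first.
      by rewrite (er (x, x)); apply: eq_bigl => t; rewrite inE.
    apply: ideal_sum => t _; apply: ideal_mul; last by case: (hphi t).
    by apply: (pol_comp (s := fun x => (x, x)) _ (pr t)); apply: polm_linm; apply: linm_pair; lm.
  have [||dg|dh] := @dense_or K Kinf V (fun _ => True) (fun x' => ideal [set: T] (fun t x => z t x - phi t x') g)
     (fun x' => ideal [set: T] (fun t x => z t x - phi t x') h).
  - by move=> f _ [y fy]; exists y.
  - move=> x' _; have [pr _] := nz (fun t => phi t x'); apply: pr => // x hx; apply: ghz => i iJ.
    by apply: (zero x x') => // t; apply/eqP; rewrite -subr_eq0 hx ?inE.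
  - by left; apply: fin.
  by right; apply: fin.
have [_ [x0 [x00 x0i]]] := nz (fun t => phi t 0).
exists x0; split=> [i iJ|c hcP i iJ].
  by apply: (zero x0 0) => // t; apply/eqP; rewrite -subr_eq0 x00 ?inE.
have [M hM] := dchoice (fun t => alg_D Kinf x0 pc (h4 t)).
have Dz t v : D (fun x => z t x - phi t 0) x0 v = D (z t) x0 v.
  by rewrite (D_sub Kinf) ?(D_cst Kinf) ?subr0 //; exact: pol_cst.
have [|a ha t _|v hv] := @lin_dual K V _ [set: T] (fun t => D (z t) x0).
- by move=> t _; apply: D_linr.
- by apply: (x0i a) => [u|]; rewrite ?inE // -[RHS](ha u); apply: eq_bigr => s _; rewrite Dz.
pose n := #|T|; pose tv (a : 'I_n) : T := enum_val a.
have reT (F : T -> K) : \sum_t F t = \sum_(a < n) F (tv a).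
  by rewrite (reindex (@enum_val T T)) //=; exact: onW_bij (enum_val_bij T).
(* The independent differentials of [z] are combinations of those of [cur], equal in number; the
   square matrices are inverse to each other, so the differentials of [cur], among them those of
   [P], are independent. *)
pose MM := \matrix_(a < n, b < n) M (tv a) (tv b); pose N := \matrix_(a < n, b < n) D (cur (tv a)) x0 (v (tv b)).
have MN : MM *m N = 1%:M.
  apply/matrixP => a b; rewrite !mxE; transitivity (D (z (tv a)) x0 (v (tv b))).
    by rewrite hM reT; apply: eq_bigr => s _; rewrite !mxE.
  by rewrite hv ?inE // (inj_eq enum_val_inj).
have NM := mulmx1C MN.
have [t rt ut] := h2 i iJ.
pose dd t := if rho t is Some k then c k else 0.
have dN : (\row_a dd (tv a)) *m N = 0.
  apply/rowP => b; rewrite !mxE -[RHS](hcP (v (tv b))).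
  transitivity (\sum_t dd t * D (cur t) x0 (v (tv b))).
    by rewrite reT; apply: eq_bigr => a _; rewrite !mxE.
  transitivity (\sum_t \sum_(k in J | rho t == Some k) c k * D (P k) x0 (v (tv b))).
    apply: eq_bigr => s _; rewrite /dd; case E: (rho s) => [k|]; last by rewrite big_pred0 ?mul0r // => k; rewrite andbF.
    have [kJ ck _] := h1 s k E; rewrite (big_pred1 k) => [|k']; last first.
      by rewrite /= eq_sym; apply/andP/eqP => [[_ /eqP[]]|->].
    by congr (_ * D _ _ _); apply: functional_extensionality.
  rewrite (exchange_big_dep [in J]) /= => [|s k _ /andP[] //]; apply: eq_bigr => k kJ.
  have [s rs us] := h2 k kJ; rewrite (big_pred1 s) // => s' /=; rewrite kJ.
  by apply/eqP/eqP => [/us|->].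
have d0 : \row_a dd (tv a) = 0 by rewrite -[LHS]mulmx1 -NM mulmxA dN mul0mx.
have := congr1 (fun B : 'rV_n => B 0 (enum_rank t)) d0; rewrite !mxE /tv enum_rankK /dd rt //.
Qed.

End OneSpace.
End Step.

(** * The induction on the degree *)

Section Final.
Variable K : fieldType.
Hypothesis Kinf : infinite_field K.
Hypothesis Kbr : brauer_field K.

Lemma strong_nice_step d : strong_nice K d -> nf_regular K d.+1 -> strong_nice K d.+1.
Proof.
move=> hT hR m; have [S hS] := dchoice (nice_nf Kinf Kbr hT).
(* [S x] makes the level sets of [x] normal forms nice; the second term makes these forms a regular
   sequence. *)
pose G x := maxn (S x) (x * (2 * d.+1))%N.
have [N' hN'] := hR G (m * d.+1)%N.
exists (N' * d.+1)%N => V I J e A P hI he hA pP hPA hP0 hs.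
(* All positive degree components of the [P i] are regularized together, so that [P i] with its
   lower terms lies in the algebra in weight [e i]. *)
pose f (p : I * 'I_d.+1) x := if p.1 \in J then comp p.2.+1 (P p.1) x else 0.
have hf (p : I * 'I_d.+1) : hom p.2.+1 (f p).
  by rewrite /f; case: (p.1 \in J); [apply: (hom_comp Kinf) | apply: hom_zero].
have [||T [q [e' [z [hT' hz hsz ha]]]]] := hN' V (I * 'I_d.+1)%type (fun p : I * 'I_d.+1 => p.2.+1) f _ _ hf.
- by rewrite card_prod card_ord leq_mul2r hI orbT.
- by move=> p; rewrite ltn_ord.
have hq t : frob K (q t) by case: (hz t).
have hd t : (q t * e' t <= d)%N by case: (hz t).
have hn t : nf (q t) (e' t) (z t) by case: (hz t).
pose w t := (1 + q t * e' t)%N.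
have hzw t : hom (w t) (z t) := nf_hom (hn t).
have nz (L : {set T}) (k : T -> K) : Nice L (fun t x => z t x - k t).
  apply: (hS #|T| V T L q e' z (leqnn _) hq hd hn).
  by apply: (hsN_sub (subsetT L) _ hsz); apply: leq_maxl.
have rz : regular [set: T] z.
  apply: regular_of => [t|L t _ _ _|L t LT tT tL].
  - exact: hom_pol (hzw t).
  - by have [] := Nice_ext (fun t _ x => subr0 (z t x)) (nz L (fun _ => 0)).
  by apply: (hsN_nideal Kinf hq hn hd _ hsz LT tT tL); apply: leq_maxr.
have sz (c : T -> K) : exists x, forall t, z t x = c t.
  have [_ [x [hx _]]] := nz [set: T] c; exists x => t.
  by apply/eqP; rewrite -subr_eq0 hx ?inE.
have he0 i : (0 < e i)%N by case/andP: (he i).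
have hed i : (e i <= d.+1)%N by case/andP: (he i).
have aP i : i \in J -> alg w z (e i) (P i).
  move=> iJ; apply: (alg_ext (f := fun x => P i 0 + \sum_(l < d.+1) f (i, l) x)) => [|x].
    apply: (alg_add (f := fun _ => P i 0) (g := fun x => \sum_(l < d.+1) f (i, l) x)) => //.
      exact: alg_cst.
    apply: alg_sum => l _; have [le|el] := leqP l.+1 (e i); first exact: alg_leq le (ha (i, l)).
    by apply: (alg_cst _ _ _ (c := 0)) => x; rewrite /f /= iJ hP0.
  have [N [_ hN]] := comp_bound Kinf (pP i).
  rewrite [RHS](hN (maxn N d.+2) _ (leq_maxl _ _)) -(subnKC (leq_maxr N d.+2)) big_split_ord /= [X in _ = _ + X]big1.
    rewrite addr0 [RHS]big_ord_recl comp0 //; congr (_ + _); apply: eq_bigr => l _; by rewrite /f /= iJ.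
  by move=> l _; apply: hP0 => //; have := hed i; rewrite /=; lia.
have w0 t : (0 < w t)%N by [].
have TC : (#|T| * d.+1 <= N' * d.+1)%N by rewrite leq_mul2r hT' orbT.
have [cur [rho ex]] := exchange_all Kinf w0 hzw he0 pP hPA aP hed TC hs sz.
exact: (nice_of_exchanged Kinf w0 hzw aP ex rz (nz [set: T])).
Qed.

Lemma strong_nice0 : strong_nice K 0.
Proof.
move=> m; exists 0%N => V I J e A P _ he _ _ _ _ _.
suff -> : J = set0 by apply: Nice_empty.
by apply/setP => i; have := he i; case: (e i).
Qed.

Theorem strong_nice_all d : strong_nice K d.
Proof.
suff [] : strong_nice K d /\ forall d', (d' < d)%N -> split_nf K d' by [].
elim: d => [|d [hT hsp]]; first by split=> //; apply: strong_nice0.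
have hR := nf_regular_of Kinf hsp.
have hsp' d' : (d' < d.+1)%N -> split_nf K d'.
  by rewrite ltnS leq_eqVlt => /orP[/eqP ->|/hsp //]; apply: (split_nf_of Kinf Kbr hT hR).
by split=> //; apply: strong_nice_step hT (nf_regular_of Kinf hsp').
Qed.

End Final.

(** * Zariski density *)

Section Bridge.
Variable K : fieldType.
Hypothesis Kinf : infinite_field K.
Variable n : nat.

Definition ev (F : {mpoly K[n]}) (x : 'rV[K]_n) : K := F.@[fun i => x 0 i].

Lemma lin_coord i : lin (fun x : 'rV[K]_n => x 0 i).
Proof. by move=> a x y; rewrite !mxE. Qed.

Lemma pol_ev F : pol (ev F).
Proof. exact: (pol_meval F lin_coord). Qed.

Lemma ev_inj F G : ev F =1 ev G -> F = G.
Proof.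
move=> h; apply/eqP; rewrite -subr_eq0; apply/eqP; apply: (meval_inj0 Kinf) => v.
have E H : H.@[v] = ev H (\row_i v i) by rewrite /ev; apply: meval_eq => i; rewrite mxE.
by rewrite mevalB !E h subrr.
Qed.

Lemma ev_surj (f : 'rV[K]_n -> K) : pol f -> exists F, f =1 ev F.
Proof.
move=> pf; have [|||F [hF _]] := @pol_mpoly K Kinf _ n (fun i (x : 'rV[K]_n) => x 0 i) (fun i => delta_mx 0 i) _ _ _ f pf.
- exact: lin_coord.
- by move=> x; apply: row_sum_delta.
- by move=> i j; rewrite mxE eqxx eq_sym.
by exists F.
Qed.

Lemma hom_ev d F : F \is d.-homog -> hom d (ev F).
Proof.
move=> /dhomogP hF; split=> [|t x]; first exact: pol_ev.
rewrite /ev !mevalE mulr_sumr; apply: eq_big_seq => m mF.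
have <- : mdeg m = d by apply: hF.
rewrite mulrCA; congr (_ * _); rewrite mdegE -prodrXr -big_split /=; apply: eq_bigr => i _.
by rewrite mxE exprMn.
Qed.

Lemma hom_ev_surj d (f : 'rV[K]_n -> K) : hom d f -> exists2 F, F \is d.-homog & f =1 ev F.
Proof.
move=> hf; have [F eF] := ev_surj (hom_pol hf).
exists (pihomog mdeg d F); first exact: pihomogP.
move=> x; rewrite -(comp_id Kinf x hf) (_ : f = ev F); last exact: functional_extensionality.
pose k := maxn (msize F) d.+1.
have -> : ev F = fun x => \sum_(i < k) ev (pihomog mdeg i F) x.
  apply: functional_extensionality => y; rewrite /ev {1}(pihomog_partitionE (k := k) (mf := mdeg) (p := F)) ?raddf_sum //.
  by rewrite leq_maxl.
rewrite (comp_sum Kinf) => [|i _]; last exact: pol_ev.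
have dk : (d < k)%N by rewrite leq_maxr.
have hi (i : nat) := hom_ev (pihomogP mdeg i F).
rewrite (bigD1 (Ordinal dk)) //= (comp_id Kinf x (hi d)) big1 ?addr0 // => i id.
by rewrite (comp_neq Kinf x (hi i)) //; apply: contraNneq id => E; apply/eqP/val_inj.
Qed.

Lemma strength_lowstr d C F : strength_gt d F C -> ~ lowstr d C (ev F).
Proof.
move=> hs hl; apply: hs; have [s [a [g [h [sC hgh eF]]]]] := lowstr_factors hl.
have hg i : exists G, G \is (a i).-homog /\ g i =1 ev G.
  by case: (hgh i) => _ /hom_ev_surj [G ? ?] _; exists G.
have hh i : exists G, G \is (d - a i).-homog /\ h i =1 ev G.
  by case: (hgh i) => _ _ /hom_ev_surj [G ? ?]; exists G.
have [G hG] := dchoice hg; have [H hH] := dchoice hh.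
exists s, G, H; split=> // [i|i|].
- by exists (a i); case: (hgh i) (hG i) => /andP[_ ?] _ _ [].
- by exists (d - a i)%N; case: (hgh i) (hH i) => ai _ _ [h1 _]; split=> //; lia.
apply: ev_inj => x; rewrite eF /ev raddf_sum /=; apply: eq_bigr => i _.
by rewrite mevalM (proj2 (hG i)) (proj2 (hH i)).
Qed.

End Bridge.

Theorem theorem1p4 :
  forall (k : fieldType), infinite_field k -> brauer_field k ->
  forall (r : nat) (d : 'I_r -> nat), multidegree d ->
  exists C : nat,
    forall (n : nat) (f : 'I_r -> {mpoly k[n]}),
      (forall i, f i \is (d i).-homog) ->
      tuple_strength_gt d f C ->
      kpoints_zariski_dense f.
Proof.
move=> k kinf kbr r d [d1 _].
have [C hC] := strong_nice_all kinf kbr (\max_i d i) r.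
exists C => n f hf hs g hg.
have hh i := hom_ev (hf i).
have [|||||||pr _] := hC 'rV[k]_n 'I_r [set: 'I_r] d (fun i => ev (f i)) (fun i => ev (f i)).
- by rewrite card_ord.
- by move=> i; rewrite d1 leq_bigmax.
- exact: hh.
- by move=> i; apply: pol_ev.
- by move=> i x _; rewrite (comp_id kinf x (hh i)).
- by move=> i l x _ dl; rewrite (comp_neq kinf x (hh i)) //; apply/eqP => E; move: dl; rewrite E ltnn.
- move=> e c hc [i _ ci] hl.
  apply: (strength_lowstr kinf (hs e c (fun j => hc j (in_setT j)) (ex_intro _ i ci))).
  apply: (lowstr_ext hl) => x; rewrite /ev raddf_sum /=; apply: eq_big => [j|j _]; first by rewrite inE.
  by rewrite mevalZ.
have [|q [pq eq]] := prime_vanish pr (pol_ev g).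
  by move=> x hx; apply: hg => i; apply: hx; rewrite inE.
have [Q hQ] := dchoice (fun i => ev_surj kinf (pq i)).
(* Primality puts [g] itself in the ideal, so the exponent is 1. *)
exists 1%N, Q; rewrite expr1; apply: (ev_inj kinf) => x.
rewrite eq /ev raddf_sum /=; apply: eq_big => [j|j _]; first by rewrite inE.
by rewrite mevalM hQ.
Qed.
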